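(* The category $\mathcal D^\dagger$, equipped with its tensor product, braiding, twist and dualities and with the conjugation $g\mapsto g^\dagger$ given by the Hermitian adjoint (and the identity on objects), is a Hermitian ribbon category.
   Context: **Quantum group.** Fix an integer $r\ge 2$; $q=e^{\pi\sqrt{-1}/r}$, $q^x:=e^{\pi\sqrt{-1}x/r}$ for $x\in\mathbb C$, $\{x\}=q^x-q^{-x}$, $[x]=\{x\}/\{1\}$, $\{n\}!=\{n\}\{n-1\}\cdots\{1\}$. Let $\overline U$ be the Hopf algebra over $\mathbb C$ generated by $E,F,K^{\pm1},H$ with relations $KK^{-1}=K^{-1}K=1$, $KEK^{-1}=q^2E$, $KFK^{-1}=q^{-2}F$, $[E,F]=\frac{K-K^{-1}}{q-q^{-1}}$, $HK=KH$, $[H,E]=2E$, $[H,F]=-2F$, $E^r=F^r=0$; coproduct $\Delta E=1\otimes E+E\otimes K$, $\Delta F=K^{-1}\otimes F+F\otimes 1$, $\Delta K=K\otimes K$, $\Delta H=H\otimes 1+1\otimes H$; counit $\varepsilon(E)=\varepsilon(F)=\varepsilon(H)=0$, $\varepsilon(K)=1$; antipode $S(E)=-EK^{-1}$, $S(F)=-KF$, $S(K)=K^{-1}$, $S(H)=-H$. A weight module is a finite-dimensional $\overline U$-module on which $H$ is diagonalizable and $K=q^H$ (i.e. $Kv=q^\lambda v$ if $Hv=\lambda v$). $\mathcal C$ is the monoidal category of weight modules, with unit $\mathbb C$. **Ribbon structure on $\mathcal C$.** For $V$ with basis $(v_i)$ and dual basis $(v_i^* )$ of $V^*$: $\mathrm{coev}_V:\mathbb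 C\to V\otimes V^*$, $1\mapsto\sum v_i\otimes v_i^*$; $\mathrm{ev}_V:V^*\otimes V\to\mathbb C$, $f\otimes w\mapsto f(w)$. On $V\otimes W$ let $R=q^{H\otimes H/2}\sum_{n=0}^{r-1}\frac{\{1\}^{2n}}{\{n\}!}q^{n(n-1)/2}E^n\otimes F^n$, where $q^{H\otimes H/2}(v\otimes v')=q^{\lambda\lambda'/2}v\otimes v'$ for weight vectors of weights $\lambda,\lambda'$. The braiding is $c_{V,W}=\tau\circ R$ with $\tau(x\otimes y)=y\otimes x$. Let $\theta=K^{r-1}\sum_{n=0}^{r-1}\frac{\{1\}^{2n}}{\{n\}!}q^{n(n-1)/2}S(F^n)q^{-H^2/2}E^n$ (acting on weight modules); the twist is $\theta_V:v\mapsto\theta^{-1}v$. **Modules.** For $\alpha\in\mathbb C$, $V_\alpha$ has basis $v_0,\dots,v_{r-1}$ with $Hv_i=(\alpha+r-1-2i)v_i$, $Ev_i=\frac{\{i\}\{i-\alpha\}}{\{1\}^2}v_{i-1}$, $Fv_i=v_{i+1}$ ($v_r=0$). For $n\in\{0,\dots,r-2\}$, $S_n$ has basis $s_0,\dots,s_n$ with $Hs_i=(n-2i)s_i$, $Fs_i=s_{i+1}$ ($s_{n+1}=0$), $Es_i=\frac{\{i\}\{n+1-i\}}{\{1\}^2}s_{i-1}$. For $a\in\mathbb Z$, $\mathbb C^H_{ar}$ is one-dimensional with $E=F=0$, $H=ar$. $P_i$ ($0\le i\le r-2$) is the projective cover of $S_i$ in $\mathcal C$. The simple objects of $\mathcal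 C$ are, up to isomorphism, the $S_n\otimes\mathbb C^H_{ar}$ and the $V_\alpha$ with $\alpha\in(\mathbb C\setminus\mathbb Z)\cup r\mathbb Z$. **$\mathcal D$.** Let $\mathsf A=\{V_\alpha,S_n,P_i,\mathbb C^H_{ar}: \alpha\in(\mathbb R\setminus\mathbb Z)\cup r\mathbb Z,\ n,i\in\{0,\dots,r-2\},\ a\in\mathbb Z\}$. $\mathcal D$ is the full subcategory of $\mathcal C$ whose objects are all direct sums of retracts of tensor products $X_1\otimes\cdots\otimes X_p$ with each $X_k$ in $\mathsf A$ or a dual of an element of $\mathsf A$. **Hermitian modules.** $\dagger:\overline U\to\overline U$ is the antilinear antialgebra involution with $E^\dagger=F$, $F^\dagger=E$, $K^\dagger=K^{-1}$, $H^\dagger=H$. Hermitian forms are linear in the second variable, antilinear in the first, with $f(v,v')=\overline{f(v',v)}$. A Hermitian $\overline U$-module is a weight module $V$ with a non-degenerate Hermitian form satisfying $(x^\dagger v,v')=(v,xv')$ for all $x\in\overline U$, $v,v'\in V$. $\mathcal D^\dagger$ is the category whose objects are Hermitian $\overline U$-modules with underlying module in $\mathcal D$ and whose morphisms are all $\overline U$-linear maps. For $g:V\to W$, $g^\dagger:W\to V$ is the adjoint: $(w,g(v))_W=(g^\dagger(w),v)_V$. **Half twist and $\mathsf X$.** The half twist $\sqrt\theta$ is the natural automorphism of $\mathrm{Id}_{\mathcal C}$ such that, for indecomposable $V$, $\sqrt\theta_V$ is the square root of $\theta_V$ whose only eigenvalue is the common value assigned to the composition factors of $V$ by: $q^{(\alpha^2-(r-1)^2)/4}$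 for $V_\alpha$ ($\alpha\in(\mathbb C\setminus\mathbb Z)\cup r\mathbb Z$); $q^{i(i+2-2r)/4}$ for $S_i\otimes\mathbb C^H_{kr}$, $k$ even; $q^{j(j+2-2r)/4}$ with $j=r-2-i$ for $S_i\otimes\mathbb C^H_{kr}$, $k$ odd. Set $\mathsf X_{V,W}=(\sqrt\theta_{W\otimes V})^{-1}c_{V,W}(\sqrt\theta_V\otimes\sqrt\theta_W):V\otimes W\to W\otimes V$. **Structure on $\mathcal D^\dagger$.** For $W_1,W_2\in\mathcal D^\dagger$ put $(x\otimes y,x'\otimes y')_p=(x,x')_{W_1}(y,y')_{W_2}$; the Hermitian structure on $W_1\otimes W_2$ is $(v,v')=(v,\tau(\mathsf X_{W_1,W_2}v'))_p$. The unit is $\mathbb C$ with $(1,1)=1$. The Hermitian structure on $V^*$ is $(\varphi,\psi)=\sum_i\overline{\varphi(e_i)}\psi(e_i')$ for any basis $(e_i)$ of $V$ and $(e_i')$ with $(e_i',e_j)=\delta_{ij}$. Braiding, twist and $\mathrm{ev},\mathrm{coev}$ are those of $\mathcal C$. **Hermitian ribbon category.** A conjugation on a strict monoidal category assigns to each $f:V\to W$ a morphism $f^\dagger:W\to V$ with $(f^\dagger)^\dagger=f$, $(f\otimes g)^\dagger=f^\dagger\otimes g^\dagger$, $(f\circ g)^\dagger=g^\dagger\circ f^\dagger$. A Hermitian ribbon category is a ribbon category with a conjugation such that for all objects $V,W$: $c_{V,W}^\dagger=(c_{V,W})^{-1}$, $\theta_V^\dagger=(\theta_V)^{-1}$, $\mathrm{coev}_V^\dagger=\mathrm{ev}_V\,c_{V,V^*}(\theta_V\otimes\mathrm{Id}_{V^*})$,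 $\mathrm{ev}_V^\dagger=(\mathrm{Id}_{V^*}\otimes\theta_V)\,c_{V,V^*}\,\mathrm{coev}_V$. *)

(* Defs.v *)
From Stdlib Require Import ClassicalEpsilon.
From HB Require Import structures.
From mathcomp Require Import all_boot all_order all_algebra.
From mathcomp Require Import all_classical all_reals all_analysis.
From mathcomp Require Import complex mxtens.

Set Implicit Arguments.
Unset Strict Implicit.
Unset Printing Implicit Defensive.

Import Order.TTheory GRing.Theory Num.Theory.
Local Open Scope ring_scope.
Local Open Scope complex_scope.
Local Open Scope sesquilinear_scope.

(** * Hermitian ribbon categories *)

(* The raw data of a (not necessarily strict) ribbon category with a
   conjugation.  The objects are the elements of [ob] satisfying [isob] and the
   morphisms V -> W are the elements of [hom V W] satisfying [ishom]; the
   operations are total on raw data, so that their being well defined on objects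
   and morphisms is part of the laws below rather than of the data. *)
Record ribbon_data := RibbonData {
  ob : Type;
  isob : ob -> Prop;
  hom : ob -> ob -> Type;
  ishom : forall V W, hom V W -> Prop;
  idm : forall V, hom V V;
  cmp : forall U V W, hom V W -> hom U V -> hom U W;
  tob : ob -> ob -> ob;
  thom : forall V V' W W',
    hom V V' -> hom W W' -> hom (tob V W) (tob V' W');
  uob : ob;
  assoc : forall U V W, hom (tob (tob U V) W) (tob U (tob V W));
  assocV : forall U V W, hom (tob U (tob V W)) (tob (tob U V) W);
  lunit : forall V, hom (tob uob V) V;
  runit : forall V, hom (tob V uob) V;
  braid : forall V W, hom (tob V W) (tob W V);
  twist : forall V, hom V V;
  dualob : ob -> ob;
  ev : forall V, hom (tob (dualob V) V) uob;
  coev : forall V, hom uob (tob V (dualob V));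
  conjm : forall V W, hom V W -> hom W V
}.

Arguments idm {_} V.
Arguments uob {_}.
Arguments assoc {_} U V W.
Arguments assocV {_} U V W.
Arguments lunit {_} V.
Arguments runit {_} V.
Arguments braid {_} V W.
Arguments twist {_} V.
Arguments ev {_} V.
Arguments coev {_} V.

Section Laws.
Variable D : ribbon_data.
Implicit Types U V W X : ob D.

Local Notation "g \oc f" := (cmp g f) (at level 50, left associativity).
Local Notation "f \ox g" := (thom f g) (at level 40, left associativity).
Local Notation "V \OX W" := (tob V W) (at level 40, left associativity).

Definition mor V W (f : hom V W) : Prop := [/\ isob V, isob W & ishom f].

Definition inverse V W (f : hom V W) (g : hom W V) : Prop :=
  g \oc f = idm V /\ f \oc g = idm W.

Definition isom V W (f : hom V W) : Prop :=
  mor f /\ exists2 g : hom W V, mor g & inverse f g.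

Record category_laws : Prop := {
  idm_mor : forall V, isob V -> mor (idm V);
  cmp_mor : forall U V W (g : hom V W) (f : hom U V),
    mor g -> mor f -> mor (g \oc f);
  cmp_idl : forall V W (f : hom V W), mor f -> idm W \oc f = f;
  cmp_idr : forall V W (f : hom V W), mor f -> f \oc idm V = f;
  cmpA : forall U V W X (h : hom W X) (g : hom V W) (f : hom U V),
    mor h -> mor g -> mor f -> h \oc (g \oc f) = h \oc g \oc f
}.

Record monoidal_laws : Prop := {
  uob_ob : isob (@uob D);
  tob_ob : forall V W, isob V -> isob W -> isob (V \OX W);
  thom_mor : forall V V' W W' (f : hom V V') (g : hom W W'),
    mor f -> mor g -> mor (f \ox g);
  thom_id : forall V W, isob V -> isob W ->
    idm V \ox idm W = idm (V \OX W);
  thom_cmp : forall V V' V'' W W' W'' (f' : hom V' V'') (f : hom V V')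
      (g' : hom W' W'') (g : hom W W'),
    mor f' -> mor f -> mor g' -> mor g ->
    (f' \oc f) \ox (g' \oc g) = (f' \ox g') \oc (f \ox g);
  assoc_mor : forall U V W, isob U -> isob V -> isob W -> mor (assoc U V W);
  assocV_mor : forall U V W, isob U -> isob V -> isob W -> mor (assocV U V W);
  assocK : forall U V W, isob U -> isob V -> isob W ->
    inverse (assoc U V W) (assocV U V W);
  assoc_nat : forall U U' V V' W W'
      (f : hom U U') (g : hom V V') (h : hom W W'),
    mor f -> mor g -> mor h ->
    assoc U' V' W' \oc (f \ox g \ox h) = f \ox (g \ox h) \oc assoc U V W;
  lunit_isom : forall V, isob V -> isom (lunit V);
  lunit_nat : forall V W (f : hom V W), mor f ->
    lunit W \oc (idm uob \ox f) = f \oc lunit V;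
  runit_isom : forall V, isob V -> isom (runit V);
  runit_nat : forall V W (f : hom V W), mor f ->
    runit W \oc (f \ox idm uob) = f \oc runit V;
  pentagon : forall U V W X, isob U -> isob V -> isob W -> isob X ->
    (idm U \ox assoc V W X) \oc assoc U (V \OX W) X
      \oc (assoc U V W \ox idm X)
    = assoc U V (W \OX X) \oc assoc (U \OX V) W X;
  triangle : forall V W, isob V -> isob W ->
    (idm V \ox lunit W) \oc assoc V uob W = runit V \ox idm W
}.

Record braiding_laws : Prop := {
  braid_isom : forall V W, isob V -> isob W -> isom (braid V W);
  braid_nat : forall V V' W W' (f : hom V V') (g : hom W W'),
    mor f -> mor g -> braid V' W' \oc (f \ox g) = (g \ox f) \oc braid V W;
  hexagonl : forall U V W, isob U -> isob V -> isob W ->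
    assoc V W U \oc braid U (V \OX W) \oc assoc U V W
    = (idm V \ox braid U W) \oc assoc V U W \oc (braid U V \ox idm W);
  hexagonr : forall U V W, isob U -> isob V -> isob W ->
    assocV W U V \oc braid (U \OX V) W \oc assocV U V W
    = (braid U W \ox idm V) \oc assocV U W V \oc (idm U \ox braid V W)
}.

Record twist_laws : Prop := {
  twist_isom : forall V, isob V -> isom (twist V);
  twist_nat : forall V W (f : hom V W), mor f ->
    twist W \oc f = f \oc twist V;
  twist_tensor : forall V W, isob V -> isob W ->
    twist (V \OX W) = braid W V \oc braid V W \oc (twist V \ox twist W)
}.

Record duality_laws : Prop := {
  dual_ob : forall V, isob V -> isob (dualob V);
  ev_mor : forall V, isob V -> mor (ev V);
  coev_mor : forall V, isob V -> mor (coev V);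
  zigzag : forall V, isob V ->
    runit V \oc (idm V \ox ev V) \oc assoc V (dualob V) V
      \oc (coev V \ox idm V)
    = lunit V;
  zigzag_dual : forall V, isob V ->
    lunit (dualob V) \oc (ev V \ox idm (dualob V))
      \oc assocV (dualob V) V (dualob V) \oc (idm (dualob V) \ox coev V)
    = runit (dualob V);
  (* the twist of V^* is the transpose of the twist of V *)
  twist_dual : forall V, isob V ->
    (twist V \ox idm (dualob V)) \oc coev V
    = (idm V \ox twist (dualob V)) \oc coev V
}.

Record ribbon_category : Prop := {
  ribbon_category_laws : category_laws;
  ribbon_monoidal_laws : monoidal_laws;
  ribbon_braiding_laws : braiding_laws;
  ribbon_twist_laws : twist_laws;
  ribbon_duality_laws : duality_laws
}.

(* The last three conditions are the counterpart, for a category that is not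
   strict, of the suppression of the coherence isomorphisms; they are void when
   these isomorphisms are identities. *)
Record conjugation_laws : Prop := {
  conjm_mor : forall V W (f : hom V W), mor f -> mor (conjm f);
  conjmK : forall V W (f : hom V W), mor f -> conjm (conjm f) = f;
  conjm_tensor : forall V V' W W' (f : hom V V') (g : hom W W'),
    mor f -> mor g -> conjm (f \ox g) = conjm f \ox conjm g;
  conjm_cmp : forall U V W (f : hom V W) (g : hom U V),
    mor f -> mor g -> conjm (f \oc g) = conjm g \oc conjm f;
  conjm_assoc : forall U V W, isob U -> isob V -> isob W ->
    inverse (assoc U V W) (conjm (assoc U V W));
  conjm_lunit : forall V, isob V -> inverse (lunit V) (conjm (lunit V));
  conjm_runit : forall V, isob V -> inverse (runit V) (conjm (runit V))
}.

Record hermitian_ribbon_category : Prop := {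
  hermitian_ribbon : ribbon_category;
  hermitian_conjugation : conjugation_laws;
  conjm_braid : forall V W, isob V -> isob W ->
    inverse (braid V W) (conjm (braid V W));
  conjm_twist : forall V, isob V -> inverse (twist V) (conjm (twist V));
  conjm_coev : forall V, isob V ->
    conjm (coev V)
    = ev V \oc braid V (dualob V) \oc (twist V \ox idm (dualob V));
  conjm_ev : forall V, isob V ->
    conjm (ev V)
    = (idm (dualob V) \ox twist V) \oc braid V (dualob V) \oc coev V
}.

End Laws.

(** * Functions of a diagonalizable matrix *)

Section SpectralCalculus.
Variables (F : closedFieldType) (n : nat).
Implicit Types A : 'M[F]_n.

Definition spectrum A : seq F :=
  undup (sval (closed_field_poly_normal (char_poly A))).

(* For A diagonalizable, the projector onto its a-eigenspace along the other
   ones (Lagrange interpolation). *)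
Definition specproj A (a : F) : 'M[F]_n :=
  \prod_(b <- spectrum A | b != a) ((a - b)^-1 *: (A - b%:M)).

Definition mxfun (f : F -> F) A : 'M[F]_n :=
  \sum_(a <- spectrum A) f a *: specproj A a.

Lemma mem_spec A (c : F) (v : 'cV_n) :
  A *m v = c *: v -> v != 0 -> c \in spectrum A.
Proof.
move=> Av v0; rewrite /spectrum mem_undup.
case: closed_field_poly_normal => s /= Ds.
have : root (char_poly A) c.
  have -> : char_poly A = char_poly A^T.
    by rewrite /char_poly -det_tr /char_poly_mx raddfB /= tr_scalar_mx map_trmx.
  rewrite -eigenvalue_root_char.
  apply/eigenvalueP; exists v^T; last by rewrite trmx_eq0.
  by rewrite -trmx_mul Av linearZ.
by rewrite Ds (monicP (char_poly_monic A)) scale1r root_prod_XsubC.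
Qed.

Lemma specproj_eigen A (a c : F) (v : 'cV_n) :
  A *m v = c *: v ->
  specproj A a *m v
  = (\prod_(b <- spectrum A | b != a) ((a - b)^-1 * (c - b))) *: v.
Proof.
move=> Av; rewrite /specproj; elim: (spectrum A) => [|b s IH].
  by rewrite !big_nil mul1mx scale1r.
rewrite !big_cons; case: (b != a) => //.
rewrite -[_ * _]/(_ *m _) -mulmxA IH -scalemxAr -scalemxAl mulmxBl Av.
rewrite mul_scalar_mx.
by rewrite -scalerBl !scalerA -mulrA mulrC.
Qed.

Lemma specproj_weight A a c (v : 'cV_n) :
  A *m v = c *: v -> a \in spectrum A -> v != 0 ->
  specproj A a *m v = (a == c)%:R *: v.
Proof.
move=> Av aA v0; rewrite (specproj_eigen a Av).
have cA := mem_spec Av v0.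
case: eqVneq => [<-|ne].
  congr (_ *: _); apply: big1_seq => b /andP[ba _].
  by rewrite mulVf // subr_eq0 eq_sym.
rewrite (big_rem c cA) /= eq_sym ne subrr mulr0 mul0r //.
Qed.

Lemma mxfun_weight (f : F -> F) A c (v : 'cV_n) :
  A *m v = c *: v -> mxfun f A *m v = f c *: v.
Proof.
move=> Av; have [->|v0] := eqVneq v 0; first by rewrite mulmx0 scaler0.
rewrite /mxfun mulmx_suml.
under eq_big_seq => a aA do
  rewrite -scalemxAl (specproj_weight Av aA v0) scalerA.
rewrite -scaler_suml (bigD1_seq c) ?mem_spec //=; last exact: undup_uniq.
  rewrite eqxx mulr1 big1 ?addr0 // => a /negPf->; by rewrite mulr0.
exact: mem_spec Av v0.
Qed.

End SpectralCalculus.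

(** * The unrolled restricted quantum group and its modules *)

Section QuantumGroup.
Variables (R : realType) (r : nat).
Local Notation C := R[i].

Definition expC (z : C) : C :=
  let: a +i* b := z in (expR a)%:C * (cos b +i* sin b).

(* q^x with q = exp (i pi / r) *)
Definition qpow (x : C) : C := expC ((0 +i* pi) * x / r%:R).
Definition qbr (x : C) : C := qpow x - qpow (- x).
Definition qfact (n : nat) : C := \prod_(1 <= k < n.+1) qbr k%:R.

(* Expressions in the generators; each element of the quantum group is the
   class of such an expression. *)
Inductive uexpr :=
  | UE | UF | UK | UKi | UH
  | UConst of C
  | UAdd of uexpr & uexpr
  | UMul of uexpr & uexpr.

Fixpoint udag (x : uexpr) : uexpr :=
  match x with
  | UE => UF | UF => UE | UK => UKi | UKi => UK | UH => UH
  | UConst c => UConst c^*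
  | UAdd x y => UAdd (udag x) (udag y)
  | UMul x y => UMul (udag y) (udag x)
  end.

Fixpoint uantipode (x : uexpr) : uexpr :=
  match x with
  | UE => UMul (UConst (-1)) (UMul UE UKi)
  | UF => UMul (UConst (-1)) (UMul UK UF)
  | UK => UKi | UKi => UK
  | UH => UMul (UConst (-1)) UH
  | UConst c => UConst c
  | UAdd x y => UAdd (uantipode x) (uantipode y)
  | UMul x y => UMul (uantipode y) (uantipode x)
  end.

(* The generators acting on column vectors of size [udim].  Tensor products are
   Kronecker products: the basis vector of index [mxtens_index (i, j)] is
   e_i (x) e_j. *)
Record umod := Umod {
  udim : nat;
  aE : 'M[C]_udim; aF : 'M[C]_udim;
  aK : 'M[C]_udim; aKi : 'M[C]_udim; aH : 'M[C]_udim
}.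

Fixpoint uact (V : umod) (x : uexpr) : 'M[C]_(udim V) :=
  match x with
  | UE => aE V | UF => aF V | UK => aK V | UKi => aKi V | UH => aH V
  | UConst c => c%:M
  | UAdd x y => uact V x + uact V y
  | UMul x y => uact V x *m uact V y
  end.

Record umod_relations (V : umod) : Prop := {
  rel_KKi : aK V *m aKi V = 1%:M;
  rel_KiK : aKi V *m aK V = 1%:M;
  rel_KE : aK V *m aE V *m aKi V = qpow 2 *: aE V;
  rel_KF : aK V *m aF V *m aKi V = qpow (- 2) *: aF V;
  rel_EF : aE V *m aF V - aF V *m aE V
           = (qpow 1 - (qpow 1)^-1)^-1 *: (aK V - aKi V);
  rel_HK : aH V *m aK V = aK V *m aH V;
  rel_HE : aH V *m aE V - aE V *m aH V = 2 *: aE V;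
  rel_HF : aH V *m aF V - aF V *m aH V = - 2 *: aF V;
  rel_Er : aE V ^+ r = 0;
  rel_Fr : aF V ^+ r = 0
}.

(* The objects of the category C of weight modules. *)
Record weight_module (V : umod) : Prop := {
  weight_relations : umod_relations V;
  weight_diag : diagonalizable (aH V);
  weight_K : forall (a : C) (v : 'cV[C]_(udim V)),
    aH V *m v = a *: v -> aK V *m v = qpow a *: v
}.

Definition ulinear (V W : umod) (f : 'M[C]_(udim W, udim V)) : Prop :=
  forall x, f *m uact V x = uact W x *m f.

(** ** Tensor products and duals *)

Definition unit_mod : umod :=
  @Umod 1 0 0 1%:M 1%:M 0.

Definition tens (V W : umod) : umod :=
  @Umod (udim V * udim W)
    (tensmx 1%:M (aE W) + tensmx (aE V) (aK W))
    (tensmx (aKi V) (aF W) + tensmx (aF V) 1%:M)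
    (tensmx (aK V) (aK W))
    (tensmx (aKi V) (aKi W))
    (tensmx (aH V) 1%:M + tensmx 1%:M (aH W)).

(* In the dual basis: (x phi)(v) = phi (S(x) v). *)
Definition dual_mod (V : umod) : umod :=
  @Umod (udim V)
    (uact V (uantipode UE))^T (uact V (uantipode UF))^T
    (uact V (uantipode UK))^T (uact V (uantipode UKi))^T
    (uact V (uantipode UH))^T.

Definition flip (m n : nat) : 'M[C]_(n * m, m * n) :=
  \matrix_(k, l)
    (mxtens_unindex k == ((mxtens_unindex l).2, (mxtens_unindex l).1))%:R.

Definition ev_mx (V : umod) : 'M[C]_(1, udim V * udim V) :=
  \row_k ((mxtens_unindex k).1 == (mxtens_unindex k).2)%:R.

Definition coev_mx (V : umod) : 'M[C]_(udim V * udim V, 1) :=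
  \col_k ((mxtens_unindex k).1 == (mxtens_unindex k).2)%:R.

(* Kronecker products are associative and unital up to the equality of the
   dimensions; this is the identity matrix along such an equality. *)
Definition idcast_mx (m n : nat) : 'M[C]_(m, n) :=
  \matrix_(i, j) (i == j :> nat)%:R.

(** ** Braiding and twist *)

(* {1}^{2n} / {n}! q^{n(n-1)/2} *)
Definition Rcoef (n : nat) : C :=
  qbr 1 ^+ (2 * n) / qfact n * qpow (n%:R * (n%:R - 1) / 2).

(* q^{H (x) H / 2} *)
Definition qHH (V W : umod) : 'M[C]_(udim V * udim W) :=
  \sum_(a <- spectrum (aH V)) \sum_(b <- spectrum (aH W))
    qpow (a * b / 2) *: tensmx (specproj (aH V) a) (specproj (aH W) b).

Lemma qHH_weight (V W : umod) (a b : C) (v : 'cV_(udim V)) (w : 'cV_(udim W)) :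
  aH V *m v = a *: v -> aH W *m w = b *: w ->
  qHH V W *m tensmx v w = qpow (a * b / 2) *: tensmx v w.
Proof.
move=> Hv Hw.
have E (x y : C) (A : 'M[C]_(udim V)) (B : 'M[C]_(udim W)) :
    A *m v = x *: v -> B *m w = y *: w ->
   tensmx A B *m tensmx v w = (x * y) *: tensmx v w.
  move=> Ha Hb; rewrite tensmx_mul Ha Hb; apply/matrixP => i j; rewrite !mxE.
  by rewrite mulrACA.
have [->|v0] := eqVneq v 0.
  have -> : tensmx (0 : 'cV_(udim V)) w = 0
    by apply/matrixP => i j; rewrite !mxE mul0r.
  by rewrite mulmx0 scaler0.
have [->|w0] := eqVneq w 0.
  have -> : tensmx v (0 : 'cV_(udim W)) = 0
    by apply/matrixP => i j; rewrite !mxE mulr0.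
  by rewrite mulmx0 scaler0.
have va := mem_spec Hv v0; have wb := mem_spec Hw w0.
rewrite /qHH mulmx_suml (bigD1_seq a) ?undup_uniq //=.
rewrite [X in _ + X]big1_seq ?addr0; last first.
  move=> c /andP[ca cA]; rewrite mulmx_suml; apply: big1_seq => d /andP[_ dA].
  rewrite -scalemxAl
    (E _ _ _ _ (specproj_weight Hv cA v0) (specproj_weight Hw dA w0)).
  by rewrite (negPf ca) mul0r scale0r scaler0.
rewrite mulmx_suml (bigD1_seq b) ?undup_uniq //=.
rewrite [X in _ + X]big1_seq ?addr0; last first.
  move=> d /andP[db dA].
  rewrite -scalemxAl
    (E _ _ _ _ (specproj_weight Hv va v0) (specproj_weight Hw dA w0)).
  by rewrite (negPf db) mulr0 scale0r scaler0.
by rewrite -scalemxAl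
    (E _ _ _ _ (specproj_weight Hv va v0) (specproj_weight Hw wb w0))
  !eqxx mulr1 scale1r.
Qed.

Definition Rmatrix (V W : umod) : 'M[C]_(udim V * udim W) :=
  qHH V W *m \sum_(n < r) Rcoef n *: tensmx (aE V ^+ n) (aF W ^+ n).

Definition braiding (V W : umod) : 'M[C]_(udim W * udim V, udim V * udim W) :=
  flip (udim V) (udim W) *m Rmatrix V W.

Definition theta (V : umod) : 'M[C]_(udim V) :=
  aK V ^+ r.-1 *m
  \sum_(n < r) Rcoef n *:
    (uact V (uantipode UF) ^+ n *m mxfun (fun a => qpow (- (a ^+ 2 / 2))) (aH V)
       *m aE V ^+ n).

Definition twist_mx (V : umod) : 'M[C]_(udim V) := invmx (theta V).

(** ** The modules V_alpha, S_n, C^H_{ar} and P_i *)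

Definition ladder (n : nat) (h : 'I_n -> C) (e : nat -> C) : umod :=
  @Umod n
    (\matrix_(i, j) ((i.+1 == j :> nat)%:R * e j))
    (\matrix_(i, j) (i == j.+1 :> nat)%:R)
    (diag_mx (\row_i qpow (h i)))
    (diag_mx (\row_i qpow (- h i)))
    (diag_mx (\row_i h i)).

Definition Vmod (a : C) : umod :=
  @ladder r (fun i => a + r%:R - 1 - 2 * i%:R)
    (fun i => qbr i%:R * qbr (i%:R - a) / qbr 1 ^+ 2).

Definition Smod (n : nat) : umod :=
  @ladder n.+1 (fun i => n%:R - 2 * i%:R)
    (fun i => qbr i%:R * qbr (n%:R + 1 - i%:R) / qbr 1 ^+ 2).

Definition Cmod (a : int) : umod :=
  let h : C := a%:~R * r%:R in
  @Umod 1 0 0 (qpow h)%:M (qpow (- h))%:M h%:M.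

(* (C \ Z) u rZ *)
Definition admissible (a : C) : Prop :=
  (~ exists k : int, a = k%:~R) \/ exists k : int, a = k%:~R * r%:R.

(* Matrices act on columns: [row_free g] says that g is onto. *)
Definition projective (P : umod) : Prop :=
  forall (M N : umod) (g : 'M[C]_(udim N, udim M)) (f : 'M[C]_(udim N, udim P)),
    weight_module M -> weight_module N -> ulinear g -> ulinear f ->
    row_free g ->
    exists2 h : 'M[C]_(udim M, udim P), ulinear h & g *m h = f.

Definition projective_cover (P S : umod) : Prop :=
  [/\ weight_module P, projective P &
    exists p : 'M[C]_(udim S, udim P), [/\ ulinear p, row_free p &
      forall (Q : umod) (h : 'M[C]_(udim P, udim Q)),
        weight_module Q -> ulinear h -> row_free (p *m h) -> row_free h]].

(** ** Half twist *)

Definition direct_sum (k : nat) (X : 'I_k -> umod) (V : umod) : Prop :=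
  exists (inj : forall i, 'M[C]_(udim V, udim (X i)))
         (prj : forall i, 'M[C]_(udim (X i), udim V)),
  [/\ forall i, ulinear (inj i) /\ ulinear (prj i),
      forall i, prj i *m inj i = 1%:M,
      forall i j, i != j -> prj i *m inj j = 0
    & \sum_i inj i *m prj i = 1%:M].

Definition indecomposable (V : umod) : Prop :=
  [/\ weight_module V, udim V <> 0%N &
    forall X : 'I_2 -> umod, (forall i, weight_module (X i)) ->
      direct_sum X V -> exists i, udim (X i) = 0%N].

(* X (simple) is a composition factor of V iff it is a quotient of a submodule
   of V; [row_free f^T] says that f is injective on columns. *)
Definition composition_factor (X V : umod) : Prop :=
  exists (W : umod) (f : 'M[C]_(udim V, udim W)) (p : 'M[C]_(udim X, udim W)),
    [/\ weight_module W, ulinear f /\ row_free f^T & ulinear p /\ row_free p].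

(* The value assigned to each simple weight module. *)
Inductive half_twist_value : umod -> C -> Prop :=
  | HTV (a : C) of admissible a :
      half_twist_value (Vmod a) (qpow ((a ^+ 2 - (r%:R - 1) ^+ 2) / 4))
  | HTSeven (i : nat) (k : int) of (i.+2 <= r)%N & (2 %| k)%Z :
      half_twist_value (tens (Smod i) (Cmod k))
        (qpow (i%:R * (i%:R + 2 - 2 * r%:R) / 4))
  | HTSodd (i j : nat) (k : int) of (i.+2 <= r)%N & ~~ (2 %| k)%Z &
      j = (r - 2 - i)%N :
      half_twist_value (tens (Smod i) (Cmod k))
        (qpow (j%:R * (j%:R + 2 - 2 * r%:R) / 4)).

Definition is_half_twist (s : forall V : umod, 'M[C]_(udim V)) : Prop :=
  [/\ forall V, weight_module V -> ulinear (s V) /\ s V \in unitmx,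
      forall (V W : umod) (f : 'M[C]_(udim W, udim V)),
        weight_module V -> weight_module W -> ulinear f ->
        s W *m f = f *m s V
    & forall V, indecomposable V ->
        s V *m s V = twist_mx V /\
        forall X c, half_twist_value X c -> composition_factor X V ->
          forall a, eigenvalue (s V) a = (a == c)].

(* The natural automorphism of the identity of C characterized by
   [is_half_twist]. *)
Definition half_twist : forall V : umod, 'M[C]_(udim V) :=
  epsilon (inhabits (fun V : umod => 0)) is_half_twist.

Definition Xmap (V W : umod) : 'M[C]_(udim W * udim V, udim V * udim W) :=
  invmx (half_twist (tens W V)) *m braiding V W
    *m tensmx (half_twist V) (half_twist W).

(** ** The category D *)

Inductive inA : umod -> Prop :=
  | inA_V (a : R) of admissible a%:C : inA (Vmod a%:C)
  | inA_S (n : nat) of (n.+2 <= r)%N : inA (Smod n)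
  | inA_P (i : nat) (P : umod) of (i.+2 <= r)%N & projective_cover P (Smod i) :
      inA P
  | inA_C (a : int) : inA (Cmod a).

Inductive tensor_product_of_A : umod -> Prop :=
  | TPA X of inA X : tensor_product_of_A X
  | TPdual X of inA X : tensor_product_of_A (dual_mod X)
  | TPtens X Y of tensor_product_of_A X & tensor_product_of_A Y :
      tensor_product_of_A (tens X Y).

Definition retract_of (X Y : umod) : Prop :=
  exists (i : 'M[C]_(udim Y, udim X)) (p : 'M[C]_(udim X, udim Y)),
    [/\ ulinear i, ulinear p & p *m i = 1%:M].

Definition in_D (V : umod) : Prop :=
  weight_module V /\
  exists (k : nat) (X : 'I_k -> umod), direct_sum X V /\
    forall i, weight_module (X i) /\
      exists2 Y, tensor_product_of_A Y & retract_of (X i) Y.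

(** ** Hermitian modules and the category D^dagger *)

(* [gram V i j] is the value of the form at (e_i, e_j). *)
Record hmod := Hmod { hmod_mod :> umod; gram : 'M[C]_(udim hmod_mod) }.

Definition hform (V : hmod) (v w : 'cV[C]_(udim V)) : C :=
  (v ^t* *m gram V *m w) ord0 ord0.

Record hermitian_module (V : hmod) : Prop := {
  herm_weight : weight_module V;
  herm_sym : forall v w, hform (V := V) v w = (hform (V := V) w v)^*;
  herm_nondeg : forall v, (forall w, hform (V := V) v w = 0) -> v = 0;
  herm_inv : forall x v w,
    hform (V := V) (uact V (udag x) *m v) w = hform (V := V) v (uact V x *m w)
}.

Definition in_Ddagger (V : hmod) : Prop := hermitian_module V /\ in_D V.

Definition hunit : hmod := @Hmod unit_mod 1%:M.

(* (v, v') = (v, flip (X v'))_p, and [tensmx (gram V) (gram W)] is the Gram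
   matrix of the form ( , )_p. *)
Definition htens (V W : hmod) : hmod :=
  @Hmod (tens V W)
    (tensmx (gram V) (gram W) *m (flip (udim W) (udim V) *m Xmap V W)).

(* [dual_vec i] is the vector e_i' with (e_i', e_j) = delta_ij, for (e_i) the
   standard basis. *)
Definition dual_vec (V : hmod) (i : 'I_(udim V)) : 'cV[C]_(udim V) :=
  col i ((invmx (gram V)) ^t*).

Lemma dual_vecP (V : hmod) i j : gram V \in unitmx ->
  hform (V:=V) (dual_vec i) (delta_mx j 0) = (i == j)%:R.
Proof.
move=> uV. rewrite /hform /dual_vec tr_col map_row trmxCK.
by rewrite -row_mul mulVmx // -colE !mxE.
Qed.

(* On the basis of V^* dual to (e_i):
   (e_j^* , e_k^* ) = \sum_i (e_j^* (e_i))^* e_k^* (e_i') = e_k^* (e_j'). *)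
Definition hdual (V : hmod) : hmod :=
  @Hmod (dual_mod V) (\matrix_(j, k) dual_vec j k ord0).

Definition adjoint (V W : hmod) (g : 'M[C]_(udim W, udim V)) :
    'M[C]_(udim V, udim W) :=
  invmx (gram V) *m g ^t* *m gram W.

Lemma hform_adjoint (V W : hmod) (g : 'M[C]_(udim W, udim V)) v w :
  gram V \in unitmx -> (gram V) ^t* = gram V -> (gram W) ^t* = gram W ->
  hform (V:=W) w (g *m v) = hform (V:=V) (@adjoint V W g *m w) v.
Proof.
move=> uV hV hW; rewrite /hform /adjoint; congr (_ _ _).
rewrite !trmx_mul !map_mxM /= trmxCK hW !mulmxA.
by rewrite trmx_inv map_invmx hV mulmxKV.
Qed.

Definition Ddagger : ribbon_data := {|
  ob := hmod;
  isob := in_Ddagger;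
  hom := fun V W => 'M[C]_(udim W, udim V);
  ishom := fun V W f => ulinear f;
  idm := fun V => 1%:M;
  cmp := fun U V W g f => g *m f;
  tob := htens;
  thom := fun V V' W W' f g => tensmx f g;
  uob := hunit;
  assoc := fun U V W => idcast_mx _ _;
  assocV := fun U V W => idcast_mx _ _;
  lunit := fun V => idcast_mx _ _;
  runit := fun V => idcast_mx _ _;
  braid := fun V W => braiding V W;
  twist := fun V => twist_mx V;
  dualob := hdual;
  ev := fun V => ev_mx V;
  coev := fun V => coev_mx V;
  conjm := adjoint
|}.

End QuantumGroup.

(* Main.v *)
Require Import Defs.
From mathcomp Require Import all_boot all_order all_algebra.
From mathcomp Require Import all_classical all_reals all_analysis.
From mathcomp Require Import complex mxtens ring lra zify.
Set Implicit Arguments. Unset Strict Implicit. Unset Printing Implicit Defensive.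
Import Order.TTheory GRing.Theory Num.Theory.
Local Open Scope ring_scope.
Local Open Scope complex_scope.
Local Open Scope sesquilinear_scope.

(** The half twist is made explicit.  A vector of weight [a] splits into
    generalized eigenvectors of the Casimir element, and those with eigenvalue
    [casval a i] must be scaled, up to a unipotent factor, by the value [xval]
    attached to the simple quotient of [Vmod r (vpar a i)].  This gives an
    endomorphism [sig], polynomial in the Casimir element on each weight space;
    as [theta * sig^2 - 1] squares to zero, [half = (sig + theta^-1 sig^-1) / 2]
    is a natural square root of the twist.  A nonzero submodule contains a
    highest weight vector, and on those the axioms determine the half twist, so
    that [half_twist = half].

    For real weights the values [xval] have modulus 1.  By the same highest
    weight argument, [half] is unitary for every nondegenerate pairing that is
    compatible with the antiinvolution, and [half (dual_mod V)] is the transpose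
    of [half V].  Together with [theta (V (x) W) R21 R = theta V (x) theta W] and
    the fact that the adjoint of [R] is [R21^-1], this makes the form on a tensor
    product Hermitian and nondegenerate and the structure morphisms unitary, the
    unitarity of the associator being a consequence of the Yang-Baxter
    equation. *)

(** * Powers of q and q-exponential coefficients *)

(** [half_twist] is known only through [epsilon] and axioms on indecomposable modules; their
    classification is avoided. On weight [a] the relation E^r = 0 makes the product of the
    [X - casval a i], i < r, annihilate the Casimir element, and no value occurs three times. There
    theta is a polynomial in the Casimir with value [xval^-2] at each root. Interpolating [xval]
    modulo squares thus makes theta sig^2 - 1 vanish to first order at each root, so its square is
    zero. Commutation of [sig] with E and F compares the weights [a] and [a + 2], whose values
    differ by a shift of the index. Only the index wrapping round modulo r is delicate: if its
    parameter is admissible then E or F kills the vector concerned, otherwise [xval] is unchanged.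

    Commuting s and t with s^2 = t^2 satisfy (s - t)(s + t) = 0, so s = t once s + t is invertible,
    which is tested on highest weight vectors. Uniqueness, unitarity and the transpose formula all
    follow this pattern. The formula for duals also needs theta to be invariant under the exchange
    of E and F, a polynomial identity checked at generic weights. *)

Section QPow.
Variables (R : realType) (r : nat).
Hypothesis hr : (2 <= r)%N.
Local Notation C := R[i].
Local Notation q := (@qpow R r).
Implicit Types (x y a b : C).

Lemma expCD x y : expC (x + y) = expC x * expC y.
Proof.
case: x => a b; case: y => c d; rewrite /expC /=.
by apply/eqP; rewrite eq_complex /= expRD cosD sinD; apply/andP; split; apply/eqP; ring.
Qed.

Lemma expC0 : expC (0 : C) = 1.
Proof.
rewrite /expC /= expR0 cos0 sin0; apply/eqP; rewrite eq_complex /=.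
by rewrite !mulr0 !mul0r !mulr1 subr0 addr0 !eqxx.
Qed.

Lemma qpowD x y : q (x + y) = q x * q y.
Proof. by rewrite /qpow mulrDr mulrDl expCD. Qed.

Lemma qpow0 : q 0 = 1.
Proof. by rewrite /qpow mulr0 mul0r expC0. Qed.

Lemma qpow_mulN x : q x * q (- x) = 1.
Proof. by rewrite -qpowD subrr qpow0. Qed.

Lemma qpow_neq0 x : q x != 0.
Proof.
apply/eqP => q0; have := qpow_mulN x; rewrite q0 mul0r => /eqP.
by rewrite eq_sym oner_eq0.
Qed.

Lemma qpowN x : q (- x) = (q x)^-1.
Proof. by apply: (mulfI (qpow_neq0 x)); rewrite qpow_mulN mulfV ?qpow_neq0. Qed.

Lemma qpowX x (n : nat) : q x ^+ n = q (n%:R * x).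
Proof.
elim: n => [|n IH]; first by rewrite mul0r qpow0.
by rewrite exprS IH -qpowD; congr (q _); rewrite -natr1; ring.
Qed.

Lemma r_neq0 : (r%:R : C) != 0.
Proof. by rewrite pnatr_eq0 -lt0n (leq_trans _ hr). Qed.

Lemma rR_neq0 : (r%:R : R) != 0.
Proof. by rewrite pnatr_eq0 -lt0n (leq_trans _ hr). Qed.

Lemma natC (n : nat) : (n%:R : C) = (n%:R : R)%:C.
Proof. by rewrite (rmorph_nat (real_complex R)). Qed.

Lemma qpowE (a b : R) :
  q (a +i* b) = (expR (- (pi * b / r%:R)))%:C
                * (cos (pi * a / r%:R) +i* sin (pi * a / r%:R)).
Proof.
rewrite /qpow (_ : _ / _ = (- (pi * b / r%:R)) +i* (pi * a / r%:R)) //.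
apply: (mulIf r_neq0); rewrite divfK ?r_neq0 // natC.
apply/eqP; rewrite eq_complex /=; apply/andP; split; apply/eqP.
  by rewrite mul0r sub0r mulr0 subr0 mulNr divfK ?rR_neq0.
by rewrite mul0r mulr0 !add0r divfK ?rR_neq0.
Qed.

Lemma qpow_conj x : (q x)^*%C = q (- x^*%C).
Proof.
case: x => a b; rewrite !qpowE; apply/eqP; rewrite eq_complex /=.
rewrite !opprK !mulrN !mulNr cosN sinN.
by apply/andP; split; apply/eqP; ring.
Qed.

(** Subtracting a multiple of 2 pi brings t to some u in [0, 2 pi). If u were positive, sin (u / 2)
    would be positive, while cos u = 1 - 2 sin^2 (u / 2). *)
Lemma cos_eq1 (t : R) : cos t = 1 -> exists k : int, t = k%:~R * (pi *+ 2).
Proof.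
move=> ct; set p := (pi : R) *+ 2.
have p0 : 0 < p by rewrite pmulrn_lgt0 ?pi_gt0.
have cosDz (k : int) (x : R) : cos (x + k%:~R * p) = cos x.
  case: k => n.
    by rewrite -pmulrn mulr_natl (periodicn (@cosD2pi R)).
  rewrite NegzE mulrNz mulNr -pmulrn mulr_natl.
  by rewrite -{2}(subrK (p *+ n.+1) x) (periodicn (@cosD2pi R)).
pose k := Num.floor (t / p); exists k.
pose u := t - k%:~R * p.
have cu : cos u = 1 by rewrite -(cosDz k) subrK.
have /andP[k1 k2] := floor_itv (t / p); rewrite -/k in k1 k2.
have u0 : 0 <= u by rewrite subr_ge0 -ler_pdivlMr.
have u1 : u < p.
  rewrite ltrBlDr addrC -[X in _ + X]mul1r -mulrDl -ltr_pdivrMr //.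
  by rewrite intrD in k2.
suff : u = 0 by move/eqP; rewrite subr_eq0 => /eqP.
apply/eqP; rewrite eq_le u0 andbT leNgt; apply/negP => upos.
have su : 0 < sin (u / 2).
  apply: sin_gt0_pi; rewrite divr_gt0 //= ltr_pdivrMr // mulr_natr //.
have := cos_mulr2n (u / 2).
have -> : (u / 2) *+ 2 = u by rewrite -mulr_natr divfK ?pnatr_eq0.
rewrite cu cos2sin2.
by move=> e; move: su; rewrite lt_neqAle eq_sym -sqrf_eq0 => /andP[/eqP[]]; lra.
Qed.

(** Modulus and argument are separated: cos^2 + sin^2 = 1 forces the real exponential to be 1, and
    the argument is then a multiple of 2 pi. Through this kernel, coincidences of powers of q become
    arithmetic modulo 2r. *)
Lemma qpow_eq1 x : q x = 1 -> exists k : int, x = k%:~R * (2 * r%:R).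
Proof.
case: x => a b; rewrite qpowE => /eqP; rewrite eq_complex /=.
rewrite !mul0r subr0 addr0 => /andP[/eqP e1 /eqP e2].
have e0 : expR (- (pi * b / r%:R)) = 1 :> R.
  set e := expR _ in e1 e2 *; set c := cos _ in e1; set s := sin _ in e2.
  have ep : 0 < e by exact: expR_gt0.
  have s0 : s = 0 by move/eqP: e2; rewrite mulf_eq0 gt_eqF //= => /eqP.
  have cs : c ^+ 2 = 1 by have := cos2Dsin2 (pi * a / r%:R); rewrite -/c -/s s0; lra.
  have ec : e ^+ 2 = 1 by rewrite -(mulr1 (e ^+ 2)) -cs -exprMn e1 expr1n.
  by move/eqP: ec; rewrite sqrf_eq1 => /orP[] /eqP //; lra.
move: e1; rewrite e0 mul1r => /cos_eq1[k ek].
exists k; move: e0; rewrite -[RHS]expR0 => /expR_inj e0.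
have -> : b = 0.
  have : (pi * b / r%:R) * r%:R = 0.
    by rewrite -[pi * b / _]opprK e0 oppr0 mul0r.
  by rewrite divfK ?rR_neq0 // => /eqP; rewrite mulf_eq0 (gt_eqF (pi_gt0 R)) => /eqP.
apply/eqP; rewrite -(natrM _ 2 r) natC -(rmorph_int (real_complex R)) eq_complex.
have -> : a = k%:~R * (2 * r%:R).
  apply: (mulfI (lt0r_neq0 (pi_gt0 R))); apply: (mulIf (invr_neq0 rR_neq0)).
  rewrite ek -mulr_natr; field; exact: rR_neq0.
rewrite /= natrM; by apply/andP; split; apply/eqP; ring.
Qed.

Lemma qpow_r : q r%:R = -1.
Proof.
rewrite natC qpowE mulr0 mul0r oppr0 expR0 mulfK ?rR_neq0 // cospi sinpi.
by apply/eqP; rewrite eq_complex /=; apply/andP; split; apply/eqP; ring.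
Qed.

Lemma qpow_2r (k : int) : q (k%:~R * (2 * r%:R)) = 1.
Proof.
have H (n : nat) : q (n%:R * (2 * r%:R)) = 1.
  by rewrite -qpowX mulr_natl mulr2n qpowD qpow_r mulrNN mulr1 expr1n.
case: k => n; first by rewrite -pmulrn.
by rewrite NegzE mulrNz mulNr qpowN -pmulrn H invr1.
Qed.

Lemma qpowDr x : q (x + r%:R) = - q x.
Proof. by rewrite qpowD qpow_r mulrN1. Qed.

Lemma qpowBr x : q (x - r%:R) = - q x.
Proof. by rewrite -[X in - q X](subrK r%:R) qpowDr opprK. Qed.

Lemma qbrN x : qbr r (- x) = - qbr r x.
Proof. by rewrite /qbr opprK opprB. Qed.

Lemma qbr0 : qbr r (0 : C) = 0.
Proof. by rewrite /qbr oppr0 subrr. Qed.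

Lemma qbr_r : qbr r (r%:R : C) = 0.
Proof. by rewrite /qbr qpowN qpow_r invrN1 subrr. Qed.

Lemma qbrDr x : qbr r (x + r%:R) = - qbr r x.
Proof. by rewrite /qbr opprD qpowDr qpowBr -opprD. Qed.

Lemma qbr_eq0 x : qbr r x = 0 -> exists k : int, x = k%:~R * r%:R.
Proof.
move=> /eqP; rewrite subr_eq0 => /eqP e.
have : q (2 * x) = 1 by rewrite mulr_natl mulr2n qpowD {2}e qpow_mulN.
move=> /qpow_eq1[k ek]; exists k.
by apply: (mulfI (_ : 2 != 0 :> C)); rewrite ?pnatr_eq0 // ek; ring.
Qed.

Lemma intC_inj (k l : int) : k%:~R = l%:~R :> C -> k = l.
Proof. exact: intr_inj. Qed.

Lemma qbr_nat_neq0 n : (0 < n < r)%N -> qbr r (n%:R : C) != 0.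
Proof.
move=> /andP[n0 nr]; apply/eqP => /qbr_eq0[k].
rewrite [n%:R]pmulrn [r%:R]pmulrn -intrM => /intC_inj e.
have : (Posz r %| Posz n)%Z by rewrite e dvdz_mull.
by rewrite dvdzE /= => /(dvdn_leq n0); rewrite leqNgt nr.
Qed.

Lemma qbr1_neq0 : qbr r (1 : C) != 0.
Proof. by have := @qbr_nat_neq0 1; apply; rewrite /= hr. Qed.

(** q^x + q^-x - q^y - q^-y = (q^x - q^y)(1 - q^-(x+y)). Casimir eigenvalues have this form, so
    their coincidences become the congruences x = y or x = -y modulo 2r. *)
Lemma qpow_inj_sum x y : q x + q (- x) = q y + q (- y) ->
  q (x - y) = 1 \/ q (x + y) = 1.
Proof.
move=> e; have : (q x - q y) * (1 - q (- (x + y))) = 0.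
  rewrite opprD qpowD !qpowN in e *.
  have x0 := qpow_neq0 x; have y0 := qpow_neq0 y.
  transitivity (q x + (q x)^-1 - (q y + (q y)^-1)); last by rewrite e subrr.
  by field; rewrite x0 y0.
move/eqP; rewrite mulf_eq0 !subr_eq0 => /orP[] /eqP e'.
  by left; rewrite qpowD e' qpow_mulN.
by right; rewrite -[x + y]opprK qpowN -e' invr1.
Qed.

Local Notation c_ := (@Rcoef R r).

Lemma qfactS n : qfact R r n.+1 = qfact R r n * qbr r n.+1%:R.
Proof. by rewrite /qfact big_nat_recr. Qed.

(** The computations with q-exponentials use this recursion rather than the closed formula; the
    bound keeps the factors of the q-factorial invertible. *)
Lemma RcoefS n : (n.+1 < r)%N ->
  qbr r n.+1%:R * c_ n.+1 = qbr r 1 ^+ 2 * q n%:R * c_ n.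
Proof.
move=> nr; rewrite /Rcoef qfactS mulnS exprD.
have -> : n.+1%:R * (n.+1%:R - 1) / 2 = n%:R + n%:R * (n%:R - 1) / 2 :> C.
  by rewrite -natr1; field.
rewrite qpowD; have b0 : qbr r (n.+1%:R : C) != 0 by apply: qbr_nat_neq0.
have f0 : qfact R r n != 0.
  rewrite /qfact prodf_seq_neq0; apply/allP => k; rewrite mem_index_iota.
  move=> /andP[k0 kn]; apply: qbr_nat_neq0; rewrite k0 /=.
  by rewrite (leq_trans kn) // ltnW.
by field; rewrite b0 f0.
Qed.

Lemma Rcoef0 : c_ 0 = 1.
Proof.
rewrite /Rcoef /qfact big_geq // muln0 expr0 mul0r mul0r qpow0.
by rewrite invr1 !mulr1.
Qed.

(* The coefficients of the inverse q-exponential series. *)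
Definition RcoefV (n : nat) : C := (-1) ^+ n * q (- (n%:R * (n%:R - 1))) * c_ n.

Lemma RcoefV0 : RcoefV 0 = 1.
Proof. by rewrite /RcoefV Rcoef0 mul0r oppr0 qpow0 !mul1r. Qed.

Lemma RcoefVS n : (n.+1 < r)%N ->
  qbr r n.+1%:R * RcoefV n.+1 = - (qbr r 1 ^+ 2 * q (- n%:R) * RcoefV n).
Proof.
move=> nr; rewrite /RcoefV mulrCA RcoefS // exprS.
have -> : - (n.+1%:R * (n.+1%:R - 1)) = - n%:R - n%:R - n%:R * (n%:R - 1) :> C.
  by rewrite -natr1; ring.
rewrite !qpowD; have := qpow_mulN n%:R; move: (q _) (q (- n%:R)) => u v uv.
move: (c_ n) (q (- _)) ((-1) ^+ n) (qbr _ _) => x y z w.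
transitivity (- (z * (v * y) * (w ^+ 2 * x)) * (u * v)); first by ring.
by rewrite uv; ring.
Qed.

(** After multiplication by {n}, each term splits by {n} = q^(n-i) {i} + q^(-i) {n-i}. By the two
    recursions the first sum, shifted by one index, is the opposite of the second. *)
Lemma RcoefV_conv n : (0 < n < r)%N ->
  \sum_(i < n.+1) RcoefV i * c_ (n - i) = 0.
Proof.
case: n => // n /= nr.
apply: (mulfI (qbr_nat_neq0 (n := n.+1) _)); first by [].
rewrite mulr0 mulr_sumr.
have -> : \sum_(i < n.+2) qbr r n.+1%:R * (RcoefV i * c_ (n.+1 - i)) =
  \sum_(i < n.+2) q (n.+1 - i)%:R * (qbr r i%:R * RcoefV i) * c_ (n.+1 - i)
  + \sum_(i < n.+2) q (- i%:R) * RcoefV i * (qbr r (n.+1 - i)%:R * c_ (n.+1 - i)).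
  rewrite -big_split /=; apply: eq_bigr => i _.
  have -> : n.+1%:R = i%:R + (n.+1 - i)%:R :> C by rewrite -natrD subnKC // -ltnS.
  by rewrite /qbr !opprD !qpowD; ring.
rewrite big_ord_recl qbr0 mul0r mulr0 mul0r add0r.
rewrite [X in _ + X]big_ord_recr /= subnn qbr0 mul0r mulr0 addr0.
rewrite -big_split big1 //= => i _.
have ir : (i.+1 < r)%N by rewrite (leq_trans _ nr) // ltnS.
rewrite /bump /= add1n subSS RcoefVS //.
have -> : (n.+1 - i = (n - i).+1)%N by rewrite subSn // -ltnS.
rewrite RcoefS; last by rewrite (leq_trans _ nr) // ltnS ltnS leq_subr.
by ring.
Qed.

Lemma qpow_nat_conj n : (q (n%:R : C))^*%C = q (- n%:R).
Proof. by rewrite qpow_conj conjc_nat. Qed.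

Lemma qbr_nat_conj n : (qbr r (n%:R : C))^*%C = - qbr r n%:R.
Proof.
by rewrite /qbr rmorphB /= !qpow_conj rmorphN /= conjc_nat opprK opprB.
Qed.

(** Conjugation sends q to its inverse and so carries the recursion of [Rcoef] to that of [RcoefV].
    Hence the adjoint of an R-matrix is built from the inverse q-exponential. *)
Lemma Rcoef_conj n : (n < r)%N -> (c_ n)^*%C = RcoefV n.
Proof.
elim: n => [|n IH] nr; first by rewrite Rcoef0 RcoefV0 rmorph1.
apply: (mulfI (qbr_nat_neq0 (n := n.+1) _)); first by rewrite nr.
rewrite RcoefVS // -[X in X * _]opprK -qbr_nat_conj mulNr -rmorphM /= RcoefS //.
have -> (u v w : C) : (u ^+ 2 * v * w)^*%C = (u^*%C) ^+ 2 * v^*%C * w^*%C.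
  by rewrite 2!rmorphM rmorphXn.
rewrite (qbr_nat_conj 1) IH; last exact: ltnW.
by rewrite qpow_nat_conj; ring.
Qed.

End QPow.

(** * Linear algebra *)

Section LinearAlgebra.
Variable F : fieldType.

(** The library definition refers to row vectors. Modules consist of column vectors here, so the
    eigenbasis is given by the columns of P. *)
Lemma diagonalizableP' n (A : 'M[F]_n) :
  diagonalizable A <->
  exists P : 'M[F]_n, exists2 d : 'rV[F]_n, P \in unitmx & A *m P = P *m diag_mx d.
Proof.
split=> [[P Pu /diagonalizable_forPex[d Pd]]|[P [d Pu AP]]].
  exists (invmx P); exists d; first by rewrite unitmx_inv.
  have e := simmxPp (stablemx_unit A Pu) Pd.
  by apply: (can_inj (mulKmx Pu)); rewrite mulKVmx // !mulmxA e -mulmxA mulmxV ?mulmx1.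
exists (invmx P); first by rewrite unitmx_inv.
apply/diagonalizable_forPex; exists d; apply/simmxP; rewrite ?row_free_unit ?unitmx_inv //.
by apply: (can_inj (mulmxK Pu)); rewrite -mulmxA AP mulmxA mulVmx // mul1mx -mulmxA mulVmx // mulmx1.
Qed.

Lemma col_diag_eigen n (A P : 'M[F]_n) d i : A *m P = P *m diag_mx d ->
  A *m col i P = d 0 i *: col i P.
Proof.
move=> AP; rewrite colE mulmxA AP -mulmxA.
have -> : diag_mx d *m delta_mx i 0 = d 0 i *: delta_mx i 0 :> 'cV_n.
  apply/matrixP => k l; rewrite mul_diag_mx !mxE.
  by case: eqVneq => [->|] //=; rewrite !mulr0.
by rewrite scalemxAr.
Qed.

Lemma eq_on_cols m n (A B : 'M[F]_(m, n)) (P : 'M[F]_n) : P \in unitmx ->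
  (forall i, A *m col i P = B *m col i P) -> A = B.
Proof.
move=> Pu e; apply: (can_inj (mulmxK Pu)); apply/matrixP => i j.
by have /matrixP/(_ i 0) := e j; rewrite !colE !mulmxA -!colE !mxE.
Qed.

Lemma nonunit_ker n (A : 'M[F]_n) : A \notin unitmx ->
  exists2 v : 'cV[F]_n, v != 0 & A *m v = 0.
Proof.
move=> Au; have : ~~ row_free A^T by rewrite row_free_unit unitmx_tr.
rewrite -kermx_eq0 => /rowV0Pn[u /sub_kermxP uA u0].
exists u^T; first by rewrite trmx_eq0.
by apply: trmx_inj; rewrite trmx_mul trmxK uA trmx0.
Qed.

Lemma unit_ker n (A : 'M[F]_n) :
  (forall v : 'cV[F]_n, A *m v = 0 -> v = 0) -> A \in unitmx.
Proof.
move=> h; apply: contraT => /nonunit_ker[v v0 /h e]; by rewrite e eqxx in v0.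
Qed.

End LinearAlgebra.

(** * Weight vectors *)

Section Weights.
Variables (R : realType) (r : nat).
Hypothesis hr : (2 <= r)%N.
Local Notation C := R[i].
Local Notation q := (@qpow R r).
Implicit Types (V W : umod R) (a b : C).

Definition wt V a (v : 'cV[C]_(udim V)) := aH V *m v = a *: v.
Arguments wt : clear implicits.

Definition gen_linear V W (f : 'M[C]_(udim W, udim V)) :=
  [/\ f *m aE V = aE W *m f, f *m aF V = aF W *m f, f *m aK V = aK W *m f,
      f *m aKi V = aKi W *m f & f *m aH V = aH W *m f].

Lemma ulinearP V W (f : 'M[C]_(udim W, udim V)) : ulinear f <-> gen_linear f.
Proof.
split=> [h|[hE hF hK hKi hH]].
  by split; [exact: (h (UE _)) | exact: (h (UF _)) | exact: (h (UK _))
            | exact: (h (UKi _)) | exact: (h (UH _))].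
elim=> //= [c|x IHx y IHy|x IHx y IHy].
- by rewrite scalar_mxC.
- by rewrite mulmxDr mulmxDl IHx IHy.
- by rewrite mulmxA IHx -mulmxA IHy mulmxA.
Qed.

Lemma ulinear1 V : ulinear (1%:M : 'M[C]_(udim V)).
Proof. by move=> x; rewrite mul1mx mulmx1. Qed.

Lemma ulinear_mul U V W (g : 'M[C]_(udim W, udim V)) (f : 'M[C]_(udim V, udim U)) :
  ulinear g -> ulinear f -> ulinear (g *m f).
Proof. by move=> hg hf x; rewrite -mulmxA hf mulmxA hg mulmxA. Qed.

Lemma ulinearD V W (g f : 'M[C]_(udim W, udim V)) :
  ulinear g -> ulinear f -> ulinear (g + f).
Proof. by move=> hg hf x; rewrite mulmxDl mulmxDr hg hf. Qed.

Lemma ulinearZ V W c (f : 'M[C]_(udim W, udim V)) : ulinear f -> ulinear (c *: f).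
Proof. by move=> hf x; rewrite -scalemxAl -scalemxAr hf. Qed.

Lemma ulinearB V W (g f : 'M[C]_(udim W, udim V)) :
  ulinear g -> ulinear f -> ulinear (g - f).
Proof. by move=> hg hf; rewrite -scaleN1r; apply: ulinearD => //; apply: ulinearZ. Qed.

Lemma ulinear_inv V W (f : 'M[C]_(udim W, udim V)) (g : 'M[C]_(udim V, udim W)) :
  ulinear f -> g *m f = 1%:M -> f *m g = 1%:M -> ulinear g.
Proof.
move=> hf gf fg x; have := hf x => e.
by rewrite -[LHS]mulmx1 -fg mulmxA -(mulmxA g) -e !mulmxA gf mul1mx.
Qed.

Lemma ulinear_invmx V (f : 'M[C]_(udim V)) : ulinear f -> f \in unitmx ->
  ulinear (invmx f).
Proof. by move=> hf uf; apply: ulinear_inv hf _ _; rewrite ?mulmxV ?mulVmx. Qed.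

Lemma eq_on_wt V m (A B : 'M[C]_(m, udim V)) : diagonalizable (aH V) ->
  (forall a v, wt V a v -> A *m v = B *m v) -> A = B.
Proof.
case/diagonalizableP' => P [d Pu HP] e; apply: (eq_on_cols Pu) => i.
exact: e (col_diag_eigen i HP).
Qed.

Lemma sum_specproj V : diagonalizable (aH V) ->
  \sum_(a <- spectrum (aH V)) specproj (aH V) a = 1%:M.
Proof.
move=> dV; apply: eq_on_wt => // a v hv.
rewrite mul1mx -[RHS]scale1r -(mxfun_weight (fun=> 1) hv); congr (_ *m _).
by apply: eq_bigr => b _; rewrite scale1r.
Qed.

Lemma specproj_wt V a : diagonalizable (aH V) -> a \in spectrum (aH V) ->
  forall v, wt V a (specproj (aH V) a *m v).
Proof.
move=> dV ha v; rewrite /wt mulmxA [RHS]scalemxAl; congr (_ *m _).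
apply: eq_on_wt => // b w hw; have [->|w0] := eqVneq w 0; first by rewrite !mulmx0.
rewrite -mulmxA -scalemxAl (specproj_weight hw ha w0).
by rewrite -scalemxAr hw; case: eqVneq => [->|_] /=; rewrite ?scale0r ?scale1r // !scaler0.
Qed.

Lemma wt_ulinear V W (f : 'M[C]_(udim W, udim V)) a v :
  ulinear f -> wt V a v -> wt W a (f *m v).
Proof. by move=> /ulinearP[_ _ _ _ fH] hv; rewrite /wt mulmxA -fH -mulmxA hv -scalemxAr. Qed.

Section Module.
Variable V : umod R.
Hypothesis wV : weight_module r V.
Let rel := weight_relations wV.
Let dV := weight_diag wV.

Lemma wtE a v : wt V a v -> wt V (a + 2) (aE V *m v).
Proof.
move=> hv; rewrite /wt mulmxA; have /eqP := rel_HE rel.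
rewrite subr_eq => /eqP ->; rewrite mulmxDl -scalemxAl -mulmxA hv -scalemxAr.
by rewrite -scalerDl addrC.
Qed.

Lemma wtF a v : wt V a v -> wt V (a - 2) (aF V *m v).
Proof.
move=> hv; rewrite /wt mulmxA; have /eqP := rel_HF rel.
rewrite subr_eq => /eqP ->; rewrite mulmxDl -scalemxAl -mulmxA hv -scalemxAr.
by rewrite -scalerDl addrC.
Qed.

Lemma wtEn n a v : wt V a v -> wt V (a + 2 * n%:R) (aE V ^+ n *m v).
Proof.
elim: n => [|n IH] hv; first by rewrite expr0 mulr0 addr0 mul1mx.
rewrite exprS -mulmxA.
have -> : a + 2 * n.+1%:R = a + 2 * n%:R + 2 by rewrite -natr1; ring.
exact/wtE/IH.
Qed.

Lemma wtFn n a v : wt V a v -> wt V (a - 2 * n%:R) (aF V ^+ n *m v).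
Proof.
elim: n => [|n IH] hv; first by rewrite expr0 mulr0 subr0 mul1mx.
rewrite exprS -mulmxA.
have -> : a - 2 * n.+1%:R = a - 2 * n%:R - 2 by rewrite -natr1; ring.
exact/wtF/IH.
Qed.

Lemma wtK a v : wt V a v -> aK V *m v = q a *: v.
Proof. exact: weight_K. Qed.

Lemma wtKi a v : wt V a v -> aKi V *m v = q (- a) *: v.
Proof.
move=> hv; rewrite -[RHS]mul1mx -(rel_KiK rel) -mulmxA -scalemxAr (wtK hv).
by rewrite scalerA mulrC qpow_mulN scale1r.
Qed.

Lemma EF_wt a v : wt V a v ->
  aE V *m (aF V *m v) = aF V *m (aE V *m v) + (qbr r a / qbr r 1) *: v.
Proof.
move=> hv; have /eqP := rel_EF rel; rewrite subr_eq => /eqP e.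
rewrite mulmxA e mulmxDl -scalemxAl mulmxBl (wtK hv) (wtKi hv) addrC mulmxA.
by congr (_ + _); rewrite -scalerBl scalerA /qbr (qpowN r 1) mulrC.
Qed.

Lemma En0 n (v : 'cV_(udim V)) : (r <= n)%N -> aE V ^+ n *m v = 0.
Proof. by move=> /subnKC <-; rewrite exprD (rel_Er rel) mul0r mul0mx. Qed.

Lemma Fn0 n (v : 'cV_(udim V)) : (r <= n)%N -> aF V ^+ n *m v = 0.
Proof. by move=> /subnKC <-; rewrite exprD (rel_Fr rel) mul0r mul0mx. Qed.

Lemma top_E (v : 'cV_(udim V)) : v != 0 ->
  exists i, [/\ (i < r)%N, aE V ^+ i *m v != 0 & aE V *m (aE V ^+ i *m v) = 0].
Proof.
move=> v0; have ex : exists i, aE V ^+ i *m v == 0 by exists r; rewrite En0.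
case: (ex_minnP ex) => -[|i] /eqP ei mini.
  by move: ei; rewrite expr0 mul1mx => ei; rewrite ei eqxx in v0.
exists i; split; first by apply: mini; rewrite En0.
  by apply/negP => /mini; rewrite ltnn.
by rewrite mulmxA -[aE V *m _]/(aE V * _) -exprS.
Qed.

(** The kernel of an endomorphism is a submodule. If nonzero, it contains a weight vector, and the
    last nonzero power of E applied to it is a highest weight vector of the kernel. *)
Lemma hw_unit (D : 'M[C]_(udim V)) : ulinear D ->
  (forall a v, wt V a v -> aE V *m v = 0 -> v != 0 -> D *m v != 0) ->
  D \in unitmx.
Proof.
move=> lD h; have {}h a v : wt V a v -> D *m v = 0 -> v = 0.
  move=> hv Dv; apply/eqP; apply: contraT => /top_E[i [_ Ei0 EEi]].
  have /eqP[] := h _ _ (wtEn i hv) EEi Ei0.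
  have /ulinearP[DE _ _ _ _] := lD.
  have -> : forall w : 'cV_(udim V), D *m (aE V ^+ i *m w) = aE V ^+ i *m (D *m w).
    elim: i {Ei0 EEi} => [|i IH] w; first by rewrite expr0 (mul1mx w) (mul1mx (D *m w)).
    by rewrite exprS -!mulmxA mulmxA DE -mulmxA IH.
  by rewrite Dv mulmx0.
apply: unit_ker => v Dv.
rewrite -[v]mul1mx -sum_specproj // mulmx_suml big_seq big1 // => a ha.
apply: (h a); first exact: specproj_wt.
(* D preserves weights, hence commutes with the spectral projectors, so the weight components of a
   kernel vector lie in the kernel. *)
have -> : D *m (specproj (aH V) a *m v) = specproj (aH V) a *m (D *m v).
  rewrite !mulmxA; congr (_ *m _); apply: eq_on_wt => // b w hw.
  have hDw := wt_ulinear lD hw; rewrite -!mulmxA.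
  by rewrite (specproj_eigen _ hw) (specproj_eigen _ hDw) -scalemxAr.
by rewrite Dv mulmx0.
Qed.

(** Induction on n; the step is the bracket identity {1}{a-2n-2} + {n+1}{a-n} = {n+2}{a-n-1}. *)
Lemma EFn n a v : wt V a v ->
  aE V *m (aF V ^+ n.+1 *m v) = aF V ^+ n.+1 *m (aE V *m v)
  + (qbr r n.+1%:R * qbr r (a - n%:R) / qbr r 1 ^+ 2) *: (aF V ^+ n *m v).
Proof.
move=> hv; have b0 := @qbr1_neq0 R r hr.
elim: n => [|n IH].
  rewrite expr1 expr0 mul1mx (EF_wt hv) subr0; congr (_ + _ *: _).
  by field.
rewrite exprS -[aF V * _]/(aF V *m _) -mulmxA (EF_wt (wtFn n.+1 hv)) IH mulmxDr -scalemxAr.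
rewrite -addrA -?mulmxA; congr (_ + _).
rewrite [aF V ^+ n.+1]exprS -[aF V * _]/(aF V *m _) -mulmxA -scalerDl; congr (_ *: _).
have -> : a - 2 * n.+1%:R = a - n%:R - n%:R - 1 - 1 by rewrite -natr1; ring.
rewrite -[n.+2%:R]natr1 -[n.+1%:R]natr1; move: b0.
rewrite /qbr !(opprD, opprK, qpowD, qpowN).
have := qpow_neq0 r (1 : C); have := qpow_neq0 r (n%:R : C); have := qpow_neq0 r a.
move: (q 1) (q n%:R) (q a) => u x y y0 x0 u0 b1.
(* [field] meets the denominator {1} = u - u^-1 in the form u^2 - 1. *)
have u1 : u ^+ 2 - 1 != 0.
  apply: contra b1 => /eqP e; apply/eqP.
  have -> : u - u^-1 = (u ^+ 2 - 1) / u by field.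
  by rewrite e mul0r.
by field; rewrite u1 u0 x0 y0.
Qed.

End Module.
End Weights.

(** * Matrix powers, Kronecker products and q-exponentials *)

Section MatrixPowers.
Variable F : comPzRingType.

Lemma expmx0 n (A : 'M[F]_n) : A ^+ 0 = 1%:M. Proof. by []. Qed.

Lemma expmxS n (A : 'M[F]_n) m : A ^+ m.+1 = A *m A ^+ m.
Proof. exact: exprS. Qed.

Lemma expmxSr n (A : 'M[F]_n) m : A ^+ m.+1 = A ^+ m *m A.
Proof. exact: exprSr. Qed.

Lemma expmxD n (A : 'M[F]_n) l m : A ^+ (l + m) = A ^+ l *m A ^+ m.
Proof. exact: exprD. Qed.

Lemma expmx_tr n (A : 'M[F]_n) m : (A ^+ m)^T = A^T ^+ m.
Proof.
elim: m => [|m IH]; first by rewrite !expmx0 trmx1.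
by rewrite expmxS trmx_mul IH expmxSr.
Qed.

Lemma expmxZ n (A : 'M[F]_n) c m : (c *: A) ^+ m = c ^+ m *: A ^+ m.
Proof.
elim: m => [|m IH]; first by rewrite !expmx0 expr0 scale1r.
by rewrite !expmxS IH -scalemxAl -scalemxAr scalerA exprS.
Qed.

Lemma qcommX n (X Y : 'M[F]_n) c m : X *m Y = c *: (Y *m X) ->
  X ^+ m *m Y = c ^+ m *: (Y *m X ^+ m).
Proof.
move=> XY; elim: m => [|m IH]; first by rewrite !expmx0 mul1mx mulmx1 scale1r.
by rewrite expmxS -mulmxA IH -scalemxAr [X *m (Y *m _)]mulmxA XY -scalemxAl scalerA -[Y *m X *m _]mulmxA exprSr.
Qed.

(** On the dual module this makes E K^-1 and K F nilpotent of order r. *)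
Lemma qcomm_exp_mul n (X Y : 'M[F]_n) c : X *m Y = c *: (Y *m X) ->
  forall m, (Y *m X) ^+ m = c ^+ 'C(m, 2) *: (Y ^+ m *m X ^+ m).
Proof.
move=> XY; elim=> [|m IH]; first by rewrite !expmx0 mul1mx scale1r.
rewrite expmxSr IH -scalemxAl -mulmxA (mulmxA _ Y) (qcommX _ XY) -scalemxAl.
rewrite -scalemxAr scalerA -exprD expmxSr [X ^+ m.+1]expmxSr !mulmxA.
by rewrite binS bin1.
Qed.

Lemma nilp_band n (A : 'M[F]_n) : (forall i j : 'I_n, j != i.+1 :> nat -> A i j = 0) ->
  forall m (i j : 'I_n), j != (i + m)%N :> nat -> (A ^+ m) i j = 0.
Proof.
move=> hA; elim=> [|m IH] i j ij.
  by move: ij; rewrite addn0 expmx0 mxE; case: (eqVneq i j) => // ->; rewrite eqxx.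
rewrite expmxSr mxE big1 // => k _.
case: (eqVneq (k : nat) (i + m)%N) => [ek|nk]; last by rewrite IH ?mul0r.
by rewrite hA ?mulr0 // ek -addnS.
Qed.

Lemma nilp_exp n (A : 'M[F]_n) m : (forall i j : 'I_n, j != i.+1 :> nat -> A i j = 0) ->
  (n <= m)%N -> A ^+ m = 0.
Proof.
move=> hA nm; apply/matrixP => i j; rewrite (nilp_band hA) ?mxE //.
by rewrite neq_ltn (leq_trans (ltn_ord j)) // (leq_trans nm) ?leq_addl.
Qed.

End MatrixPowers.

Section Tensmx.
Variable F : comPzRingType.

Lemma tensmxDl m n p k (A A' : 'M[F]_(m, n)) (B : 'M[F]_(p, k)) :
  tensmx (A + A') B = tensmx A B + tensmx A' B.
Proof. by apply/matrixP => i j; rewrite !mxE mulrDl. Qed.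

Lemma tensmxDr m n p k (A : 'M[F]_(m, n)) (B B' : 'M[F]_(p, k)) :
  tensmx A (B + B') = tensmx A B + tensmx A B'.
Proof. by apply/matrixP => i j; rewrite !mxE mulrDr. Qed.

Lemma tensmxZl m n p k c (A : 'M[F]_(m, n)) (B : 'M[F]_(p, k)) :
  tensmx (c *: A) B = c *: tensmx A B.
Proof. by apply/matrixP => i j; rewrite !mxE mulrA. Qed.

Lemma tensmxZr m n p k c (A : 'M[F]_(m, n)) (B : 'M[F]_(p, k)) :
  tensmx A (c *: B) = c *: tensmx A B.
Proof. by apply/matrixP => i j; rewrite !mxE mulrCA. Qed.

Lemma tensmxBl m n p k (A A' : 'M[F]_(m, n)) (B : 'M[F]_(p, k)) :
  tensmx (A - A') B = tensmx A B - tensmx A' B.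
Proof. by apply/matrixP => i j; rewrite !mxE mulrBl. Qed.

Lemma tensmxBr m n p k (A : 'M[F]_(m, n)) (B B' : 'M[F]_(p, k)) :
  tensmx A (B - B') = tensmx A B - tensmx A B'.
Proof. by apply/matrixP => i j; rewrite !mxE mulrBr. Qed.

Lemma tensmx1 m n : tensmx (1%:M : 'M[F]_m) (1%:M : 'M[F]_n) = 1%:M.
Proof.
apply/matrixP => i j; case: (mxtens_indexP i) => i1 i2; case: (mxtens_indexP j) => j1 j2.
rewrite tensmxE !mxE (inj_eq (can_inj (@mxtens_indexK m n))) xpair_eqE.
by case: (i1 == j1); case: (i2 == j2); rewrite ?mulr1 ?mulr0.
Qed.

Lemma tensmxX m n (A : 'M[F]_m) (B : 'M[F]_n) k :
  tensmx A B ^+ k = tensmx (A ^+ k) (B ^+ k).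
Proof.
elim: k => [|k IH]; first by rewrite !expmx0 tensmx1.
by rewrite !expmxS IH tensmx_mul.
Qed.

End Tensmx.

Section Tensv.
Variables (F : comPzRingType) (m n : nat).

(** A Kronecker product of two columns has 1 * 1 columns. Retyping it as one column lets vectors of
    tensor products be nested and acted upon by [*m]. *)
Definition tensv (v : 'cV[F]_m) (w : 'cV[F]_n) : 'cV[F]_(m * n) := tensmx v w.

Lemma tensvE v w i j : tensv v w (mxtens_index (i, j)) 0 = v i 0 * w j 0.
Proof. by rewrite !mxE !mxtens_indexK; congr (v _ _ * w _ _); apply: val_inj. Qed.

Lemma tensvDl v v' w : tensv (v + v') w = tensv v w + tensv v' w.
Proof. exact: (@tensmxDl F m 1 n 1). Qed.

Lemma tensvDr v w w' : tensv v (w + w') = tensv v w + tensv v w'.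
Proof. exact: (@tensmxDr F m 1 n 1). Qed.

Lemma tensvZl c v w : tensv (c *: v) w = c *: tensv v w.
Proof. exact: (@tensmxZl F m 1 n 1). Qed.

Lemma tensvZr c v w : tensv v (c *: w) = c *: tensv v w.
Proof. exact: (@tensmxZr F m 1 n 1). Qed.

Lemma tensv_delta i j : tensv (delta_mx i 0) (delta_mx j 0) = delta_mx (mxtens_index (i, j)) 0.
Proof.
apply/colP => l; case: (mxtens_indexP l) => l1 l2.
rewrite tensvE !mxE (inj_eq (can_inj (@mxtens_indexK _ _))) xpair_eqE !eqxx !andbT.
by case: (l1 == i); case: (l2 == j); rewrite ?mulr1 ?mulr0.
Qed.

Lemma eq_tensv k (A B : 'M[F]_(k, m * n)) :
  (forall v w, A *m tensv v w = B *m tensv v w) -> A = B.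
Proof.
move=> h; apply/matrixP => i j; case: (mxtens_indexP j) => j1 j2.
have /matrixP/(_ i 0) := h (delta_mx j1 0) (delta_mx j2 0).
by rewrite tensv_delta -!colE [LHS]mxE [RHS]mxE.
Qed.

End Tensv.

Lemma tensv_mul (F : comPzRingType) m n k l (A : 'M[F]_(k, m)) (B : 'M[F]_(l, n)) v w :
  tensmx A B *m tensv v w = tensv (A *m v) (B *m w).
Proof. exact: (@tensmx_mul F k m l n 1 1). Qed.

Lemma tensmx_inv_unit (F : fieldType) m n (A : 'M[F]_m) (B : 'M[F]_n) :
  A \in unitmx -> B \in unitmx -> tensmx A B \in unitmx.
Proof.
move=> Au Bu; suff : tensmx A B *m tensmx (invmx A) (invmx B) = 1%:M by case/mulmx1_unit.
by rewrite tensmx_mul !mulmxV // tensmx1.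
Qed.

(** Meant for products of two truncated q-exponentials: by nilpotency the pairs with a + b >= r
    contribute nothing, so the triangle of total degree below r and the full square carry the same
    sum. *)
Lemma sum_triangle (M : nmodType) r (f : nat -> nat -> M) :
  (forall a b, (r <= a + b)%N -> f a b = 0) ->
  \sum_(n < r) \sum_(i < n.+1) f i (n - i)%N = \sum_(a < r) \sum_(b < r) f a b.
Proof.
move=> f0; transitivity (\sum_(n < r) \sum_(i < r | (i < n.+1)%N) f i (n - i)%N).
  by apply: eq_bigr => n _; rewrite (big_ord_widen r (fun i => f i (n - i)%N)).
rewrite (exchange_big_dep predT) //=; apply: eq_bigr => a _.
rewrite -(big_mkord (fun n => (a < n.+1)%N) (fun n => f a (n - a)%N)).
rewrite -(big_mkord xpredT (f a)) [RHS](@big_cat_nat _ _ _ (r - a)) ?leq_subr //=.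
rewrite [X in _ = _ + X]big_nat_cond [X in _ = _ + X]big1 ?addr0; last first.
  by move=> b /andP[/andP[b1 _] _]; apply: f0; lia.
rewrite (@big_cat_nat _ _ _ a) ?(ltnW (ltn_ord a)) //=.
rewrite [X in X + _]big_nat_cond [X in X + _]big1 ?add0r; last by lia.
rewrite -{1}[a : nat]add0n big_addn; apply: congr_big_nat => //; first by lia.
by move=> i _; rewrite addnK.
Qed.

Section QExp.
Variables (R : realType) (r : nat).
Hypothesis hr : (2 <= r)%N.
Local Notation C := R[i].
Local Notation q := (@qpow R r).
Local Notation c_ := (@Rcoef R r).
Variables (N : nat) (X Y : 'M[C]_N).
Hypothesis XY : X *m Y = q 2 *: (Y *m X).

Lemma qexp_comm i j : (X ^+ i *m Y ^+ j) *m X = q (- (2 * j%:R)) *: (X ^+ i.+1 *m Y ^+ j).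
Proof.
have YX : Y *m X = q (- 2) *: (X *m Y).
  by rewrite XY scalerA mulrC qpow_mulN scale1r.
rewrite -mulmxA (qcommX _ YX) -scalemxAr mulmxA -expmxSr; congr (_ *: _).
by rewrite qpowX; congr q; ring.
Qed.

Lemma qexp_mulS n : (n < r)%N ->
  c_ n *: (X + Y) ^+ n = \sum_(i < n.+1) (c_ i * c_ (n - i)) *: (X ^+ i *m Y ^+ (n - i)) ->
  c_ n *: (X + Y) ^+ n.+1 =
   \sum_(i < n.+1) (c_ i * c_ (n - i)) *:
      (q (- (2 * (n - i)%:R)) *: (X ^+ i.+1 *m Y ^+ (n - i)) + X ^+ i *m Y ^+ (n - i).+1).
Proof.
move=> nr IH; rewrite expmxSr scalemxAl IH mulmx_suml; apply: eq_bigr => i _.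
by rewrite -scalemxAl mulmxDr qexp_comm -[X ^+ i *m Y ^+ _ *m Y]mulmxA -expmxSr.
Qed.

(** The addition theorem exp(X + Y) = exp(X) exp(Y) for q-exponentials, in degree n. The induction
    splits {n+1} = q^(-(n+1-i)) {i} + q^i {n+1-i} and applies the recursion of the coefficients to
    each half. *)
Lemma qexp_add n : (n < r)%N ->
  c_ n *: (X + Y) ^+ n = \sum_(i < n.+1) (c_ i * c_ (n - i)) *: (X ^+ i *m Y ^+ (n - i)).
Proof.
elim: n => [|n IH] nr.
  by rewrite big_ord1 subn0 Rcoef0 !expmx0 mul1mx mulr1.
have {}IH := qexp_mulS (ltnW nr) (IH (ltnW nr)).
have b0 : qbr r (n.+1%:R : C) != 0 by apply: qbr_nat_neq0; rewrite ?nr.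
apply: (scalerI b0); rewrite scalerA RcoefS // -scalerA IH !scaler_sumr.
have -> : \sum_(i < n.+2) qbr r n.+1%:R *: ((c_ i * c_ (n.+1 - i)) *: (X ^+ i *m Y ^+ (n.+1 - i)))
 = \sum_(i < n.+2) (q (- (n.+1 - i)%:R) * (qbr r i%:R * c_ i) * c_ (n.+1 - i)) *: (X ^+ i *m Y ^+ (n.+1 - i))
 + \sum_(i < n.+2) (q i%:R * c_ i * (qbr r (n.+1 - i)%:R * c_ (n.+1 - i))) *: (X ^+ i *m Y ^+ (n.+1 - i)).
  rewrite -big_split /=; apply: eq_bigr => i _.
  rewrite -scalerDl scalerA; congr (_ *: _).
  have -> : n.+1%:R = i%:R + (n.+1 - i)%:R :> C by rewrite -natrD subnKC // -ltnS.
  by rewrite /qbr !opprD !qpowD; ring.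
rewrite [X in _ = X + _]big_ord_recl qbr0 mul0r mulr0 mul0r scale0r add0r.
rewrite [X in _ = _ + X]big_ord_recr /= subnn qbr0 mul0r mulr0 scale0r addr0.
rewrite -big_split /=; apply: eq_bigr => i _.
have ir : (i.+1 < r)%N by rewrite (leq_trans _ nr) // ltnS.
rewrite /bump /= add1n subSS RcoefS //.
have -> : (n.+1 - i = (n - i).+1)%N by rewrite subSn // -ltnS.
rewrite (@RcoefS R r hr); last by rewrite (leq_trans _ nr) // ltnS ltnS leq_subr.
rewrite !scalerDr !scalerA; congr (_ *: _ + _ *: _).
  have -> : n%:R = i%:R + (n - i)%:R :> C by rewrite -natrD subnKC // -ltnS.
  have -> : - (2 * (n - i)%:R) = - (n - i)%:R - (n - i)%:R :> C by ring.
  rewrite !qpowD; have := qpow_mulN r ((n - i)%:R : C).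
  move: (q (n - i)%:R) (q (- (n - i)%:R)) => u v uv.
  by rewrite -[RHS]mulr1 -[X in _ = _ * X]uv; ring.
have -> : n%:R = i%:R + (n - i)%:R :> C by rewrite -natrD subnKC // -ltnS.
by rewrite qpowD; ring.
Qed.

(** Degree r is out of reach of the induction, as {r} = 0. Instead the formula in degree r - 1 is
    multiplied once more by X + Y: the extreme terms are X^r and Y^r, and each mixed monomial
    receives two contributions that cancel. *)
Lemma qexp_nil : X ^+ r = 0 -> Y ^+ r = 0 -> (X + Y) ^+ r = 0.
Proof.
have [k rk] : exists k, r = k.+1 by case: r hr => // k; exists k.
move=> X0 Y0; have -> : (X + Y) ^+ r = (X + Y) ^+ k.+1 by rewrite -rk.
have {}X0 : X ^+ k.+1 = 0 by rewrite -rk.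
have {}Y0 : Y ^+ k.+1 = 0 by rewrite -rk.
have kr : (k < r)%N by rewrite rk.
have ck : c_ k != 0.
  have : (k < r)%N by [].
  elim: k {rk X0 Y0 kr} => [|m IH] mk; first by rewrite Rcoef0 oner_neq0.
  apply/negP => /eqP c0.
  have := mulf_neq0 (mulf_neq0 (expf_neq0 2 (qbr1_neq0 R hr)) (qpow_neq0 r (m%:R : C))) (IH (ltnW mk)).
  by rewrite -RcoefS // c0 mulr0 eqxx.
apply: (scalerI ck); rewrite scaler0 qexp_mulS //; last exact: qexp_add.
under eq_bigr do rewrite scalerDr; rewrite big_split /=.
rewrite big_ord_recr /= X0 mul0mx scaler0 scaler0 addr0.
rewrite [X in _ + X]big_ord_recl /= subn0 Y0 mulmx0 scaler0 add0r -big_split big1 //= => i _.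
rewrite /bump /= add1n; have ik := ltn_ord i.
have -> : (k - i = (k - i.+1).+1)%N by lia.
rewrite scalerA -scalerDl; apply/eqP; rewrite scaler_eq0; apply/orP; left; apply/eqP.
have b1 := qbr1_neq0 R hr; apply: (mulfI (expf_neq0 2 b1)); rewrite mulr0.
have e2 := @RcoefS R r hr i ltac:(lia).
have e1 := @RcoefS R r hr (k - i.+1) ltac:(lia).
have qq (m : nat) : q (m%:R : C) * q (- m%:R) = 1 by exact: qpow_mulN.
have {}e1 : qbr r 1 ^+ 2 * c_ (k - i.+1) = q (- (k - i.+1)%:R) * (qbr r (k - i.+1).+1%:R * c_ (k - i.+1).+1).
  rewrite e1; transitivity ((q (k - i.+1)%:R * q (- (k - i.+1)%:R)) * (qbr r 1 ^+ 2 * c_ (k - i.+1))); last by ring.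
  by rewrite qq mul1r.
have {}e2 : qbr r 1 ^+ 2 * c_ i = q (- i%:R) * (qbr r i.+1%:R * c_ i.+1).
  rewrite e2; transitivity ((q i%:R * q (- i%:R)) * (qbr r 1 ^+ 2 * c_ i)); last by ring.
  by rewrite qq mul1r.
transitivity (qbr r 1 ^+ 2 * c_ i * c_ (k - i.+1).+1 * q (- (2 * (k - i.+1).+1%:R))
  + c_ i.+1 * (qbr r 1 ^+ 2 * c_ (k - i.+1))); first by ring.
rewrite e1 e2.
(* {x+r} = -{x} makes the two brackets equal; the remaining powers of q are then opposite by q^r =
   -1. *)
have eb : qbr r (i.+1%:R : C) = qbr r (k - i.+1).+1%:R.
  have -> : i.+1%:R = - (k - i.+1).+1%:R + r%:R :> C.
    have -> : (r = (k - i.+1).+1 + i.+1)%N by lia.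
    by rewrite natrD; ring.
  by rewrite qbrDr // qbrN opprK.
rewrite eb; set x := q (- i%:R); set y := q (- (2 * _)); set z := q (- (k - i.+1)%:R).
suff e : x * y = - z.
  rewrite (_ : _ + _ = (x * y + z) * (qbr r (k - i.+1).+1%:R * c_ i.+1 * c_ (k - i.+1).+1)).
    by rewrite e addNr mul0r.
  by ring.
rewrite /x /y /z -qpowD -qpowBr //; congr q.
have -> : (r%:R : C) = ((k - i.+1).+1 + i.+1)%:R by congr (_%:R); lia.
by rewrite natrD -!natr1; ring.
Qed.

End QExp.

(** * Constructions of weight modules *)

Section Constructions.
Variables (R : realType) (r : nat).
Hypothesis hr : (2 <= r)%N.
Local Notation C := R[i].
Local Notation q := (@qpow R r).
Implicit Types (V W : umod R) (a b : C).

(** K and its inverse act on weight vectors through q^H, so their commutation relations follow from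
    E and F moving weights by 2. *)
Lemma mk_weight V :
  diagonalizable (aH V) ->
  (forall a v, wt a v -> aK V *m v = q a *: v) ->
  (forall a v, wt a v -> aKi V *m v = q (- a) *: v) ->
  aH V *m aE V - aE V *m aH V = 2 *: aE V ->
  aH V *m aF V - aF V *m aH V = - 2 *: aF V ->
  aE V *m aF V - aF V *m aE V = (q 1 - (q 1)^-1)^-1 *: (aK V - aKi V) ->
  aE V ^+ r = 0 -> aF V ^+ r = 0 -> weight_module r V.
Proof.
move=> dV wK wKi HE HF EF Er Fr.
have wE a v : wt a v -> wt (a + 2) (aE V *m v).
  move=> hv; rewrite /wt mulmxA; move/eqP: HE; rewrite subr_eq => /eqP ->.
  by rewrite mulmxDl -scalemxAl -mulmxA hv -scalemxAr -scalerDl addrC.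
have wF a v : wt a v -> wt (a - 2) (aF V *m v).
  move=> hv; rewrite /wt mulmxA; move/eqP: HF; rewrite subr_eq => /eqP ->.
  by rewrite mulmxDl -scalemxAl -mulmxA hv -scalemxAr -scalerDl addrC.
split; [split | exact: dV | exact: wK].
- apply: (eq_on_wt dV) => a v hv; rewrite mul1mx -mulmxA.
  by rewrite (wKi _ _ hv) -scalemxAr (wK _ _ hv) scalerA mulrC qpow_mulN scale1r.
- apply: (eq_on_wt dV) => a v hv; rewrite mul1mx -mulmxA.
  by rewrite (wK _ _ hv) -scalemxAr (wKi _ _ hv) scalerA qpow_mulN scale1r.
- apply: (eq_on_wt dV) => a v hv; rewrite -!mulmxA (wKi _ _ hv) -!scalemxAr.
  rewrite (wK _ _ (wE _ _ hv)) scalerA -qpowD -scalemxAl.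
  by congr (q _ *: _); ring.
- apply: (eq_on_wt dV) => a v hv; rewrite -!mulmxA (wKi _ _ hv) -!scalemxAr.
  rewrite (wK _ _ (wF _ _ hv)) scalerA -qpowD -scalemxAl.
  by congr (q _ *: _); ring.
- exact: EF.
- apply: (eq_on_wt dV) => a v hv; rewrite -[LHS]mulmxA -[RHS]mulmxA.
  by rewrite (wK _ _ hv) hv -!scalemxAr (wK _ _ hv) hv !scalerA mulrC.
- exact: HE.
- exact: HF.
- exact: Er.
exact: Fr.
Qed.

(** An eigenbasis of H on which A acts by f of the weight identifies A with [mxfun f], which acts in
    this way on every weight vector. *)
Lemma wt_fun V (P : 'M[C]_(udim V)) d A (f : C -> C) : P \in unitmx ->
  aH V *m P = P *m diag_mx d -> A *m P = P *m diag_mx (\row_i f (d 0 i)) ->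
  forall a v, wt a v -> A *m v = f a *: v.
Proof.
move=> Pu HP AP a v hv; rewrite -(mxfun_weight f hv); congr (_ *m _).
apply: (eq_on_cols Pu) => i; rewrite (col_diag_eigen i AP).
by rewrite (mxfun_weight _ (col_diag_eigen i HP)) !mxE.
Qed.

Lemma diag_of V (P : 'M[C]_(udim V)) d : P \in unitmx ->
  aH V *m P = P *m diag_mx d -> diagonalizable (aH V).
Proof. by move=> Pu HP; apply/diagonalizableP'; exists P; exists d. Qed.

Lemma weight_basis V : weight_module r V ->
  exists P : 'M[C]_(udim V), exists2 d, P \in unitmx &
   [/\ aH V *m P = P *m diag_mx d, aK V *m P = P *m diag_mx (\row_i q (d 0 i))
     & aKi V *m P = P *m diag_mx (\row_i q (- d 0 i))].
Proof.
move=> wV; have /diagonalizableP'[P [d Pu HP]] := weight_diag wV.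
have colE' (A : 'M[C]_(udim V)) (e : 'rV_(udim V)) :
    (forall i, A *m col i P = e 0 i *: col i P) -> A *m P = P *m diag_mx e.
  move=> h; apply/matrixP => i j; have /matrixP/(_ i 0) := h j.
  by rewrite !colE mulmxA -!colE mul_mx_diag !mxE => ->; exact: mulrC.
exists P; exists d; [exact: Pu | split; [exact: HP | |]]; apply: colE' => i; rewrite mxE.
  exact: wtK wV _ _ (col_diag_eigen i HP).
exact: wtKi wV _ _ (col_diag_eigen i HP).
Qed.

(** The twist by the Chevalley involution, exchanging E with F and K with K^-1 and negating H. It
    exchanges highest and lowest weight vectors, so that results about F^n E^n give results about
    E^n F^n. *)
Definition chev_mod V : umod R := @Umod R (udim V) (aF V) (aE V) (aKi V) (aK V) (- aH V).

Lemma tr_diag n (A P : 'M[C]_n) d : P \in unitmx -> A *m P = P *m diag_mx d ->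
  A^T *m (invmx P)^T = (invmx P)^T *m diag_mx d.
Proof.
move=> Pu AP; rewrite -[diag_mx d]tr_diag_mx -!trmx_mul; congr trmx.
by apply: (can_inj (mulKmx Pu)); rewrite !mulmxA mulmxV // mul1mx -AP -mulmxA mulmxV ?mulmx1.
Qed.

Lemma chev_mod_weight V : weight_module r V -> weight_module r (chev_mod V).
Proof.
move=> wV; have rel := weight_relations wV; have dV := weight_diag wV.
have wtN a v : wt (V := chev_mod V) a v -> wt (V := V) (- a) v.
  by rewrite /wt /= mulNmx => e; rewrite scaleNr -e opprK.
apply: mk_weight => /=.
- case/diagonalizableP': dV => P [d Pu HP]; apply/diagonalizableP'.
  by exists P; exists (- d) => //; rewrite mulNmx HP linearN /= mulmxN.
- by move=> a v /wtN/(wtKi wV); rewrite opprK.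
- by move=> a v /wtN/(wtK wV).
- by rewrite mulNmx mulmxN opprK addrC -opprB (rel_HF rel) scaleNr opprK.
- by rewrite mulNmx mulmxN opprK addrC -opprB (rel_HE rel) scaleNr.
- by rewrite -opprB (rel_EF rel) -scalerN opprB.
- exact: (rel_Fr rel).
- exact: (rel_Er rel).
Qed.

Lemma dual_E V : aE (dual_mod V) = - (aE V *m aKi V)^T.
Proof. by rewrite /= mul_scalar_mx scaleN1r linearN. Qed.

Lemma dual_F V : aF (dual_mod V) = - (aK V *m aF V)^T.
Proof. by rewrite /= mul_scalar_mx scaleN1r linearN. Qed.

Lemma dual_H V : aH (dual_mod V) = - (aH V)^T.
Proof. by rewrite /= mul_scalar_mx scaleN1r linearN. Qed.

Section Rel.
Variable V : umod R.
Hypothesis wV : weight_module r V.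
Let rel := weight_relations wV.

Lemma KE_comm : aK V *m aE V = q 2 *: (aE V *m aK V).
Proof. by rewrite -[LHS]mulmx1 -(rel_KiK rel) mulmxA (rel_KE rel) -scalemxAl. Qed.

Lemma KF_comm : aK V *m aF V = q (- 2) *: (aF V *m aK V).
Proof. by rewrite -[LHS]mulmx1 -(rel_KiK rel) mulmxA (rel_KF rel) -scalemxAl. Qed.

Lemma KiE_comm : aKi V *m aE V = q (- 2) *: (aE V *m aKi V).
Proof.
have -> : aE V *m aKi V = aKi V *m (aK V *m aE V) *m aKi V.
  by rewrite [aKi V *m (_ *m _)]mulmxA (rel_KiK rel) mul1mx.
rewrite KE_comm -scalemxAr -scalemxAl scalerA mulrC qpow_mulN scale1r.
by rewrite -!mulmxA (rel_KKi rel) mulmx1.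
Qed.

Lemma KiF_comm : aKi V *m aF V = q 2 *: (aF V *m aKi V).
Proof.
have -> : aF V *m aKi V = aKi V *m (aK V *m aF V) *m aKi V.
  by rewrite [aKi V *m (_ *m _)]mulmxA (rel_KiK rel) mul1mx.
rewrite KF_comm -scalemxAr -scalemxAl scalerA qpow_mulN scale1r.
by rewrite -!mulmxA (rel_KKi rel) mulmx1.
Qed.

Lemma HK_comm : aH V *m aKi V = aKi V *m aH V.
Proof.
rewrite -[LHS]mul1mx -(rel_KiK rel) -mulmxA (mulmxA (aK V)) -(rel_HK rel) -mulmxA.
by rewrite (rel_KKi rel) mulmx1.
Qed.

Lemma qpowKV a : q a * q (- a) = 1. Proof. exact: qpow_mulN. Qed.

Lemma dual_weight : weight_module r (dual_mod V).
Proof.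
have NN n (A B : 'M[C]_n) : (- A) *m (- B) = A *m B by rewrite mulNmx mulmxN opprK.
have [P [d Pu [HP KP KiP]]] := weight_basis wV.
have Pu' : (invmx P)^T \in unitmx by rewrite unitmx_tr unitmx_inv.
have HP' : aH (dual_mod V) *m (invmx P)^T = (invmx P)^T *m diag_mx (- d).
  by rewrite dual_H mulNmx (tr_diag Pu HP) linearN /= mulmxN.
apply: mk_weight.
- exact: (diag_of (V := dual_mod V) Pu' HP').
- apply: (wt_fun (V := dual_mod V) Pu' HP').
  rewrite /= (tr_diag Pu KiP); congr (_ *m diag_mx _); apply/rowP => i; by rewrite !mxE.
- apply: (@wt_fun (dual_mod V) _ _ _ (fun x => q (- x)) Pu' HP').
  rewrite /= (tr_diag Pu KP); congr (_ *m diag_mx _); apply/rowP => i; by rewrite !mxE opprK.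
- rewrite dual_H dual_E !NN -!trmx_mul -linearB /=.
  have -> : aE V *m aKi V *m aH V - aH V *m (aE V *m aKi V) = - (2 *: (aE V *m aKi V)).
    rewrite scalemxAl -(rel_HE rel) mulmxBl opprB -!mulmxA HK_comm; by [].
  by rewrite linearN linearZ /= scalerN.
- rewrite dual_H dual_F !NN -!trmx_mul -linearB /=.
  have -> : aK V *m aF V *m aH V - aH V *m (aK V *m aF V) = 2 *: (aK V *m aF V).
    rewrite -[2]opprK scaleNr scalemxAr -(rel_HF rel) mulmxBr opprB !mulmxA (rel_HK rel); by [].
  by rewrite linearZ /= scaleNr scalerN opprK.
- rewrite dual_E dual_F !NN -!trmx_mul -linearB /=.
  have -> : aK V *m aF V *m (aE V *m aKi V) = aF V *m aE V.
    rewrite KF_comm -scalemxAl -mulmxA (mulmxA (aK V)) KE_comm -scalemxAl -scalemxAr scalerA.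
    by rewrite -mulmxA (rel_KKi rel) mulmx1 mulrC qpowKV scale1r.
  have -> : aE V *m aKi V *m (aK V *m aF V) = aE V *m aF V.
    by rewrite -mulmxA (mulmxA (aKi V)) (rel_KiK rel) mul1mx.
  by rewrite -opprB (rel_EF rel) -scalerN opprB linearZ /= linearB.
- rewrite dual_E -linearN /= -expmx_tr -scaleN1r expmxZ.
  by rewrite (qcomm_exp_mul KiE_comm) (rel_Er rel) mul0mx !scaler0 trmx0.
rewrite dual_F -linearN /= -expmx_tr -scaleN1r expmxZ.
have FK : aF V *m aK V = q 2 *: (aK V *m aF V).
  by rewrite KF_comm scalerA qpowKV scale1r.
by rewrite (qcomm_exp_mul FK) (rel_Fr rel) mulmx0 !scaler0 trmx0.
Qed.
End Rel.

Section Tens.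
Variables V W : umod R.
Hypotheses (wV : weight_module r V) (wW : weight_module r W).
Let relV := weight_relations wV.
Let relW := weight_relations wW.

(** The coproducts of E and F are sums of two q-commuting nilpotent matrices, hence nilpotent by
    [qexp_nil]; a tensor product of eigenbases diagonalizes H. *)
Lemma tens_weight : weight_module r (tens V W).
Proof.
have [P [d Pu [HP KP KiP]]] := weight_basis wV.
have [Q [e Qu [HQ KQ KiQ]]] := weight_basis wW.
have PQu := tensmx_inv_unit Pu Qu.
pose dd := \row_(k < udim V * udim W) (d 0 (mxtens_unindex k).1 + e 0 (mxtens_unindex k).2).
have diagE (f : 'rV[C]_(udim V)) (g : 'rV[C]_(udim W)) :
    tensmx (diag_mx f) (diag_mx g) = diag_mx (\row_k (f 0 (mxtens_unindex k).1 * g 0 (mxtens_unindex k).2)).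
  apply/matrixP => i j; case: (mxtens_indexP i) => i1 i2; case: (mxtens_indexP j) => j1 j2.
  rewrite tensmxE !mxE !mxtens_indexK (inj_eq (can_inj (@mxtens_indexK _ _))) xpair_eqE.
  by case: (eqVneq i1 j1); case: (eqVneq i2 j2); rewrite ?mulr1n ?mulr0n ?mulr0 ?mul0r.
have one m : (1%:M : 'M[C]_m) = diag_mx (const_mx 1).
  by rewrite diag_const_mx.
have HPQ : aH (tens V W) *m tensmx P Q = tensmx P Q *m diag_mx dd.
  rewrite /= mulmxDl !tensmx_mul HP HQ !mul1mx.
  rewrite -[X in tensmx _ X + _]mulmx1 -[X in _ + tensmx X _]mulmx1 -!tensmx_mul -mulmxDr.
  congr (_ *m _); rewrite !one !diagE -linearD /=; congr diag_mx.
  by apply/rowP => k; rewrite !mxE mulr1 mul1r.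
apply: mk_weight.
- exact: (diag_of (V := tens V W) PQu HPQ).
- apply: (wt_fun (V := tens V W) PQu HPQ); rewrite /= tensmx_mul KP KQ -tensmx_mul diagE.
  by congr (_ *m diag_mx _); apply/rowP => k; rewrite !mxE qpowD.
- apply: (@wt_fun (tens V W) _ _ _ (fun x => q (- x)) PQu HPQ).
  rewrite /= tensmx_mul KiP KiQ -tensmx_mul diagE.
  by congr (_ *m diag_mx _); apply/rowP => k; rewrite !mxE opprD qpowD.
- rewrite /= !mulmxDl !mulmxDr !tensmx_mul !mul1mx !mulmx1.
  rewrite [tensmx (aE V *m aH V) _ + _]addrC.
  rewrite opprD !opprD [in LHS]addrACA.
  transitivity (tensmx 1%:M (aH W *m aE W - aE W *m aH W) + tensmx (aH V *m aE V - aE V *m aH V) (aK W)).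
    rewrite tensmxBr tensmxBl (rel_HK relW); move: (tensmx (aH V) (aE W)) (tensmx (aH V *m aE V) _) => x y.
    move: (tensmx 1%:M (aH W *m aE W)) (tensmx (aE V) (aK W *m aH W)) => z t.
    move: (tensmx 1%:M (aE W *m aH W)) (tensmx (aE V *m aH V) (aK W)) => u v.
    by rewrite !addrA; apply/matrixP => i j; rewrite !mxE; ring.
  by rewrite (rel_HE relV) (rel_HE relW) tensmxZl tensmxZr -scalerDr.
- rewrite /= !mulmxDl !mulmxDr !tensmx_mul !mul1mx !mulmx1.
  transitivity (tensmx (aKi V) (aH W *m aF W - aF W *m aH W) + tensmx (aH V *m aF V - aF V *m aH V) 1%:M).
    rewrite tensmxBr tensmxBl (HK_comm wV); move: (tensmx (aKi V *m aH V) _) (tensmx (aH V *m aF V) _) => x y.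
    move: (tensmx (aKi V) _) (tensmx (aKi V) _) (tensmx (aF V) _) (tensmx (aF V *m _) _) => z t u w.
    by apply/matrixP => i j; rewrite !mxE; ring.
  by rewrite (rel_HF relV) (rel_HF relW) tensmxZl tensmxZr -scalerDr.
- rewrite /= !mulmxDl !mulmxDr !tensmx_mul !mul1mx !mulmx1.
  have e1 : tensmx (aKi V *m aE V) (aF W *m aK W) = tensmx (aE V *m aKi V) (aK W *m aF W).
    rewrite (KiE_comm wV) (KF_comm wW) tensmxZl tensmxZr; by [].
  rewrite e1; transitivity (tensmx (aKi V) (aE W *m aF W - aF W *m aE W) + tensmx (aE V *m aF V - aF V *m aE V) (aK W)).
    rewrite tensmxBr tensmxBl; apply/matrixP => i j; rewrite !mxE; ring.
  rewrite (rel_EF relV) (rel_EF relW) tensmxZl tensmxZr -scalerDr; congr (_ *: _).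
  by rewrite tensmxBr tensmxBl addrC addrA subrK.
- rewrite /= addrC; apply: (qexp_nil hr).
  + by rewrite !tensmx_mul !mul1mx !mulmx1 (KE_comm wW) tensmxZr.
  + by rewrite tensmxX (rel_Er relV) tens0mx.
  by rewrite tensmxX (rel_Er relW) tensmx0.
rewrite /=; apply: (qexp_nil hr).
+ by rewrite !tensmx_mul !mul1mx !mulmx1 (KiF_comm wV) tensmxZl.
+ by rewrite tensmxX (rel_Fr relW) tensmx0.
by rewrite tensmxX (rel_Fr relV) tens0mx.
Qed.

Lemma wt_tensv a b (v : 'cV_(udim V)) (w : 'cV_(udim W)) :
  wt a v -> wt b w -> wt (V := tens V W) (a + b) (tensv v w).
Proof.
move=> hv hw; rewrite /wt /= mulmxDl !tensv_mul !mul1mx hv hw tensvZl tensvZr.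
by rewrite -scalerDl.
Qed.

Lemma eq_on_tens m (A B : 'M[C]_(m, udim V * udim W)) :
  (forall a b v w, wt (V := V) a v -> wt (V := W) b w ->
    A *m tensv v w = B *m tensv v w) -> A = B.
Proof.
move=> h; have [P [d Pu [HP _ _]]] := weight_basis wV.
have [Q [e Qu [HQ _ _]]] := weight_basis wW.
apply: (eq_on_cols (tensmx_inv_unit Pu Qu)) => k.
case: (mxtens_indexP k) => i j.
have -> : col (mxtens_index (i, j)) (tensmx P Q) = tensv (col i P) (col j Q).
  apply/colP => l; case: (mxtens_indexP l) => l1 l2.
  by rewrite !mxE !mxtens_indexK.
exact: h (col_diag_eigen i HP) (col_diag_eigen j HQ).
Qed.
End Tens.

Lemma ulinear_tens V V' W W' (f : 'M[C]_(udim V', udim V)) (g : 'M[C]_(udim W', udim W)) :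
  ulinear f -> ulinear g -> ulinear (V := tens V W) (W := tens V' W') (tensmx f g).
Proof.
move=> /ulinearP[fE fF fK fKi fH] /ulinearP[gE gF gK gKi gH].
by apply/ulinearP; split; rewrite /= ?mulmxDl ?mulmxDr !tensmx_mul
  ?(fE, fF, fK, fKi, fH, gE, gF, gK, gKi, gH) ?mul1mx ?mulmx1.
Qed.

Lemma ulinear_dual V W (f : 'M[C]_(udim W, udim V)) : ulinear f ->
  ulinear (V := dual_mod W) (W := dual_mod V) f^T.
Proof.
move=> /ulinearP[fE fF fK fKi fH]; apply/ulinearP; split.
- by rewrite !dual_E mulmxN mulNmx -!trmx_mul; congr (- _^T); rewrite mulmxA fE -[RHS]mulmxA fKi mulmxA.
- by rewrite !dual_F mulmxN mulNmx -!trmx_mul; congr (- _^T); rewrite mulmxA fK -[RHS]mulmxA fF mulmxA.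
- by rewrite /= -!trmx_mul fKi.
- by rewrite /= -!trmx_mul fK.
by rewrite !dual_H mulmxN mulNmx -!trmx_mul fH.
Qed.

(** The image of the idempotent [i *m p], with the action compressed to it. It is meant for
    [p *m i = 1] and a linear idempotent. *)
Definition sub_mod V k (i : 'M[C]_(udim V, k)) (p : 'M[C]_(k, udim V)) : umod R :=
  @Umod R k (p *m aE V *m i) (p *m aF V *m i) (p *m aK V *m i) (p *m aKi V *m i) (p *m aH V *m i).

Section Sub.
Variables (V : umod R) (k : nat) (i : 'M[C]_(udim V, k)) (p : 'M[C]_(k, udim V)).
Hypotheses (pi1 : p *m i = 1%:M) (lin : ulinear (V := V) (W := V) (i *m p)).

Lemma sub_mod_lin : ulinear (V := sub_mod i p) (W := V) i /\ ulinear (V := V) (W := sub_mod i p) p.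
Proof.
have /ulinearP[lE lF lK lKi lH] := lin.
have h1 A : i *m p *m A = A *m (i *m p) -> i *m (p *m A *m i) = A *m i.
  by move=> e; rewrite !mulmxA e -!mulmxA pi1 mulmx1.
have h2 A : i *m p *m A = A *m (i *m p) -> p *m A = p *m A *m i *m p.
  by move=> e; rewrite -!mulmxA -e !mulmxA pi1 mul1mx.
by split; apply/ulinearP; split; by [apply: h1 | apply: h2].
Qed.

Lemma sub_mod_weight : weight_module r V -> weight_module r (sub_mod i p).
Proof.
move=> wV; have rel := weight_relations wV; have dV := weight_diag wV.
have [/ulinearP[iE iF iK iKi iH] /ulinearP[pE pF pK pKi pH]] := sub_mod_lin.
have comp (A B : 'M[C]_(udim V)) (B' : 'M[C]_k) : B *m i = i *m B' ->
    p *m A *m i *m B' = p *m (A *m B) *m i.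
  by move=> e; rewrite -!mulmxA e.
have pw (A : 'M[C]_(udim V)) (A' : 'M[C]_k) n : p *m A = A' *m p -> A' ^+ n = p *m A ^+ n *m i.
  move=> e; elim: n => [|n IH]; first by rewrite !expmx0 mulmx1 pi1.
  by rewrite expmxS IH expmxS !mulmxA -e.
apply: mk_weight.
- case/diagonalizableP': dV => P [d Pu HP].
  have pP : row_free (p *m P).
    apply/row_freeP; exists (invmx P *m i); by rewrite -!mulmxA (mulmxA P) mulmxV // mul1mx.
  have pHP : p *m P *m diag_mx d = aH (sub_mod i p) *m (p *m P).
    by rewrite -mulmxA -HP mulmxA pH -mulmxA.
  have st : stablemx (p *m P) (diag_mx d) by rewrite pHP submxMl.
  (* Conjugating the diagonal matrix to the stable space spanned by the rows of [p *m P] gives the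
     matrix of H on the summand. *)
  have := mxpoly.diagonalizable_conj_diag st pP; rewrite /mxpoly.conjmx.
  have -> : p *m P *m diag_mx d *m pinvmx (p *m P) = aH (sub_mod i p).
    by rewrite pHP -mulmxA mulmxVp // mulmx1.
  by [].
- move=> a v hv; have : wt (V := V) a (i *m v) by rewrite /wt mulmxA -iH -mulmxA hv -scalemxAr.
  by move=> /(wtK wV) e; rewrite /= -!mulmxA e -scalemxAr mulmxA pi1 mul1mx.
- move=> a v hv; have : wt (V := V) a (i *m v) by rewrite /wt mulmxA -iH -mulmxA hv -scalemxAr.
  by move=> /(wtKi wV) e; rewrite /= -!mulmxA e -scalemxAr mulmxA pi1 mul1mx.
- rewrite /= (comp _ _ _ (esym iE)) (comp _ _ _ (esym iH)) -mulmxBl -mulmxBr (rel_HE rel).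
  by rewrite -scalemxAr -scalemxAl.
- rewrite /= (comp _ _ _ (esym iF)) (comp _ _ _ (esym iH)) -mulmxBl -mulmxBr (rel_HF rel).
  by rewrite -scalemxAr -scalemxAl.
- rewrite /= (comp _ _ _ (esym iF)) (comp _ _ _ (esym iE)) -mulmxBl -mulmxBr (rel_EF rel).
  by rewrite -scalemxAr -scalemxAl mulmxBr mulmxBl.
- by rewrite (pw _ _ _ pE) (rel_Er rel) mulmx0 mul0mx.
by rewrite (pw _ _ _ pF) (rel_Fr rel) mulmx0 mul0mx.
Qed.
End Sub.

Lemma idempotent_split n (e : 'M[C]_n) : e *m e = e ->
  exists k, exists (i : 'M[C]_(n, k)) (p : 'M[C]_(k, n)), p *m i = 1%:M /\ i *m p = e.
Proof.
move=> ee; exists (\rank e); exists (col_base e); exists (row_base e); split; last exact: mulmx_base.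
have fc : row_free (col_base e)^T by rewrite /row_free mxrank_tr; have := col_base_full e; rewrite /row_full.
have fr := row_base_free e.
apply: (row_free_inj fr); rewrite mul1mx.
have inj (A B : 'M[C]_(\rank e, n)) : col_base e *m A = col_base e *m B -> A = B.
  move=> eq; apply: trmx_inj; apply: (row_free_inj fc); by rewrite -!trmx_mul eq.
apply: inj; transitivity (col_base e *m row_base e *m (col_base e *m row_base e)).
  by rewrite !mulmxA.
by rewrite mulmx_base ee.
Qed.

Lemma sum_nat_delta n m (f : nat -> C) :
  \sum_(k < n) (k == m :> nat)%:R * f k = if (m < n)%N then f m else 0.
Proof.
case: ltnP => mn; last first.
  by rewrite big1 // => k _; rewrite (ltn_eqF (leq_trans (ltn_ord k) mn)) mul0r.
rewrite (bigD1 (Ordinal mn)) //= eqxx mul1r big1 ?addr0 // => k.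
by rewrite -val_eqE /= => /negPf ->; rewrite mul0r.
Qed.

(** On a ladder the commutator of E and F is diagonal with entries [e i.+1 - e i]; the vanishing of
    e at 0 and n closes the ladder at both ends. V_alpha and S_n are instances. *)
Lemma ladder_weight n c (e : nat -> C) : (n <= r)%N -> e 0%N = 0 -> e n = 0 ->
  (forall i, (i < n)%N -> e i.+1 - e i = qbr r (c - 2 * i%:R) / qbr r 1) ->
  weight_module r (@ladder R r n (fun i => c - 2 * i%:R) e).
Proof.
move=> nr e0 en eS; set L := ladder _ _ _.
have HP : aH L *m 1%:M = 1%:M *m aH L by rewrite mulmx1 mul1mx.
have u1 : (1%:M : 'M[C]_n) \in unitmx by rewrite unitmx1.
apply: mk_weight.
- exact: (diag_of (V := L) u1 HP).
- apply: (wt_fun (V := L) u1 HP); rewrite mulmx1 mul1mx; congr diag_mx.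
  by apply/rowP => j; rewrite !mxE.
- apply: (@wt_fun L _ _ _ (fun x => q (- x)) u1 HP); rewrite mulmx1 mul1mx; congr diag_mx.
  by apply/rowP => j; rewrite !mxE.
- rewrite /= mul_diag_mx mul_mx_diag; apply/matrixP => i j; rewrite !mxE.
  case: (eqVneq i.+1 (j : nat)) => [<-|_] /=; last by ring.
  by rewrite -natr1; ring.
- rewrite /= mul_diag_mx mul_mx_diag; apply/matrixP => i j; rewrite !mxE.
  case: (eqVneq (i : nat) j.+1) => [->|_] /=; last by ring.
  by rewrite -natr1; ring.
- apply/matrixP => i j; rewrite !mxE.
  have -> : \sum_k aE L i k * aF L k j = (i == j)%:R * e i.+1.
    under eq_bigr => k _ do rewrite !mxE -mulrA mulrC.
    transitivity (\sum_(k < n) (k == i.+1 :> nat)%:R * (e k * (k == j.+1 :> nat)%:R)).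
      by apply: eq_bigr => k _; rewrite mulrC eq_sym.
    rewrite (sum_nat_delta n i.+1 (fun k => e k * (k == j.+1)%:R)) eqSS val_eqE mulrC.
    by case: ltnP => // ni; have -> : i.+1 = n by [apply/eqP; rewrite eqn_leq ltn_ord]; rewrite en mulr0.
  have -> : \sum_k aF L i k * aE L k j = (i == j)%:R * e i.
    case: i => -[|i] hi.
      rewrite e0 mulr0 big1 // => k _; by rewrite !mxE /= mul0r.
    under eq_bigr => k _ do rewrite !mxE /= eqSS eq_sym.
    rewrite (sum_nat_delta n i (fun k => (k.+1 == j)%:R * e j)) (ltnW hi) -val_eqE /=.
    by case: (eqVneq i.+1 (j : nat)) => [->|_] //; rewrite !mul0r.
  case: (eqVneq i j) => [_|ne].
    rewrite !mul1r eS // mulr1n /qbr (qpowN r 1) mulrC; congr (_ * (_ - _)).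
  by rewrite /= !mulr0n !mul0r subrr mulr0.
- apply: nilp_exp nr => i j ij; rewrite mxE; by rewrite eq_sym (negPf ij) mul0r.
rewrite -[aF L]trmxK -expmx_tr (_ : (_ ^+ r)%R = 0) ?trmx0 //.
by apply: nilp_exp nr => i j ij; rewrite !mxE (negPf ij).
Qed.

Lemma qbr_ladder (x y : C) :
  qbr r (x + 1) * qbr r (y - 1) - qbr r x * qbr r y = qbr r (y - x - 1) * qbr r 1.
Proof.
rewrite /qbr !(opprD, opprK, qpowD, qpowN).
have := qpow_neq0 r x; have := qpow_neq0 r y; have := qpow_neq0 r (1 : C).
move: (q x) (q y) (q 1) => X Y Z; move=> Z0 Y0 X0; field; by rewrite X0 Y0 Z0.
Qed.

Lemma Vmod_weight a : weight_module r (Vmod r a).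
Proof.
have b0 := qbr1_neq0 R hr.
rewrite /Vmod; set e := fun i : nat => _.
apply: (@ladder_weight r (a + r%:R - 1) e) => //.
- by rewrite /e qbr0 !mul0r.
- by rewrite /e qbr_r // !mul0r.
move=> i ir; have -> : a + r%:R - 1 - 2 * i%:R = (a - 1 - 2 * i%:R) + r%:R by ring.
rewrite qbrDr // /e -mulrBl.
have -> : i%:R - a = - (a - i%:R) by ring.
have -> : i.+1%:R - a = - (a - i%:R - 1) by rewrite -natr1; ring.
rewrite -natr1 !qbrN !mulrN -opprD qbr_ladder //.
have -> : a - i%:R - i%:R - 1 = a - 1 - 2 * i%:R by ring.
by field.
Qed.

Lemma Smod_weight n : (n.+2 <= r)%N -> weight_module r (Smod R r n).
Proof.
move=> nr; have b0 := qbr1_neq0 R hr.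
rewrite /Smod; set e := fun i : nat => _.
apply: (@ladder_weight n.+1 n%:R e) => //; first exact: ltnW.
- by rewrite /e qbr0 !mul0r.
- by rewrite /e natr1 subrr qbr0 mulr0 mul0r.
move=> i ir; rewrite /e -mulrBl -natr1.
have -> : n%:R + 1 - (i%:R + 1) = n%:R + 1 - i%:R - 1 :> C by ring.
rewrite qbr_ladder //.
have -> : n%:R + 1 - i%:R - i%:R - 1 = n%:R - 2 * i%:R :> C by ring.
by field.
Qed.

Lemma Cmod_weight (k : int) : weight_module r (Cmod R r k).
Proof.
apply: mk_weight => /=.
- exact: diagonalizable_scalar.
- move=> a v; rewrite /wt /= !mul_scalar_mx => /eqP; rewrite -subr_eq0 -scalerBl scaler_eq0.
  by rewrite subr_eq0 => /orP[/eqP-> //|/eqP ->]; rewrite !scaler0.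
- move=> a v; rewrite /wt /= !mul_scalar_mx => /eqP; rewrite -subr_eq0 -scalerBl scaler_eq0.
  by rewrite subr_eq0 => /orP[/eqP-> //|/eqP ->]; rewrite !scaler0.
- by rewrite mulmx0 mul0mx subrr scaler0.
- by rewrite mulmx0 mul0mx subrr scaler0.
- rewrite mulmx0 subrr -raddfB /=.
  have -> : q (k%:~R * r%:R) - q (- (k%:~R * r%:R)) = 0; last by rewrite raddf0 scaler0.
  have {1}-> : k%:~R * r%:R = k%:~R * (2 * r%:R) + - (k%:~R * r%:R) :> C by ring.
  by rewrite qpowD qpow_2r // mul1r subrr.
- by rewrite expr0n; case: r hr.
by rewrite expr0n; case: r hr.
Qed.

Lemma unit_weight : weight_module r (unit_mod R).
Proof.
have wt0 a v : wt (V := unit_mod R) a v -> a = 0 \/ v = 0.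
  rewrite /wt /= mul0mx => /esym/eqP; rewrite scaler_eq0 => /orP[]/eqP; by [left|right].
apply: mk_weight => /=.
- exact: diagonalizable0.
- by move=> a v /wt0[]->; rewrite ?mulmx0 ?scaler0 // qpow0 scale1r mul1mx.
- by move=> a v /wt0[]->; rewrite ?mulmx0 ?scaler0 // oppr0 qpow0 scale1r mul1mx.
- by rewrite mulmx0 subrr scaler0.
- by rewrite mulmx0 subrr scaler0.
- by rewrite mulmx0 !subrr scaler0.
- by rewrite expr0n; case: r hr.
by rewrite expr0n; case: r hr.
Qed.

End Constructions.

Lemma sum_shift (M : nmodType) r (g : nat -> M) : g 0%N = 0 -> g r = 0 ->
  \sum_(n < r) g n = \sum_(n < r) g n.+1.
Proof.
move=> g0 gr; transitivity (\sum_(n < r.+1) g n).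
  by rewrite big_ord_recr /= gr addr0.
by rewrite big_ord_recl /= g0 add0r.
Qed.

(** * The braiding *)

Section Flip.
Variables (R : realType).
Local Notation C := R[i].

Lemma flip_tensv m n (v : 'cV[C]_m) (w : 'cV[C]_n) :
  flip R m n *m tensv v w = tensv w v.
Proof.
apply/colP => k; case: (mxtens_indexP k) => j i; rewrite tensvE mxE.
rewrite (bigD1 (mxtens_index (i, j))) //= big1 ?addr0.
  by rewrite mxE !mxtens_indexK eqxx mul1r tensvE mulrC.
move=> l; case: (mxtens_indexP l) => i' j' ne; rewrite mxE !mxtens_indexK.
case: eqP => [[ej ei]|_]; last by rewrite mul0r.
by rewrite ej ei eqxx in ne.
Qed.

Lemma idcastK m n (e : m = n) : idcast_mx R m n *m idcast_mx R n m = 1%:M.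
Proof.
case: n / e; apply/matrixP => i j; rewrite !mxE (bigD1 i) //= !mxE eqxx mul1r.
rewrite big1 ?addr0 // => k ki; rewrite mxE.
by rewrite val_eqE eq_sym (negPf ki) mul0r.
Qed.

Lemma idcast_col m n (e : m = n) (x : 'cV[C]_m) (i : 'I_n) (j : 'I_m) :
  i = j :> nat -> (idcast_mx R n m *m x) i 0 = x j 0.
Proof.
move=> ij; rewrite mxE (bigD1 j) //= mxE ij eqxx mul1r big1 ?addr0 // => k kj.
by rewrite mxE ij val_eqE eq_sym (negPf kj) mul0r.
Qed.

Lemma assoc_tensv m n p (u : 'cV[C]_m) (v : 'cV[C]_n) (w : 'cV[C]_p) :
  idcast_mx R (m * (n * p)) (m * n * p) *m tensv (tensv u v) w = tensv u (tensv v w).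
Proof.
apply/colP => k; case: (mxtens_indexP k) => i k'; case: (mxtens_indexP k') => j l.
rewrite (@idcast_col _ _ _ _ _ (mxtens_index (mxtens_index (i, j), l))); first last.
- by rewrite /=; lia.
- by rewrite mulnA.
by rewrite !tensvE mulrA.
Qed.

Lemma assocV_tensv m n p (u : 'cV[C]_m) (v : 'cV[C]_n) (w : 'cV[C]_p) :
  idcast_mx R (m * n * p) (m * (n * p)) *m tensv u (tensv v w) = tensv (tensv u v) w.
Proof.
by rewrite -assoc_tensv mulmxA idcastK ?mul1mx // mulnA.
Qed.

Lemma lunit_tensv m (u : 'cV[C]_1) (v : 'cV[C]_m) :
  idcast_mx R m (1 * m) *m tensv u v = u 0 0 *: v.
Proof.
apply/colP => i; rewrite (@idcast_col _ _ _ _ _ (mxtens_index (0, i))) ?mul1n //.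
by rewrite tensvE mxE.
Qed.

Lemma runit_tensv m (u : 'cV[C]_1) (v : 'cV[C]_m) :
  idcast_mx R m (m * 1) *m tensv v u = u 0 0 *: v.
Proof.
apply/colP => i; rewrite (@idcast_col _ _ _ _ _ (mxtens_index (i, 0))) ?muln1 //.
  by rewrite tensvE mxE mulrC.
by rewrite /= muln1 addn0.
Qed.

End Flip.

Section Braiding.
Variables (R : realType) (r : nat).
Hypothesis hr : (2 <= r)%N.
Local Notation C := R[i].
Local Notation q := (@qpow R r).
Local Notation c_ := (@Rcoef R r).
Implicit Types (V W U : umod R) (a b : C).

Lemma eq_on_tens3 U V W m (A B : 'M[C]_(m, udim U * udim V * udim W)) :
  weight_module r U -> weight_module r V -> weight_module r W ->
  (forall a b c u v w, wt (V := U) a u -> wt (V := V) b v -> wt (V := W) c w ->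
    A *m tensv (tensv u v) w = B *m tensv (tensv u v) w) -> A = B.
Proof.
move=> wU wV wW h; have [P [d Pu [HP _ _]]] := weight_basis wU.
have [Q [e Qu [HQ _ _]]] := weight_basis wV.
have [S [f Su [HS _ _]]] := weight_basis wW.
apply: (eq_on_cols (tensmx_inv_unit (tensmx_inv_unit Pu Qu) Su)) => k.
case: (mxtens_indexP k) => k' l; case: (mxtens_indexP k') => i j.
have -> : col (mxtens_index (mxtens_index (i, j), l)) (tensmx (tensmx P Q) S)
    = tensv (tensv (col i P) (col j Q)) (col l S).
  apply/colP => x; case: (mxtens_indexP x) => y z; case: (mxtens_indexP y) => y1 y2.
  by rewrite !mxE !mxtens_indexK.
exact: h (col_diag_eigen i HP) (col_diag_eigen j HQ) (col_diag_eigen l HS).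
Qed.

Lemma eq_on_tens3' U V W m (A B : 'M[C]_(m, udim U * (udim V * udim W))) :
  weight_module r U -> weight_module r V -> weight_module r W ->
  (forall a b c u v w, wt (V := U) a u -> wt (V := V) b v -> wt (V := W) c w ->
    A *m tensv u (tensv v w) = B *m tensv u (tensv v w)) -> A = B.
Proof.
move=> wU wV wW h; pose J := idcast_mx R (udim U * (udim V * udim W)) (udim U * udim V * udim W).
have JK : J *m idcast_mx R _ _ = 1%:M by apply: idcastK; rewrite mulnA.
rewrite -[A]mulmx1 -[B]mulmx1 -JK !mulmxA; congr (_ *m _).
apply: (eq_on_tens3 wU wV wW) => a b c u v w hu hv hw.
by rewrite -!mulmxA assoc_tensv; apply: h hu hv hw.
Qed.

Lemma tens_E V W v w : aE (tens V W) *m tensv v w = tensv v (aE W *m w) + tensv (aE V *m v) (aK W *m w).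
Proof. by rewrite mulmxDl !tensv_mul mul1mx. Qed.

Lemma tens_F V W v w : aF (tens V W) *m tensv v w = tensv (aKi V *m v) (aF W *m w) + tensv (aF V *m v) w.
Proof. by rewrite mulmxDl !tensv_mul mul1mx. Qed.

Lemma tensv0l m n (w : 'cV[C]_n) : tensv (0 : 'cV[C]_m) w = 0.
Proof. by rewrite -[0 in LHS](scale0r 0) tensvZl scale0r. Qed.

Lemma tensv0r m n (v : 'cV[C]_m) : tensv v (0 : 'cV[C]_n) = 0.
Proof. by rewrite -[0 in LHS](scale0r 0) tensvZr scale0r. Qed.

Lemma tensv_suml m n (I : finType) (P : pred I) (f : I -> 'cV[C]_m) (w : 'cV[C]_n) :
  tensv (\sum_(i | P i) f i) w = \sum_(i | P i) tensv (f i) w.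
Proof. exact: (big_morph (fun x => tensv x w) (fun x y => tensvDl x y w) (tensv0l _ w)). Qed.

Lemma tensv_sumr m n (I : finType) (P : pred I) (v : 'cV[C]_m) (f : I -> 'cV[C]_n) :
  tensv v (\sum_(i | P i) f i) = \sum_(i | P i) tensv v (f i).
Proof. exact: (big_morph (fun x => tensv v x) (fun x y => tensvDr v x y) (tensv0r _ v)). Qed.

(** This is [EFn] in [chev_mod V], where v has weight -a, the sign being absorbed by {-x} = -{x}. *)
Lemma FEn V n a v : weight_module r V -> wt (V := V) a v ->
  aE V ^+ n.+1 *m (aF V *m v) = aF V *m (aE V ^+ n.+1 *m v)
  + (qbr r n.+1%:R * qbr r (a + n%:R) / qbr r 1 ^+ 2) *: (aE V ^+ n *m v).
Proof.
move=> wV hv; have wt' : wt (V := chev_mod V) (- a) v.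
  by rewrite /wt /= mulNmx hv scaleNr.
have := EFn hr (chev_mod_weight wV) n wt'; rewrite /= => ->.
rewrite -addrA -scalerDl -mulrDl -mulrDr -[- a - n%:R]opprD qbrN.
by rewrite addNr mulr0 mul0r scale0r addr0.
Qed.

Section Two.
Variables V W : umod R.
Hypotheses (wV : weight_module r V) (wW : weight_module r W).

Lemma qHH_wt a b v w : wt (V := V) a v -> wt (V := W) b w ->
  qHH r V W *m tensv v w = q (a * b / 2) *: tensv v w.
Proof. exact: qHH_weight. Qed.

Lemma Rmatrix_wt a b v w : wt (V := V) a v -> wt (V := W) b w ->
  Rmatrix r V W *m tensv v w =
  \sum_(n < r) (c_ n * q ((a + 2 * n%:R) * (b - 2 * n%:R) / 2)) *:
     tensv (aE V ^+ n *m v) (aF W ^+ n *m w).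
Proof.
move=> hv hw; rewrite /Rmatrix -mulmxA [X in qHH r V W *m X]mulmx_suml mulmx_sumr.
apply: eq_bigr => n _; rewrite -scalemxAl tensv_mul -scalemxAr.
by rewrite (qHH_wt (wtEn wV n hv) (wtFn wW n hw)) scalerA.
Qed.

Lemma braiding_wt a b v w : wt (V := V) a v -> wt (V := W) b w ->
  braiding r V W *m tensv v w =
  \sum_(n < r) (c_ n * q ((a + 2 * n%:R) * (b - 2 * n%:R) / 2)) *:
     tensv (aF W ^+ n *m w) (aE V ^+ n *m v).
Proof.
move=> hv hw; rewrite /braiding -mulmxA (Rmatrix_wt hv hw) mulmx_sumr.
by apply: eq_bigr => n _; rewrite -scalemxAr flip_tensv.
Qed.

Lemma qHH_unit : qHH r V W \in unitmx.
Proof.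
(* Negating the weights of W, as in [chev_mod W], inverts the Cartan factor. *)
pose M : 'M[C]_(udim V * udim W) := qHH r V (chev_mod W).
have hM a b v w : wt (V := V) a v -> wt (V := W) b w ->
    M *m tensv v w = q (- (a * b / 2)) *: tensv v w.
  move=> hv hw; have hw' : wt (V := chev_mod W) (- b) w by rewrite /wt /= mulNmx hw scaleNr.
  by have := qHH_weight r hv hw'; rewrite mulrN mulNr.
suff : M *m qHH r V W = 1%:M by case/mulmx1_unit.
move: M hM => M hM; apply: (eq_on_tens wV wW) => a b v w hv hw.
by rewrite -mulmxA (qHH_wt hv hw) -scalemxAr (hM _ _ _ _ hv hw) scalerA mul1mx qpow_mulN scale1r.
Qed.

Lemma qHHV_wt a b v w : wt (V := V) a v -> wt (V := W) b w ->
  invmx (qHH r V W) *m tensv v w = q (- (a * b / 2)) *: tensv v w.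
Proof.
move=> hv hw; apply: (can_inj (mulKmx qHH_unit)).
rewrite mulmxA mulmxV ?qHH_unit // mul1mx -scalemxAr (qHH_wt hv hw) scalerA.
by rewrite mulrC qpow_mulN scale1r.
Qed.

Definition Rmatrix_inv : 'M[C]_(udim V * udim W) :=
  (\sum_(n < r) RcoefV R r n *: tensmx (aE V ^+ n) (aF W ^+ n)) *m invmx (qHH r V W).

(** The Cartan parts cancel, and the product of the two q-exponentials is regrouped by total degree:
    [RcoefV_conv] kills every positive degree. *)
Lemma Rmatrix_invE : Rmatrix_inv *m Rmatrix r V W = 1%:M.
Proof.
rewrite /Rmatrix_inv /Rmatrix mulmxA (mulmxKV qHH_unit).
rewrite mulmx_suml.
under eq_bigr => i _ do (rewrite mulmx_sumr; under eq_bigr => j _ do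
  rewrite -scalemxAl -scalemxAr tensmx_mul -!expmxD scalerA).
rewrite -(sum_triangle (f := fun i j => (RcoefV R r i * c_ j) *: tensmx (aE V ^+ (i + j)) (aF W ^+ (i + j)))).
  have r0 : (0 < r)%N by case: r hr.
  rewrite (bigD1 (Ordinal r0)) //= big_ord1 RcoefV0 Rcoef0 // !expmx0 tensmx1 mulr1 scale1r.
  rewrite big1 ?addr0 // => n n0.
  rewrite (eq_bigr (fun i : 'I_n.+1 => (RcoefV R r i * c_ (n - i)) *: tensmx (aE V ^+ n) (aF W ^+ n))).
    rewrite -scaler_suml RcoefV_conv ?scale0r // ltn_ord andbT lt0n.
    by apply: contraNN n0 => /eqP e; apply/eqP/val_inj.
  by move=> i _; rewrite subnKC // -ltnS.
move=> i j /subnKC <-; have rel := weight_relations wV.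
by rewrite expmxD (rel_Er rel) mul0mx tens0mx scaler0.
Qed.

Lemma Rmatrix_unit : Rmatrix r V W \in unitmx.
Proof. by case: (mulmx1_unit Rmatrix_invE). Qed.

Lemma braiding_inv : braiding r V W *m (invmx (Rmatrix r V W) *m flip R (udim W) (udim V)) = 1%:M
  /\ (invmx (Rmatrix r V W) *m flip R (udim W) (udim V)) *m braiding r V W = 1%:M.
Proof.
have ff (m n : nat) : flip R m n *m flip R n m = 1%:M.
  by apply: eq_tensv => v w; rewrite -mulmxA !flip_tensv mul1mx.
split; rewrite /braiding.
  by rewrite -mulmxA (mulmxA (Rmatrix r V W)) mulmxV ?Rmatrix_unit // mul1mx ff.
by rewrite -mulmxA (mulmxA (flip _ _ _)) ff mul1mx mulVmx ?Rmatrix_unit.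
Qed.

Opaque qHH Rmatrix braiding.

(** Moving E across F^n leaves F^(n-1) with a bracket. After a shift of the index, the recursion of
    [Rcoef] combines these terms with those where E meets E^n v into the contribution of E (x) K. *)
Lemma braiding_E : braiding r V W *m aE (tens V W) = aE (tens W V) *m braiding r V W.
Proof.
apply: (eq_on_tens wV wW) => a b v w hv hw; have b0 := qbr1_neq0 R hr.
rewrite -[LHS]mulmxA -[RHS]mulmxA (braiding_wt hv hw) tens_E.
rewrite (wtK wW hw) tensvZr mulmxDr -scalemxAr.
rewrite (braiding_wt hv (wtE wW hw)) (braiding_wt (wtE wV hv) hw).
pose k n := qbr r n%:R * qbr r (b - n%:R + 1) / qbr r 1 ^+ 2.
have EF n : aE W *m (aF W ^+ n *m w) = aF W ^+ n *m (aE W *m w) + k n *: (aF W ^+ n.-1 *m w).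
  case: n => [|n]; first by rewrite /k !expmx0 !mul1mx qbr0 !mul0r scale0r addr0.
  rewrite (EFn hr wW n hw) /k; congr (_ + (_ * qbr r _ / _) *: _).
  by rewrite -natr1; ring.
have -> : aE (tens W V) *m
   (\sum_(n < r) (c_ n * q ((a + 2 * n%:R) * (b - 2 * n%:R) / 2)) *: tensv (aF W ^+ n *m w) (aE V ^+ n *m v))
  = \sum_(n < r) (c_ n * q ((a + 2 * n%:R) * (b - 2 * n%:R) / 2)) *: tensv (aF W ^+ n *m w) (aE V ^+ n.+1 *m v)
  + \sum_(n < r) (c_ n * q ((a + 2 * n%:R) * (b - 2 * n%:R) / 2) * q (a + 2 * n%:R)) *: tensv (aF W ^+ n *m (aE W *m w)) (aE V ^+ n *m v)
  + \sum_(n < r) (c_ n * q ((a + 2 * n%:R) * (b - 2 * n%:R) / 2) * q (a + 2 * n%:R) * k n) *: tensv (aF W ^+ n.-1 *m w) (aE V ^+ n *m v).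
  rewrite mulmx_sumr -!big_split /=; apply: eq_bigr => n _.
  rewrite -scalemxAr tens_E (wtK wV (wtEn wV n hv)) EF.
  rewrite tensvZr tensvDl tensvZl !scalerDr [LHS]addrA expmxS [aE V *m (_ *m v)]mulmxA.
  have E (x y z : C) (t : 'cV[C]_(udim W * udim V)) : x * y = z -> x *: (y *: t) = z *: t.
    by move=> <-; rewrite scalerA.
  apply: (f_equal2 +%R); [apply: (f_equal2 +%R); [by [] | exact: E] |].
  by rewrite [X in _ *: X]scalerA; apply: E; rewrite mulrA.
(* The boundary terms of the shift vanish: at n = 0 by {0} = 0, at n = r by E^r = 0. *)
rewrite [X in _ = _ + _ + X](sum_shift (g := fun n => (c_ n * q ((a + 2 * n%:R) * (b - 2 * n%:R) / 2) * q (a + 2 * n%:R) * k n) *: tensv (aF W ^+ n.-1 *m w) (aE V ^+ n *m v))).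
- rewrite [RHS]addrAC [RHS]addrC; apply: (f_equal2 +%R).
    by apply: eq_bigr => n _; congr (_ *: _); rewrite -[RHS]mulrA -qpowD; congr (_ * q _); field.
  rewrite scaler_sumr -big_split /=; apply: eq_bigr => n _.
  rewrite -scalerDl scalerA mulmxA -[_ ^+ n *m aE V]expmxSr.
  have [nr|nr] := ltnP n.+1 r; last first.
    by rewrite (En0 wV v nr) tensv0r !scaler0.
  congr (_ *: _).
  rewrite /k.
  transitivity (c_ n * q ((a + 2 * n%:R) * (b - 2 * n%:R) / 2) + (qbr r n.+1%:R * c_ n.+1) * (q ((a + 2 * n.+1%:R) * (b - 2 * n.+1%:R) / 2) * q (a + 2 * n.+1%:R) * qbr r (b - n.+1%:R + 1) / qbr r 1 ^+ 2)); last by ring.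
  rewrite RcoefS //.
  have -> : (a + 2 * n.+1%:R) * (b - 2 * n.+1%:R) / 2 = (a + 2 * n%:R) * (b - 2 * n%:R) / 2 + b - n%:R - n%:R - (a + 2 * n.+1%:R) by rewrite -natr1; field.
  have -> : (a + 2 + 2 * n%:R) * (b - 2 * n%:R) / 2 = (a + 2 * n%:R) * (b - 2 * n%:R) / 2 + b - n%:R - n%:R by field.
  have -> : b - n.+1%:R + 1 = b - n%:R by rewrite -natr1; ring.
  have B0 := qpow_neq0 r b; have N0 := qpow_neq0 r (n%:R : C).
  have Z0 := qpow_neq0 r (a + 2 * n.+1%:R).
  move: (_ / 2) (a + 2 * n.+1%:R) Z0 => A Z Z0.
  rewrite [qbr r (b - _)]/qbr !(qpowD, opprD, opprK, qpowN).
  by field; rewrite b0 B0 N0 Z0.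
- by rewrite /k qbr0 !(mul0r, mulr0) scale0r.
by rewrite (En0 wV v (leqnn r)) tensv0r scaler0.
Qed.

End Two.
End Braiding.

Section Braiding2.
Variables (R : realType) (r : nat).
Hypothesis hr : (2 <= r)%N.
Local Notation C := R[i].
Local Notation q := (@qpow R r).
Local Notation c_ := (@Rcoef R r).
Implicit Types (V W U : umod R) (a b : C).

Section Two.
Variables V W : umod R.
Hypotheses (wV : weight_module r V) (wW : weight_module r W).

(** The same telescoping with the roles of E and F exchanged. *)
Lemma braiding_F : braiding r V W *m aF (tens V W) = aF (tens W V) *m braiding r V W.
Proof.
apply: (eq_on_tens wV wW) => a b v w hv hw; have b0 := qbr1_neq0 R hr.
rewrite -[LHS]mulmxA -[RHS]mulmxA (braiding_wt wV wW hv hw) tens_F.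
rewrite (wtKi wV hv) tensvZl mulmxDr -scalemxAr.
rewrite (braiding_wt wV wW hv (wtF wW hw)) (braiding_wt wV wW (wtF wV hv) hw).
pose k n := qbr r n%:R * qbr r (a + n%:R - 1) / qbr r 1 ^+ 2.
have FE n : aE V ^+ n *m (aF V *m v) = aF V *m (aE V ^+ n *m v) + k n *: (aE V ^+ n.-1 *m v).
  case: n => [|n]; first by rewrite /k !expmx0 !mul1mx qbr0 !mul0r scale0r addr0.
  rewrite (FEn hr n wV hv) /k; congr (_ + (_ * qbr r _ / _) *: _).
  by rewrite -natr1; ring.
have -> : aF (tens W V) *m
   (\sum_(n < r) (c_ n * q ((a + 2 * n%:R) * (b - 2 * n%:R) / 2)) *: tensv (aF W ^+ n *m w) (aE V ^+ n *m v))
  = \sum_(n < r) (c_ n * q ((a + 2 * n%:R) * (b - 2 * n%:R) / 2) * q (- (b - 2 * n%:R))) *: tensv (aF W ^+ n *m w) (aF V *m (aE V ^+ n *m v))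
  + \sum_(n < r) (c_ n * q ((a + 2 * n%:R) * (b - 2 * n%:R) / 2)) *: tensv (aF W ^+ n.+1 *m w) (aE V ^+ n *m v).
  rewrite mulmx_sumr -big_split /=; apply: eq_bigr => n _.
  by rewrite -scalemxAr tens_F (wtKi wW (wtFn wW n hw)) tensvZl scalerDr scalerA [aF W *m (_ *m w)]mulmxA -expmxS.
have e : \sum_(n < r) (c_ n * q ((a - 2 + 2 * n%:R) * (b - 2 * n%:R) / 2)) *: tensv (aF W ^+ n *m w) (aE V ^+ n *m (aF V *m v))
  = \sum_(n < r) (c_ n * q ((a - 2 + 2 * n%:R) * (b - 2 * n%:R) / 2)) *: tensv (aF W ^+ n *m w) (aF V *m (aE V ^+ n *m v))
  + \sum_(n < r) (c_ n * q ((a - 2 + 2 * n%:R) * (b - 2 * n%:R) / 2) * k n) *: tensv (aF W ^+ n *m w) (aE V ^+ n.-1 *m v).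
  rewrite -big_split /=; apply: eq_bigr => n _.
  by rewrite FE tensvDr tensvZr scalerDr scalerA.
rewrite [X in _ + X = _]e {e} [X in _ + (_ + X)](sum_shift (g := fun n => (c_ n * q ((a - 2 + 2 * n%:R) * (b - 2 * n%:R) / 2) * k n) *: tensv (aF W ^+ n *m w) (aE V ^+ n.-1 *m v))).
- rewrite [LHS]addrCA; apply: (f_equal2 +%R).
    by apply: eq_bigr => n _; congr (_ *: _); rewrite -[RHS]mulrA -qpowD; congr (_ * q _); field.
  rewrite scaler_sumr -big_split /=; apply: eq_bigr => n _.
  rewrite scalerA mulmxA -[_ ^+ n *m aF W]expmxSr -scalerDl.
  have [nr|nr] := ltnP n.+1 r; last first.
    by rewrite (Fn0 wW w nr) tensv0l !scaler0.
  congr (_ *: _); rewrite /k.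
  transitivity (q (- a) * (c_ n * q ((a + 2 * n%:R) * (b - 2 - 2 * n%:R) / 2)) + (qbr r n.+1%:R * c_ n.+1) * (q ((a - 2 + 2 * n.+1%:R) * (b - 2 * n.+1%:R) / 2) * qbr r (a + n.+1%:R - 1) / qbr r 1 ^+ 2)); first by ring.
  rewrite RcoefS //.
  have -> : (a - 2 + 2 * n.+1%:R) * (b - 2 * n.+1%:R) / 2 = (a + 2 * n%:R) * (b - 2 * n%:R) / 2 - a - n%:R - n%:R by rewrite -natr1; field.
  have -> : (a + 2 * n%:R) * (b - 2 - 2 * n%:R) / 2 = (a + 2 * n%:R) * (b - 2 * n%:R) / 2 - a - n%:R - n%:R by field.
  have -> : a + n.+1%:R - 1 = a + n%:R by rewrite -natr1; ring.
  have A0 := qpow_neq0 r a; have N0 := qpow_neq0 r (n%:R : C).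
  move: (_ / 2) => A.
  rewrite [qbr r (a + _)]/qbr !(qpowD, opprD, opprK, qpowN).
  by field; rewrite b0 A0 N0.
- by rewrite /k qbr0 !(mul0r, mulr0) scale0r.
by rewrite (Fn0 wW w (leqnn r)) tensv0l scaler0.
Qed.

Lemma braiding_H : braiding r V W *m aH (tens V W) = aH (tens W V) *m braiding r V W.
Proof.
apply: (eq_on_tens wV wW) => a b v w hv hw.
rewrite -[LHS]mulmxA (wt_tensv hv hw) -[RHS]mulmxA -scalemxAr (braiding_wt wV wW hv hw).
rewrite scaler_sumr mulmx_sumr; apply: eq_bigr => n _.
rewrite -scalemxAr (wt_tensv (wtFn wW n hw) (wtEn wV n hv)) !scalerA; congr (_ *: _); ring.
Qed.

Lemma braiding_Kgen (A : 'M[C]_(udim V * udim W)) (A' : 'M[C]_(udim W * udim V)) f :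
  (forall c (x : 'cV_(udim V * udim W)), wt (V := tens V W) c x -> A *m x = f c *: x) ->
  (forall c (x : 'cV_(udim W * udim V)), wt (V := tens W V) c x -> A' *m x = f c *: x) ->
  braiding r V W *m A = A' *m braiding r V W.
Proof.
move=> hA hA'; apply: (eq_on_tens wV wW) => a b v w hv hw.
have hx := wt_tensv hv hw.
rewrite -[LHS]mulmxA (hA _ _ hx) -scalemxAr -[RHS]mulmxA (hA' (a + b)) //.
by rewrite /wt mulmxA -braiding_H -mulmxA hx -scalemxAr.
Qed.

Lemma braiding_lin : ulinear (V := tens V W) (W := tens W V) (braiding r V W).
Proof.
have wVW := tens_weight hr wV wW; have wWV := tens_weight hr wW wV.
apply/ulinearP; split; [exact: braiding_E|exact: braiding_F| | |exact: braiding_H].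
  apply: (@braiding_Kgen _ _ q) => c x; [exact: wtK wVW c x|exact: wtK wWV c x].
apply: (@braiding_Kgen _ _ (fun x => q (- x))) => c x; [exact: wtKi wVW c x|exact: wtKi wWV c x].
Qed.

End Two.

Lemma Xn_ulinear V W (f : 'M[C]_(udim W, udim V)) n (v : 'cV_(udim V)) : ulinear f ->
  f *m (aE V ^+ n *m v) = aE W ^+ n *m (f *m v) /\ f *m (aF V ^+ n *m v) = aF W ^+ n *m (f *m v).
Proof.
move=> /ulinearP[fE fF _ _ _]; elim: n => [|n [IH1 IH2]]; first by rewrite !expmx0 !mul1mx.
split.
  by rewrite [in LHS]expmxS [in RHS]expmxS -[X in _ *m X = _]mulmxA -[RHS]mulmxA -IH1 !mulmxA fE.
by rewrite [in LHS]expmxS [in RHS]expmxS -[X in _ *m X = _]mulmxA -[RHS]mulmxA -IH2 !mulmxA fF.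
Qed.

Lemma Rmatrix_nat V V' W W' (f : 'M[C]_(udim V', udim V)) (g : 'M[C]_(udim W', udim W)) :
  weight_module r V -> weight_module r V' -> weight_module r W -> weight_module r W' ->
  ulinear f -> ulinear g -> Rmatrix r V' W' *m tensmx f g = tensmx f g *m Rmatrix r V W.
Proof.
move=> wV wV' wW wW' hf hg; apply: (eq_on_tens wV wW) => a b v w hv hw.
rewrite -[LHS]mulmxA -[RHS]mulmxA (Rmatrix_wt wV wW hv hw) tensv_mul.
rewrite (Rmatrix_wt wV' wW' (wt_ulinear hf hv) (wt_ulinear hg hw)) mulmx_sumr.
apply: eq_bigr => n _; rewrite -scalemxAr tensv_mul.
by rewrite (Xn_ulinear n v hf).1 (Xn_ulinear n w hg).2.
Qed.

Lemma flip_nat m n m' n' (f : 'M[C]_(m', m)) (g : 'M[C]_(n', n)) :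
  flip R m' n' *m tensmx f g = tensmx g f *m flip R m n.
Proof. by apply: eq_tensv => v w; rewrite -!mulmxA flip_tensv !tensv_mul flip_tensv. Qed.

Lemma braidingE V W : braiding r V W = flip R (udim V) (udim W) *m Rmatrix r V W.
Proof. by []. Qed.

Lemma braiding_nat V V' W W' (f : 'M[C]_(udim V', udim V)) (g : 'M[C]_(udim W', udim W)) :
  weight_module r V -> weight_module r V' -> weight_module r W -> weight_module r W' ->
  ulinear f -> ulinear g -> braiding r V' W' *m tensmx f g = tensmx g f *m braiding r V W.
Proof.
move=> wV wV' wW wW' hf hg.
by rewrite !braidingE -[LHS]mulmxA (Rmatrix_nat wV wV' wW wW' hf hg) mulmxA flip_nat -!mulmxA.
Qed.

Lemma wtKn V a v n : weight_module r V -> wt (V := V) a v -> aK V ^+ n *m v = q (n%:R * a) *: v.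
Proof.
move=> wV hv; elim: n => [|n IH]; first by rewrite expmx0 mul1mx mul0r qpow0 scale1r.
rewrite expmxS -mulmxA IH -scalemxAr (wtK wV hv) scalerA -qpowD.
by congr (q _ *: _); rewrite -natr1; ring.
Qed.

Lemma wtKin V a v n : weight_module r V -> wt (V := V) a v -> aKi V ^+ n *m v = q (- (n%:R * a)) *: v.
Proof.
move=> wV hv; elim: n => [|n IH]; first by rewrite expmx0 mul1mx mul0r oppr0 qpow0 scale1r.
rewrite expmxS -mulmxA IH -scalemxAr (wtKi wV hv) scalerA -qpowD.
by congr (q _ *: _); rewrite -natr1; ring.
Qed.

Lemma tens_Fn V W N a v w : weight_module r V -> weight_module r W -> wt (V := V) a v -> (N < r)%N ->
  c_ N *: (aF (tens V W) ^+ N *m tensv v w) =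
  \sum_(m < N.+1) (c_ m * c_ (N - m) * q (- (m%:R * (a - 2 * (N - m)%:R)))) *:
    tensv (aF V ^+ (N - m) *m v) (aF W ^+ m *m w).
Proof.
move=> wV wW hv Nr; rewrite scalemxAl.
have XY : tensmx (aKi V) (aF W) *m tensmx (aF V) 1%:M = q 2 *: (tensmx (aF V) 1%:M *m tensmx (aKi V) (aF W)).
  by rewrite !tensmx_mul mul1mx mulmx1 (KiF_comm wV) tensmxZl.
rewrite /= (qexp_add hr XY Nr) mulmx_suml; apply: eq_bigr => m _.
rewrite -scalemxAl -mulmxA !tensmxX !tensv_mul.
have -> : (1%:M : 'M[C]_(udim W)) ^+ (N - m) = 1%:M by exact: expr1n.
rewrite mul1mx.
by rewrite (wtKin m wV (wtFn wV (N - m) hv)) tensvZl scalerA.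
Qed.

Lemma tens_En V W N b v w : weight_module r V -> weight_module r W -> wt (V := W) b w -> (N < r)%N ->
  c_ N *: (aE (tens V W) ^+ N *m tensv v w) =
  \sum_(m < N.+1) (c_ m * c_ (N - m) * q (m%:R * (b + 2 * (N - m)%:R))) *:
    tensv (aE V ^+ m *m v) (aE W ^+ (N - m) *m w).
Proof.
move=> wV wW hw Nr; rewrite scalemxAl.
have XY : tensmx (aE V) (aK W) *m tensmx 1%:M (aE W) = q 2 *: (tensmx 1%:M (aE W) *m tensmx (aE V) (aK W)).
  by rewrite !tensmx_mul mul1mx mulmx1 (KE_comm wW) tensmxZr.
rewrite /= addrC (qexp_add hr XY Nr) mulmx_suml; apply: eq_bigr => m _.
rewrite -scalemxAl -mulmxA !tensmxX !tensv_mul.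
have -> : (1%:M : 'M[C]_(udim V)) ^+ (N - m) = 1%:M by exact: expr1n.
rewrite mul1mx.
by rewrite (wtKn m wW (wtEn wW (N - m) hw)) tensvZr scalerA.
Qed.

(** The identity (1 (x) Delta)(R) = R13 R12. The coproduct of F^N is expanded by the addition
    theorem for q-exponentials, and the pairs (m, n) with m + n = N regroup into two successive
    braidings. *)
Lemma braid_hexl U V W : weight_module r U -> weight_module r V -> weight_module r W ->
  idcast_mx R (udim V * (udim W * udim U)) (udim V * udim W * udim U) *m braiding r U (tens V W)
     *m idcast_mx R (udim U * (udim V * udim W)) (udim U * udim V * udim W)
  = tensmx 1%:M (braiding r U W) *m idcast_mx R (udim V * (udim U * udim W)) (udim V * udim U * udim W)
     *m tensmx (braiding r U V) 1%:M.
Proof.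
move=> wU wV wW; have wVW := tens_weight hr wV wW.
apply: (eq_on_tens3 wU wV wW) => a b c u v w hu hv hw.
rewrite -[LHS]mulmxA assoc_tensv -[LHS]mulmxA (braiding_wt wU wVW hu (wt_tensv hv hw)).
rewrite -[RHS]mulmxA tensv_mul mul1mx (braiding_wt wU wV hu hv) mulmx_sumr.
pose g m n := (c_ m * c_ n * q ((a + 2 * n%:R) * (b - 2 * n%:R) / 2 + (a + 2 * n%:R + 2 * m%:R) * (c - 2 * m%:R) / 2)) *:
  tensv (aF V ^+ n *m v) (tensv (aF W ^+ m *m w) (aE U ^+ (m + n) *m u)).
transitivity (\sum_(N < r) \sum_(m < N.+1) g m (N - m)%N).
  apply: eq_bigr => N _; rewrite mulrC -scalerA.
  have -> : c_ N *: tensv (aF (tens V W) ^+ N *m tensv v w) (aE U ^+ N *m u) = tensv (c_ N *: (aF (tens V W) ^+ N *m tensv v w)) (aE U ^+ N *m u) by rewrite tensvZl.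
  rewrite (tens_Fn _ wV wW hv) // tensv_suml.
  rewrite scaler_sumr mulmx_sumr; apply: eq_bigr => m _.
  have mN : (m <= N)%N by rewrite -ltnS.
  rewrite tensvZl scalerA -scalemxAr assoc_tensv /g subnKC //; congr (_ *: _).
  rewrite [LHS]mulrCA -qpowD; congr (_ * q _).
  have -> : (N%:R : C) = m%:R + (N - m)%:R by rewrite -natrD subnKC.
  by field.
rewrite (sum_triangle (f := g)); last first.
  by move=> m n mn; rewrite /g (En0 wU u mn) !tensv0r scaler0.
rewrite exchange_big /= -[RHS]/(tensmx 1%:M (braiding r U W) *m idcast_mx R (udim V * (udim U * udim W)) (udim V * udim U * udim W) *m _).
rewrite -mulmxA tensv_suml mulmx_sumr mulmx_sumr.
apply: eq_bigr => n _; rewrite tensvZl -!scalemxAr assoc_tensv tensv_mul mul1mx.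
rewrite (braiding_wt wU wW (wtEn wU n hu) hw).
rewrite tensv_sumr scaler_sumr.
apply: eq_bigr => m _; rewrite /g tensvZr scalerA mulmxA -expmxD; congr (_ *: _).
by rewrite qpowD; ring.
Qed.

(** Likewise (Delta (x) 1)(R) = R13 R23, from the coproduct of E^N. *)
Lemma braid_hexr U V W : weight_module r U -> weight_module r V -> weight_module r W ->
  idcast_mx R (udim W * udim U * udim V) (udim W * (udim U * udim V)) *m braiding r (tens U V) W
     *m idcast_mx R (udim U * udim V * udim W) (udim U * (udim V * udim W))
  = tensmx (braiding r U W) 1%:M *m idcast_mx R (udim U * udim W * udim V) (udim U * (udim W * udim V))
     *m tensmx 1%:M (braiding r V W).
Proof.
move=> wU wV wW; have wUV := tens_weight hr wU wV.
apply: (eq_on_tens3' wU wV wW) => a b c u v w hu hv hw.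
rewrite -[LHS]mulmxA assocV_tensv -[LHS]mulmxA (braiding_wt wUV wW (wt_tensv hu hv) hw).
rewrite -[RHS]mulmxA tensv_mul mul1mx (braiding_wt wV wW hv hw) mulmx_sumr.
pose g m n := (c_ m * c_ n * q ((b + 2 * n%:R) * (c - 2 * n%:R) / 2 + (a + 2 * m%:R) * (c - 2 * n%:R - 2 * m%:R) / 2)) *:
  tensv (tensv (aF W ^+ (m + n) *m w) (aE U ^+ m *m u)) (aE V ^+ n *m v).
transitivity (\sum_(N < r) \sum_(m < N.+1) g m (N - m)%N).
  apply: eq_bigr => N _; rewrite mulrC -scalerA.
  have -> : c_ N *: tensv (aF W ^+ N *m w) (aE (tens U V) ^+ N *m tensv u v) = tensv (aF W ^+ N *m w) (c_ N *: (aE (tens U V) ^+ N *m tensv u v)) by rewrite tensvZr.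
  rewrite (tens_En _ wU wV hv) // tensv_sumr.
  rewrite scaler_sumr mulmx_sumr; apply: eq_bigr => m _.
  have mN : (m <= N)%N by rewrite -ltnS.
  rewrite tensvZr scalerA -scalemxAr assocV_tensv /g subnKC //; congr (_ *: _).
  rewrite [LHS]mulrCA -qpowD; congr (_ * q _).
  have -> : (N%:R : C) = m%:R + (N - m)%:R by rewrite -natrD subnKC.
  by field.
rewrite (sum_triangle (f := g)); last first.
  by move=> m n mn; rewrite /g (Fn0 wW w mn) !tensv0l scaler0.
rewrite exchange_big /= -mulmxA tensv_sumr mulmx_sumr mulmx_sumr.
apply: eq_bigr => n _; rewrite tensvZr -!scalemxAr assocV_tensv tensv_mul mul1mx.
rewrite (braiding_wt wU wW hu (wtFn wW n hw)).
rewrite tensv_suml scaler_sumr.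
apply: eq_bigr => m _; rewrite /g tensvZl scalerA mulmxA -expmxD; congr (_ *: _).
by rewrite qpowD; ring.
Qed.

End Braiding2.

(** * The twist *)

Section Theta.
Variables (R : realType) (r : nat).
Hypothesis hr : (2 <= r)%N.
Local Notation C := R[i].
Local Notation q := (@qpow R r).
Local Notation c_ := (@Rcoef R r).
Implicit Types (V W U : umod R) (a b : C).

Definition antiF V : 'M[C]_(udim V) := uact V (uantipode (UF R)).

Definition ribbon_g V : 'M[C]_(udim V) := mxfun (fun a => q (- (a ^+ 2 / 2))) (aH V).

(* The Drinfeld element [u], for which [theta = K^(r-1) u]. *)
Definition drinfeld V : 'M[C]_(udim V) :=
  \sum_(n < r) c_ n *: (antiF V ^+ n *m ribbon_g V *m aE V ^+ n).

Lemma thetaE V : theta r V = aK V ^+ r.-1 *m drinfeld V.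
Proof. by []. Qed.

Lemma ribbon_g_wt V a v : wt (V := V) a v -> ribbon_g V *m v = q (- (a ^+ 2 / 2)) *: v.
Proof. exact: mxfun_weight. Qed.

Lemma antiFE V : antiF V = - (aK V *m aF V).
Proof. by rewrite /antiF /= mul_scalar_mx scaleN1r. Qed.

Lemma antiFn V n a v : weight_module r V -> wt (V := V) a v ->
  antiF V ^+ n *m v = ((-1) ^+ n * q (n%:R * a - n%:R * (n%:R + 1))) *: (aF V ^+ n *m v).
Proof.
move=> wV hv; elim: n => [|n IH].
  by rewrite !expmx0 mul1mx expr0 !mul0r subrr qpow0 mul1r scale1r.
rewrite expmxS -mulmxA IH -scalemxAr antiFE mulNmx -mulmxA mulmxA -[in LHS]mulmxA.
rewrite [aF V *m (_ *m v)]mulmxA -expmxS (wtK wV (wtFn wV n.+1 hv)) scalerN -scaleNr scalerA.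
congr (_ *: _); rewrite -mulNr -mulrA -qpowD exprS mulN1r; congr (_ * q _).
by rewrite -natr1; ring.
Qed.

(** The coefficient of F^n E^n in theta on weight a; it collects the scalars coming from S(F)^n,
    q^(-H^2/2) and K^(r-1). *)
Definition tcoef n a : C := c_ n * (-1) ^+ n *
  q ((r%:R - 1) * a - a ^+ 2 / 2 - n%:R * a - n%:R ^+ 2 - n%:R).

Lemma pred_r : (r.-1%:R : C) = r%:R - 1.
Proof. by case: r hr => // k _; rewrite -natr1 addrK. Qed.

Lemma drinfeld_wt V a v : weight_module r V -> wt (V := V) a v ->
  drinfeld V *m v = \sum_(n < r) (c_ n * (-1) ^+ n * q (- (a ^+ 2 / 2) - n%:R * a - n%:R ^+ 2 - n%:R)) *:
     (aF V ^+ n *m (aE V ^+ n *m v)).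
Proof.
move=> wV hv; rewrite /drinfeld mulmx_suml; apply: eq_bigr => n _.
have hE := wtEn wV n hv.
rewrite -scalemxAl -!mulmxA (ribbon_g_wt hE) -scalemxAr (antiFn n wV hE) !scalerA.
congr (_ *: _).
have -> : - (a ^+ 2 / 2) - n%:R * a - n%:R ^+ 2 - n%:R = - ((a + 2 * n%:R) ^+ 2 / 2) + (n%:R * (a + 2 * n%:R) - n%:R * (n%:R + 1)) by field.
by rewrite [in RHS]qpowD; ring.
Qed.

Lemma theta_wt V a v : weight_module r V -> wt (V := V) a v ->
  theta r V *m v = \sum_(n < r) tcoef n a *: (aF V ^+ n *m (aE V ^+ n *m v)).
Proof.
move=> wV hv; rewrite thetaE -mulmxA (drinfeld_wt wV hv) mulmx_sumr; apply: eq_bigr => n _.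
have hE : wt (V := V) a (aF V ^+ n *m (aE V ^+ n *m v)).
  by have := wtFn wV n (wtEn wV n hv); rewrite addrK.
rewrite -scalemxAr (wtKn r.-1 wV hE) scalerA pred_r /tcoef; congr (_ *: _).
by rewrite -[LHS]mulrA -qpowD; congr (_ * q _); ring.
Qed.

Opaque theta.

Lemma theta_H V : weight_module r V -> theta r V *m aH V = aH V *m theta r V.
Proof.
move=> wV; apply: (eq_on_wt (weight_diag wV)) => a v hv.
rewrite -[LHS]mulmxA -[RHS]mulmxA hv -scalemxAr (theta_wt wV hv) scaler_sumr mulmx_sumr.
apply: eq_bigr => n _; rewrite -scalemxAr.
have := wtFn wV n (wtEn wV n hv); rewrite addrK => ->.
by rewrite !scalerA mulrC.
Qed.

(** Again a telescoping sum. The factor K^(r-1) makes it close up: from weight a to a + 2 it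
    contributes q^(2r-2) = q^-2. *)
Lemma theta_E V : weight_module r V -> theta r V *m aE V = aE V *m theta r V.
Proof.
move=> wV; have b0 := qbr1_neq0 R hr; apply: (eq_on_wt (weight_diag wV)) => a v hv.
rewrite -[LHS]mulmxA -[RHS]mulmxA (theta_wt wV hv) (theta_wt wV (wtE wV hv)) mulmx_sumr.
pose k n := qbr r n%:R * qbr r (a + n%:R + 1) / qbr r 1 ^+ 2.
have EF n : aE V *m (aF V ^+ n *m (aE V ^+ n *m v)) = aF V ^+ n *m (aE V ^+ n.+1 *m v) + k n *: (aF V ^+ n.-1 *m (aE V ^+ n *m v)).
  case: n => [|n]; first by rewrite /k !expmx0 expr1 !mul1mx qbr0 !mul0r scale0r addr0.
  rewrite (EFn hr wV n (wtEn wV n.+1 hv)) /k [aE V *m _]mulmxA -expmxS.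
  by congr (_ + (_ * qbr r _ / _) *: _); rewrite -natr1; ring.
have -> : \sum_(n < r) aE V *m (tcoef n a *: (aF V ^+ n *m (aE V ^+ n *m v)))
  = \sum_(n < r) tcoef n a *: (aF V ^+ n *m (aE V ^+ n.+1 *m v))
  + \sum_(n < r) (tcoef n a * k n) *: (aF V ^+ n.-1 *m (aE V ^+ n *m v)).
  by rewrite -big_split /=; apply: eq_bigr => n _; rewrite -scalemxAr EF scalerDr scalerA.
rewrite [X in _ = _ + X](sum_shift (g := fun n => (tcoef n a * k n) *: (aF V ^+ n.-1 *m (aE V ^+ n *m v)))).
- rewrite -big_split /=; apply: eq_bigr => n _.
  rewrite [aE V ^+ n *m _]mulmxA -expmxSr -scalerDl.
  have [nr|nr] := ltnP n.+1 r; last by rewrite (En0 wV v nr) mulmx0 !scaler0.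
  congr (_ *: _); rewrite /k /tcoef.
  transitivity (c_ n * (-1) ^+ n * q ((r%:R - 1) * a - a ^+ 2 / 2 - n%:R * a - n%:R ^+ 2 - n%:R)
   + (qbr r n.+1%:R * c_ n.+1) * ((-1) ^+ n.+1 * q ((r%:R - 1) * a - a ^+ 2 / 2 - n.+1%:R * a - n.+1%:R ^+ 2 - n.+1%:R) * qbr r (a + n.+1%:R + 1) / qbr r 1 ^+ 2)); last by ring.
  rewrite RcoefS // [(-1) ^+ n.+1]exprS mulN1r.
  have -> : (r%:R - 1) * a - a ^+ 2 / 2 - n.+1%:R * a - n.+1%:R ^+ 2 - n.+1%:R = (r%:R - 1) * a - a ^+ 2 / 2 - n%:R * a - n%:R ^+ 2 - n%:R - a - n%:R - n%:R - 1 - 1.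
    by rewrite -natr1; ring.
  have -> : (r%:R - 1) * (a + 2) - (a + 2) ^+ 2 / 2 - n%:R * (a + 2) - n%:R ^+ 2 - n%:R = (r%:R - 1) * a - a ^+ 2 / 2 - n%:R * a - n%:R ^+ 2 - n%:R + 1%:~R * (2 * r%:R) - a - a - n%:R - n%:R - 1 - 1 - 1 - 1.
    by field.
  rewrite -[n.+1%:R]natr1 [qbr r (a + _ + 1)]/qbr.
  have A0 := qpow_neq0 r a; have N0 := qpow_neq0 r (n%:R : C); have Z0 := qpow_neq0 r (1 : C).
  move: ((r%:R - 1) * a - a ^+ 2 / 2 - n%:R * a - n%:R ^+ 2 - n%:R) => A; rewrite !(opprD, opprK, qpowD, qpowN) qpow_2r // mulr1.
  by field; rewrite b0 A0 N0 Z0.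
- by rewrite /k qbr0 !(mul0r, mulr0) scale0r.
by rewrite (En0 wV v (leqnn r)) mulmx0 scaler0.
Qed.

Lemma theta_F V : weight_module r V -> theta r V *m aF V = aF V *m theta r V.
Proof.
move=> wV; have b0 := qbr1_neq0 R hr; apply: (eq_on_wt (weight_diag wV)) => a v hv.
rewrite -[LHS]mulmxA -[RHS]mulmxA (theta_wt wV hv) (theta_wt wV (wtF wV hv)) mulmx_sumr.
pose k n := qbr r n%:R * qbr r (a + n%:R - 1) / qbr r 1 ^+ 2.
have FE n : aF V ^+ n *m (aE V ^+ n *m (aF V *m v)) = aF V *m (aF V ^+ n *m (aE V ^+ n *m v)) + k n *: (aF V ^+ n *m (aE V ^+ n.-1 *m v)).
  case: n => [|n]; first by rewrite /k !expmx0 !mul1mx qbr0 !mul0r scale0r addr0.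
  rewrite [X in _ *m X = _](FEn hr n wV hv) [LHS]mulmxDr; apply: (f_equal2 +%R); last rewrite -[LHS]scalemxAr.
    by rewrite [LHS]mulmxA -expmxSr expmxS -[LHS]mulmxA.
  by congr (_ *: _); rewrite /k; congr (_ * qbr r _ / _); rewrite -natr1; ring.
have -> : \sum_(n < r) tcoef n (a - 2) *: (aF V ^+ n *m (aE V ^+ n *m (aF V *m v)))
  = \sum_(n < r) tcoef n (a - 2) *: (aF V *m (aF V ^+ n *m (aE V ^+ n *m v)))
  + \sum_(n < r) (tcoef n (a - 2) * k n) *: (aF V ^+ n *m (aE V ^+ n.-1 *m v)).
  by rewrite -big_split /=; apply: eq_bigr => n _; rewrite FE scalerDr scalerA.
rewrite [X in _ + X = _](sum_shift (g := fun n => (tcoef n (a - 2) * k n) *: (aF V ^+ n *m (aE V ^+ n.-1 *m v)))).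
- rewrite -big_split /=; apply: eq_bigr => n _.
  rewrite -scalemxAr [aF V *m (_ *m _)]mulmxA -expmxS -scalerDl.
  have [nr|nr] := ltnP n.+1 r; last by rewrite (Fn0 wV _ nr) !scaler0.
  congr (_ *: _); rewrite /k /tcoef.
  transitivity (c_ n * (-1) ^+ n * q ((r%:R - 1) * (a - 2) - (a - 2) ^+ 2 / 2 - n%:R * (a - 2) - n%:R ^+ 2 - n%:R)
   + (qbr r n.+1%:R * c_ n.+1) * ((-1) ^+ n.+1 * q ((r%:R - 1) * (a - 2) - (a - 2) ^+ 2 / 2 - n.+1%:R * (a - 2) - n.+1%:R ^+ 2 - n.+1%:R) * qbr r (a + n.+1%:R - 1) / qbr r 1 ^+ 2)); first by ring.
  rewrite RcoefS // [(-1) ^+ n.+1]exprS mulN1r.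
  have -> : (r%:R - 1) * (a - 2) - (a - 2) ^+ 2 / 2 - n.+1%:R * (a - 2) - n.+1%:R ^+ 2 - n.+1%:R = (r%:R - 1) * a - a ^+ 2 / 2 - n%:R * a - n%:R ^+ 2 - n%:R + (-1)%:~R * (2 * r%:R) + a + n%:R + n%:R - a - n%:R - n%:R + a - n%:R + n%:R.
    by rewrite -natr1; field.
  have -> : (r%:R - 1) * (a - 2) - (a - 2) ^+ 2 / 2 - n%:R * (a - 2) - n%:R ^+ 2 - n%:R = (r%:R - 1) * a - a ^+ 2 / 2 - n%:R * a - n%:R ^+ 2 - n%:R + (-1)%:~R * (2 * r%:R) + a + a + n%:R + n%:R.
    by field.
  rewrite -[n.+1%:R]natr1.
  have -> : a + (n%:R + 1) - 1 = a + n%:R by ring.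
  rewrite [qbr r (a + _)]/qbr.
  have A0 := qpow_neq0 r a; have N0 := qpow_neq0 r (n%:R : C).
  move: ((r%:R - 1) * a - a ^+ 2 / 2 - n%:R * a - n%:R ^+ 2 - n%:R) => A; rewrite !(opprD, opprK, qpowD, qpowN) qpow_2r // mulr1.
  by field; rewrite b0 A0 N0.
- by rewrite /k qbr0 !(mul0r, mulr0) scale0r.
by rewrite (Fn0 wV _ (leqnn r)) scaler0.
Qed.

Lemma theta_lin V : weight_module r V -> ulinear (theta r V).
Proof.
move=> wV; have hw a v : wt (V := V) a v -> wt (V := V) a (theta r V *m v).
  by move=> hv; rewrite /wt mulmxA -theta_H // -mulmxA hv -scalemxAr.
apply/ulinearP; split; [exact: theta_E | exact: theta_F | | | exact: theta_H];
  apply: (eq_on_wt (weight_diag wV)) => a v hv; rewrite -[LHS]mulmxA -[RHS]mulmxA.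
  by rewrite (wtK wV hv) (wtK wV (hw _ _ hv)) -scalemxAr.
by rewrite (wtKi wV hv) (wtKi wV (hw _ _ hv)) -scalemxAr.
Qed.

Lemma theta_hw V a v : weight_module r V -> wt (V := V) a v -> aE V *m v = 0 ->
  theta r V *m v = q ((r%:R - 1) * a - a ^+ 2 / 2) *: v.
Proof.
move=> wV hv Ev; rewrite (theta_wt wV hv); have r0 : (0 < r)%N by case: r hr.
rewrite (bigD1 (Ordinal r0)) //= big1 ?addr0 => [|n n0].
  by rewrite !expmx0 !mul1mx /tcoef Rcoef0 // expr0 !mul1r mul0r expr0n !subr0.
have : (0 < n)%N by rewrite lt0n; apply: contraNN n0 => /eqP e; apply/eqP/val_inj.
by case: (n : nat) => // m _; rewrite [aE V ^+ m.+1]expmxSr -[aE V ^+ m *m _ *m v]mulmxA Ev !mulmx0 scaler0.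
Qed.

Lemma theta_unit V : weight_module r V -> theta r V \in unitmx.
Proof.
move=> wV; apply: (hw_unit wV (theta_lin wV)) => a v hv Ev v0.
by rewrite (theta_hw wV hv Ev) scaler_eq0 (negPf (qpow_neq0 _ _)).
Qed.

Lemma twist_lin V : weight_module r V -> ulinear (twist_mx r V).
Proof. by move=> wV; apply: ulinear_invmx; [exact: theta_lin|exact: theta_unit]. Qed.

Lemma twist_unit V : weight_module r V -> twist_mx r V \in unitmx.
Proof. by move=> wV; rewrite unitmx_inv theta_unit. Qed.

Lemma theta_nat V W (f : 'M[C]_(udim W, udim V)) :
  weight_module r V -> weight_module r W -> ulinear f -> theta r W *m f = f *m theta r V.
Proof.
move=> wV wW hf; apply: (eq_on_wt (weight_diag wV)) => a v hv.
rewrite -[LHS]mulmxA -[RHS]mulmxA (theta_wt wV hv) (theta_wt wW (wt_ulinear hf hv)) mulmx_sumr.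
apply: eq_bigr => n _; rewrite -scalemxAr.
by rewrite -(Xn_ulinear n v hf).1 -(Xn_ulinear n _ hf).2.
Qed.

Lemma twist_nat V W (f : 'M[C]_(udim W, udim V)) :
  weight_module r V -> weight_module r W -> ulinear f -> twist_mx r W *m f = f *m twist_mx r V.
Proof.
move=> wV wW hf; apply: (can_inj (mulKmx (theta_unit wW))).
rewrite mulmxA mulmxV ?theta_unit // mul1mx mulmxA (theta_nat wV wW hf) -mulmxA.
by rewrite mulmxV ?theta_unit // mulmx1.
Qed.

End Theta.

(** * The twist of a tensor product *)

Section Sandwich.
Variables (R : realType) (r : nat).
Hypothesis hr : (2 <= r)%N.
Local Notation C := R[i].
Local Notation q := (@qpow R r).
Local Notation c_ := (@Rcoef R r).

(* The coproduct turns [drinfeld (tens V W)] into such a sum with [A] and [B]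
   q-commuting sums of two terms; splitting both q-exponentials leaves four
   successive sums of this kind. *)
Definition sand N (A B M : 'M[C]_N) := \sum_(n < r) c_ n *: (A ^+ n *m M *m B ^+ n).

(** The addition theorem splits (X + Y)^n, and the nilpotency of the matrix on the other side allows
    the triangle of exponents to be completed to a square. *)
Lemma sand_addl N (X Y Z M : 'M[C]_N) : X *m Y = q 2 *: (Y *m X) -> Z ^+ r = 0 ->
  sand (X + Y) Z M = sand X Z (sand Y Z M).
Proof.
move=> XY Zr; rewrite /sand.
pose f a b := (c_ a * c_ b) *: (X ^+ a *m Y ^+ b *m M *m Z ^+ (a + b)).
transitivity (\sum_(n < r) \sum_(i < n.+1) f i (n - i)%N).
  apply: eq_bigr => n _; rewrite 2!scalemxAl (qexp_add hr XY (ltn_ord n)) !mulmx_suml.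
  apply: eq_bigr => i _; rewrite /f -!scalemxAl subnKC // -ltnS; exact: ltn_ord.
rewrite sum_triangle; last first.
  by move=> a b ab; rewrite /f -(subnKC ab) expmxD Zr mul0mx mulmx0 scaler0.
apply: eq_bigr => a _; rewrite mulmx_sumr mulmx_suml scaler_sumr; apply: eq_bigr => b _.
rewrite /f -scalemxAr -scalemxAl scalerA; congr (_ *: _).
by rewrite addnC expmxD !mulmxA.
Qed.

Lemma sand_addr N (X Y Z M : 'M[C]_N) : X *m Y = q 2 *: (Y *m X) -> Z ^+ r = 0 ->
  sand Z (X + Y) M = sand Z Y (sand Z X M).
Proof.
move=> XY Zr; rewrite /sand.
pose f a b := (c_ a * c_ b) *: (Z ^+ (a + b) *m M *m (X ^+ a *m Y ^+ b)).
transitivity (\sum_(n < r) \sum_(i < n.+1) f i (n - i)%N).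
  apply: eq_bigr => n _; rewrite scalemxAr (qexp_add hr XY (ltn_ord n)) mulmx_sumr.
  apply: eq_bigr => i _; rewrite /f -!scalemxAr subnKC // -ltnS; exact: ltn_ord.
rewrite sum_triangle; last first.
  by move=> a b ab; rewrite /f -(subnKC ab) expmxD Zr !mul0mx scaler0.
rewrite exchange_big; apply: eq_bigr => b _; rewrite mulmx_sumr mulmx_suml scaler_sumr; apply: eq_bigr => a _.
rewrite /f -scalemxAr -scalemxAl scalerA [c_ a * _]mulrC; congr (_ *: _).
by rewrite addnC expmxD !mulmxA.
Qed.

Lemma RcoefV_conv' n : (0 < n < r)%N -> \sum_(i < n.+1) c_ i * RcoefV R r (n - i) = 0.
Proof.
move=> hn; transitivity (\sum_(i < n.+1) RcoefV R r i * c_ (n - i)); last exact: RcoefV_conv.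
rewrite [LHS](reindex_inj rev_ord_inj) /=.
by apply: eq_bigr => i _; rewrite subSS subKn 1?mulrC // -ltnS.
Qed.

Lemma sand_mul N (A B M : 'M[C]_N) (x : 'cV_N) :
  sand A B M *m x = \sum_(n < r) c_ n *: (A ^+ n *m (M *m (B ^+ n *m x))).
Proof. by rewrite /sand mulmx_suml; apply: eq_bigr => n _; rewrite -scalemxAl !mulmxA. Qed.

End Sandwich.

Section TwistTensor.
Variables (R : realType) (r : nat).
Hypothesis hr : (2 <= r)%N.
Local Notation C := R[i].
Local Notation q := (@qpow R r).
Local Notation c_ := (@Rcoef R r).
Variables V W : umod R.
Hypotheses (wV : weight_module r V) (wW : weight_module r W).
Let wVW : weight_module r (tens V W) := tens_weight hr wV wW.

(** The flipped R-matrix, acting on V (x) W with powers of F on V and of E on W. *)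
Definition R21 : 'M[C]_(udim V * udim W) := braiding r W V *m flip R (udim V) (udim W).

Lemma R21_wt a b v w : wt (V := V) a v -> wt (V := W) b w ->
  R21 *m tensv v w = \sum_(n < r) (c_ n * q ((b + 2 * n%:R) * (a - 2 * n%:R) / 2)) *:
     tensv (aF V ^+ n *m v) (aE W ^+ n *m w).
Proof. by move=> hv hw; rewrite -[LHS]mulmxA flip_tensv (braiding_wt wW wV hw hv). Qed.

Lemma flipK m n : flip R m n *m flip R n m = 1%:M.
Proof. by apply: eq_tensv => v w; rewrite -mulmxA !flip_tensv mul1mx. Qed.

(** KE2 + E1 is the opposite coproduct of E, and X + Y is S(F) on the tensor product. G is
    q^(-H^2/2) there; D1, D2, D3 are the results of summing successively over the pairs (Y, KE2),
    (Y, E1), (X, KE2). *)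
Let E1 : 'M[C]_(udim V * udim W) := tensmx (aE V) 1%:M.
Let KE2 : 'M[C]_(udim V * udim W) := tensmx (aK V) (aE W).
Let X : 'M[C]_(udim V * udim W) := tensmx 1%:M (antiF W).
Let Y : 'M[C]_(udim V * udim W) := tensmx (antiF V) (aK W).
Let G : 'M[C]_(udim V * udim W) := ribbon_g r (tens V W).
Let D1 : 'M[C]_(udim V * udim W) := tensmx (ribbon_g r V) (ribbon_g r W) *m invmx (qHH r V W).
Let D2 : 'M[C]_(udim V * udim W) := tensmx (drinfeld r V) (ribbon_g r W) *m invmx (qHH r V W).
Let D3 : 'M[C]_(udim V * udim W) := tensmx (drinfeld r V) (drinfeld r W) *m invmx (qHH r V W).

Lemma X_pow n v w : X ^+ n *m tensv v w = tensv v (antiF W ^+ n *m w).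
Proof.
rewrite tensmxX tensv_mul; have -> : (1%:M : 'M[C]_(udim V)) ^+ n = 1%:M by exact: expr1n.
by rewrite mul1mx.
Qed.

Lemma E1_pow n v w : E1 ^+ n *m tensv v w = tensv (aE V ^+ n *m v) w.
Proof.
rewrite tensmxX tensv_mul; have -> : (1%:M : 'M[C]_(udim W)) ^+ n = 1%:M by exact: expr1n.
by rewrite mul1mx.
Qed.

Lemma Y_pow n v w : Y ^+ n *m tensv v w = tensv (antiF V ^+ n *m v) (aK W ^+ n *m w).
Proof. by rewrite tensmxX tensv_mul. Qed.

Lemma KE2_pow n v w : KE2 ^+ n *m tensv v w = tensv (aK V ^+ n *m v) (aE W ^+ n *m w).
Proof. by rewrite tensmxX tensv_mul. Qed.

Lemma drinfeld_theta (U : umod R) b w : weight_module r U -> wt (V := U) b w ->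
  drinfeld r U *m w = q (- ((r%:R - 1) * b)) *: (theta r U *m w).
Proof.
move=> wU hw; rewrite (theta_wt hr wU hw) (drinfeld_wt wU hw) scaler_sumr.
apply: eq_bigr => n _; rewrite scalerA /tcoef; congr (_ *: _).
by rewrite [RHS]mulrCA -qpowD; congr (_ * q _); ring.
Qed.

Lemma drinfeld_wt_pres (U : umod R) b w : weight_module r U -> wt (V := U) b w -> wt (V := U) b (drinfeld r U *m w).
Proof.
move=> wU hw; rewrite (drinfeld_theta wU hw) /wt -scalemxAr mulmxA.
by rewrite -(theta_H hr wU) -[theta r U *m _ *m _]mulmxA hw -scalemxAr scalerA mulrC -scalerA.
Qed.

(** The Drinfeld element is theta times K^(1-r). As theta is central, F^n only has to cross K^(1-r),
    which contributes q^(2n(r-1)) = q^(-2n). *)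
Lemma drinfeld_F n (U : umod R) b w : weight_module r U -> wt (V := U) b w ->
  drinfeld r U *m (aF U ^+ n *m w) = q (- (2 * n%:R)) *: (aF U ^+ n *m (drinfeld r U *m w)).
Proof.
move=> wU hw; rewrite (drinfeld_theta wU (wtFn wU n hw)) (drinfeld_theta wU hw).
rewrite (Xn_ulinear n w (theta_lin hr wU)).2 -scalemxAr scalerA -qpowD; congr (_ *: _).
have -> : - ((r%:R - 1) * (b - 2 * n%:R)) = - (2 * n%:R) + - ((r%:R - 1) * b) + n%:Z%:~R * (2 * r%:R) :> C by rewrite -pmulrn; ring.
by rewrite [LHS]qpowD qpow_2r // mulr1.
Qed.

(** Once the powers of q are collected, the q-exponential inside R21 and the sum over S(F) (x) K and
    K (x) E are mutually inverse, so only a Cartan factor survives. *)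
Lemma sand_step1 : sand r Y KE2 (G *m R21) = D1.
Proof.
apply: (eq_on_tens wV wW) => a b v w hv hw.
(* [kap] gathers what depends on n + m alone; the remaining (-1)^m q^(-m(m-1)) turns [Rcoef] at m
   into [RcoefV]. *)
pose kap N : C := (-1) ^+ N * q ((b + 2 * N%:R) * (a - 2 * N%:R) / 2 - (a + b) ^+ 2 / 2 + N%:R ^+ 2 - N%:R).
pose f n m : 'cV[C]_(udim V * udim W) := (c_ n * RcoefV R r m * kap (n + m)%N) *:
  tensv (aF V ^+ (n + m) *m v) (aE W ^+ (n + m) *m w).
transitivity (\sum_(n < r) \sum_(m < r) f n m).
  rewrite sand_mul; apply: eq_bigr => n _.
  have hE := wtEn wW n hw.
  rewrite KE2_pow (wtKn n wV hv) tensvZl -[G *m R21 *m _]mulmxA -scalemxAr (R21_wt hv hE).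
  rewrite -[G *m (_ *: _)]scalemxAr -[Y ^+ n *m (_ *: _)]scalemxAr scalerA !mulmx_sumr scaler_sumr.
  apply: eq_bigr => m _.
  have hF := wtFn wV m hv; have hEE := wtEn wW m hE.
  rewrite -[G *m (_ *: _)]scalemxAr (ribbon_g_wt r (wt_tensv hF hEE)) scalerA -[Y ^+ n *m (_ *: _)]scalemxAr.
  rewrite Y_pow (antiFn n wV hF) (wtKn n wW hEE) tensvZl tensvZr !scalerA /f.
  rewrite [aF V ^+ n *m _]mulmxA [aE W ^+ m *m _]mulmxA -!expmxD [(m + n)%N]addnC.
  congr (_ *: _); rewrite /kap /RcoefV exprD.
  have sg : (-1) ^+ m * (-1) ^+ m = 1 :> C by rewrite -exprMn mulrNN mulr1 expr1n.
  transitivity (c_ n * c_ m * (-1) ^+ n * (q (n%:R * a) * q ((b + 2 * n%:R + 2 * m%:R) * (a - 2 * m%:R) / 2)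
    * q (- ((a - 2 * m%:R + (b + 2 * n%:R + 2 * m%:R)) ^+ 2 / 2)) * q (n%:R * (a - 2 * m%:R) - n%:R * (n%:R + 1)) * q (n%:R * (b + 2 * n%:R + 2 * m%:R)))).
    by ring.
  transitivity (c_ n * c_ m * (-1) ^+ n * (q (- (m%:R * (m%:R - 1))) * q ((b + 2 * (n + m)%:R) * (a - 2 * (n + m)%:R) / 2 - (a + b) ^+ 2 / 2 + (n + m)%:R ^+ 2 - (n + m)%:R)) * ((-1) ^+ m * (-1) ^+ m)); last by ring.
  rewrite sg mulr1 -!qpowD; congr (_ * q _); rewrite natrD; by field.
transitivity (\sum_(n < r) \sum_(i < n.+1) f i (n - i)%N).
  by symmetry; apply: sum_triangle => n m nm; rewrite /f (Fn0 wV _ nm) tensv0l scaler0.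
have r0 : (0 < r)%N by case: r hr.
rewrite (bigD1 (Ordinal r0)) //= big_ord1 [X in _ + X]big1 ?addr0 => [|n n0].
  rewrite /f /kap Rcoef0 // RcoefV0 // !expmx0 !mul1mx expr0 !mul1r /D1 -[RHS]mulmxA.
  rewrite (qHHV_wt wV wW hv hw) -scalemxAr tensv_mul (ribbon_g_wt r hv) (ribbon_g_wt r hw).
  rewrite tensvZl tensvZr !scalerA -!qpowD; congr (q _ *: _); rewrite mulr0n; by field.
rewrite (eq_bigr (fun i : 'I_n.+1 => (c_ i * RcoefV R r (n - i)) *: (kap n *: tensv (aF V ^+ n *m v) (aE W ^+ n *m w)))).
  rewrite -scaler_suml RcoefV_conv' ?scale0r // ltn_ord andbT lt0n.
  by apply: contraNN n0 => /eqP e; apply/eqP/val_inj.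
by move=> i _; rewrite /f subnKC ?scalerA // -ltnS.
Qed.

(** The powers of K on W coming from S(F) (x) K compensate the change of the Cartan factor under E
    on V, which leaves the defining sum of the Drinfeld element of V. The next step does the same on
    W. *)
Lemma sand_step2 : sand r Y E1 D1 = D2.
Proof.
apply: (eq_on_tens wV wW) => a b v w hv hw.
rewrite /D2 -[RHS]mulmxA (qHHV_wt wV wW hv hw) -scalemxAr tensv_mul (ribbon_g_wt r hw).
rewrite sand_mul [drinfeld r V *m v]mulmx_suml tensv_suml scaler_sumr.
apply: eq_bigr => n _; have hE := wtEn wV n hv.
rewrite E1_pow -[D1 *m _]mulmxA (qHHV_wt wV wW hE hw) -scalemxAr tensv_mul.
rewrite (ribbon_g_wt r hw) (ribbon_g_wt r hE) tensvZl tensvZr -!scalemxAr Y_pow (wtKn n wW hw) tensvZr.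
rewrite -scalemxAl -!mulmxA (ribbon_g_wt r hE) -scalemxAr !tensvZl tensvZr !scalerA.
congr (_ *: _).
transitivity (c_ n * (q (- ((a + 2 * n%:R) * b / 2)) * q (- ((a + 2 * n%:R) ^+ 2 / 2)) * q (- (b ^+ 2 / 2)) * q (n%:R * b))); first by ring.
transitivity (c_ n * (q (- (a * b / 2)) * q (- ((a + 2 * n%:R) ^+ 2 / 2)) * q (- (b ^+ 2 / 2)))); last by ring.
by rewrite -!qpowD; congr (_ * q _); field.
Qed.

Lemma sand_step3 : sand r X KE2 D2 = D3.
Proof.
apply: (eq_on_tens wV wW) => a b v w hv hw.
rewrite /D3 -[RHS]mulmxA (qHHV_wt wV wW hv hw) -scalemxAr tensv_mul.
rewrite sand_mul [drinfeld r W *m w]mulmx_suml tensv_sumr scaler_sumr.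
apply: eq_bigr => n _; have hE := wtEn wW n hw.
rewrite KE2_pow (wtKn n wV hv) tensvZl -scalemxAr -[D2 *m _]mulmxA (qHHV_wt wV wW hv hE) -!scalemxAr tensv_mul.
rewrite (ribbon_g_wt r hE) tensvZr -!scalemxAr X_pow.
rewrite -scalemxAl -!mulmxA (ribbon_g_wt r hE) -scalemxAr !tensvZr !scalerA.
congr (_ *: _).
have -> : q (- (a * b / 2)) = q (n%:R * a) * q (- (a * (b + 2 * n%:R) / 2)).
  by rewrite -qpowD; congr (q _); field.
by ring.
Qed.

(** Moving F^n across the Drinfeld element of W gives q^(-2n), which completes the coefficients to
    those of the inverse R-matrix. *)
Lemma sand_step4 : sand r X E1 D3 = tensmx (drinfeld r V) (drinfeld r W) *m Rmatrix_inv r V W.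
Proof.
apply: (eq_on_tens wV wW) => a b v w hv hw.
rewrite sand_mul /Rmatrix_inv -[RHS]mulmxA -[_ *m invmx _ *m _]mulmxA (qHHV_wt wV wW hv hw).
rewrite -!scalemxAr !mulmx_suml mulmx_sumr scaler_sumr.
apply: eq_bigr => n _; have hE := wtEn wV n hv.
rewrite E1_pow -[D3 *m _]mulmxA (qHHV_wt wV wW hE hw) -!scalemxAr tensv_mul X_pow.
rewrite (antiFn n wW (drinfeld_wt_pres wW hw)).
rewrite -scalemxAl tensv_mul -scalemxAr tensv_mul (drinfeld_F n wW hw) !tensvZr !scalerA.
congr (_ *: _); rewrite /RcoefV.
transitivity (c_ n * (-1) ^+ n * (q (- ((a + 2 * n%:R) * b / 2)) * q (n%:R * b - n%:R * (n%:R + 1)))); first by ring.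
transitivity (c_ n * (-1) ^+ n * (q (- (a * b / 2)) * q (- (n%:R * (n%:R - 1))) * q (- (2 * n%:R)))); last by ring.
by rewrite -!qpowD; congr (_ * q _); field.
Qed.

Lemma antiF_tens : antiF (tens V W) = X + Y.
Proof.
rewrite antiFE /= mulmxDr !tensmx_mul mulmx1 (rel_KKi (weight_relations wV)) opprD /X /Y !antiFE.
by congr (_ + _); apply/matrixP => i j; rewrite !mxE ?mulrN ?mulNr.
Qed.

Lemma antiF_comm (U : umod R) : weight_module r U -> antiF U *m aK U = q 2 *: (aK U *m antiF U).
Proof.
move=> wU; rewrite !antiFE mulNmx mulmxN scalerN; congr (- _).
rewrite {2}(KF_comm wU) -scalemxAr scalerA qpow_mulN scale1r mulmxA; by [].
Qed.

Lemma antiF_nil (U : umod R) : weight_module r U -> antiF U ^+ r = 0.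
Proof.
move=> wU; apply: (eq_on_wt (weight_diag wU)) => a v hv.
by rewrite (antiFn r wU hv) (Fn0 wU v (leqnn r)) scaler0 mul0mx.
Qed.

(** R21 exchanges the coproduct of E with its opposite, so it can be moved into the middle of the
    sum defining the Drinfeld element. Both q-commuting sums are then split and the four steps
    applied. *)
Lemma drinfeld_tens : drinfeld r (tens V W) *m R21 *m Rmatrix r V W = tensmx (drinfeld r V) (drinfeld r W).
Proof.
have relV := weight_relations wV; have relW := weight_relations wW.
have KE : KE2 *m E1 = q 2 *: (E1 *m KE2).
  by rewrite !tensmx_mul mul1mx mulmx1 (KE_comm wV) tensmxZl.
have XY : X *m Y = q 2 *: (Y *m X).
  by rewrite !tensmx_mul mul1mx mulmx1 (antiF_comm wW) tensmxZr.
have Zr : (KE2 + E1) ^+ r = 0.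
  apply: (qexp_nil hr KE); rewrite tensmxX ?(rel_Er relV) ?(rel_Er relW) ?tens0mx ?tensmx0 //.
have Xr : X ^+ r = 0 by rewrite tensmxX (antiF_nil wW) tensmx0.
have Yr : Y ^+ r = 0 by rewrite tensmxX (antiF_nil wV) tens0mx.
have ER n : aE (tens V W) ^+ n *m R21 = R21 *m (KE2 + E1) ^+ n.
  elim: n => [|n IH]; first by rewrite !expmx0 mul1mx mulmx1.
  rewrite [aE _ ^+ _]expmxSr [(KE2 + E1) ^+ _]expmxSr -[LHS]mulmxA.
  have -> : aE (tens V W) *m R21 = R21 *m (KE2 + E1).
    rewrite /R21 mulmxA -(braiding_E hr wW wV) -[LHS]mulmxA -[RHS]mulmxA; congr (_ *m _).
    apply: eq_tensv => v w; rewrite -[LHS]mulmxA flip_tensv tens_E -[RHS]mulmxA mulmxDl !tensv_mul mul1mx.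
    by rewrite mulmxDr !flip_tensv addrC.
  by rewrite [LHS]mulmxA IH -[LHS]mulmxA.
have T m (P Q S Z : 'M[C]_m) : P *m Q *m (S *m Z) = P *m (Q *m S) *m Z by rewrite !mulmxA.
have -> : drinfeld r (tens V W) *m R21 = sand r (X + Y) (KE2 + E1) (G *m R21).
  rewrite /drinfeld /sand mulmx_suml antiF_tens; apply: eq_bigr => n _.
  by rewrite -scalemxAl -[_ *m R21 in LHS]mulmxA ER T.
rewrite (sand_addl hr _ XY Zr) (sand_addr hr _ KE Yr) sand_step1 sand_step2.
rewrite (sand_addr hr _ KE Xr) sand_step3 sand_step4 -mulmxA (Rmatrix_invE hr wV wW) mulmx1; by [].
Qed.

Lemma theta_tens : theta r (tens V W) *m R21 *m Rmatrix r V W = tensmx (theta r V) (theta r W).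
Proof.
rewrite !thetaE -[LHS]mulmxA -[LHS]mulmxA [drinfeld r (tens V W) *m _]mulmxA drinfeld_tens.
by rewrite /= tensmxX tensmx_mul.
Qed.

Lemma twist_tens : twist_mx r (tens V W) = braiding r W V *m braiding r V W *m tensmx (twist_mx r V) (twist_mx r W).
Proof.
have cc : braiding r W V *m braiding r V W = R21 *m Rmatrix r V W.
  by rewrite /R21 -[RHS]mulmxA -braidingE.
rewrite cc; apply: (can_inj (mulKmx (theta_unit hr wVW))).
rewrite (mulmxV (theta_unit hr wVW)) [RHS]mulmxA.
have -> : theta r (tens V W) *m (R21 *m Rmatrix r V W) = tensmx (theta r V) (theta r W) by rewrite mulmxA theta_tens.
by rewrite tensmx_mul !mulmxV ?(theta_unit hr) // tensmx1.
Qed.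

End TwistTensor.

Global Opaque qHH Rmatrix braiding theta drinfeld.

(** * The Casimir element *)

Section MatrixPoly.
Variable F : fieldType.

(** [horner_mx] is stated for positive size; the case of size 0 covers zero modules. *)
Definition pmx n : 'M[F]_n -> {poly F} -> 'M[F]_n :=
  if n is k.+1 then fun A p => horner_mx A p else fun _ _ => 0.

Lemma mx0_eq (A B : 'M[F]_0) : A = B.
Proof. by apply/matrixP => -[]. Qed.

Lemma pmxD n (A : 'M[F]_n) p s : pmx A (p + s) = pmx A p + pmx A s.
Proof. by case: n A => [|n] A; [exact: mx0_eq | exact: rmorphD]. Qed.

Lemma pmxB n (A : 'M[F]_n) p s : pmx A (p - s) = pmx A p - pmx A s.
Proof. by case: n A => [|n] A; [exact: mx0_eq | exact: rmorphB]. Qed.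

Lemma pmxM n (A : 'M[F]_n) p s : pmx A (p * s) = pmx A p *m pmx A s.
Proof. by case: n A => [|n] A; [exact: mx0_eq | exact: rmorphM]. Qed.

Lemma pmxC n (A : 'M[F]_n) c : pmx A c%:P = c%:M.
Proof. by case: n A => [|n] A; [exact: mx0_eq | exact: horner_mx_C]. Qed.

Lemma pmx1 n (A : 'M[F]_n) : pmx A 1 = 1%:M.
Proof. exact: pmxC. Qed.

Lemma pmx0 n (A : 'M[F]_n) : pmx A 0 = 0.
Proof. by rewrite -(subrr 0) pmxB subrr. Qed.

Lemma pmxX n (A : 'M[F]_n) : pmx A 'X = A.
Proof. by case: n A => [|n] A; [exact: mx0_eq | exact: horner_mx_X]. Qed.

Lemma pmxXsubC n (A : 'M[F]_n) c : pmx A ('X - c%:P) = A - c%:M.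
Proof. by rewrite pmxB pmxX pmxC. Qed.

Lemma pmxZ n (A : 'M[F]_n) c p : pmx A (c *: p) = c *: pmx A p.
Proof. by rewrite -mul_polyC pmxM pmxC mul_scalar_mx. Qed.

Lemma pmx_sum n (A : 'M[F]_n) (I : finType) (p : I -> {poly F}) :
  pmx A (\sum_i p i) = \sum_i pmx A (p i).
Proof. exact: (big_morph (pmx A) (pmxD A) (pmx0 A)). Qed.

Lemma pmx_char n (A : 'M[F]_n) : pmx A (char_poly A) = 0.
Proof. by case: n A => [|n] A; [exact: mx0_eq | exact: Cayley_Hamilton]. Qed.

Lemma pmx_intertwine m n (A : 'M[F]_n) (B : 'M[F]_m) (f : 'M[F]_(n, m)) p :
  A *m f = f *m B -> pmx A p *m f = f *m pmx B p.
Proof.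
move=> Af; elim/poly_ind: p => [|p c IH]; first by rewrite !pmx0 mul0mx mulmx0.
rewrite !pmxD !pmxM !pmxC !pmxX mulmxDl mulmxDr -mulmxA Af mulmxA IH mulmxA.
by rewrite scalar_mxC.
Qed.

Lemma pmx_eigen n (A : 'M[F]_n) c (v : 'cV_n) p : A *m v = c *: v ->
  pmx A p *m v = p.[c] *: v.
Proof.
move=> Av; elim/poly_ind: p => [|p d IH]; first by rewrite pmx0 mul0mx horner0 scale0r.
rewrite pmxD pmxM pmxC pmxX mulmxDl -mulmxA Av -scalemxAr IH hornerMXaddC.
by rewrite mul_scalar_mx scalerA mulrC -scalerDl.
Qed.

End MatrixPoly.

Lemma trmxZ (F : comPzRingType) m n c (A : 'M[F]_(m, n)) : (c *: A)^T = c *: A^T.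
Proof. by apply/matrixP => i j; rewrite !mxE. Qed.

Section Laurent.
Variable F : fieldType.

(** Laurent polynomials as functions of a nonzero scalar. They carry an identity known at infinitely
    many values of q^a over to all of them. *)
Definition laurent (f : F -> F) :=
  exists N (p : {poly F}), forall z, z != 0 -> z ^+ N * f z = p.[z].

Lemma laurentC c : laurent (fun=> c).
Proof. by exists 0%N, c%:P => z _; rewrite hornerC mul1r. Qed.

Lemma laurentX : laurent id.
Proof. by exists 0%N, 'X => z _; rewrite hornerX mul1r. Qed.

Lemma laurentV : laurent (fun z => z^-1).
Proof. by exists 1%N, 1 => z z0; rewrite expr1 hornerE mulfV. Qed.

Lemma laurentM f g : laurent f -> laurent g -> laurent (fun z => f z * g z).
Proof.
move=> [N [p fp]] [M [s gs]]; exists (N + M)%N, (p * s) => z z0.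
by rewrite hornerM -fp // -gs // exprD; ring.
Qed.

Lemma laurentD f g : laurent f -> laurent g -> laurent (fun z => f z + g z).
Proof.
move=> [N [p fp]] [M [s gs]]; exists (N + M)%N, ('X^M * p + 'X^N * s) => z z0.
by rewrite hornerD !hornerM !hornerXn -fp // -gs // exprD; ring.
Qed.

Lemma laurentB f g : laurent f -> laurent g -> laurent (fun z => f z - g z).
Proof.
move=> lf lg; have [N [p h]] := laurentD lf (laurentM (laurentC (-1)) lg).
by exists N, p => z z0; rewrite -h // mulN1r.
Qed.

Lemma laurent_exp f n : laurent f -> laurent (fun z => f z ^+ n).
Proof.
move=> lf; elim: n => [|n [N [p h]]]; first exact: laurentC.
have [M [s h']] := laurentM lf (ex_intro _ N (ex_intro _ p h)).
by exists M, s => z z0; rewrite exprS h'.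
Qed.

Lemma laurent_sum n (f : nat -> F -> F) : (forall i, laurent (f i)) ->
  laurent (fun z => \sum_(i < n) f i z).
Proof.
move=> lf; elim: n => [|n [N [p h]]].
  by exists 0%N, 0 => z _; rewrite big_ord0 mulr0 horner0.
have [M [s h']] := laurentD (ex_intro _ N (ex_intro _ p h)) (lf n).
by exists M, s => z z0; rewrite big_ord_recr h'.
Qed.

Lemma laurent_prod n (f : nat -> F -> F) : (forall i, laurent (f i)) ->
  laurent (fun z => \prod_(i < n) f i z).
Proof.
move=> lf; elim: n => [|n [N [p h]]].
  by exists 0%N, 1%:P => z _; rewrite big_ord0 expr0 mul1r hornerC.
have [M [s h']] := laurentM (ex_intro _ N (ex_intro _ p h)) (lf n).
by exists M, s => z z0; rewrite big_ord_recr h'.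
Qed.

Lemma laurent_eq0 f (x : nat -> F) : laurent f -> injective x ->
  (forall k, x k != 0) -> (forall k, f (x k) = 0) -> forall z, z != 0 -> f z = 0.
Proof.
move=> [N [p fp]] xI x0 fx z z0; suff p0 : p = 0.
  apply: (mulfI (expf_neq0 N z0)); by rewrite fp // p0 horner0 mulr0.
apply/eqP; apply: contraT => pn0.
have := @max_poly_roots _ p (mkseq x (size p)) pn0; rewrite size_mkseq ltnn.
move=> h; suff : false by []; apply: h; last by rewrite mkseq_uniq.
by apply/allP => _ /mapP[k _ ->]; rewrite rootE -fp // fx mulr0.
Qed.

End Laurent.

Section Casimir.
Variables (R : realType) (r : nat).
Hypothesis hr : (2 <= r)%N.
Local Notation C := R[i].
Local Notation q := (@qpow R r).
Local Notation c_ := (@Rcoef R r).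
Local Notation b1 := (qbr r (1 : C)).
Implicit Types (V W U : umod R) (a b : C).

Definition wsum (x : C) : C := q x + q (- x).

Lemma wsumN x : wsum (- x) = wsum x.
Proof. by rewrite /wsum opprK addrC. Qed.

Lemma wsumDr x : wsum (x + r%:R) = - wsum x.
Proof. by rewrite /wsum qpowDr // opprD qpowBr // -opprD. Qed.

Definition casimir V : 'M[C]_(udim V) :=
  b1 ^+ 2 *: (aF V *m aE V) + q 1 *: aK V + q (-1) *: aKi V.

Section Mod.
Variable V : umod R.
Hypothesis wV : weight_module r V.
Let dV := weight_diag wV.

Lemma casimir_FE a v : wt (V := V) a v ->
  b1 ^+ 2 *: (aF V *m (aE V *m v)) = casimir V *m v - wsum (a + 1) *: v.
Proof.
move=> hv; rewrite /casimir !mulmxDl -!scalemxAl -mulmxA (wtK wV hv) (wtKi wV hv).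
rewrite /wsum opprD !qpowD !scalerA scalerDl [q 1 * _]mulrC [q (-1) * _]mulrC.
have E (A x y : 'cV[C]_(udim V)) : A + x + y - (x + y) = A.
  by apply/colP => i; rewrite !mxE; ring.
by rewrite E.
Qed.

Lemma casimir_EF a v : wt (V := V) a v ->
  b1 ^+ 2 *: (aE V *m (aF V *m v)) = casimir V *m v - wsum (a - 1) *: v.
Proof.
move=> hv; have b0 := qbr1_neq0 R hr.
rewrite (EF_wt wV hv) scalerDr (casimir_FE hv) -addrA; congr (_ + _).
rewrite scalerA -scaleNr -scalerDl -scaleNr; congr (_ *: _).
rewrite /wsum !(opprD, opprK, qpowD); transitivity (- (q a * q 1 + q (- a) * q (-1)) + (b1 ^+ 2 / b1) * qbr r a); first by ring.
have -> : b1 ^+ 2 / b1 = q 1 - q (-1) by rewrite -[q 1 - _]/(qbr r 1); field.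
by rewrite /qbr; ring.
Qed.

Lemma wt_casimir a v : wt (V := V) a v -> wt (V := V) a (casimir V *m v).
Proof.
move=> hv; have hFE := wtF wV (wtE wV hv); rewrite addrK in hFE.
have -> : casimir V *m v = b1 ^+ 2 *: (aF V *m (aE V *m v)) + wsum (a + 1) *: v by rewrite (casimir_FE hv) subrK.
by rewrite /wt mulmxDr -!scalemxAr hFE hv !scalerDr !scalerA ![a * _]mulrC.
Qed.

Lemma casimir_lin : ulinear (casimir V).
Proof.
have b0 := expf_neq0 2 (qbr1_neq0 R hr).
apply/ulinearP; split; apply: (eq_on_wt dV) => a v hv; rewrite -!mulmxA.
- have e1 := casimir_EF (wtE wV hv); have := congr1 (mulmx (aE V)) (casimir_FE hv).
  rewrite -scalemxAr e1 mulmxBr -scalemxAr.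
  by have -> : a + 2 - 1 = a + 1 by [ring]; move/addIr.
- have e1 := casimir_FE (wtF wV hv); have := congr1 (mulmx (aF V)) (casimir_EF hv).
  rewrite -scalemxAr e1 mulmxBr -scalemxAr.
  by have -> : a - 2 + 1 = a - 1 by [ring]; move/addIr.
- by rewrite (wtK wV hv) (wtK wV (wt_casimir hv)) -scalemxAr.
- by rewrite (wtKi wV hv) (wtKi wV (wt_casimir hv)) -scalemxAr.
by rewrite hv (wt_casimir hv) -scalemxAr.
Qed.

(** On weight a, {1}^2 F E is the Casimir element minus [wsum (a + 1)]. Factors F E are peeled off
    one at a time, at the weights a, a + 2 and so on, the Casimir element commuting with E. *)
Lemma casimir_FEn n a v : wt (V := V) a v ->
  b1 ^+ (2 * n) *: (aF V ^+ n *m (aE V ^+ n *m v)) =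
  pmx (casimir V) (\prod_(i < n) ('X - (wsum (a + 1 + 2 * i%:R))%:P)) *m v.
Proof.
elim: n v a => [|n IH] v a hv.
  by rewrite !expmx0 big_ord0 pmx1 !mul1mx muln0 expr0 scale1r.
rewrite big_ord_recl pmxM pmxXsubC mulnS exprD -scalerA.
have -> : aF V ^+ n.+1 *m (aE V ^+ n.+1 *m v) = aF V *m (aF V ^+ n *m (aE V ^+ n *m (aE V *m v))).
  by rewrite [in LHS]expmxS expmxSr -!mulmxA.
rewrite scalemxAr (IH _ _ (wtE wV hv)).
have -> : \prod_(i < n) ('X - (wsum (a + 2 + 1 + 2 * i%:R))%:P) = \prod_(i < n) ('X - (wsum (a + 1 + 2 * (bump 0 i)%:R))%:P).
  by apply: eq_bigr => i _; congr ('X - (wsum _)%:P); rewrite /bump /= add1n -natr1; ring.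
set P := \prod_(i < n) _.
have /ulinearP[OE OF _ _ _] := casimir_lin.
rewrite [pmx _ P *m _]mulmxA (pmx_intertwine P OE) -[aE V *m _ *m v]mulmxA.
have hw : wt (V := V) a (pmx (casimir V) P *m v).
  have /ulinearP[_ _ _ _ OH] := casimir_lin.
  by rewrite /wt mulmxA -(pmx_intertwine P OH) -mulmxA hv -scalemxAr.
rewrite (casimir_FE hw) mulr0 addr0 mulmxBl mul_scalar_mx mulmxBl -scalemxAl.
by rewrite [casimir V *m (_ *m _)]mulmxA.
Qed.

End Mod.

Definition theta_poly a : {poly C} :=
  \sum_(n < r) (tcoef r n a / b1 ^+ (2 * n)) *: \prod_(i < n) ('X - (wsum (a + 1 + 2 * i%:R))%:P).

Lemma theta_polyE V a v : weight_module r V -> wt (V := V) a v ->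
  theta r V *m v = pmx (casimir V) (theta_poly a) *m v.
Proof.
move=> wV hv; rewrite (theta_wt hr wV hv) pmx_sum mulmx_suml; apply: eq_bigr => n _.
rewrite pmxZ -scalemxAl -(casimir_FEn wV n hv) scalerA divfK //.
by rewrite expf_neq0 // qbr1_neq0.
Qed.

Lemma casimir_chev V : weight_module r V -> casimir (chev_mod V) = casimir V.
Proof.
move=> wV; apply: (eq_on_wt (weight_diag wV)) => a v hv.
have hv' : wt (V := chev_mod V) (- a) v by rewrite /wt /= mulNmx hv scaleNr.
have := casimir_FE (chev_mod_weight wV) hv'; rewrite /= (casimir_EF wV hv).
have -> : wsum (- a + 1) = wsum (a - 1) by rewrite -wsumN opprD opprK.
by move/addIr/esym.
Qed.

Lemma Vmod_basis_wt a (j : 'I_r) : wt (V := Vmod r a) (a + r%:R - 1 - 2 * j%:R) (delta_mx j 0).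
Proof.
rewrite /wt /=; apply/matrixP => k l; rewrite mul_diag_mx !mxE.
by case: (eqVneq k j) => [->|] //=; rewrite !mulr0.
Qed.

Lemma r_gt0 : (0 < r)%N. Proof. by case: r hr. Qed.

Definition hw_idx : 'I_r := Ordinal r_gt0.

Lemma Vmod_Fn a (j : 'I_r) : aF (Vmod r a) ^+ j *m delta_mx hw_idx 0 = delta_mx j 0 :> 'cV[C]_r.
Proof.
case: j => j; elim: j => [|j IH] jr.
  by rewrite expmx0 mul1mx; congr delta_mx; apply: val_inj.
rewrite expmxS -mulmxA; have := IH (ltnW jr) => /= ->.
by rewrite -colE; apply/colP => k; rewrite !mxE andbT.
Qed.

Lemma Vmod_hw a : aE (Vmod r a) *m (delta_mx hw_idx 0 : 'cV[C]_r) = 0.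
Proof. by rewrite -colE; apply/colP => k; rewrite !mxE mul0r. Qed.

Lemma Vmod_lw a (j : 'I_r) : j.+1 = r -> aF (Vmod r a) *m (delta_mx j 0 : 'cV[C]_r) = 0.
Proof. by move=> jr; rewrite -colE; apply/colP => k; rewrite !mxE jr ltn_eqF. Qed.

Lemma Vmod_wt0 a (v : 'cV[C]_r) : wt (V := Vmod r a) (a + r%:R - 1) v -> v = v hw_idx 0 *: delta_mx hw_idx 0.
Proof.
rewrite /wt => hv; apply/colP => k; have /colP/(_ k) := hv; rewrite mul_diag_mx !mxE.
case: (eqVneq k hw_idx) => [->|kn] /=; first by rewrite mulr1.
rewrite mulr0 => /eqP; rewrite -subr_eq0 -mulrBl mulf_eq0 => /orP[|/eqP //].
have -> : a + r%:R - 1 - 2 * k%:R - (a + r%:R - 1) = - (2 * k%:R) by ring.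
rewrite oppr_eq0 mulf_eq0 !pnatr_eq0 /=.
by move=> k0; case/negP: kn; apply/eqP/val_inj/eqP.
Qed.

(** V_alpha is generated by its highest weight vector, which spans its weight space. This holds
    whether or not V_alpha is simple. *)
Lemma Vmod_scalar a (D : 'M[C]_r) : ulinear (V := Vmod r a) (W := Vmod r a) D ->
  exists c, D = c%:M.
Proof.
move=> lD; have w0 := Vmod_basis_wt a hw_idx; rewrite mulr0 subr0 in w0.
have e0 := Vmod_wt0 (wt_ulinear lD w0).
set c := (D *m _) hw_idx 0 in e0; exists c.
apply: (eq_on_cols (unitmx1 _ _)) => j; rewrite col1 -(Vmod_Fn a j).
by rewrite (Xn_ulinear j _ lD).2 e0 -scalemxAr mul_scalar_mx.
Qed.

Lemma Vmod_theta a : theta r (Vmod r a) = (q (((r%:R - 1) ^+ 2 - a ^+ 2) / 2))%:M.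
Proof.
have wV := Vmod_weight hr a; have [c ec] := Vmod_scalar (theta_lin hr wV).
have w0 := Vmod_basis_wt a hw_idx; rewrite mulr0 subr0 in w0.
have := theta_hw hr wV w0 (Vmod_hw a); rewrite ec mul_scalar_mx => e.
congr (_%:M); move/colP/(_ hw_idx): e; rewrite !mxE !eqxx !mulr1 => ->.
by congr (q _); field.
Qed.

Lemma Vmod_casimir a : casimir (Vmod r a) = (- wsum a)%:M.
Proof.
have wV := Vmod_weight hr a; have [c ec] := Vmod_scalar (casimir_lin wV).
have w0 := Vmod_basis_wt a hw_idx; rewrite mulr0 subr0 in w0.
have := casimir_FE wV w0; rewrite (Vmod_hw a) mulmx0 scaler0 ec mul_scalar_mx => /esym/eqP.
rewrite -scalerBl scaler_eq0 => /orP[|/eqP/colP/(_ hw_idx)]; last first.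
  by rewrite !mxE !eqxx => /eqP; rewrite oner_eq0.
rewrite subr_eq0 => /eqP->; congr (_%:M).
by rewrite (_ : a + r%:R - 1 + 1 = a + r%:R) ?wsumDr //; ring.
Qed.

(** An endomorphism of the twisted module is one of V_alpha, hence scalar. Its value is read off at
    the lowest weight vector, a highest weight vector of weight r - 1 - alpha after the twist. *)
Lemma Vmod_theta_chev a : theta r (chev_mod (Vmod r a)) = theta r (Vmod r a).
Proof.
have wV := Vmod_weight hr a; have wV' := chev_mod_weight wV.
have lin : ulinear (V := Vmod r a) (W := Vmod r a) (theta r (chev_mod (Vmod r a))).
  have /ulinearP[hE hF hK hKi hH] := theta_lin hr wV'.
  apply/ulinearP; split => //; move: hH; rewrite /= mulmxN mulNmx; exact: oppr_inj.
have [c ec] := Vmod_scalar lin; rewrite ec Vmod_theta; congr (_%:M).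
have hl : (r.-1 < r)%N by case: r hr.
have w0 := Vmod_basis_wt a (Ordinal hl).
have w1 : wt (V := chev_mod (Vmod r a)) (r%:R - 1 - a) (delta_mx (Ordinal hl) 0).
  rewrite /wt [aH _]/(- aH (Vmod r a)) mulNmx w0 -scaleNr; congr (_ *: _).
  by rewrite /= (pred_r R hr); ring.
have hF : aF (Vmod r a) *m (delta_mx (Ordinal hl) 0 : 'cV[C]_r) = 0.
  by apply: Vmod_lw; rewrite /= prednK // r_gt0.
have := theta_hw hr wV' w1 hF; rewrite ec mul_scalar_mx => e.
move/colP/(_ (Ordinal hl)): e; rewrite !mxE !eqxx !mulr1 => ->.
by congr (q _); field.
Qed.

Definition nonint a := forall k : int, a <> k%:~R.

(** Both polynomials have degree below r, so agreement at r points suffices. The points come from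
    the modules V_alpha containing weight a at position j < r, where theta equals its Chevalley
    twist; they are distinct because a is not an integer. *)
Lemma theta_poly_nonint a : nonint a -> theta_poly a = theta_poly (- a).
Proof.
(* Basis vector j of V_alpha with alpha = [al j] has weight a, and the Casimir element acts on it by
   [x j]. *)
move=> na; pose al (j : nat) : C := a - (r%:R - 1) + 2 * j%:R.
pose x (j : nat) : C := - wsum (al j).
have b0 := qbr1_neq0 R hr.
have sz d : (size (theta_poly d) <= r)%N.
  apply: (leq_trans (size_sum _ _ _)); apply/bigmax_leqP => n _.
  apply: (leq_trans (size_scale_leq _ _)); rewrite size_prod_XsubC.
  have -> : size (index_enum 'I_n) = n by rewrite -[RHS]card_ord cardT enumT.
  exact: ltn_ord.
have ev (j : 'I_r) : (theta_poly a).[x j] = (theta_poly (- a)).[x j].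
  have wV := Vmod_weight hr (al j); have wV' := chev_mod_weight wV.
  have w0 := Vmod_basis_wt (al j) j.
  have ej : al j + r%:R - 1 - 2 * j%:R = a by rewrite /al; ring.
  rewrite ej in w0.
  have w1 : wt (V := chev_mod (Vmod r (al j))) (- a) (delta_mx j 0).
    by rewrite /wt [aH _]/(- aH (Vmod r (al j))) mulNmx w0 scaleNr.
  have e1 := theta_polyE wV w0; have e2 := theta_polyE wV' w1.
  rewrite Vmod_theta_chev e1 casimir_chev // in e2.
  have cs : casimir (Vmod r (al j)) *m (delta_mx j 0 : 'cV[C]_r) = x j *: delta_mx j 0.
    by rewrite Vmod_casimir mul_scalar_mx.
  move: e2; rewrite !(pmx_eigen _ cs) => /colP/(_ j).
  by rewrite !mxE !eqxx !mulr1.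
have xI : injective (fun j : 'I_r => x j).
  move=> j k /oppr_inj /qpow_inj_sum[|] /(qpow_eq1 hr)[m em].
    have {}em : (j%:R : C) - k%:R = m%:~R * r%:R.
      apply: (mulfI (_ : 2 != 0 :> C)); rewrite ?pnatr_eq0 //.
      have -> : 2 * (m%:~R * r%:R) = m%:~R * (2 * r%:R) :> C by ring.
      by rewrite -em /al; ring.
    have {}em : Posz j - Posz k = m * Posz r.
      by apply: (@intC_inj R); rewrite intrM intrB -!pmulrn.
    apply/val_inj/eqP; rewrite /= -eqz_nat -subr_eq0 em.
    have := ltn_ord j; have := ltn_ord k; move: em; case: (m =P 0) => [->|m0]; first by rewrite mul0r.
    nia.
  (* If [al j] and [al k] were opposite modulo 2r, a would be this integer. *)
  case: (na (m * Posz r + Posz r - 1 - Posz j - Posz k)).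
  rewrite !intrB intrD intrM -!pmulrn.
  apply: (mulfI (_ : 2 != 0 :> C)); rewrite ?pnatr_eq0 //.
  transitivity (al j + al k + 2 * (r%:R - 1 - j%:R - k%:R)); first by rewrite /al; ring.
  by rewrite em; ring.
apply/eqP; rewrite -subr_eq0; apply: contraT => pn0.
have := @max_poly_roots _ _ [seq x j | j : 'I_r] pn0.
rewrite map_inj_uniq ?enum_uniq // => h.
have {h} : (size [seq x j | j : 'I_r] < size (theta_poly a - theta_poly (- a))%R)%N.
  apply: h => //; apply/allP => _ /mapP[j _ ->].
  by rewrite rootE hornerD hornerN ev subrr.
rewrite size_map size_enum_ord ltnNge; case/negP.
by rewrite (leq_trans (size_polyD _ _)) // size_polyN geq_max !sz.
Qed.

(** At a fixed X, the difference is q^(-b^2/2) times a Laurent polynomial in q^b. It vanishes at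
    nonintegral b, hence everywhere. *)
Lemma theta_poly_sym a : theta_poly a = theta_poly (- a).
Proof.
pose T n (s z : C) (X : C) : C := (c_ n * (-1) ^+ n / b1 ^+ (2 * n) * q (- (n%:R ^+ 2 + n%:R))
   * (s ^+ r * z ^+ n)) * \prod_(i < n) (X - (q (1 + 2 * i%:R) * z^-1 + q (- (1 + 2 * i%:R)) * z)).
pose L (s z : C) (X : C) : C := \sum_(n < r) T n s z X.
have ev b X : (theta_poly b).[X] = q (- (b ^+ 2 / 2) - b) * L (q b) (q (- b)) X.
  rewrite /theta_poly horner_sum /L mulr_sumr; apply: eq_bigr => n _.
  rewrite hornerZ horner_prod mulrA; congr (_ * _).
    rewrite /tcoef !qpowX.
    transitivity (c_ n * (-1) ^+ n / b1 ^+ (2 * n) * (q (- (b ^+ 2 / 2) - b) * q (- (n%:R ^+ 2 + n%:R)) * (q (r%:R * b) * q (n%:R * - b)))); last by ring.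
    by rewrite -!qpowD mulrAC; congr (_ * q _); field.
  apply: eq_bigr => i _; rewrite hornerXsubC /wsum; congr (X - (_ + _)).
    by rewrite -qpowN opprK -qpowD; congr (q _); ring.
  by rewrite -qpowD; congr (q _); ring.
have Lq1 X : laurent (fun z => L z z^-1 X).
  apply: (@laurent_sum _ r (fun n z => T n z z^-1 X)) => n; apply: laurentM.
    apply: laurentM; first exact: laurentC.
    by apply: laurentM; apply: laurent_exp; [exact: laurentX | exact: laurentV].
  apply: (@laurent_prod _ n (fun i z => X - (q (1 + 2 * i%:R) * z^-1^-1 + q (- (1 + 2 * i%:R)) * z^-1))) => i.
  apply: laurentB; first exact: laurentC.
  apply: laurentD; apply: laurentM; try exact: laurentC; last exact: laurentV.
  by exists 0%N, 'X => z _; rewrite hornerX mul1r invrK.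
have Lq2 X : laurent (fun z => L z^-1 z X).
  apply: (@laurent_sum _ r (fun n z => T n z^-1 z X)) => n; apply: laurentM.
    apply: laurentM; first exact: laurentC.
    by apply: laurentM; apply: laurent_exp; [exact: laurentV | exact: laurentX].
  apply: (@laurent_prod _ n (fun i z => X - (q (1 + 2 * i%:R) * z^-1 + q (- (1 + 2 * i%:R)) * z))) => i.
  apply: laurentB; first exact: laurentC.
  by apply: laurentD; apply: laurentM; try exact: laurentC; [exact: laurentV | exact: laurentX].
(* The factor q^(-b^2/2), common to b and -b, is not a Laurent polynomial in q^b; f is the
   difference without it. *)
pose f X z := z^-1 * L z z^-1 X - z * L z^-1 z X.
have lf X : laurent (f X).
  by apply: laurentB; apply: laurentM => //; [exact: laurentV | exact: laurentX].
have fE b X : (theta_poly b).[X] - (theta_poly (- b)).[X] = q (- (b ^+ 2 / 2)) * f X (q b).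
  rewrite !ev opprK sqrrN /f -!qpowN !(opprK, qpowD).
  by ring.
(* These weights on the imaginary axis are nonintegral, and q is injective on them. *)
pose x (k : nat) : C := q (0 +i* k.+1%:R).
have xI : injective x.
  move=> k l e; have : q ((0 +i* k.+1%:R) - (0 +i* l.+1%:R)) = 1.
    by rewrite qpowD [q (_ +i* k.+1%:R)]e qpow_mulN.
  move=> /(qpow_eq1 hr)[m]; rewrite -(natrM _ 2 r) natC -(rmorph_int (real_complex R)).
  move=> /eqP; rewrite eq_complex /= => /andP[_ /eqP].
  rewrite mulr0 mul0r addr0 => /eqP; rewrite subr_eq0 eqr_nat eqSS => /eqP; by [].
have nx (k : nat) : nonint (0 +i* k.+1%:R).
  move=> m; rewrite -(rmorph_int (real_complex R)) => /eqP; rewrite eq_complex /= => /andP[_].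
  by rewrite pnatr_eq0.
apply/eqP; rewrite -subr_eq0; apply: contraT => pn0.
have := @max_poly_roots _ _ (mkseq (fun k => k%:R) (size (theta_poly a - theta_poly (- a)))) pn0.
rewrite size_mkseq ltnn mkseq_uniq; last by move=> k l /eqP; rewrite eqr_nat => /eqP.
move=> h; suff : false by []; apply: h => //; apply/allP => _ /mapP[k _ ->].
rewrite rootE hornerD hornerN fE.
suff -> : f k%:R (q a) = 0 by rewrite mulr0.
apply: (laurent_eq0 (lf _) xI) => [j|j|]; [exact: qpow_neq0 | | exact: qpow_neq0].
have := fE (0 +i* j.+1%:R) k%:R; rewrite (theta_poly_nonint (nx j)) subrr => /esym/eqP.
by rewrite mulf_eq0 (negPf (qpow_neq0 _ _)) => /eqP.
Qed.

Lemma theta_chev V : weight_module r V -> theta r (chev_mod V) = theta r V.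
Proof.
move=> wV; apply: (eq_on_wt (weight_diag wV)) => a v hv.
have hv' : wt (V := chev_mod V) (- a) v by rewrite /wt [aH _]/(- aH V) mulNmx hv scaleNr.
have e1 := theta_polyE (chev_mod_weight wV) hv'; have e2 := theta_polyE wV hv.
rewrite -theta_poly_sym in e1; rewrite casimir_chev in e1; last exact: wV.
change (theta r (chev_mod V) *m v = pmx (casimir V) (theta_poly a) *m v) in e1.
set y := theta r (chev_mod V) in e1 *; move: y e1 => y e1; rewrite e1; exact: esym e2.
Qed.

(** The signs and powers of q that the antipode brings to E^n and to F^n cancel in the product. *)
Lemma dual_En V n b (p : 'cV[C]_(udim V)) : weight_module r V -> wt (V := dual_mod V) b p ->
  aF (dual_mod V) ^+ n *m (aE (dual_mod V) ^+ n *m p) = (aF V ^+ n)^T *m ((aE V ^+ n)^T *m p).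
Proof.
move=> wV hp; have wD := dual_weight wV.
have h0 (x : 'cV[C]_(udim V)) : (aE V)^T *m x = - ((aK V)^T *m (aE (dual_mod V) *m x)).
  rewrite dual_E mulNmx mulmxN opprK trmx_mul !mulmxA -trmx_mul.
  by rewrite (rel_KiK (weight_relations wV)) trmx1 mul1mx.
have h0' (x : 'cV[C]_(udim V)) : aF (dual_mod V) *m x = - ((aF V)^T *m ((aK V)^T *m x)).
  by rewrite dual_F mulNmx trmx_mul -mulmxA.
have hE m : aE (dual_mod V) ^+ m *m p = ((-1) ^+ m * q (m%:R * b + m%:R * (m%:R + 1))) *: ((aE V ^+ m)^T *m p).
  elim: m => [|m IH]; first by rewrite !expmx0 trmx1 !mul0r addr0 qpow0 mulr1 scale1r.
  have h1 : (aE V)^T *m (aE (dual_mod V) ^+ m *m p) = - q (- (b + 2 * m.+1%:R)) *: (aE (dual_mod V) ^+ m.+1 *m p).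
    have hw := wtEn wD m.+1 hp; rewrite h0 [aE _ *m (_ *m p)]mulmxA -expmxS.
    by have := wtKi wD hw; rewrite [aKi _]/((aK V)^T) => ->; rewrite scaleNr.
  have -> : aE (dual_mod V) ^+ m.+1 *m p = - q (b + 2 * m.+1%:R) *: ((aE V)^T *m (aE (dual_mod V) ^+ m *m p)).
    by rewrite h1 scalerA mulrNN qpow_mulN scale1r.
  rewrite IH -scalemxAr scalerA expmxSr trmx_mul -mulmxA; congr (_ *: _).
  rewrite exprS mulN1r !mulNr mulrCA -qpowD; congr (- (_ * q _)); rewrite -natr1; ring.
have hF m c x : wt (V := dual_mod V) c x -> aF (dual_mod V) ^+ m *m x = ((-1) ^+ m * q (- (m%:R * c) + m%:R * (m%:R - 1))) *: ((aF V ^+ m)^T *m x).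
  move=> hx; elim: m => [|m IH]; first by rewrite !expmx0 trmx1 mul1mx !mul0r oppr0 addr0 qpow0 mulr1 scale1r.
  have hw := wtFn wD m hx.
  have h1 : aF (dual_mod V) *m (aF (dual_mod V) ^+ m *m x) = - q (- (c - 2 * m%:R)) *: ((aF V)^T *m (aF (dual_mod V) ^+ m *m x)).
    have := wtKi wD hw; rewrite [aKi _]/((aK V)^T) => e.
    by rewrite h0' e -scalemxAr scaleNr.
  rewrite expmxS -mulmxA h1 IH -scalemxAr scalerA expmxSr trmx_mul -mulmxA; congr (_ *: _).
  rewrite exprS mulN1r !mulNr mulrCA -qpowD; congr (- (_ * q _)); rewrite -natr1; ring.
have T m (c d : C) (A : 'M[C]_m) (x : 'cV[C]_m) : c *: (A *m (d *: x)) = (c * d) *: (A *m x).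
  by rewrite -scalemxAr scalerA.
rewrite (hF n _ _ (wtEn wD n hp)) hE [LHS]T.
rewrite mulrACA -exprMn mulrNN mulr1 expr1n mul1r -qpowD.
rewrite [X in q X](_ : _ = 0) ?qpow0 ?scale1r //; ring.
Qed.

(** Transposition turns F^n E^n into E^n F^n, the same expression for the Chevalley twist, under
    which theta is invariant. The coefficients agree because a vector of weight b of the dual
    vanishes on weights other than -b. *)
Lemma theta_dual V : weight_module r V -> theta r (dual_mod V) = (theta r V)^T.
Proof.
move=> wV; have wD := dual_weight wV; have wC := chev_mod_weight wV.
apply: (eq_on_wt (weight_diag wD)) => b p hp.
rewrite (theta_wt hr wD hp) -theta_chev //; apply: trmx_inj.
rewrite linear_sum trmx_mul trmxK /=; apply: (eq_on_wt (weight_diag wV)) => a v hv.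
have hv' : wt (V := chev_mod V) (- a) v by rewrite /wt [aH _]/(- aH V) mulNmx hv scaleNr.
rewrite -[RHS]mulmxA (theta_wt hr wC hv') mulmx_suml mulmx_sumr; apply: eq_bigr => n _.
have T m k (A B : 'M[C]_m) (x y : 'cV[C]_m) :
    (k *: (A^T *m (B^T *m x)))^T *m y = k *: (x^T *m (B *m (A *m y))).
  by rewrite linearZ /= !trmx_mul !trmxK -scalemxAl -!mulmxA.
rewrite (dual_En n wV hp) T -[RHS]scalemxAr.
have hy : wt (V := V) a (aE V ^+ n *m (aF V ^+ n *m v)).
  by have := wtEn wV n (wtFn wV n hv); rewrite subrK.
have [->//|nab] := eqVneq b (- a).
suff -> : p^T *m (aE V ^+ n *m (aF V ^+ n *m v)) = 0 by rewrite !scaler0.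
have pH : p^T *m aH V = - b *: p^T.
  move: hp; rewrite /wt dual_H mulNmx => /(congr1 trmx); rewrite linearN linearZ /= trmx_mul trmxK => e.
  by rewrite scaleNr -e opprK.
move: (congr1 (mulmx p^T) hy); rewrite [p^T *m (aH V *m _)]mulmxA pH -scalemxAl -scalemxAr => /eqP.
rewrite -subr_eq0 -scalerBl scaler_eq0 => /orP[|/eqP //].
by rewrite subr_eq0 eqr_oppLR (negPf nab).
Qed.

Lemma twist_dualE V : weight_module r V -> twist_mx r (dual_mod V) = (twist_mx r V)^T.
Proof. by move=> wV; rewrite /twist_mx theta_dual // trmx_inv. Qed.

End Casimir.

(** * The half twist *)

Section TwistValues.
Variables (R : realType) (r : nat).
Hypothesis hr : (2 <= r)%N.
Local Notation C := R[i].
Local Notation q := (@qpow R r).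
Implicit Types (a b : C) (m n k : int).

Definition hexp a : C := q ((a ^+ 2 - (r%:R - 1) ^+ 2) / 4).

(** An inadmissible parameter is an integer, and [xval] uses its representative modulo 2r in (-r,
    r). The choice matters, since [hexp] may change sign under translation by 2r. *)
Definition residue a m := exists2 k, a = m%:~R + k%:~R * (2 * r%:R) & (`|m| < r)%N.

(* The value of the half twist on the simple quotient of [Vmod r a]. *)
Definition xval a : C :=
  if `[< admissible r a >] then hexp a else hexp (xget 0 [set m | residue a m]%classic)%:~R.

Lemma hexpN a : hexp (- a) = hexp a. Proof. by rewrite /hexp sqrrN. Qed.

Lemma admissibleN a : admissible r (- a) <-> admissible r a.
Proof.
have H b : admissible r b -> admissible r (- b).
  case=> [h|[k ->]]; last by right; exists (- k); rewrite intrN mulNr.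
  by left=> -[k e]; apply: h; exists (- k); rewrite intrN -e opprK.
by split; [rewrite -{2}(opprK a)|]; apply: H.
Qed.

Lemma admissibleD2r a k : admissible r (a + k%:~R * (2 * r%:R)) <-> admissible r a.
Proof.
have H b l : admissible r b -> admissible r (b + l%:~R * (2 * r%:R)).
  case=> [h|[n ->]]; last first.
    by right; exists (n + l * 2); rewrite intrD intrM; ring.
  left=> -[n e]; apply: h; exists (n - l * (2 * Posz r)).
  by rewrite intrB !intrM -!pmulrn -e; ring.
split; last exact: H.
by move/(H _ (- k)); rewrite intrN mulNr addrK.
Qed.

Lemma nonadmissibleP a : ~ admissible r a -> exists m, residue a m.
Proof.
have rp := r_gt0 hr.
move=> na; have /contrapT[n en] : ~ ~ exists n, a = n%:~R by move=> h; apply: na; left.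
exists (((n + Posz r) %% (2 * Posz r))%Z - Posz r).
have d := divz_eq (n + Posz r) (2 * Posz r).
have l0 : (0 <= (n + Posz r) %% (2 * Posz r))%Z by apply: modz_ge0; lia.
have l1 : ((n + Posz r) %% (2 * Posz r) < 2 * Posz r)%Z by apply: ltz_pmod; lia.
move: d l0 l1; set u := ((n + Posz r) %% _)%Z; set w := ((n + Posz r) %/ _)%Z => d l0 l1.
exists w.
  rewrite en (_ : n = u - Posz r + w * (2 * Posz r)); last by rewrite addrAC [u + _]addrC -d addrK.
  by rewrite !intrD !intrM -!pmulrn.
have u0 : u <> 0.
  move=> u0; apply: na; right; exists (w * 2 - 1).
  rewrite en (_ : n = (w * 2 - 1) * Posz r) ?intrM -?pmulrn //.
  by move: d; rewrite u0 addr0; lia.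
lia.
Qed.

Lemma residue_uniq a m n : residue a m -> residue a n -> m = n.
Proof.
case=> k -> hm [l e hn].
have {e} : m + k * (2 * Posz r) = n + l * (2 * Posz r).
  by apply: (@intC_inj R); rewrite !intrD !intrM -!pmulrn.
case: (ltgtP k l) => [||->]; nia.
Qed.

Lemma xval_adm a : admissible r a -> xval a = hexp a.
Proof. by move=> h; rewrite /xval asboolT. Qed.

Lemma xval_non a m : ~ admissible r a -> residue a m -> xval a = hexp m%:~R.
Proof.
move=> h hm; rewrite /xval asboolF //; congr (hexp _%:~R).
by apply: xget_unique => // n hn; exact: residue_uniq hn hm.
Qed.

Lemma xvalN a : xval (- a) = xval a.
Proof.
have [h|h] := pselect (admissible r a).
  by rewrite !xval_adm ?hexpN //; apply/admissibleN.
have [m hm] := nonadmissibleP h; rewrite (xval_non h hm) (@xval_non _ (- m)) ?intrN ?hexpN //.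
  by move/admissibleN.
by case: hm => k -> hm; exists (- k); [rewrite !intrN; ring | lia].
Qed.

Lemma xvalD2r a k : ~ admissible r a -> xval (a + k%:~R * (2 * r%:R)) = xval a.
Proof.
move=> h; have [m hm] := nonadmissibleP h; rewrite (xval_non h hm) (@xval_non _ m) //.
  by move/admissibleD2r.
by case: hm => l -> hm; exists (l + k) => //; rewrite intrD; ring.
Qed.

Lemma xval_neq0 a : xval a != 0.
Proof. by rewrite /xval; case: ifP => _; apply: qpow_neq0. Qed.

Lemma hexp_sq a : hexp a ^+ 2 = q ((a ^+ 2 - (r%:R - 1) ^+ 2) / 2).
Proof. by rewrite qpowX; congr (q _); field. Qed.

Lemma xval_sq a : xval a ^+ 2 = q ((a ^+ 2 - (r%:R - 1) ^+ 2) / 2).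
Proof.
have [h|h] := pselect (admissible r a); first by rewrite xval_adm // hexp_sq.
have [m hm] := nonadmissibleP h; rewrite (xval_non h hm) hexp_sq.
case: hm => k -> _.
transitivity (q ((m%:~R ^+ 2 - (r%:R - 1) ^+ 2) / 2) * q ((k * m + k * k * Posz r)%:~R * (2 * r%:R))).
  by rewrite (qpow_2r R hr) mulr1.
by rewrite -qpowD; congr (q _); rewrite intrD !intrM -pmulrn; field.
Qed.

Lemma xval_conj (a : R) : (xval a%:C)^*%C = (xval a%:C)^-1.
Proof.
have H (b : R) : (hexp b%:C)^*%C = (hexp b%:C)^-1.
  rewrite /hexp (qpow_conj hr) -[RHS]qpowN; congr (q (- _)).
  have -> : (b%:C ^+ 2 - (r%:R - 1) ^+ 2) / 4 = ((b ^+ 2 - (r%:R - 1) ^+ 2) / 4)%:C :> C.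
    by rewrite rmorphM rmorphB !rmorphXn rmorphB /= rmorph_nat rmorph1 fmorphV rmorph_nat.
  exact: conjc_real.
have [h|h] := pselect (admissible r a%:C); first by rewrite xval_adm.
have [m hm] := nonadmissibleP h; rewrite (xval_non h hm).
by have := H m%:~R; rewrite rmorph_int.
Qed.

(** Equal Casimir values make the parameters equal or opposite modulo 2r. The first case forces i =
    j. The second makes them integers: [xval] is even, and periodic on inadmissible parameters,
    while an admissible one is a multiple of r and again i = j. *)
Lemma xval_congr a (i j : nat) : (i < r)%N -> (j < r)%N ->
  wsum r (a + 2 * i%:R) = wsum r (a + 2 * j%:R) -> xval (a + 2 * i%:R) = xval (a + 2 * j%:R).
Proof.
move=> ir jr /qpow_inj_sum[] /(qpow_eq1 hr)[k ek].
  suff -> : i = j by [].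
  have : Posz i - Posz j = k * Posz r.
    apply: (@intC_inj R); rewrite intrB intrM -!pmulrn; apply: (mulfI (_ : 2 != 0 :> C)).
      by rewrite pnatr_eq0.
    by transitivity (k%:~R * (2 * r%:R) : C); [rewrite -ek; ring | ring].
  by case: (ltgtP k 0) => [||->]; nia.
have ea : a + 2 * i%:R = (k * Posz r + Posz i - Posz j)%:~R.
  apply: (mulfI (_ : 2 != 0 :> C)); first by rewrite pnatr_eq0.
  rewrite intrB intrD intrM -!pmulrn; transitivity (k%:~R * (2 * r%:R) + 2 * (i%:R - j%:R) : C).
    by rewrite -ek; ring.
  by ring.
have eb : a + 2 * j%:R = - (a + 2 * i%:R) + k%:~R * (2 * r%:R) by rewrite -ek addKr.
have [[h|[l el]]|h] := pselect (admissible r (a + 2 * i%:R)).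
- by case: h; exists (k * Posz r + Posz i - Posz j).
- suff -> : i = j by [].
  move: el; rewrite ea => el; have {el} : k * Posz r + Posz i - Posz j = l * Posz r.
    by apply: (@intC_inj R); rewrite el intrM -pmulrn.
  by case: (ltgtP k l) => [||->]; nia.
by rewrite eb xvalD2r ?xvalN // => /admissibleN.
Qed.

End TwistValues.

(** * Interpolation modulo squares and generalized eigenspaces *)

Section Interpolation.
Variable F : fieldType.
Implicit Types (s : seq F) (p g : {poly F}).
Local Notation sq w := (('X - (w : F)%:P) ^+ 2).

Lemma coprime_sq_prod w s : w \notin s -> coprimep (sq w) (\prod_(x <- s) sq x).
Proof.
elim: s => [_|x s IH]; first by rewrite big_nil coprimep1.
rewrite inE negb_or big_cons => /andP[wx ws]; rewrite coprimepMr IH // andbT.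
by rewrite coprimep_expl // coprimep_expr // coprimep_XsubC2 // subr_eq0 eq_sym.
Qed.

(** Chinese remainders for coprime squares. Congruence modulo squares, stronger than prescribed
    values, makes [pmx A g] act as the scalar [c w] on every vector killed by (A - w)^2. *)
Lemma hermite_interp (c : F -> F) s : uniq s ->
  exists g, forall w, w \in s -> sq w %| g - (c w)%:P.
Proof.
elim: s => [_|w s IH /= /andP[ws us]]; first by exists 0.
have [g hg] := IH us; have /Bezout_eq1_coprimepP[[u1 u2] /= e] := coprime_sq_prod ws.
set P := \prod_(x <- s) _ in e.
exists (g + u2 * P * ((c w)%:P - g)) => x; rewrite inE => /orP[/eqP->|xs].
  have -> : g + u2 * P * ((c w)%:P - g) - (c w)%:P = (u1 * ((c w)%:P - g)) * - sq w.
    transitivity ((g - (c w)%:P) * (1 - u2 * P)); first by ring.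
    by rewrite -e; ring.
  by apply: dvdp_mull; rewrite dvdpNr.
rewrite addrAC dvdp_add ?hg // dvdp_mulr // dvdp_mull //.
by rewrite /P (big_rem x) //= dvdp_mulr.
Qed.

Lemma pmx_coprime0 n (A : 'M[F]_n) p g (v : 'cV_n) : coprimep p g ->
  pmx A p *m v = 0 -> pmx A g *m v = 0 -> v = 0.
Proof.
move=> /Bezout_eq1_coprimepP[[u1 u2] /= e] hp hg.
by rewrite -[v]mul1mx -(pmx1 A) -e pmxD !pmxM mulmxDl -!mulmxA hp hg !mulmx0 addr0.
Qed.

Lemma pmx_dvd0 n (A : 'M[F]_n) p g (v : 'cV_n) : p %| g -> pmx A p *m v = 0 -> pmx A g *m v = 0.
Proof. by move=> /dvdpP[u ->] hp; rewrite pmxM -mulmxA hp mulmx0. Qed.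

(* Generalized eigenspace decomposition of the cyclic submodule spanned by [v]. *)
Lemma pmx_split n m (A : 'M[F]_n) (D : 'M[F]_(m, n)) s (v : 'cV[F]_n) : uniq s ->
  pmx A (\prod_(w <- s) sq w) *m v = 0 ->
  (forall w p, w \in s -> pmx A (sq w) *m (pmx A p *m v) = 0 -> D *m (pmx A p *m v) = 0) ->
  D *m v = 0.
Proof.
suff H : uniq s -> forall p, pmx A (\prod_(w <- s) sq w) *m (pmx A p *m v) = 0 ->
    (forall w p, w \in s -> pmx A (sq w) *m (pmx A p *m v) = 0 -> D *m (pmx A p *m v) = 0) ->
    D *m (pmx A p *m v) = 0.
  by move=> us hv h; have := H us 1; rewrite pmx1 mul1mx; apply.
elim: s => [_ p|w s IH /= /andP[ws us] p]; first by rewrite big_nil pmx1 mul1mx => ->; rewrite mulmx0.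
rewrite big_cons => hp hD.
have /Bezout_eq1_coprimepP[[u1 u2] /= e] := coprime_sq_prod ws.
set P := \prod_(x <- s) _ in e hp.
have -> : pmx A p *m v = pmx A (u1 * sq w * p) *m v + pmx A (u2 * P * p) *m v.
  by rewrite -mulmxDl -pmxD -mulrDl e mul1r.
rewrite mulmxDr (IH us) ?add0r.
- apply: (hD w); first by rewrite mem_head.
  rewrite mulmxA -pmxM (_ : sq w * _ = u2 * (sq w * P * p)); last by ring.
  by rewrite pmxM -mulmxA [pmx A (_ * p)]pmxM -mulmxA hp mulmx0.
- rewrite mulmxA -pmxM (_ : _ * _ = u1 * (sq w * P * p)); last by rewrite /P; ring.
  by rewrite pmxM -mulmxA [pmx A (_ * p)]pmxM -mulmxA hp mulmx0.
by move=> x p' xs; apply: hD; rewrite inE xs orbT.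
Qed.

(** The hypothesis forbids three distinct indices with one value, so every root on the left has
    multiplicity at most two. *)
Lemma dvd_prod_sq n (w : nat -> F) :
  (forall i j k, (i < n)%N -> (j < n)%N -> (k < n)%N -> w i = w j -> w i = w k ->
     [|| i == j, i == k | j == k]) ->
  \prod_(i < n) ('X - (w i)%:P) %| \prod_(x <- undup (map w (iota 0 n))) sq x.
Proof.
move=> h; rewrite -(big_mkord xpredT (fun i => 'X - (w i)%:P)) /index_iota subn0.
rewrite -(big_map w xpredT (fun x => 'X - x%:P)) /=.
rewrite -big_undup_iterop_count /=.
apply: (big_ind2 (fun p g : {poly F} => p %| g)) => [|p1 g1 p2 g2 h1 h2|x _]; [exact: dvdpp | exact: dvdp_mul | ].
change (('X - x%:P) ^+ (count_mem x (map w (iota 0 n))) %| sq x).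
apply: dvdp_exp2l.
rewrite count_map -size_filter; set l := seq.filter _ _.
have : uniq l by rewrite filter_uniq // iota_uniq.
have : forall i, i \in l -> (i < n)%N /\ w i = x.
  by move=> i; rewrite mem_filter mem_iota /= => /andP[/eqP-> ->].
case: l => [|i [|j [|k l]]] //= hl /and3P[ij jk _].
have [i1 i2] := hl i (mem_head _ _).
have [j1 j2] : (j < n)%N /\ w j = x by apply: hl; rewrite !inE eqxx orbT.
have [k1 k2] : (k < n)%N /\ w k = x by apply: hl; rewrite !inE eqxx !orbT.
have := h i j k i1 j1 k1; rewrite i2 j2 k2 => /(_ erefl erefl).
by move: ij jk; rewrite !inE !negb_or => /and3P[/negPf-> /negPf-> _] /andP[/negPf-> _].
Qed.

End Interpolation.

Section HalfTwist.
Variables (R : realType) (r : nat).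
Hypothesis hr : (2 <= r)%N.
Local Notation C := R[i].
Local Notation sq w := (('X - (w : C)%:P) ^+ 2).
Implicit Types (V W : umod R) (a b : C) (i j k : nat).

(* A highest weight vector of weight [a + 2 * i] generates a quotient of
   [Vmod r (vpar a i)], on which the Casimir is [casval a i]. *)
Definition vpar a i : C := a - r%:R + 1 + 2 * i%:R.
Definition casval a i : C := wsum r (a + 1 + 2 * i%:R).

Lemma casvalE a i : casval a i = - wsum r (vpar a i).
Proof. by rewrite -(wsumDr hr); congr (wsum r _); rewrite /vpar; ring. Qed.

Lemma casval_xval a i j : (i < r)%N -> (j < r)%N -> casval a i = casval a j ->
  xval r (vpar a i) = xval r (vpar a j).
Proof. by move=> ir jr; rewrite !casvalE => /oppr_inj; apply: xval_congr. Qed.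

Lemma half_poly_ex a : exists g : {poly C}, forall i, (i < r)%N ->
  sq (casval a i) %| g - (xval r (vpar a i))%:P.
Proof.
pose s := map (casval a) (iota 0 r).
(* The value prescribed at w is that of the first index realizing w; [casval_xval] gives the same
   value for any other. *)
have [g hg] := hermite_interp (fun w => xval r (vpar a (index w s))) (undup_uniq s).
exists g => i ir; have ws : casval a i \in s by rewrite map_f // mem_iota.
have := hg (casval a i); rewrite mem_undup => /(_ ws).
have js : (index (casval a i) s < r)%N by move: ws; rewrite -index_mem size_map size_iota.
rewrite (@casval_xval a i (index (casval a i) s)) //.
by have := nth_index 0 ws; rewrite (nth_map 0%N) ?size_iota // nth_iota.
Qed.

Definition half_poly a : {poly C} := sval (cid (half_poly_ex a)).

Lemma half_polyP a i : (i < r)%N -> sq (casval a i) %| half_poly a - (xval r (vpar a i))%:P.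
Proof. by move: i; rewrite /half_poly; case: cid. Qed.

Lemma root_half_poly a i : (i < r)%N -> (half_poly a).[casval a i] = xval r (vpar a i).
Proof.
move=> /(half_polyP a) /dvdpP[u /(congr1 (horner^~ (casval a i)))].
rewrite hornerM horner_exp hornerXsubC subrr expr0n mulr0 hornerD hornerN hornerC => /eqP; by rewrite subr_eq0 => /eqP.
Qed.

(** For distinct i and j, equal values make a + 1 + 2i and a + 1 + 2j opposite modulo 2r, which
    determines j from i among the indices below r. *)
Lemma casval_mult a i j k : (i < r)%N -> (j < r)%N -> (k < r)%N ->
  casval a i = casval a j -> casval a i = casval a k -> [|| i == j, i == k | j == k].
Proof.
have H l m : (l < r)%N -> (m < r)%N -> casval a l = casval a m ->
    l == m \/ exists n : int, 2 * a + 2 + 2 * l%:R + 2 * m%:R = n%:~R * (2 * r%:R).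
  move=> lr mr /qpow_inj_sum[] /(qpow_eq1 hr)[n en]; last by right; exists n; rewrite -en; ring.
  left; have {en} : Posz l - Posz m = n * Posz r.
    apply: (@intC_inj R); rewrite intrB intrM -!pmulrn; apply: (mulfI (_ : 2 != 0 :> C)).
      by rewrite pnatr_eq0.
    by transitivity (n%:~R * (2 * r%:R) : C); [rewrite -en; ring | ring].
  by case: (ltgtP n 0) => [||->]; nia.
move=> ir jr kr /(H _ _ ir jr)[->//|[n en]] /(H _ _ ir kr)[->|[m em]]; rewrite ?orbT //.
suff -> : j = k by rewrite eqxx !orbT.
have : Posz j - Posz k = (n - m) * Posz r.
  apply: (@intC_inj R); rewrite intrM !intrB -!pmulrn; apply: (mulfI (_ : 2 != 0 :> C)).
    by rewrite pnatr_eq0.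
  by transitivity ((n%:~R - m%:~R) * (2 * r%:R) : C); [rewrite mulrBl -en -em; ring | ring].
by case: (ltgtP n m) => [||->]; nia.
Qed.

(** A coincidence would make b - r an integer strictly between consecutive multiples of r. For b = a
    + 1 this says that, when the parameter at index 0 is admissible, its Casimir value does not
    recur at a later index. *)
Lemma wsum_sep b i : (i.+1 < r)%N -> admissible r (b - r%:R) ->
  wsum r (b + 2 + 2 * i%:R) <> wsum r b.
Proof.
move=> ir hb /qpow_inj_sum[] /(qpow_eq1 hr)[k ek].
  have : Posz i + 1 = k * Posz r.
    apply: (@intC_inj R); rewrite intrD intrM -!pmulrn; apply: (mulfI (_ : 2 != 0 :> C)).
      by rewrite pnatr_eq0.
    by transitivity (k%:~R * (2 * r%:R) : C); [rewrite -ek; ring | ring].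
  by case: (ltgtP k 0) => [||->]; nia.
have e : b - r%:R = ((k - 1) * Posz r - 1 - Posz i)%:~R.
  rewrite !intrB intrM intrB -!pmulrn; apply: (mulfI (_ : 2 != 0 :> C)); first by rewrite pnatr_eq0.
  by transitivity (k%:~R * (2 * r%:R) - 2 * r%:R - 2 - 2 * i%:R : C); [rewrite -ek; ring | ring].
case: hb => [[]|[l el]]; first by eexists; exact: e.
have : (k - 1) * Posz r - 1 - Posz i = l * Posz r.
  by apply: (@intC_inj R); rewrite -e el intrM -pmulrn.
by case: (ltgtP (k - 1) l) => [||->]; nia.
Qed.

Lemma coprime_sq_range n (w : C) (f : nat -> C) : (forall i, (i < n)%N -> f i <> w) ->
  coprimep (sq w) (\prod_(i < n) ('X - (f i)%:P)).
Proof.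
move=> hf; rewrite coprimep_expl //; apply: (big_ind (fun p => coprimep _ p)) => [|p g hp hg|i _]; first exact: coprimep1.
  by rewrite coprimepMr hp.
by rewrite coprimep_XsubC2 // subr_eq0; apply/eqP/hf.
Qed.

Definition sig V : 'M[C]_(udim V) :=
  \sum_(a <- spectrum (aH V)) pmx (casimir r V) (half_poly a) *m specproj (aH V) a.

(* With [U = theta sig^2], this is [sig U^(-1/2)], the binomial series stopping
   because [U - 1] squares to zero. *)
Definition half V : 'M[C]_(udim V) := 2^-1 *: (sig V + twist_mx r V *m invmx (sig V)).

Section Mod.
Variable V : umod R.
Hypothesis wV : weight_module r V.
Let dV := weight_diag wV.

Lemma pmx_casimir_lin p : ulinear (pmx (casimir r V) p : 'M[C]_(udim V)).
Proof.
have /ulinearP[h1 h2 h3 h4 h5] := casimir_lin hr wV.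
apply/ulinearP; split; [exact: (pmx_intertwine p h1) | exact: (pmx_intertwine p h2)
  | exact: (pmx_intertwine p h3) | exact: (pmx_intertwine p h4) | exact: (pmx_intertwine p h5)].
Qed.

Lemma sig_wt a v : wt (V := V) a v -> sig V *m v = pmx (casimir r V) (half_poly a) *m v.
Proof.
move=> hv; have [->|v0] := eqVneq v 0; first by rewrite !mulmx0.
have ha := mem_spec hv v0; rewrite /sig mulmx_suml (bigD1_seq a) ?undup_uniq //=.
rewrite -mulmxA (specproj_weight hv ha v0) eqxx scale1r big1_seq ?addr0 // => b /andP[ba hb].
by rewrite -mulmxA (specproj_weight hv hb v0) (negPf ba) scale0r mulmx0.
Qed.

Lemma casimir_ann a v : wt (V := V) a v ->
  pmx (casimir r V) (\prod_(i < r) ('X - (casval a i)%:P)) *m v = 0.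
Proof. by move=> hv; rewrite -(casimir_FEn hr wV r hv) (rel_Er (weight_relations wV)) mul0mx mulmx0 scaler0. Qed.

(** By [casimir_ann] the product of the [X - casval a i] annihilates weight a. It divides the
    product of the squares over distinct values, so generalized eigenvectors of order two
    suffice. *)
Lemma gen_ind m (A B : 'M[C]_(m, udim V)) :
  (forall a i v, (i < r)%N -> wt (V := V) a v -> pmx (casimir r V) (sq (casval a i)) *m v = 0 ->
     A *m v = B *m v) -> A = B.
Proof.
move=> h; apply: (eq_on_wt dV) => a v hv; apply/eqP; rewrite -subr_eq0 -mulmxBl; apply/eqP.
apply: (@pmx_split _ _ _ (casimir r V) _ (undup (map (casval a) (iota 0 r)))); first exact: undup_uniq.
  apply: pmx_dvd0 (casimir_ann hv); apply: dvd_prod_sq; exact: casval_mult.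
move=> w p; rewrite mem_undup => /mapP[k]; rewrite mem_iota => /andP[_ kr] -> e.
rewrite mulmxBl (h a k) ?subrr //; exact: wt_ulinear (pmx_casimir_lin p) hv.
Qed.

Lemma sig_gen a i v : (i < r)%N -> wt (V := V) a v ->
  pmx (casimir r V) (sq (casval a i)) *m v = 0 -> sig V *m v = xval r (vpar a i) *: v.
Proof.
move=> ir hv hw; rewrite (sig_wt hv); apply/eqP; rewrite -subr_eq0 -mul_scalar_mx -(pmxC (casimir r V)).
by rewrite -mulmxBl -pmxB (pmx_dvd0 (half_polyP a ir) hw).
Qed.

Lemma casimir_EFn n a v : wt (V := V) a v ->
  qbr r 1 ^+ (2 * n) *: (aE V ^+ n *m (aF V ^+ n *m v)) =
  pmx (casimir r V) (\prod_(i < n) ('X - (wsum r (- a + 1 + 2 * i%:R))%:P)) *m v.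
Proof.
move=> hv; rewrite -(casimir_chev hr wV).
have hv' : wt (V := chev_mod V) (- a) v by rewrite /wt [aH _]/(- aH V) mulNmx hv scaleNr.
exact: (casimir_FEn hr (chev_mod_weight wV) n hv').
Qed.

Lemma gen_E a i v p : wt (V := V) a v -> pmx (casimir r V) p *m v = 0 ->
  pmx (casimir r V) p *m (aE V *m v) = 0.
Proof. by move=> hv hw; have /(_ (UE _)) /= e := pmx_casimir_lin p; rewrite mulmxA e -mulmxA hw mulmx0. Qed.

Lemma gen_F a i v p : wt (V := V) a v -> pmx (casimir r V) p *m v = 0 ->
  pmx (casimir r V) p *m (aF V *m v) = 0.
Proof. by move=> hv hw; have /(_ (UF _)) /= e := pmx_casimir_lin p; rewrite mulmxA e -mulmxA hw mulmx0. Qed.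

Lemma vparE a i : vpar (a + 2) i = vpar a i.+1.
Proof. by rewrite /vpar -natr1; ring. Qed.

Lemma casvalS a i : casval (a + 2) i = casval a i.+1.
Proof. by congr (wsum r _); rewrite -natr1; ring. Qed.

Lemma predrE : (r.-1%:R : C) = r%:R - 1.
Proof. by rewrite -[in RHS](prednK (r_gt0 hr)) -natr1 addrK. Qed.

Lemma vpar_last a : vpar (a + 2) r.-1 = vpar a 0 + 1%:~R * (2 * r%:R).
Proof. by rewrite /vpar predrE; ring. Qed.

Lemma casval_last a : casval (a + 2) r.-1 = casval a 0.
Proof.
rewrite /casval -[RHS]opprK -(wsumDr hr) -(wsumDr hr (_ + _)).
by congr (wsum r _); rewrite predrE; ring.
Qed.

(** E raises the weight by 2 and lowers the index by 1, leaving the parameter unchanged. Index 0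
    reappears as r - 1 with the parameter shifted by 2r: [xval] is unchanged if the parameter is
    inadmissible, and otherwise E v = 0. *)
Lemma sig_E : sig V *m aE V = aE V *m sig V.
Proof.
apply: gen_ind => a i v ir hv hw; rewrite -!mulmxA (sig_gen ir hv hw) -scalemxAr.
have hv' := wtE wV hv; have hw' := gen_E i hv hw.
case: i ir hw hw' => [|i] ir hw hw'; last first.
  by rewrite (@sig_gen (a + 2) i) ?vparE ?casvalS // ltnW.
have rl : (r.-1 < r)%N by rewrite ltn_predL r_gt0.
have [ha|ha] := pselect (admissible r (vpar a 0)); last first.
  by rewrite (@sig_gen (a + 2) r.-1) ?casval_last // vpar_last xvalD2r.
(* E^(r-1) kills E v, so r - 1 Casimir factors annihilate it. By admissibility they are coprime to
   the square at index 0, which annihilates E v as well. *)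
suff -> : aE V *m v = 0 by rewrite mulmx0 scaler0.
apply: (pmx_coprime0 (g := \prod_(i < r.-1) ('X - (wsum r (a + 2 + 1 + 2 * i%:R))%:P)) _ hw'); last first.
  rewrite -(casimir_FEn hr wV r.-1 hv') [_ *m (_ *m v)]mulmxA -expmxSr prednK ?r_gt0 //.
  by rewrite (rel_Er (weight_relations wV)) mul0mx mulmx0 scaler0.
apply: (coprime_sq_range (f := fun i => wsum r (a + 2 + 1 + 2 * i%:R))) => i ir' e.
apply: (@wsum_sep (a + 1) i); first by lia.
  by move: ha; rewrite /vpar mulr0 addr0 (addrAC a).
by rewrite (addrAC a) e /casval mulr0 addr0.
Qed.

(** The mirror image: index r - 1 wraps to 0, and the annihilating factors come from F^r = 0 through
    the Chevalley twist. *)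
Lemma sig_F : sig V *m aF V = aF V *m sig V.
Proof.
apply: gen_ind => a i v ir hv hw; rewrite -!mulmxA (sig_gen ir hv hw) -scalemxAr.
have hv' := wtF wV hv; have hw' := gen_F i hv hw.
have [ir'|ir'] := ltnP i.+1 r.
  by rewrite (@sig_gen (a - 2) i.+1) -?vparE -?casvalS ?subrK.
have {ir ir'} ei : i = r.-1 by lia.
rewrite {}ei in hw hw' *.
have := vpar_last (a - 2); have := casval_last (a - 2); rewrite subrK => ew ev.
have [ha|ha] := pselect (admissible r (vpar a r.-1)); last first.
  rewrite (@sig_gen (a - 2) 0) -?ew ?r_gt0 // ev xvalD2r //.
  by move: ha; rewrite ev => ha ha'; apply/ha/admissibleD2r.
suff -> : aF V *m v = 0 by rewrite mulmx0 scaler0.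
apply: (pmx_coprime0 (g := \prod_(i < r.-1) ('X - (wsum r (- (a - 2) + 1 + 2 * i%:R))%:P)) _ hw'); last first.
  rewrite -(casimir_EFn r.-1 hv') [_ *m (_ *m v)]mulmxA -expmxSr prednK ?r_gt0 //.
  by rewrite (rel_Fr (weight_relations wV)) mul0mx mulmx0 scaler0.
apply: (coprime_sq_range (f := fun i => wsum r (- (a - 2) + 1 + 2 * i%:R))) => j jr e.
apply: (@wsum_sep (1 - a) j); first by lia.
  apply/admissibleN; move: ha; rewrite /vpar predrE.
  by rewrite (_ : _ + _ = - (1 - a - r%:R)) //; ring.
have -> : 1 - a + 2 + 2 * j%:R = - (a - 2) + 1 + 2 * j%:R by ring.
by rewrite e ew /casval -wsumN; congr (wsum r _); ring.
Qed.

Lemma sig_lin : ulinear (sig V : 'M[C]_(udim V)).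
Proof.
apply/ulinearP; split; [exact: sig_E | exact: sig_F | | |]; apply: (eq_on_wt dV) => a v hv.
- by rewrite -!mulmxA (wtK wV hv) -scalemxAr (sig_wt hv) (wtK wV (wt_ulinear (pmx_casimir_lin _) hv)).
- by rewrite -!mulmxA (wtKi wV hv) -scalemxAr (sig_wt hv) (wtKi wV (wt_ulinear (pmx_casimir_lin _) hv)).
by rewrite -!mulmxA hv -scalemxAr (sig_wt hv) (wt_ulinear (pmx_casimir_lin _) hv).
Qed.

End Mod.
End HalfTwist.

Lemma pmx_row_eigen (F : fieldType) n (A : 'M[F]_n) c (v : 'rV_n) p :
  v *m A = c *: v -> v *m pmx A p = p.[c] *: v.
Proof.
move=> Av; elim/poly_ind: p => [|p d IH]; first by rewrite pmx0 mulmx0 horner0 scale0r.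
rewrite pmxD pmxM pmxC pmxX mulmxDr mulmxA IH -scalemxAl Av hornerMXaddC.
by rewrite mul_mx_scalar scalerA -scalerDl.
Qed.

Lemma invmx_nat (F : fieldType) m n (A : 'M[F]_n) (B : 'M[F]_m) (f : 'M[F]_(n, m)) :
  A \in unitmx -> B \in unitmx -> A *m f = f *m B -> invmx A *m f = f *m invmx B.
Proof.
move=> uA uB e; apply: (can_inj (mulKmx uA)); rewrite mulKVmx // mulmxA e -mulmxA.
by rewrite mulmxV // mulmx1.
Qed.

Lemma invmx_eigen (F : fieldType) n (A : 'M[F]_n) c (v : 'cV_n) :
  A \in unitmx -> c != 0 -> A *m v = c *: v -> invmx A *m v = c^-1 *: v.
Proof.
move=> uA c0 e; apply: (can_inj (mulKmx uA)).
by rewrite mulKVmx // -scalemxAr e scalerA mulVf // scale1r.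
Qed.

Lemma invmx_row_eigen (F : fieldType) n (A : 'M[F]_n) c (v : 'rV_n) :
  A \in unitmx -> c != 0 -> v *m A = c *: v -> v *m invmx A = c^-1 *: v.
Proof.
move=> uA c0 e; apply: (can_inj (mulmxK uA)).
by rewrite mulmxKV // -scalemxAl e scalerA mulVf // scale1r.
Qed.

Section HalfTwistProps.
Variables (R : realType) (r : nat).
Hypothesis hr : (2 <= r)%N.
Local Notation C := R[i].
Local Notation q := (@qpow R r).
Local Notation sq w := (('X - (w : C)%:P) ^+ 2).
Implicit Types (V W : umod R) (a b : C) (i j k : nat).
Local Notation sig := (sig hr).
Local Notation half := (half hr).

(** The pair (a, i) is realized by basis vector i of V_alpha with alpha = [vpar r a i], where theta
    and the Casimir element are known scalars. *)
Lemma theta_root a i : (i < r)%N ->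
  (theta_poly r a).[casval r a i] = (xval r (vpar r a i) ^+ 2)^-1.
Proof.
move=> ir; set b := vpar r a i; have wV := Vmod_weight hr b.
have hw := Vmod_basis_wt b (Ordinal ir); rewrite /= in hw.
have eb : b + r%:R - 1 - 2 * i%:R = a by rewrite /b /vpar; ring.
rewrite eb in hw; have := theta_polyE hr wV hw.
have cs : casimir r (Vmod r b) *m (delta_mx (Ordinal ir) 0 : 'cV[C]_r) = casval r a i *: delta_mx (Ordinal ir) 0.
  by rewrite (Vmod_casimir hr) mul_scalar_mx (casvalE hr).
rewrite (pmx_eigen _ cs) (Vmod_theta hr) mul_scalar_mx => /colP/(_ (Ordinal ir)).
rewrite !mxE !eqxx !mulr1 => <-; rewrite (xval_sq hr) -qpowN; congr (q _).
by field.
Qed.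

Lemma casimir_nat V W (f : 'M[C]_(udim W, udim V)) : ulinear f ->
  casimir r W *m f = f *m casimir r V.
Proof.
move/ulinearP=> [hE hF hK hKi _]; rewrite /casimir !mulmxDl !mulmxDr -!scalemxAl -!scalemxAr.
by rewrite hK hKi -mulmxA -hE mulmxA -hF -mulmxA.
Qed.

Lemma sig_nat V W (f : 'M[C]_(udim W, udim V)) : weight_module r V -> weight_module r W ->
  ulinear f -> sig W *m f = f *m sig V.
Proof.
move=> wV wW hf; apply: (eq_on_wt (weight_diag wV)) => a v hv.
rewrite -!mulmxA (sig_wt hr hv) (sig_wt hr (wt_ulinear hf hv)) !mulmxA.
by rewrite (pmx_intertwine _ (casimir_nat hf)).
Qed.

Section Mod.
Variable V : umod R.
Hypothesis wV : weight_module r V.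
Let dV := weight_diag wV.

Lemma casimir_hw a (v : 'cV[C]_(udim V)) : wt (V := V) a v -> aE V *m v = 0 ->
  casimir r V *m v = casval r a 0 *: v.
Proof.
move=> hv Ev; have := casimir_FE wV hv; rewrite Ev mulmx0 scaler0 => /esym/eqP.
by rewrite subr_eq0 /casval mulr0 addr0 => /eqP.
Qed.

Lemma sig_col a i (v : 'cV[C]_(udim V)) : (i < r)%N -> wt (V := V) a v ->
  casimir r V *m v = casval r a i *: v -> sig V *m v = xval r (vpar r a i) *: v.
Proof. by move=> ir hv cv; rewrite (sig_wt hr hv) (pmx_eigen _ cv) root_half_poly. Qed.

Lemma theta_col a i (v : 'cV[C]_(udim V)) : (i < r)%N -> wt (V := V) a v ->
  casimir r V *m v = casval r a i *: v -> theta r V *m v = (xval r (vpar r a i) ^+ 2)^-1 *: v.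
Proof. by move=> ir hv cv; rewrite (theta_polyE hr wV hv) (pmx_eigen _ cv) theta_root. Qed.

Lemma sig_unit : sig V \in unitmx.
Proof.
apply: (hw_unit wV (sig_lin hr wV)) => a v hv Ev v0.
rewrite (sig_col (r_gt0 hr) hv (casimir_hw hv Ev)) scaler_eq0 negb_or v0 andbT.
exact: xval_neq0.
Qed.

(** A left eigenvector of H vanishes on the weight spaces of all other eigenvalues. Row vectors are
    treated because adjoints and transposes are evaluated through them. *)
Lemma row_wt_sum a (u : 'rV[C]_(udim V)) (A : 'M[C]_(udim V)) c : u *m aH V = a *: u ->
  (forall v, wt (V := V) a v -> u *m (A *m v) = c *: (u *m v)) ->
  (forall b v, wt (V := V) b v -> wt (V := V) b (A *m v)) -> u *m A = c *: u.
Proof.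
have ker b v : u *m aH V = a *: u -> wt (V := V) b v -> b != a -> u *m v = 0.
  move=> hu hv ba; have : u *m (aH V *m v) = a *: (u *m v) by rewrite mulmxA hu -scalemxAl.
  rewrite hv -scalemxAr => /eqP; rewrite -subr_eq0 -scalerBl scaler_eq0 subr_eq0 (negPf ba) /=.
  by move/eqP.
move=> hu hA wA; apply: (eq_on_wt dV) => b v hv; rewrite -mulmxA -scalemxAl.
have [e|ba] := eqVneq b a; first by rewrite hA -?e.
by rewrite (ker b) ?(ker b v) ?scaler0 //; apply: wA.
Qed.

Lemma sig_row a i (u : 'rV[C]_(udim V)) : (i < r)%N -> u *m aH V = a *: u ->
  u *m casimir r V = casval r a i *: u -> u *m sig V = xval r (vpar r a i) *: u.
Proof.
move=> ir hu cu; apply: (row_wt_sum hu) => [v hv|b v hv]; last exact: wt_ulinear (sig_lin hr wV) hv.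
by rewrite (sig_wt hr hv) mulmxA (pmx_row_eigen _ cu) root_half_poly // scalemxAl.
Qed.

Lemma theta_row a i (u : 'rV[C]_(udim V)) : (i < r)%N -> u *m aH V = a *: u ->
  u *m casimir r V = casval r a i *: u -> u *m theta r V = (xval r (vpar r a i) ^+ 2)^-1 *: u.
Proof.
move=> ir hu cu; apply: (row_wt_sum hu) => [v hv|b v hv]; last exact: wt_ulinear (theta_lin hr wV) hv.
by rewrite (theta_polyE hr wV hv) mulmxA (pmx_row_eigen _ cu) theta_root // scalemxAl.
Qed.

Lemma half_col a i (v : 'cV[C]_(udim V)) : (i < r)%N -> wt (V := V) a v ->
  casimir r V *m v = casval r a i *: v -> half V *m v = xval r (vpar r a i) *: v.
Proof.
move=> ir hv cv; have x0 := xval_neq0 r (vpar r a i); have x1 : (xval r (vpar r a i) ^+ 2)^-1 != 0 by rewrite invr_eq0 expf_neq0.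
rewrite /half -scalemxAl mulmxDl (sig_col ir hv cv) -mulmxA (invmx_eigen sig_unit x0 (sig_col ir hv cv)).
rewrite -scalemxAr (invmx_eigen (theta_unit hr wV) x1 (theta_col ir hv cv)) scalerA -scalerDl scalerA.
by congr (_ *: _); field.
Qed.

Lemma half_row a i (u : 'rV[C]_(udim V)) : (i < r)%N -> u *m aH V = a *: u ->
  u *m casimir r V = casval r a i *: u -> u *m half V = xval r (vpar r a i) *: u.
Proof.
move=> ir hu cu; have x0 := xval_neq0 r (vpar r a i); have x1 : (xval r (vpar r a i) ^+ 2)^-1 != 0 by rewrite invr_eq0 expf_neq0.
rewrite /half -scalemxAr mulmxDr (sig_row ir hu cu) mulmxA (invmx_row_eigen (theta_unit hr wV) x1 (theta_row ir hu cu)).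
rewrite -scalemxAl (invmx_row_eigen sig_unit x0 (sig_row ir hu cu)) scalerA -scalerDl scalerA.
by congr (_ *: _); field.
Qed.

(** On a generalized eigenvector [sig] is the scalar [xval] and theta a polynomial in the Casimir.
    The difference is then a polynomial with a root at the eigenvalue, and its square is divisible
    by the square that annihilates the vector. *)
Lemma sig_theta_nilp : (theta r V *m sig V *m sig V - 1%:M) *m (theta r V *m sig V *m sig V - 1%:M) = 0.
Proof.
apply: (gen_ind hr wV) => a i v ir hv hw; rewrite mul0mx; set U := _ - _.
pose g := xval r (vpar r a i) ^+ 2 *: theta_poly r a - 1.
have hg : ('X - (casval r a i)%:P) %| g.
  rewrite dvdp_XsubCl rootE /g hornerD hornerN hornerZ theta_root // hornerC.
  by rewrite mulfV ?subrr // expf_neq0 // xval_neq0.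
have E w : wt (V := V) a w -> pmx (casimir r V) (sq (casval r a i)) *m w = 0 ->
    U *m w = pmx (casimir r V) g *m w.
  move=> hw1 hw2; rewrite /U mulmxBl mul1mx.
  have -> : theta r V *m sig V *m sig V *m w = xval r (vpar r a i) ^+ 2 *: (pmx (casimir r V) (theta_poly r a) *m w).
    rewrite -[_ *m sig V *m w]mulmxA (sig_gen hr ir hw1 hw2) -scalemxAr -[_ *m sig V *m w]mulmxA.
    by rewrite (sig_gen hr ir hw1 hw2) -scalemxAr scalerA -(theta_polyE hr wV hw1).
  by rewrite /g pmxB pmxZ pmx1 mulmxBl mul1mx -scalemxAl.
rewrite -mulmxA (E v) // (E (_ *m _)).
- have hg2 : sq (casval r a i) %| g * g by rewrite -expr2 dvdp_exp2r.
  by rewrite mulmxA -pmxM; exact: pmx_dvd0 hg2 hw.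
- exact: wt_ulinear (pmx_casimir_lin hr wV _) hv.
by rewrite mulmxA -pmxM mulrC pmxM -mulmxA hw mulmx0.
Qed.

Lemma half_sq : half V *m half V = twist_mx r V.
Proof.
have uS := sig_unit; have uT := theta_unit hr wV; have N2 := sig_theta_nilp.
have cS := twist_nat hr wV wV (sig_lin hr wV).
have cSi := invmx_nat uS uS (erefl (sig V *m sig V)).
have cST : invmx (sig V) *m twist_mx r V = twist_mx r V *m invmx (sig V).
  by apply: invmx_nat.
have tT : theta r V *m twist_mx r V = 1%:M by apply: mulmxV.
have Tt : twist_mx r V *m theta r V = 1%:M by apply: mulVmx.
have cSt := theta_nat hr wV wV (sig_lin hr wV).
rewrite /half; move: N2 cS cST tT Tt cSt.
set S := sig V; set T := twist_mx r V; set th := theta r V; set Si := invmx S.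
have SSi : S *m Si = 1%:M by apply: mulmxV.
have SiS : Si *m S = 1%:M by apply: mulVmx.
clearbody S T th Si => N2 cS cST tT Tt cSt.
(* Since S = A U and (U - 1)^2 = 0, also (U + 1)^2 = 4 U, whence (S + A)^2 = A (U + 1)^2 A = 4 S
   A. *)
set U := th *m S *m S in N2; set A := T *m Si.
have AU : A *m U = S.
  by rewrite /A /U cSt -[S *m th *m S]mulmxA cSt -!mulmxA (mulmxA Si S) SiS mul1mx -cSt mulmxA Tt mul1mx.
have UA : U *m A = S.
  rewrite /A /U -cST -!mulmxA (mulmxA S Si) SSi mul1mx -cS mulmxA tT.
  by rewrite mul1mx.
have -> : S + A = A *m (U + 1%:M) by rewrite mulmxDr AU mulmx1.
have E : A *m (U + 1%:M) = (U + 1%:M) *m A by rewrite mulmxDr mulmxDl AU UA mulmx1 mul1mx.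
have E2 : (U + 1%:M) *m (U + 1%:M) = 4 *: U.
  transitivity ((U - 1%:M) *m (U - 1%:M) + 4 *: U); last by rewrite N2 add0r.
  rewrite !mulmxDl !mulmxDr !mulNmx !mulmxN !mulmx1 !mul1mx.
  by apply/matrixP => x y; rewrite !mxE; ring.
rewrite -scalemxAl -scalemxAr scalerA {2}E mulmxA -[A *m _ *m _]mulmxA E2 -scalemxAr AU -scalemxAl.
rewrite scalerA /A mulmxA -cS -mulmxA SSi mulmx1 -[RHS]scale1r; congr (_ *: _).
by field.
Qed.

Lemma half_lin : ulinear (half V : 'M[C]_(udim V)).
Proof.
apply: ulinearZ; apply: ulinearD; first exact: (sig_lin hr wV).
apply: ulinear_mul; first exact: twist_lin.
exact: ulinear_invmx (sig_lin hr wV) sig_unit.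
Qed.

Lemma half_unit : half V \in unitmx.
Proof.
have : half V *m half V \in unitmx by rewrite half_sq; exact: twist_unit.
by rewrite unitmx_mul andbb.
Qed.

Lemma half_hw a (v : 'cV[C]_(udim V)) : wt (V := V) a v -> aE V *m v = 0 ->
  half V *m v = xval r (vpar r a 0) *: v.
Proof. by move=> hv Ev; apply: (half_col (r_gt0 hr) hv); apply: casimir_hw. Qed.

End Mod.

Lemma half_nat V W (f : 'M[C]_(udim W, udim V)) : weight_module r V -> weight_module r W ->
  ulinear f -> half W *m f = f *m half V.
Proof.
move=> wV wW hf; rewrite /half -scalemxAl -scalemxAr mulmxDl mulmxDr (sig_nat wV wW hf).
rewrite -[_ *m _ *m f]mulmxA (invmx_nat (sig_unit wW) (sig_unit wV) (sig_nat wV wW hf)).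
by rewrite !mulmxA (twist_nat hr wV wW hf).
Qed.

End HalfTwistProps.

(** * Quotients of the modules V_alpha *)

Section SimpleQuotients.
Variables (R : realType) (r : nat).
Hypothesis hr : (2 <= r)%N.
Local Notation C := R[i].
Local Notation q := (@qpow R r).
Implicit Types (V W : umod R) (a b : C) (i j k : nat).

Definition hwmap V (v : 'cV[C]_(udim V)) : 'M[C]_(udim V, r) := \matrix_(i, j) (aF V ^+ j *m v) i 0.

Lemma hwmapE V v (j : 'I_r) : @hwmap V v *m delta_mx j 0 = aF V ^+ j *m v.
Proof. by rewrite -colE; apply/colP => k; rewrite !mxE. Qed.

(** V_alpha is universal for highest weight vectors of weight alpha + r - 1: [EFn] dictates the
    action of E on the F^j v, and F^r = 0 on both sides. *)
Lemma hwmap_lin V a v : weight_module r V -> wt (V := V) (a + r%:R - 1) v -> aE V *m v = 0 ->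
  ulinear (V := Vmod r a) (hwmap v).
Proof.
move=> wV hv Ev; have wA := Vmod_weight hr a; have w0 := Vmod_basis_wt a (hw_idx hr).
rewrite mulr0 subr0 in w0.
have hF n : hwmap v *m (aF (Vmod r a) ^+ n *m delta_mx (hw_idx hr) 0) = aF V ^+ n *m v.
  have [nr|nr] := ltnP n r; last by rewrite (Fn0 wA _ nr) (Fn0 wV _ nr) mulmx0.
  by rewrite (Vmod_Fn hr a (Ordinal nr)) hwmapE.
apply/ulinearP; split; apply: (eq_on_cols (unitmx1 _ _)) => j; rewrite col1 -!mulmxA -(Vmod_Fn hr a j) hF.
- case: j => -[|j] jr /=; first by rewrite !expmx0 !mul1mx (Vmod_hw hr) mulmx0 Ev.
  by rewrite (EFn hr wA _ w0) (EFn hr wV _ hv) (Vmod_hw hr) Ev !mulmx0 !add0r -scalemxAr hF.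
- by have := hF j.+1; rewrite !expmxS -!mulmxA.
- by rewrite (wtK wA (wtFn wA j w0)) (wtK wV (wtFn wV j hv)) -scalemxAr hF.
- by rewrite (wtKi wA (wtFn wA j w0)) (wtKi wV (wtFn wV j hv)) -scalemxAr hF.
by rewrite (wtFn wA j w0) (wtFn wV j hv) -scalemxAr hF.
Qed.

Lemma surj_row_free m n (p : 'M[C]_(m, n)) :
  (forall j : 'I_m, exists w : 'cV_n, p *m w = delta_mx j 0) -> row_free p.
Proof.
move=> h; have [f hf] := choice h; apply/row_freeP; exists (\matrix_(i, j) f j i 0).
apply: (eq_on_cols (unitmx1 _ _)) => j; rewrite !col1 -mulmxA mul1mx -[RHS]hf; congr (_ *m _).
by rewrite -colE; apply/colP => k; rewrite !mxE.
Qed.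

(** The solution alpha of alpha + r - 1 = i + k r, so that V_alpha has the highest weight of S_i (x)
    C^H_{kr}. *)
Definition simple_par i (k : int) : C := i%:R + k%:~R * r%:R - r%:R + 1.

Lemma simple_quot i (k : int) : (i.+2 <= r)%N ->
  exists p : 'M[C]_(udim (tens (Smod R r i) (Cmod R r k)), r),
    ulinear (V := Vmod r (simple_par i k)) p /\ row_free p.
Proof.
move=> ir; have wS := Smod_weight R hr ir; have wC := Cmod_weight R hr k.
have wT := tens_weight hr wS wC.
pose s0 : 'cV[C]_(i.+1) := delta_mx ord0 0; pose c0 : 'cV[C]_1 := delta_mx 0 0.
have hs : wt (V := Smod R r i) i%:R s0.
  by apply/colP => j; rewrite mul_diag_mx !mxE; case: eqP => [->|]; rewrite ?mulr0 // subr0.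
have hc : wt (V := Cmod R r k) (k%:~R * r%:R) c0 by rewrite /wt mul_scalar_mx.
have hF j (jr : (j < i.+1)%N) : aF (Smod R r i) ^+ j *m s0 = delta_mx (Ordinal jr) 0.
  elim: j jr => [|j IH] jr; first by rewrite expmx0 mul1mx; congr delta_mx; apply: val_inj.
  rewrite expmxS -mulmxA (IH (ltnW jr)) -colE; apply/colP => l; rewrite !mxE andbT.
  by rewrite -val_eqE.
have hFt j : aF (tens (Smod R r i) (Cmod R r k)) ^+ j *m tensv s0 c0 = tensv (aF (Smod R r i) ^+ j *m s0) c0.
  elim: j => [|j IH]; first by rewrite !expmx0 !mul1mx.
  by rewrite [in LHS]expmxS -mulmxA IH tens_F [aF (Cmod _ _ _) *m _]mul0mx tensv0r add0r expmxS mulmxA.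
have hv := wt_tensv hs hc.
exists (hwmap (V := tens (Smod R r i) (Cmod R r k)) (tensv s0 c0)); split.
  apply: hwmap_lin => //; first by rewrite /simple_par (_ : _ + _ - 1 = i%:R + k%:~R * r%:R) //; ring.
  rewrite tens_E [aE (Cmod _ _ _) *m _]mul0mx tensv0r add0r.
  suff -> : aE (Smod R r i) *m s0 = 0 by rewrite tensv0l.
  by rewrite -colE; apply/colP => l; rewrite !mxE mul0r.
apply: surj_row_free => l; rewrite -(mxtens_unindexK l).
case: (mxtens_unindex l) => j z; rewrite -tensv_delta; have -> : z = 0 by apply: ord1.
have jr : (j < r)%N by rewrite (leq_trans (ltn_ord j)) // ltnW.
exists (delta_mx (Ordinal jr) 0); rewrite hwmapE hFt /= (hF j (ltn_ord j)).
by congr (tensv (delta_mx _ _) _); apply: val_inj.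
Qed.

Lemma simple_par_non i (k : int) : (i.+2 <= r)%N -> ~ admissible r (simple_par i k).
Proof.
move=> ir; have e : simple_par i k = (Posz i + 1 + (k - 1) * Posz r)%:~R.
  by rewrite /simple_par !intrD intrM intrB -!pmulrn; ring.
case=> [[]|[l]]; first by exists (Posz i + 1 + (k - 1) * Posz r).
rewrite e [r%:R]pmulrn -intrM => /intC_inj.
by case: (ltgtP (k - 1) l) => [||->]; nia.
Qed.

(** For k even the representative modulo 2r is i + 1 - r, for k odd it is i + 1 = r - 1 - j with j =
    r - 2 - i; this is the origin of the two prescribed values. *)
Lemma simple_par_even i (k : int) : (i.+2 <= r)%N -> (2 %| k)%Z ->
  xval r (simple_par i k) = q (i%:R * (i%:R + 2 - 2 * r%:R) / 4).
Proof.
move=> ir /dvdzP[l ek]; rewrite (@xval_non _ _ hr _ (Posz i + 1 - Posz r)).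
- by rewrite /hexp intrB intrD -!pmulrn; congr (q _); field.
- exact: simple_par_non.
exists l; last by lia.
by rewrite /simple_par ek !intrB intrD intrM -!pmulrn; ring.
Qed.

Lemma simple_par_odd i (k : int) : (i.+2 <= r)%N -> ~~ (2 %| k)%Z ->
  xval r (simple_par i k) = q ((r - 2 - i)%:R * ((r - 2 - i)%:R + 2 - 2 * r%:R) / 4).
Proof.
move=> ir hk; have [l ek] : exists l : int, k = 1 + 2 * l.
  by exists ((k - 1) %/ 2)%Z; lia.
rewrite (@xval_non _ _ hr _ (Posz i + 1)).
- by rewrite /hexp intrD -!pmulrn -subnDA natrB // natrD; congr (q _); field.
- exact: simple_par_non.
exists l; last by lia.
by rewrite /simple_par ek !intrD intrM -!pmulrn; ring.
Qed.

Lemma twist_value_quot X c : half_twist_value r X c ->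
  exists a (p : 'M[C]_(udim X, r)), [/\ weight_module r X, udim X <> 0%N, c = xval r a,
    ulinear (V := Vmod r a) p & row_free p].
Proof.
have rn : r <> 0%N by case: r hr.
case=> [a ha|i k ir hk|i j k ir hk ->].
- exists a, 1%:M; split=> //; [exact: Vmod_weight | by rewrite xval_adm | exact: ulinear1 |].
  by rewrite row_free_unit unitmx1.
- have [p [h1 h2]] := simple_quot k ir; exists (simple_par i k), p; split=> //.
    by apply: tens_weight => //; [exact: Smod_weight | exact: Cmod_weight].
  by rewrite simple_par_even.
have [p [h1 h2]] := simple_quot k ir; exists (simple_par i k), p; split=> //.
  by apply: tens_weight => //; [exact: Smod_weight | exact: Cmod_weight].
by rewrite simple_par_odd.
Qed.

Lemma Vmod_quot a : exists X (p : 'M[C]_(udim X, r)),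
  [/\ half_twist_value r X (xval r a), ulinear (V := Vmod r a) p & row_free p].
Proof.
have [ha|ha] := pselect (admissible r a).
  exists (Vmod r a), 1%:M; split; [by rewrite xval_adm //; constructor | exact: ulinear1 |].
  by rewrite row_free_unit unitmx1.
have [m [k ea hm]] := nonadmissibleP hr ha.
have m0 : m <> 0.
  by move=> m0; apply: ha; right; exists (2 * k); rewrite ea m0 intrM; ring.
(* A negative residue m is i + 1 - r with l even, a positive one is i + 1 with l odd; residue 0 is
   admissible. *)
have [i [l [ir el]]] : exists i (l : int), (i.+2 <= r)%N /\ a = simple_par i l.
  have [hm'|hm'] := ltP m 0.
    exists (absz (m + Posz r - 1)%R), (2 * k); split; first by lia.
    rewrite /simple_par pmulrn (_ : Posz _ = m + Posz r - 1); last by lia.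
    by rewrite ea intrB !intrD intrM -!pmulrn; ring.
  exists (absz (m - 1)%R), (1 + 2 * k); split; first by lia.
  rewrite /simple_par pmulrn (_ : Posz _ = m - 1); last by lia.
  by rewrite ea intrB intrD intrM -!pmulrn; ring.
have [p [h1 h2]] := simple_quot l ir; exists (tens (Smod R r i) (Cmod R r l)), p.
rewrite el; split=> //; have [hl|hl] := boolP (2 %| l)%Z.
  by rewrite simple_par_even //; constructor.
by rewrite simple_par_odd //; constructor.
Qed.

End SimpleQuotients.

Global Opaque sig half.

Lemma eigenvalue_unit (F : fieldType) n (A : 'M[F]_n) c : eigenvalue A c = (A - c%:M \notin unitmx).
Proof. by rewrite /eigenvalue /eigenspace kermx_eq0 row_free_unit. Qed.

Lemma eigenvalue_col (F : fieldType) n (A : 'M[F]_n) c :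
  reflect (exists2 v : 'cV_n, v != 0 & A *m v = c *: v) (eigenvalue A c).
Proof.
rewrite eigenvalue_unit; apply: (iffP idP) => [/nonunit_ker[v v0 /eqP]|[v v0 e]].
  by rewrite mulmxBl mul_scalar_mx subr_eq0 => /eqP; exists v.
apply/negP => u; case/eqP: v0; apply: (can_inj (mulKmx u)).
by rewrite mulmx0 mulmxBl mul_scalar_mx e subrr.
Qed.

Lemma scalar1_eq0 (F : fieldType) n : (1%:M : 'M[F]_n) = 0 -> n = 0%N.
Proof. by case: n => // n /matrixP/(_ ord0 ord0)/eqP; rewrite !mxE oner_eq0. Qed.

(** * Existence and uniqueness of the half twist *)

Section Unique.
Variables (R : realType) (r : nat).
Hypothesis hr : (2 <= r)%N.
Local Notation C := R[i].
Implicit Types (V W X : umod R) (a b c : C).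
Local Notation half := (half hr).

Lemma half_Vmod a : half (Vmod r a) = (xval r a)%:M.
Proof.
have wA := Vmod_weight hr a; have [c ec] := Vmod_scalar hr (half_lin hr wA).
have w0 := Vmod_basis_wt a (hw_idx hr); rewrite mulr0 subr0 in w0.
have := half_hw hr wA w0 (Vmod_hw hr a); rewrite ec mul_scalar_mx => /colP/(_ (hw_idx hr)).
rewrite !mxE !eqxx !mulr1 => ->; congr (xval r _)%:M.
by rewrite /vpar; ring.
Qed.

Lemma half_simple X c : half_twist_value r X c ->
  [/\ weight_module r X, udim X <> 0%N & half X = c%:M].
Proof.
move=> /(twist_value_quot hr)[a [p [wX X0 -> lp fp]]]; split=> //.
apply: (row_free_inj fp); rewrite (half_nat hr (Vmod_weight hr a) wX lp) half_Vmod.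
by rewrite mul_mx_scalar mul_scalar_mx.
Qed.

(** [half] is the scalar c on X, so [half - c] is not invertible on the module W mapping onto X; an
    eigenvector found in W stays nonzero in V. *)
Lemma half_factor V X c : weight_module r V -> half_twist_value r X c -> composition_factor r X V ->
  eigenvalue (half V) c.
Proof.
move=> wV /half_simple[wX X0 eX] [W [f [p [wW [lf ff] [lp fp]]]]].
have e := half_nat hr wW wX lp; rewrite eX mul_scalar_mx in e.
have : half W - c%:M \notin unitmx.
  apply/negP => u; have : p *m (half W - c%:M) = 0 by rewrite mulmxBr -e mul_mx_scalar subrr.
  move/(congr1 (mulmx^~ (invmx (half W - c%:M)))); rewrite mulmxK // mul0mx => p0.
  by move: fp; rewrite p0 -row_leq_rank mxrank0 leqn0 => /eqP.
rewrite -eigenvalue_unit => /eigenvalue_col[w w0 hw].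
apply/eigenvalue_col; exists (f *m w); last by rewrite mulmxA (half_nat hr wW wV lf) -mulmxA hw -scalemxAr.
apply: contraNneq w0 => fw; rewrite -trmx_eq0; apply/eqP/(row_free_inj ff).
by rewrite mul0mx -trmx_mul fw trmx0.
Qed.

(** The images of e and 1 - e form a decomposition into two summands, one of which must be zero. *)
Lemma indecomposable_idem V (e : 'M[C]_(udim V)) : indecomposable r V -> ulinear e ->
  e *m e = e -> e = 0 \/ e = 1%:M.
Proof.
move=> [wV V0 hV] le ee; pose e' := 1%:M - e.
have e'e' : e' *m e' = e' by rewrite /e' mulmxBl mul1mx !mulmxBr mulmx1 ee subrr subr0.
have le' : ulinear (e' : 'M[C]_(udim V)) by apply: ulinearB => //; exact: ulinear1.
have ee' : e *m e' = 0 by rewrite mulmxBr mulmx1 ee subrr.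
have e'e : e' *m e = 0 by rewrite mulmxBl mul1mx ee subrr.
pose E (k : 'I_2) := if k == ord0 then e else e'.
have EE k : E k *m E k = E k by rewrite /E; case: ifP.
have lE k : ulinear (E k) by rewrite /E; case: ifP.
have En k l : k != l -> E k *m E l = 0.
  by rewrite /E -!val_eqE; case: k l => -[|[|//]] p [[|[|//]] s].
pose T := {k : nat & ('M[C]_(udim V, k) * 'M[C]_(k, udim V))%type}.
have ex k : exists t : T, (projT2 t).2 *m (projT2 t).1 = 1%:M /\ (projT2 t).1 *m (projT2 t).2 = E k.
  by have [d [i [p h]]] := idempotent_split (EE k); exists (existT _ d (i, p)).
have {ex} [f hf] := choice ex.
pose X k := sub_mod (projT2 (f k)).1 (projT2 (f k)).2.
have lX k : ulinear ((projT2 (f k)).1 *m (projT2 (f k)).2) by rewrite (hf k).2.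
have sX : direct_sum X V.
  exists (fun k => (projT2 (f k)).1), (fun k => (projT2 (f k)).2); split=> [k|k|k l kl|].
  - exact: sub_mod_lin (hf k).1 (lX k).
  - exact: (hf k).1.
  - rewrite -[LHS]mulmx1 -(hf l).1 -[LHS]mul1mx -(hf k).1 !mulmxA -[_ *m (projT2 (f k)).1 *m _]mulmxA.
    rewrite (hf k).2 -[_ *m (projT2 (f l)).1 *m _]mulmxA (hf l).2 -[_ *m E k *m _]mulmxA (En k l) //.
    by rewrite mulmx0 mul0mx.
  rewrite (eq_bigr E) => [|k _]; last exact: (hf k).2.
  by rewrite big_ord_recl big_ord1 /E /= /e' addrC subrK.
have [k k0] := hV X (fun k => sub_mod_weight (hf k).1 (lX k) wV) sX.
have : E k = 0.
  rewrite -(hf k).2; move: (projT2 (f k)).1 (projT2 (f k)).2; rewrite /= in k0.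
  by rewrite k0 => M N; rewrite [M]thinmx0 mul0mx.
rewrite /E; case: ifP => _ h; [by left | right].
by apply/eqP; rewrite eq_sym -subr_eq0; apply/eqP.
Qed.

(** The projector onto the generalized eigenspace of c along the others is a polynomial in A, hence
    a linear idempotent; a second eigenvalue would make it neither 0 nor 1. *)
Lemma indecomposable_eigen V (A : 'M[C]_(udim V)) a c : indecomposable r V -> ulinear A ->
  eigenvalue A a -> eigenvalue A c -> a = c.
Proof.
move=> iV lA ha hc; apply/eqP; apply: contraT => ac.
have ch0 : char_poly A != 0 by apply: monic_neq0; exact: char_poly_monic.
have [k [h]] := multiplicity_XsubC (char_poly A) c.
rewrite ch0 /= => hch ech.
have cop : coprimep (('X - c%:P) ^+ k) h by rewrite coprimep_expl // coprimep_sym coprimep_XsubC.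
(* With u1 (X - c)^k + u2 h = 1, the polynomial u2 h evaluates at A to the projector. *)
have /Bezout_eq1_coprimepP[[u1 u2] /= e] := cop.
have /eigenvalue_col[v v0 hv] := hc; have /eigenvalue_col[w w0 hw] := ha.
have root_ch b (x : 'cV[C]_(udim V)) : x != 0 -> A *m x = b *: x -> (h * ('X - c%:P) ^+ k).[b] = 0.
  move=> x0 hx; have := pmx_char A; rewrite ech => /(congr1 (mulmx^~ x)).
  by rewrite (pmx_eigen _ hx) mul0mx => /eqP; rewrite scaler_eq0 (negPf x0) orbF => /eqP.
have lp p : ulinear (pmx A p : 'M[C]_(udim V)).
  have /ulinearP[h1 h2 h3 h4 h5] := lA.
  apply/ulinearP; split; [exact: (pmx_intertwine p h1) | exact: (pmx_intertwine p h2)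
    | exact: (pmx_intertwine p h3) | exact: (pmx_intertwine p h4) | exact: (pmx_intertwine p h5)].
have ee : pmx A (u2 * h) *m pmx A (u2 * h) = pmx A (u2 * h).
  rewrite -pmxM; apply/eqP; rewrite -subr_eq0 -pmxB; apply/eqP.
  rewrite (_ : _ - _ = - (u1 * u2) * char_poly A) ?pmxM ?pmx_char ?mulmx0 //.
  by rewrite ech -[X in _ - X]mulr1 -e; ring.
have vk : ((('X - c%:P) ^+ k).[c]) = 0.
  move: (root_ch _ _ v0 hv) => /eqP; rewrite hornerM mulf_eq0 => /orP[|/eqP//].
  by rewrite -rootE (negPf hch).
have wh : h.[a] = 0.
  move: (root_ch _ _ w0 hw) => /eqP; rewrite hornerM mulf_eq0 => /orP[/eqP//|].
  by rewrite horner_exp hornerXsubC expf_eq0 subr_eq0 (negPf ac) andbF.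
have [e0|e1] := indecomposable_idem iV (lp (u2 * h)) ee.
  have := congr1 (mulmx^~ v) (pmx1 A); rewrite -e pmxD e0 addr0 mul1mx.
  by rewrite (pmx_eigen _ hv) hornerM vk mulr0 scale0r => /esym/eqP; rewrite (negPf v0).
have := congr1 (mulmx^~ w) e1; rewrite (pmx_eigen _ hw) hornerM wh mulr0 scale0r mul1mx.
by move/esym/eqP; rewrite (negPf w0).
Qed.

Lemma half_is_half_twist : @is_half_twist R r half.
Proof.
split=> [V wV|V W f wV wW lf|V iV]; first by split; [exact: half_lin | exact: half_unit].
  exact: half_nat.
have wV : weight_module r V by case: iV.
split=> [|X c hX cX a]; first exact: half_sq.
have hc := half_factor wV hX cX.
apply/idP/eqP => [ha|->//]; exact: (indecomposable_eigen iV (half_lin hr wV)).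
Qed.

Lemma half_twistP : @is_half_twist R r (@half_twist R r).
Proof. by apply: ClassicalEpsilon.epsilon_spec; exists half; exact: half_is_half_twist. Qed.

(** Induction on the dimension: a decomposable module has two nonzero, hence smaller, summands. Zero
    modules are a separate case, not being indecomposable. *)
Lemma indecomposable_ind (P : umod R -> Prop) : (forall V, indecomposable r V -> P V) ->
  (forall V, udim V = 0%N -> P V) ->
  (forall V (X : 'I_2 -> umod R), weight_module r V -> (forall k, weight_module r (X k)) ->
     direct_sum X V -> (forall k, P (X k)) -> P V) ->
  forall V, weight_module r V -> P V.
Proof.
move=> Pi P0 Ps V; have [n] := ubnP (udim V); elim: n V => // n IH V hn wV.
have [V0|V0] := eqVneq (udim V) 0%N; first exact: P0.
have [iV|niV] := pselect (indecomposable r V); first exact: Pi.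
have [X wX [sX X0]] : exists2 X : 'I_2 -> umod R, forall k, weight_module r (X k) &
    direct_sum X V /\ forall k, udim (X k) != 0%N.
  apply: contrapT => h; apply: niV; split=> // [|X wX sX]; first exact/eqP.
  apply: contrapT => h'; apply: h; exists X => //; split=> // k.
  by apply/eqP => hk; apply: h'; exists k.
apply: (Ps V X) => // k; apply: IH => //; move: sX => [inj [prj [_ pi _ ip]]].
(* The trace of the identity gives the additivity of dimensions. *)
have : \tr (\sum_k inj k *m prj k) = (udim V)%:R by rewrite ip mxtrace1.
rewrite raddf_sum /= (eq_bigr (fun k => (udim (X k))%:R)); last first.
  by move=> l _; rewrite mxtrace_mulC pi mxtrace1.
rewrite -natr_sum => /eqP; rewrite eqr_nat big_ord_recl big_ord1 => /eqP e.
have X00 := X0 ord0; have X01 := X0 (lift ord0 ord0).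
have [->|->] : k = ord0 \/ k = lift ord0 ord0.
  by case: k => -[|[|//]] ?; [left | right]; exact: val_inj.
  by move: hn; rewrite -e; lia.
by move: hn; rewrite -e; lia.
Qed.

(** V_alpha is indecomposable with a listed simple quotient, so the axioms fix its scalar, and
    naturality along [hwmap] fixes the value on highest weight vectors. The two solutions commute
    and have equal squares, and their sum is invertible. *)
Lemma half_twistE V : weight_module r V -> half_twist r V = half V.
Proof.
have [hu hn hi] := half_twistP.
apply: (indecomposable_ind (P := fun V => half_twist r V = half V)) => {V} [V iV|V V0|V X wV wX sX eX].
- have wV : weight_module r V by case: iV.
  have [lt ut] := hu V wV; have [ht _] := hi V iV.
  have hV a : half_twist r (Vmod r a) = (xval r a)%:M.
    have wA := Vmod_weight hr a; have [c ec] := Vmod_scalar hr (hu _ wA).1.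
    have [X [p [h1 h2 h3]]] := Vmod_quot hr a.
    (* Endomorphisms of V_alpha are scalars, so one of the two summands of a decomposition is
       zero. *)
    have iA : indecomposable r (Vmod r a).
      split=> // [|Y wY [inj [prj [lY pi pij sp]]]]; first by rewrite /=; case: r hr.
      have [d ed] := Vmod_scalar hr (ulinear_mul (lY ord0).1 (lY ord0).2).
      have [d0|d0] := eqVneq d 0.
        exists ord0; apply: (@scalar1_eq0 C); rewrite -[LHS]mulmx1 -{1}(pi ord0) -(pi ord0).
        by rewrite !mulmxA -[_ *m inj ord0 *m _]mulmxA ed d0 mul_mx_scalar scale0r mul0mx.
      pose k1 : 'I_2 := lift ord0 ord0.
      exists k1; apply: (@scalar1_eq0 C); apply: (scalerI d0); rewrite scaler0 -(pi k1).
      rewrite scalemxAl -mul_mx_scalar -[d%:M]ed mulmxA (pij k1 ord0) //.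
      by rewrite !mul0mx.
    have ea : eigenvalue (half_twist r (Vmod r a)) c.
      apply/eigenvalue_col; exists (delta_mx (hw_idx hr) 0); last by rewrite ec mul_scalar_mx.
      by apply/eqP => /colP/(_ (hw_idx hr)); rewrite !mxE !eqxx => /eqP; rewrite oner_eq0.
    have [_ he] := hi _ iA; rewrite (he X _ h1) in ea; first by rewrite ec (eqP ea).
    exists (Vmod r a), 1%:M, p; split=> //; split=> //; first exact: ulinear1.
    by rewrite trmx1 row_free_unit unitmx1.
  have uD : half_twist r V + half V \in unitmx.
    apply: (hw_unit wV) => [|a v hv Ev v0]; first by apply: ulinearD => //; exact: half_lin.
    have hv' : wt (V := V) (vpar r a 0 + r%:R - 1) v by rewrite (_ : vpar r a 0 + _ - _ = a) // /vpar; ring.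
    have := hn _ _ _ (Vmod_weight hr (vpar r a 0)) wV (hwmap_lin hr wV hv' Ev).
    rewrite hV mul_mx_scalar => e0; pose e1 : 'cV[C]_r := delta_mx (hw_idx hr) 0.
    have ev : @hwmap _ r V v *m e1 = v by rewrite hwmapE expmx0 mul1mx.
    have e : half_twist r V *m v = xval r (vpar r a 0) *: v.
      by rewrite -[X in _ *m X = _]ev -[X in _ = _ *: X]ev mulmxA scalemxAl; congr (_ *m _); exact: e0.
    rewrite mulmxDl e (half_hw hr wV hv Ev) -scalerDl scaler_eq0 negb_or v0 andbT.
    by rewrite -mulr2n mulrn_eq0 /= xval_neq0.
  have : (half_twist r V - half V) *m (half_twist r V + half V) = 0.
    rewrite mulmxBl !mulmxDr ht (half_sq hr wV) (half_nat hr wV wV lt).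
    by apply/matrixP => x y; rewrite !mxE; ring.
  by move/(congr1 (mulmx^~ (invmx (half_twist r V + half V)))); rewrite mulmxK // mul0mx => /eqP; rewrite subr_eq0 => /eqP.
- by apply/matrixP => j; have := ltn_ord j; rewrite [X in (_ < X)%N]V0.
case: sX => inj [prj [lip _ _ ip]].
rewrite -[LHS]mulmx1 -[RHS]mulmx1 -ip !mulmx_sumr; apply: eq_bigr => k _.
have [li _] := lip k.
by rewrite !mulmxA (hn _ _ _ (wX k) wV li) (half_nat hr (wX k) wV li) eX.
Qed.

End Unique.

(** * Hermitian forms *)

Section ConjTranspose.
Variable R : realType.
Local Notation C := R[i].

Lemma ctrM m n p (A : 'M[C]_(m, n)) (B : 'M[C]_(n, p)) : (A *m B)^t* = B^t* *m A^t*.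
Proof. by rewrite trmx_mul map_mxM. Qed.

Lemma ctrD m n (A B : 'M[C]_(m, n)) : (A + B)^t* = A^t* + B^t*.
Proof. by rewrite raddfD /= map_mxD. Qed.

Lemma ctrZ m n c (A : 'M[C]_(m, n)) : (c *: A)^t* = c^* *: A^t*.
Proof. by rewrite trmxZ map_mxZ. Qed.

Lemma ctrK m n (A : 'M[C]_(m, n)) : (A^t*)^t* = A.
Proof. exact: trmxCK. Qed.

Lemma ctr1 n : (1%:M : 'M[C]_n)^t* = 1%:M.
Proof. by rewrite trmx1 map_mx1. Qed.

Lemma ctr0 m n : (0 : 'M[C]_(m, n))^t* = 0.
Proof. by rewrite trmx0 map_mx0. Qed.

Lemma ctr_sum m n k (A : 'I_k -> 'M[C]_(m, n)) : (\sum_i A i)^t* = \sum_i (A i)^t*.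
Proof. exact: (big_morph (fun B : 'M[C]_(m, n) => B^t*) (@ctrD m n) (ctr0 m n)). Qed.

Lemma ctr_tens m n p s (A : 'M[C]_(m, n)) (B : 'M[C]_(p, s)) : (tensmx A B)^t* = tensmx (A^t*) (B^t*).
Proof. by apply/matrixP => i j; rewrite !mxE rmorphM. Qed.

Lemma ctr_unit n (A : 'M[C]_n) : (A^t* \in unitmx) = (A \in unitmx).
Proof. by rewrite map_unitmx unitmx_tr. Qed.

Lemma ctr_inv n (A : 'M[C]_n) : (invmx A)^t* = invmx (A^t*).
Proof. by rewrite trmx_inv map_invmx. Qed.

Lemma ctrM3 m n p s (A : 'M[C]_(n, m)) (B : 'M[C]_(p, n)) (y : 'M[C]_(p, s)) :
  (A^t* *m (B^t* *m y))^t* = y^t* *m (B *m A).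
Proof. by rewrite ctrM (ctrM (B^t*)) !ctrK mulmxA. Qed.

End ConjTranspose.

(** * Unitarity of the twist and of the half twist *)

Section Pairing.
Variables (R : realType) (r : nat).
Hypothesis hr : (2 <= r)%N.
Local Notation C := R[i].
Local Notation q := (@qpow R r).
Local Notation c_ := (@Rcoef R r).
Implicit Types (V W M N : umod R) (a b c : C).
Local Notation half := (half hr).

Definition real_weights V := forall a v, wt (V := V) a v -> v != 0 -> a^*%C = a.

Definition tcoefV n a : C := RcoefV R r n * (-1) ^+ n *
  q (- ((r%:R - 1) * a - a ^+ 2 / 2 - n%:R * a - n%:R ^+ 2 - n%:R)).

Lemma tcoef_conj n a : (n < r)%N -> a^*%C = a -> (tcoef r n a)^*%C = tcoefV n a.
Proof.
move=> nr ra; have cM (x y : C) : (x * y)^*%C = x^*%C * y^*%C := rmorphM _ x y.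
rewrite /tcoef /tcoefV 2!cM (Rcoef_conj _ hr nr) [((-1) ^+ n)^*%C]rmorph_sign.
congr (_ * _); rewrite (qpow_conj hr); congr (q (- _)).
have cB (x y : C) : (x - y)^*%C = x^*%C - y^*%C := rmorphB _ x y.
have cV (x : C) : (x^-1)^*%C = (x^*%C)^-1 := fmorphV _ x.
have cn (l : nat) : (l%:R : C)^*%C = l%:R := rmorph_nat _ l.
have c1 : (1 : C)^*%C = 1 := rmorph1 _.
by rewrite !expr2 !(cB, cM, cV, cn, c1) ra.
Qed.

(** Theta commutes with F, so the double sum involves F^(n+m) E^(n+m) only and collapses by
    [RcoefV_conv]. As [tcoefV] is the conjugate of [tcoef] at real weights, this is the source of
    unitarity. *)
Lemma theta_inv_wt V a v : weight_module r V -> wt (V := V) a v ->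
  theta r V *m (\sum_(n < r) tcoefV n a *: (aF V ^+ n *m (aE V ^+ n *m v))) = v.
Proof.
move=> wV hv; rewrite mulmx_sumr.
pose k (l : nat) : C := q (- (l%:R * a) - l%:R ^+ 2 - l%:R) * (-1) ^+ l.
pose f i j : 'cV[C]_(udim V) := (RcoefV R r i * c_ j * k (i + j)%N) *: (aF V ^+ (i + j) *m (aE V ^+ (i + j) *m v)).
transitivity (\sum_(i < r) \sum_(j < r) f i j).
  apply: eq_bigr => n _; rewrite -scalemxAr (Xn_ulinear n _ (theta_lin hr wV)).2.
  rewrite (theta_wt hr wV (wtEn wV n hv)) mulmx_sumr scaler_sumr; apply: eq_bigr => m _.
  rewrite -scalemxAr scalerA /f.
  have -> : aF V ^+ n *m (aF V ^+ m *m (aE V ^+ m *m (aE V ^+ n *m v))) =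
      aF V ^+ (n + m) *m (aE V ^+ (n + m) *m v).
    rewrite (expmxD (aF V) n m) [X in _ = _ *m (_ ^+ X *m _)]addnC (expmxD (aE V) m n).
    by rewrite -[RHS]mulmxA -[X in _ = _ *m (_ *m X)]mulmxA.
  congr (_ *: _); rewrite /tcoefV /tcoef /k exprD.
  set X := (X in RcoefV R r n * _ * q X); set Y := (X in c_ m * _ * q X); set Z := (X in q X * _).
  (* The exponents differ by the multiple 2rn, which comes from the factor K^(r-1). *)
  have e : q X * q Y = q Z.
    transitivity (q (X + Y) * q ((- Posz n)%:~R * (2 * r%:R))); first by rewrite (qpow_2r R hr) mulr1 (qpowD r X Y).
    by rewrite -qpowD intrN -pmulrn; congr (q _); rewrite /X /Y /Z natrD; field.
  transitivity (RcoefV R r n * c_ m * ((q X * q Y) * ((-1) ^+ n * (-1) ^+ m))); first by ring.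
  by rewrite e.
rewrite -(sum_triangle (f := f)); last by move=> i j ij; rewrite /f (En0 wV _ ij) mulmx0 scaler0.
have k0 : k 0%N = 1 by rewrite /k expr0 mulr1 (_ : _ - _ = 0) ?qpow0 //; ring.
rewrite (bigD1 (Ordinal (r_gt0 hr))) //= big_ord1 /f RcoefV0 Rcoef0 //.
rewrite subnn addn0 k0 !expmx0 !mul1mx !mulr1 scale1r.
rewrite big1 ?addr0 // => n n0.
rewrite (eq_bigr (fun i : 'I_n.+1 => (RcoefV R r i * c_ (n - i)) *: (k n *: (aF V ^+ n *m (aE V ^+ n *m v))))).
  rewrite -scaler_suml RcoefV_conv ?scale0r // ltn_ord andbT lt0n.
  by apply: contraNN n0 => /eqP e; apply/eqP/val_inj.
by move=> i _; rewrite scalerA subnKC // -ltnS.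
Qed.

(** Two different modules are allowed: besides Hermitian forms this covers the product form composed
    with the flip, which pairs V (x) W with W (x) V. *)
Definition pairing M N (P : 'M[C]_(udim M, udim N)) :=
  forall x, (uact M (udag x))^t* *m P = P *m uact N x.

Lemma pairing_adj M N (P : 'M[C]_(udim M, udim N)) Q (A : 'M[C]_(udim M)) :
  pairing P -> Q *m P = 1%:M -> P *m Q = 1%:M -> ulinear A ->
  ulinear (V := N) (W := N) (Q *m A^t* *m P).
Proof.
move=> hP QP PQ lA x.
have e1 : A^t* *m (uact M (udag x))^t* = (uact M (udag x))^t* *m A^t* by rewrite -!ctrM lA.
have e2 : uact N x *m Q = Q *m (uact M (udag x))^t*.
  by rewrite -[uact N x]mul1mx -QP -[Q *m P *m _]mulmxA -hP -!mulmxA PQ mulmx1.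
transitivity (Q *m (A^t* *m (uact M (udag x))^t*) *m P); first by rewrite -!mulmxA hP.
by rewrite e1 [RHS]mulmxA [in RHS]mulmxA e2 !mulmxA.
Qed.

Lemma pairing_row M N (P : 'M[C]_(udim M, udim N)) x (w : 'cV[C]_(udim N)) :
  pairing P -> (P *m w)^t* *m uact M (udag x) = (P *m (uact N x *m w))^t*.
Proof. by move=> hP; rewrite mulmxA -hP -mulmxA [RHS]ctrM ctrK. Qed.

Section Main.
Variables (M N : umod R) (P : 'M[C]_(udim M, udim N)) (Q : 'M[C]_(udim N, udim M)).
Hypotheses (wM : weight_module r M) (wN : weight_module r N) (rN : real_weights N).
Hypotheses (hP : pairing P) (QP : Q *m P = 1%:M) (PQ : P *m Q = 1%:M).
Let adj (A : 'M[C]_(udim M)) : 'M[C]_(udim N) := Q *m A^t* *m P.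

Lemma adjM A B : adj (A *m B) = adj B *m adj A.
Proof. by rewrite /adj ctrM -!mulmxA (mulmxA P) PQ mul1mx. Qed.

Lemma adj1 : adj 1%:M = 1%:M.
Proof. by rewrite /adj ctr1 mulmx1. Qed.

Lemma adj_wt (w : 'cV[C]_(udim N)) (A : 'M[C]_(udim M)) (w' : 'cV[C]_(udim N)) :
  (P *m w)^t* *m A = (P *m w')^t* -> adj A *m w = w'.
Proof.
move=> e; have e1 : A^t* *m (P *m w) = P *m w' by rewrite -[LHS]ctrK ctrM ctrK e ctrK.
by rewrite /adj -!mulmxA e1 mulmxA QP mul1mx.
Qed.

Lemma row_wt_conj a (w : 'cV[C]_(udim N)) : wt (V := N) a w -> w != 0 ->
  (P *m w)^t* *m aH M = a *: (P *m w)^t*.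
Proof.
move=> hw w0; have := pairing_row (UH R) w hP; rewrite /= hw -scalemxAr ctrZ => ->.
by congr (_ *: _); exact: rN hw w0.
Qed.

Lemma pairing_Fn n (w : 'cV[C]_(udim N)) : (aE M ^+ n)^t* *m (P *m w) = P *m (aF N ^+ n *m w).
Proof.
elim: n w => [|n IH] w; first by rewrite !expmx0 ctr1 !mul1mx.
have := hP (UF R); rewrite /= => e.
by rewrite expmxSr ctrM -mulmxA IH [_ *m (P *m _)]mulmxA e -mulmxA [in RHS]expmxS -!mulmxA.
Qed.

Lemma pairing_En n (w : 'cV[C]_(udim N)) : (aF M ^+ n)^t* *m (P *m w) = P *m (aE N ^+ n *m w).
Proof.
elim: n w => [|n IH] w; first by rewrite !expmx0 ctr1 !mul1mx.
have := hP (UE R); rewrite /= => e.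
by rewrite expmxSr ctrM -mulmxA IH [_ *m (P *m _)]mulmxA e -mulmxA [in RHS]expmxS -!mulmxA.
Qed.

Lemma theta_row_wt V a (u : 'rV[C]_(udim V)) : weight_module r V -> u *m aH V = a *: u ->
  u *m theta r V = \sum_(n < r) tcoef r n a *: (u *m (aF V ^+ n *m aE V ^+ n)).
Proof.
move=> wV hu; pose A := theta r V - \sum_(n < r) tcoef r n a *: (aF V ^+ n *m aE V ^+ n).
have : u *m A = 0 *: u.
  apply: (row_wt_sum wV hu) => [v hv|b v hv].
    rewrite scale0r /A mulmxBl (theta_wt hr wV hv) mulmx_suml.
    under [X in _ - X]eq_bigr => n _ do rewrite -scalemxAl -mulmxA.
    by rewrite subrr mulmx0.
  have hs n : wt (V := V) b (aF V ^+ n *m (aE V ^+ n *m v)) by have := wtFn wV n (wtEn wV n hv); rewrite addrK.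
  rewrite /wt /A mulmxBl mulmxBr scalerBr (wt_ulinear (theta_lin hr wV) hv); congr (_ - _).
  rewrite mulmx_suml mulmx_sumr scaler_sumr; apply: eq_bigr => n _.
  by rewrite -scalemxAl -scalemxAr -mulmxA hs !scalerA mulrC.
rewrite scale0r /A mulmxBr mulmx_sumr => /eqP; rewrite subr_eq0 => /eqP ->.
by apply: eq_bigr => n _; rewrite -scalemxAr.
Qed.

(** The adjoint exchanges E and F, so it preserves F^n E^n and conjugates the coefficients;
    [theta_inv_wt] identifies the result with the inverse of theta. Real weights enter through the
    conjugation. *)
Lemma adj_theta : adj (theta r M) *m theta r N = 1%:M.
Proof.
have uT := theta_unit hr wN.
suff -> : adj (theta r M) = invmx (theta r N) by rewrite mulVmx.
apply: (eq_on_wt (weight_diag wN)) => a w hw; have [->|w0] := eqVneq w 0; first by rewrite !mulmx0.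
have ra := rN hw w0; apply: (can_inj (mulKmx uT)); rewrite mulKVmx //.
rewrite -[RHS](theta_inv_wt wN hw); congr (_ *m _).
apply: adj_wt; rewrite (theta_row_wt wM (row_wt_conj hw w0)) mulmx_sumr ctr_sum; apply: eq_bigr => n _.
rewrite -scalemxAr ctrZ -pairing_Fn -pairing_En [RHS]/=; congr (_ *: _).
  by rewrite -(tcoef_conj (ltn_ord n) ra); exact: esym (conjcK _).
by rewrite ctrM3.
Qed.

Lemma casimir_rowF V a (u : 'rV[C]_(udim V)) : weight_module r V -> u *m aH V = a *: u ->
  u *m aF V = 0 -> u *m casimir r V = casval r a 0 *: u.
Proof.
move=> wV hu uF; apply: (row_wt_sum wV hu) => [v hv|b v hv]; last exact: wt_casimir.
have /eqP := casimir_FE wV hv; rewrite eq_sym subr_eq => /eqP ->.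
rewrite mulmxDr -!scalemxAr [u *m (_ *m _)]mulmxA uF mul0mx scaler0 add0r.
by rewrite /casval mulr0 addr0.
Qed.

Lemma casimir_rowE V a (u : 'rV[C]_(udim V)) : weight_module r V -> u *m aH V = a *: u ->
  u *m aE V = 0 -> u *m casimir r V = casval r a r.-1 *: u.
Proof.
move=> wV hu uE; apply: (row_wt_sum wV hu) => [v hv|b v hv]; last exact: wt_casimir.
have /eqP := casimir_EF hr wV hv; rewrite eq_sym subr_eq => /eqP ->.
rewrite mulmxDr -!scalemxAr [u *m (_ *m _)]mulmxA uE mul0mx scaler0 add0r; congr (_ *: _).
have := casval_last hr (a - 2); rewrite subrK => ->.
by congr (wsum r _); ring.
Qed.

(** The adjoint B of [half M] has square theta, so [B *m half N] is an involution. On a highest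
    weight vector it is the product of [xval] and its conjugate, that is 1, so adding 1 gives an
    invertible matrix. *)
Lemma adj_half : adj (half M) *m half N = 1%:M.
Proof.
have lM := half_lin hr wM; have lN := half_lin hr wN; have uN := half_unit hr wN.
have lA := pairing_adj hP QP PQ lM; rewrite -/(adj _) in lA.
have sA : adj (half M) *m adj (half M) = theta r N.
  rewrite -adjM (half_sq hr wM) -[LHS]mul1mx -(mulmx1C adj_theta) -mulmxA -adjM.
  by rewrite mulVmx ?adj1 ?mulmx1 // theta_unit.
set B := adj (half M) in lA sA *.
have cB := half_nat hr wN wN lA.
have uD : B *m half N + 1%:M \in unitmx.
  apply: (hw_unit wN) => [|a v hv Ev v0]; first by apply: ulinearD; [exact: ulinear_mul | exact: ulinear1].
  have ra := rN hv v0; rewrite mulmxDl mul1mx -mulmxA (half_hw hr wN hv Ev) -scalemxAr.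
  set x := xval _ _; have hx : x^*%C = x^-1.
    have -> : x = xval r (complex.Re a - r%:R + 1)%:C.
      congr (xval r _); rewrite /vpar mulr0 addr0 rmorphD rmorphB /= rmorph_nat rmorph1.
      by congr (_ - _ + _); move: ra; case: (a) => y z /= [] /eqP; rewrite eq_sym -addr_eq0 -mulr2n mulrn_eq0 /= => /eqP ->.
    exact: xval_conj.
  (* The row vector that P attaches to v is killed by F and has weight a, so [half M] acts on it by
     [xval] at index 0. *)
  have -> : B *m v = x^-1 *: v.
    have hu := row_wt_conj hv v0.
    have uF : (P *m v)^t* *m aF M = 0 by have := pairing_row (UE R) v hP; rewrite /= Ev mulmx0 ctr0.
    apply: adj_wt; rewrite (half_row hr wM (r_gt0 hr) hu (casimir_rowF wM hu uF)).
    rewrite -scalemxAr ctrZ; congr (_ *: _); rewrite -/x -hx; exact: esym (conjcK _).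
  rewrite scalerA mulfV ?scale1r ?xval_neq0 //.
  by rewrite -mulr2n -scaler_nat scaler_eq0 (negPf v0) pnatr_eq0.
have : (B *m half N - 1%:M) *m (B *m half N + 1%:M) = 0.
  have ZZ : B *m half N *m (B *m half N) = 1%:M.
    by rewrite -mulmxA (mulmxA (half N)) cB -mulmxA mulmxA sA (half_sq hr wN) mulmxV ?theta_unit.
  rewrite mulmxBl !mulmxDr !mul1mx !mulmx1 ZZ.
  by apply/matrixP => x y; rewrite !mxE; ring.
by move/(congr1 (mulmx^~ (invmx (B *m half N + 1%:M)))); rewrite mulmxK // mul0mx => /eqP; rewrite subr_eq0 => /eqP.
Qed.

Lemma half_pairing : (half M)^t* *m P *m half N = P.
Proof.
have := adj_half; rewrite /adj => /(congr1 (mulmx P)); rewrite mulmx1 !mulmxA PQ mul1mx.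
exact.
Qed.

End Main.
End Pairing.

Transparent Rmatrix.
Lemma RmatrixE (R : realType) r (V W : umod R) :
  Rmatrix r V W = qHH r V W *m \sum_(n < r) Rcoef R r n *: tensmx (aE V ^+ n) (aF W ^+ n).
Proof. by []. Qed.
Opaque Rmatrix.

Lemma ctr_inj (R : realType) m n (A B : 'M[R[i]]_(m, n)) : A^t* = B^t* -> A = B.
Proof. by move=> e; rewrite -[A]ctrK e ctrK. Qed.

Lemma mulmxA4 (F : pzSemiRingType) m n p k l (A : 'M[F]_(m, n)) (B : 'M[F]_(n, p)) (D : 'M[F]_(p, k)) (E : 'M[F]_(k, l)) :
  A *m (B *m (D *m E)) = A *m (B *m D) *m E.
Proof. by rewrite !mulmxA. Qed.

Lemma mulmxA4' (F : pzSemiRingType) m n p k l (A : 'M[F]_(m, n)) (B : 'M[F]_(n, p)) (D : 'M[F]_(p, k)) (E : 'M[F]_(k, l)) :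
  A *m B *m (D *m E) = A *m (B *m D) *m E.
Proof. by rewrite !mulmxA. Qed.

Section BraidedGram.
Variables (R : realType) (m n : nat).
Local Notation C := R[i].
Variables (f : 'M[C]_(m, n)) (g : 'M[C]_(n, m)) (G Z S : 'M[C]_n) (Q S' U : 'M[C]_m).
Variables (c : 'M[C]_(m, n)) (c' : 'M[C]_(n, m)).

(** Commuting U^-1 to the left past S' and through c' turns it into Z^-1, which then stands before
    c' c S^2 = Z^2. *)
Lemma mulmx_half_sq (T : 'M[C]_n) : U \in unitmx -> Z \in unitmx -> U *m S' = S' *m U ->
  Z *m c' = c' *m U -> c *m S = S' *m c -> S *m S = T -> Z *m Z = c' *m c *m T ->
  c' *m S' *m invmx U *m c *m S = Z.
Proof.
move=> uU uZ US Zc cS <- ZZ.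
have e1 : S' *m invmx U = invmx U *m S' by rewrite (invmx_nat uU uU US).
have e2 : invmx Z *m c' = c' *m invmx U by exact: invmx_nat Zc.
rewrite -[c' *m S' *m _]mulmxA e1 [c' *m _]mulmxA -e2 -[_ *m S' *m c]mulmxA -cS.
have -> : invmx Z *m c' *m (c *m S) *m S = invmx Z *m (c' *m c *m (S *m S)) by rewrite !mulmxA.
by rewrite -ZZ mulKmx.
Qed.

(** In the application G is the product form, f and g are flips, Z and U the half twists of V (x) W
    and W (x) V, S and S' products of half twists, c and c' the braidings, Q the inverse R-matrix on
    W (x) V. Adjunction moves U^-1 and c across G, and the formula for Z restores the original
    matrix. *)
Lemma mulmx_braided_sym : G^t* = G -> g^t* = f ->
  (invmx U)^t* *m (f *m G) = f *m G *m Z -> c^t* *m (f *m G) = G *m (g *m (Q *m f)) ->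
  S^t* *m G *m S = G -> Q *m f *m c' = 1%:M -> c' *m S' *m invmx U *m c *m S = Z ->
  g *m S' = S *m g ->
  (G *m (g *m (invmx U *m c *m S)))^t* = G *m (g *m (invmx U *m c *m S)).
Proof.
move=> sG gf hU hc hS cc eZ gS; have h1 : Q *m f *m Z = S' *m invmx U *m c *m S.
  by rewrite -eZ !mulmxA cc mul1mx.
rewrite ctrM ctrM gf sG.
have -> : (invmx U *m c *m S)^t* = S^t* *m (c^t* *m (invmx U)^t*) by rewrite !ctrM.
transitivity (S^t* *m (c^t* *m ((invmx U)^t* *m (f *m G)))); first by rewrite !mulmxA.
rewrite hU [c^t* *m _]mulmxA hc.
transitivity (S^t* *m G *m (g *m (Q *m f *m Z))); first by rewrite !mulmxA.
rewrite h1; transitivity (S^t* *m G *m (g *m S' *m (invmx U *m c *m S))); first by rewrite !mulmxA.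
by rewrite gS -[S *m g *m _]mulmxA [LHS]mulmxA hS.
Qed.

Lemma mulmx_braided_unit (P : 'M[C]_(n, m)) : S \in unitmx -> U \in unitmx ->
  f *m g = 1%:M -> P *m c = 1%:M -> g *m (invmx U *m c *m S) \in unitmx.
Proof.
move=> uS uU fg Pc.
suff h : invmx S *m P *m U *m f *m (g *m (invmx U *m c *m S)) = 1%:M by case: (mulmx1_unit h).
transitivity (invmx S *m (P *m (U *m (f *m g) *m invmx U) *m c) *m S); first by rewrite !mulmxA.
by rewrite fg mulmx1 mulmxV // mulmx1 Pc mulmx1 mulVmx.
Qed.

End BraidedGram.

(** * The Hermitian form on a tensor product *)

Section Hermitian.
Variables (R : realType) (r : nat).
Hypothesis hr : (2 <= r)%N.
Local Notation C := R[i].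
Local Notation q := (@qpow R r).
Implicit Types (V W : umod R) (a b c : C).
Local Notation half := (half hr).

Section Form.
Variable V : hmod R.

Lemma hform_ext n (A B : 'M[C]_n) : (forall v w : 'cV[C]_n, v^t* *m A *m w = v^t* *m B *m w) -> A = B.
Proof.
move=> h; apply/matrixP => i j; have := h (delta_mx i 0) (delta_mx j 0).
have -> : (delta_mx i 0 : 'cV[C]_n)^t* = delta_mx 0 i.
  by apply/matrixP => k l; rewrite !mxE andbC rmorph_nat.
by rewrite -!rowE -!colE => /matrixP/(_ 0 0); rewrite !mxE.
Qed.

Lemma hformE (v w : 'cV[C]_(udim V)) : v^t* *m gram V *m w = (hform (V := V) v w)%:M.
Proof. by rewrite [LHS]mx11_scalar. Qed.

Lemma hermitian_moduleP : hermitian_module r V <->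
  [/\ weight_module r V, (gram V)^t* = gram V, gram V \in unitmx & pairing (M := V) (N := V) (gram V)].
Proof.
split=> [[wV hs hn hi]|[wV hs hu hi]].
  have hs' : (gram V)^t* = gram V.
    apply: hform_ext => v w; rewrite hformE hs.
    transitivity ((w^t* *m gram V *m v)^t*); first by rewrite !ctrM ctrK mulmxA.
    by rewrite hformE; apply/matrixP => i j; rewrite !ord1 !mxE eqxx !mulr1n.
  split=> //.
    apply: unit_ker => v Gv; apply: hn => w.
    by rewrite /hform -[gram V]hs' -ctrM Gv ctr0 mul0mx mxE.
  move=> x; apply: hform_ext => v w; rewrite !mulmxA -ctrM.
  have := hi x v w; rewrite /hform => e; rewrite -[LHS]/((uact V (udag x) *m v)^t* *m gram V *m w).
  by apply/matrixP => i j; rewrite !ord1 e !mulmxA.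
split=> // [v w|v h|x v w].
- have e : v^t* *m gram V *m w = (w^t* *m gram V *m v)^t* by rewrite !ctrM ctrK hs mulmxA.
  by rewrite {1}/hform e [LHS]mxE [in LHS]mxE.
- apply: (can_inj (mulKmx hu)); rewrite mulmx0; apply: ctr_inj; rewrite ctr0 ctrM hs.
  apply: (eq_on_cols (unitmx1 _ _)) => k; rewrite col1 hformE h mul0mx.
  by apply/matrixP => i j; rewrite !mxE mul0rn.
by rewrite /hform ctrM -[_ *m gram V]mulmxA hi !mulmxA.
Qed.

End Form.

Lemma pairing_gen V W (P : 'M[C]_(udim V, udim W)) :
  (aF V)^t* *m P = P *m aE W -> (aE V)^t* *m P = P *m aF W -> (aKi V)^t* *m P = P *m aK W ->
  (aK V)^t* *m P = P *m aKi W -> (aH V)^t* *m P = P *m aH W -> pairing P.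
Proof.
move=> hE hF hK hKi hH; elim=> //= [c|x hx y hy|x hx y hy].
- rewrite tr_scalar_mx map_scalar_mx mul_scalar_mx mul_mx_scalar; congr (_ *: _); exact: conjcK.
- by rewrite ctrD mulmxDl hx hy mulmxDr.
by rewrite ctrM -mulmxA hy [LHS]mulmxA hx mulmxA.
Qed.

Lemma real_wt_orth V a b (G : 'M[C]_(udim V)) (v w : 'cV[C]_(udim V)) : real_weights V ->
  pairing (M := V) (N := V) G -> wt (V := V) a v -> wt (V := V) b w -> a != b -> v^t* *m G *m w = 0.
Proof.
move=> rV hG hv hw ab; have [->|v0] := eqVneq v 0; first by rewrite ctr0 !mul0mx.
have := hG (UH R); rewrite /= => e.
have e1 : v^t* *m ((aH V)^t* *m G) *m w = a *: (v^t* *m G *m w).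
  by rewrite mulmxA -ctrM hv ctrZ -!scalemxAl; congr (_ *: _); exact: rV hv v0.
have : (a - b) *: (v^t* *m G *m w) = 0.
  rewrite scalerBl -e1 e -!mulmxA hw -!scalemxAr; exact: subrr.
by move/eqP; rewrite scaler_eq0 subr_eq0 (negPf ab) => /eqP.
Qed.

(** The hypothesis says that real weight vectors span. The spectral projector of a nonreal weight
    kills all of them, hence would be zero. *)
Lemma real_weightsI V : (forall B : 'M[C]_(udim V), (forall a v, a^*%C = a -> wt (V := V) a v -> B *m v = 0) -> B = 0) ->
  real_weights V.
Proof.
move=> h c u hu u0; apply/eqP; apply: contraT => cr; have hc := mem_spec hu u0.
have B0 : specproj (aH V) c = 0.
  apply: h => a v ra hv; have [->|v0] := eqVneq v 0; first by rewrite mulmx0.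
  rewrite (specproj_weight hv hc v0); case: eqP => [ca|_]; last by rewrite scale0r.
  by rewrite ca ra eqxx in cr.
by have := specproj_weight hu hc u0; rewrite B0 mul0mx eqxx scale1r => /esym/eqP; rewrite (negPf u0).
Qed.

Lemma real_weights_tens V W : weight_module r V -> weight_module r W -> real_weights V -> real_weights W ->
  real_weights (tens V W).
Proof.
move=> wV wW rV rW; apply: real_weightsI => B hB; apply: (eq_on_tens wV wW) => a b v w hv hw.
rewrite mul0mx; have [->|v0] := eqVneq v 0; first by rewrite tensv0l mulmx0.
have [->|w0] := eqVneq w 0; first by rewrite tensv0r mulmx0.
apply: (hB (a + b)); last exact: wt_tensv.
have cD (x y : C) : (x + y)^*%C = x^*%C + y^*%C := rmorphD _ x y.
by rewrite cD (rV _ _ hv v0) (rW _ _ hw w0).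
Qed.

Lemma real_weights_dual V : weight_module r V -> real_weights V -> real_weights (dual_mod V).
Proof.
move=> wV rV a p hp p0; apply/eqP; apply: contraT => ar.
have hp' : p^T *m aH V = (- a) *: p^T.
  by have := congr1 trmx hp; rewrite dual_H mulNmx linearN /= trmx_mul trmxK trmxZ scaleNr => <-; rewrite opprK.
suff : p^T = 0 by move/eqP; rewrite trmx_eq0 (negPf p0).
apply: (eq_on_wt (weight_diag wV)) => b v hv; rewrite mul0mx.
have [->|v0] := eqVneq v 0; first by rewrite mulmx0.
have : b *: (p^T *m v) = (- a) *: (p^T *m v) by rewrite scalemxAr -hv mulmxA hp' scalemxAl.
move/eqP; rewrite -subr_eq0 -scalerBl scaler_eq0 subr_eq0 => /orP[/eqP e|/eqP //].
have cN (x : C) : (- x)^*%C = - x^*%C := rmorphN _ x.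
by have := rV _ _ hv v0; rewrite e cN => /oppr_inj ea; rewrite ea eqxx in ar.
Qed.

Lemma gram_half (V : hmod R) : hermitian_module r V -> real_weights V ->
  (half V)^t* *m gram V *m half V = gram V.
Proof.
move=> /hermitian_moduleP[wV _ uV pV] rV.
by apply: (half_pairing hr wV wV rV pV (Q := invmx (gram V))); rewrite ?mulVmx ?mulmxV.
Qed.

Section Tens.
Variables V W : hmod R.
Hypotheses (hV : hermitian_module r V) (hW : hermitian_module r W).
Hypotheses (rV : real_weights V) (rW : real_weights W).
Let wV := herm_weight hV.
Let wW := herm_weight hW.
Let GG : 'M[C]_(udim V * udim W) := tensmx (gram V) (gram W).

Lemma tens_pairing_gen (A A' : 'M[C]_(udim V)) (B B' : 'M[C]_(udim W)) :
  A^t* *m gram V = gram V *m A' -> B^t* *m gram W = gram W *m B' ->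
  (tensmx A B)^t* *m (GG *m flip R (udim W) (udim V)) = GG *m flip R (udim W) (udim V) *m tensmx B' A'.
Proof.
move=> hA hB; rewrite ctr_tens mulmxA tensmx_mul hA hB -[in RHS]mulmxA flip_nat [RHS]mulmxA.
by rewrite tensmx_mul.
Qed.

(** The antiinvolution sends the coproduct to its opposite; the flip compensates for this. *)
Lemma tens_pairing : pairing (M := tens V W) (N := tens W V) (GG *m flip R (udim W) (udim V)).
Proof.
have [_ _ _ pV] := (hermitian_moduleP V).1 hV; have [_ _ _ pW] := (hermitian_moduleP W).1 hW.
have vE := pV (UE R); have vF := pV (UF R); have vK := pV (UK R); have vKi := pV (UKi R); have vH := pV (UH R).
have wE := pW (UE R); have wF := pW (UF R); have wK := pW (UK R); have wKi := pW (UKi R); have wH := pW (UH R).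
have v1 : (1%:M)^t* *m gram V = gram V *m 1%:M by rewrite ctr1 mul1mx mulmx1.
have w1 : (1%:M)^t* *m gram W = gram W *m 1%:M by rewrite ctr1 mul1mx mulmx1.
apply: pairing_gen; rewrite /= ?ctrD ?mulmxDl ?mulmxDr.
- by rewrite (tens_pairing_gen vK wE) (tens_pairing_gen vE w1) addrC.
- by rewrite (tens_pairing_gen v1 wF) (tens_pairing_gen vF wKi) addrC.
- exact: tens_pairing_gen.
- exact: tens_pairing_gen.
by rewrite (tens_pairing_gen vH w1) (tens_pairing_gen v1 wH) addrC.
Qed.

(** Distinct weights are orthogonal, and for equal real weights the phases q^(ab/2) of the two sides
    cancel. *)
Lemma qHH_unitary : (qHH r V W)^t* *m GG *m qHH r V W = GG.
Proof.
have [_ _ _ pV] := (hermitian_moduleP V).1 hV; have [_ _ _ pW] := (hermitian_moduleP W).1 hW.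
apply: (eq_on_tens wV wW) => a b v w hv hw; rewrite -[_ *m qHH r V W *m _]mulmxA (qHH_wt r hv hw) -scalemxAr.
apply: ctr_inj; rewrite ctrZ; apply: (eq_on_tens wV wW) => a' b' x y hx hy.
rewrite !ctrM ctrK -scalemxAl -!mulmxA (qHH_wt r hx hy) -!scalemxAr scalerA.
have -> : (tensv v w)^t* *m (GG^t* *m tensv x y) = tensmx (v^t* *m (gram V)^t* *m x) (w^t* *m (gram W)^t* *m y).
  transitivity ((tensmx v w)^t* *m ((tensmx (gram V) (gram W))^t* *m tensmx x y)); first by [].
  by rewrite !ctr_tens !tensmx_mul !mulmxA.
have orthC U d d' (G : 'M[C]_(udim U)) (s t : 'cV[C]_(udim U)) : real_weights U ->
    pairing (M := U) (N := U) G -> wt (V := U) d s -> wt (V := U) d' t -> d != d' -> s^t* *m G^t* *m t = 0.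
  move=> rU pU hs ht dd; apply: ctr_inj; rewrite !ctrM !ctrK ctr0 mulmxA.
  by apply: (real_wt_orth rU pU ht hs); rewrite eq_sym.
have [->|v0] := eqVneq v 0; first by rewrite ctr0 !mul0mx tens0mx scaler0.
have [->|w0] := eqVneq w 0; first by rewrite ctr0 !mul0mx tensmx0 scaler0.
have [ea|ea] := eqVneq a a'; last by rewrite (orthC _ _ _ _ _ _ rV pV hv hx ea) tens0mx scaler0.
have [eb|eb] := eqVneq b b'; last by rewrite (orthC _ _ _ _ _ _ rW pW hw hy eb) tensmx0 scaler0.
rewrite -ea -eb -[RHS]scale1r; congr (_ *: _).
have -> : (q (a * b / 2))^*%R = q (- (a * b / 2)^*%C) by exact: (qpow_conj hr).
have -> : (a * b / 2)^*%C = a * b / 2.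
  have cM (s t : C) : (s * t)^*%C = s^*%C * t^*%C := rmorphM _ s t.
  have cV (s : C) : (s^-1)^*%C = (s^*%C)^-1 := fmorphV _ s.
  have cn (l : nat) : (l%:R : C)^*%C = l%:R := rmorph_nat _ l.
  by rewrite !cM cV cn (rV hv v0) (rW hw w0).
by rewrite mulrC qpow_mulN.
Qed.

(** Adjunction exchanges E and F, reverses the order of the Cartan part and the q-exponential, and
    turns the coefficients into [RcoefV]: the outcome is the inverse R-matrix with its factors
    exchanged. *)
Lemma Rmatrix_ctr : (Rmatrix r V W)^t* *m GG = GG *m (flip R (udim W) (udim V) *m invmx (Rmatrix r W V) *m flip R (udim V) (udim W)).
Proof.
have [_ _ _ pV] := (hermitian_moduleP V).1 hV; have [_ _ _ pW] := (hermitian_moduleP W).1 hW.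
have -> : invmx (Rmatrix r W V) = Rmatrix_inv r W V.
  apply: (can_inj (mulmxK (Rmatrix_unit hr wW wV))).
  by rewrite mulVmx ?(Rmatrix_unit hr wW wV) // (Rmatrix_invE hr wW wV).
have qu := qHH_unit wV wW.
have pow (U : umod R) (A B G : 'M[C]_(udim U)) n : A^t* *m G = G *m B -> (A ^+ n)^t* *m G = G *m B ^+ n.
  move=> e; elim: n => [|n IH]; first by rewrite !expmx0 ctr1 mul1mx mulmx1.
  by rewrite expmxSr ctrM -mulmxA IH mulmxA e -mulmxA expmxS.
have qi : flip R (udim W) (udim V) *m invmx (qHH r W V) *m flip R (udim V) (udim W) = invmx (qHH r V W).
  apply: (eq_on_tens wV wW) => a b v w hv hw; rewrite -!mulmxA flip_tensv (qHHV_wt wW wV hw hv).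
  by rewrite -scalemxAr flip_tensv (qHHV_wt wV wW hv hw) (mulrC b).
rewrite /Rmatrix_inv RmatrixE ctrM -mulmxA.
have -> : (qHH r V W)^t* *m GG = GG *m invmx (qHH r V W) by rewrite -[in RHS]qHH_unitary mulmxK.
rewrite -qi.
set S1 := \sum_(n < r) _; set S2 := \sum_(n < r) _.
have hS : flip R (udim W) (udim V) *m S2 = \sum_(n < r) RcoefV R r n *: tensmx (aF V ^+ n) (aE W ^+ n) *m flip R (udim W) (udim V).
  rewrite /S2 mulmx_sumr; apply: eq_bigr => n _.
  by rewrite -scalemxAr flip_nat scalemxAl.
rewrite [flip _ _ _ *m (S2 *m _)]mulmxA hS mulmx_suml mulmx_suml.
rewrite ctr_sum mulmx_suml mulmx_sumr; apply: eq_bigr => n _.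
rewrite ctrZ ctr_tens -!scalemxAl -!scalemxAr; congr (_ *: _); first exact: (Rcoef_conj R hr (ltn_ord n)).
rewrite !mulmxA tensmx_mul (pow V _ _ _ n (pV (UF R))) (pow W _ _ _ n (pW (UE R))).
by rewrite -tensmx_mul -!mulmxA.
Qed.

End Tens.

Section Tens2.
Variables V W : hmod R.
Hypotheses (hV : hermitian_module r V) (hW : hermitian_module r W).
Hypotheses (rV : real_weights V) (rW : real_weights W).
Let wV := herm_weight hV.
Let wW := herm_weight hW.
Let wVW := tens_weight hr wV wW.
Let wWV := tens_weight hr wW wV.
Let GG : 'M[C]_(udim V * udim W) := tensmx (gram V) (gram W).

Lemma gram_htens : gram (htens r V W) = GG *m (flip R (udim W) (udim V) *m Xmap r V W).
Proof. by []. Qed.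

Lemma XmapE : Xmap r V W = invmx (half (tens W V)) *m braiding r V W *m tensmx (half V) (half W).
Proof. by rewrite /Xmap !(half_twistE hr). Qed.

Lemma Xmap_lin : ulinear (V := tens V W) (W := tens W V) (Xmap r V W).
Proof.
rewrite XmapE; apply: (ulinear_mul (V := tens V W)); last by apply: ulinear_tens; exact: half_lin.
apply: (ulinear_mul (V := tens W V)); last exact: braiding_lin.
by apply: ulinear_invmx; [exact: half_lin | exact: half_unit].
Qed.

Lemma flip_ctr m n : (flip R m n)^t* = flip R n m.
Proof.
apply/matrixP => k l; rewrite !mxE rmorph_nat; congr (_%:R).
by case: (mxtens_unindex k) => a b; case: (mxtens_unindex l) => c d /=; rewrite !xpair_eqE andbC [b == c]eq_sym [a == d]eq_sym.
Qed.

Let Z := half (tens V W).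
Let U := half (tens W V).
Let c := braiding r V W.
Let c' := braiding r W V.
Let S := tensmx (half V) (half W).
Let S' := tensmx (half W) (half V).

Lemma half_tens_sq : c' *m S' *m invmx U *m c *m S = Z.
Proof.
have lS' : ulinear (V := tens W V) (W := tens W V) S' by apply: ulinear_tens; exact: half_lin.
have uU : U \in unitmx by exact: half_unit.
have uZ : Z \in unitmx by exact: half_unit.
have US : U *m S' = S' *m U := half_nat hr wWV wWV lS'.
have Zc : Z *m c' = c' *m U.
  by apply: (half_nat hr wWV wVW); exact: braiding_lin.
have cS : c *m S = S' *m c by apply: braiding_nat => //; exact: half_lin.
have SS : S *m S = tensmx (twist_mx r V) (twist_mx r W).
  by rewrite /S tensmx_mul (half_sq hr wV) (half_sq hr wW).
have ZZ : Z *m Z = c' *m c *m tensmx (twist_mx r V) (twist_mx r W).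
  by rewrite (half_sq hr wVW) (twist_tens hr wV wW).
exact: (mulmx_half_sq uU uZ US Zc cS SS ZZ).
Qed.

Lemma braiding_ctr : c^t* *m (tensmx (gram W) (gram V) *m flip R (udim V) (udim W)) =
  GG *m (flip R (udim W) (udim V) *m (invmx (Rmatrix r W V) *m flip R (udim V) (udim W))).
Proof.
rewrite /c braidingE ctrM flip_ctr -flip_nat -mulmxA (mulmxA (flip _ _ _) (flip _ _ _)) flipK mul1mx.
by rewrite (Rmatrix_ctr hV hW rV rW) !mulmxA.
Qed.

Lemma gram_tens_sym : (gram (htens r V W))^t* = gram (htens r V W).
Proof.
have [_ sV uV pV] := (hermitian_moduleP V).1 hV; have [_ sW uW pW] := (hermitian_moduleP W).1 hW.
have eP : flip R (udim V) (udim W) *m GG = tensmx (gram W) (gram V) *m flip R (udim V) (udim W).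
  by rewrite /GG flip_nat.
have uG : tensmx (gram W) (gram V) \in unitmx by apply: tensmx_inv_unit.
(* [half] is unitary for the pairing of W (x) V with V (x) W, across which the adjoint of U^-1
   therefore becomes Z. *)
have hU : (invmx U)^t* *m (flip R (udim V) (udim W) *m GG) = flip R (udim V) (udim W) *m GG *m Z.
  rewrite eP; set P2 := tensmx _ _ *m _.
  have := half_pairing hr (M := tens W V) (N := tens V W) (P := P2)
    (Q := flip R (udim W) (udim V) *m invmx (tensmx (gram W) (gram V)))
    wWV wVW (real_weights_tens wV wW rV rW) (tens_pairing hW hV).
  rewrite -/U -/Z => /(_ _ _) e; rewrite -[in LHS]e.
  + have ei : (invmx U)^t* = invmx (U^t*) := ctr_inv U.
    have uU : U^t* \in unitmx by rewrite ctr_unit half_unit.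
    by rewrite ei; move: (U^t*) uU => U' uU; rewrite -[U' *m P2 *m Z]mulmxA mulKmx.
  + by rewrite /P2 -mulmxA (mulmxA (invmx _)) mulVmx // mul1mx flipK.
  by rewrite /P2 -mulmxA (mulmxA (flip _ _ _)) flipK mul1mx mulmxV.
rewrite gram_htens XmapE.
apply: (mulmx_braided_sym (f := flip R (udim V) (udim W)) (Z := Z) (S' := S')
  (Q := invmx (Rmatrix r W V)) (c' := c')).
- by rewrite /GG ctr_tens sV sW.
- exact: flip_ctr.
- exact: hU.
- by rewrite eP; exact: braiding_ctr.
- by rewrite /S /GG ctr_tens !tensmx_mul !gram_half.
- by case: (braiding_inv hr wW wV).
- exact: half_tens_sq.
by rewrite flip_nat.
Qed.

Lemma gram_tens_unit : gram (htens r V W) \in unitmx.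
Proof.
have [_ sV uV pV] := (hermitian_moduleP V).1 hV; have [_ sW uW pW] := (hermitian_moduleP W).1 hW.
rewrite gram_htens unitmx_mul tensmx_inv_unit //= XmapE.
have [_ cc] := braiding_inv hr wV wW.
have uU : U \in unitmx by exact: half_unit.
have uS : S \in unitmx by rewrite tensmx_inv_unit // half_unit.
exact: (mulmx_braided_unit uS uU (flipK _ _ _) cc).
Qed.

Lemma htens_hermitian : hermitian_module r (htens r V W).
Proof.
apply/hermitian_moduleP; split; [exact: wVW | exact: gram_tens_sym | exact: gram_tens_unit |] => x.
rewrite gram_htens.
have px := tens_pairing hV hW x; rewrite -/GG in px.
transitivity ((uact (tens V W) (udag x))^t* *m (GG *m flip R (udim W) (udim V)) *m Xmap r V W).
  exact: mulmxA4.
by rewrite px -[LHS]mulmxA -(Xmap_lin x); exact: mulmxA4'.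
Qed.

End Tens2.
End Hermitian.

Lemma mulKVmx4 (F : comUnitRingType) n p k l (A : 'M[F]_n) (B : 'M[F]_(n, p)) (D : 'M[F]_(p, k)) (E : 'M[F]_(k, l)) :
  A \in unitmx -> A *m (invmx A *m B *m D *m E) = B *m (D *m E).
Proof. by move=> uA; rewrite -!mulmxA mulKVmx. Qed.

(** * Duals, evaluation and coevaluation *)

Section Dual.
Variables (R : realType) (r : nat).
Hypothesis hr : (2 <= r)%N.
Local Notation C := R[i].
Implicit Types (V W : umod R) (a b c : C).
Local Notation half := (half hr).

Lemma gram_hdual (V : hmod R) : (gram V)^t* = gram V -> gram (hdual V) = (invmx (gram V))^T.
Proof.
move=> sV; have e : (invmx (gram V))^t* = invmx (gram V) by rewrite ctr_inv sV.
by apply/matrixP => i j; rewrite [LHS]mxE /dual_vec e !mxE.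
Qed.

Lemma trC_comm m n (A : 'M[C]_(m, n)) : (A^T)^t* = (A^t*)^T.
Proof. by rewrite map_trmx. Qed.

Lemma hdual_hermitian (V : hmod R) : hermitian_module r V -> hermitian_module r (hdual V).
Proof.
move=> /[dup] hV /hermitian_moduleP[wV sV uV pV]; apply/hermitian_moduleP; rewrite gram_hdual //.
split; [exact: dual_weight | by rewrite trC_comm ctr_inv sV | by rewrite unitmx_tr unitmx_inv |].
have vE := pV (UE R); have vF := pV (UF R); have vK := pV (UK R); have vKi := pV (UKi R); have vH := pV (UH R).
rewrite /= in vE vF vK vKi vH.
have gen (A B : 'M[C]_(udim V)) : A^t* *m gram V = gram V *m B ->
    (A^T)^t* *m (invmx (gram V))^T = (invmx (gram V))^T *m B^T.
  move=> e; rewrite trC_comm -!trmx_mul; congr (_^T).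
  by apply: (can_inj (mulKmx uV)); apply: (can_inj (mulmxK uV)); rewrite mulKVmx // e mulmxA mulmxKV.
have genN (A B : 'M[C]_(udim V)) : A^t* *m gram V = gram V *m B ->
    (- A^T)^t* *m (invmx (gram V))^T = (invmx (gram V))^T *m - B^T.
  by move=> e; rewrite -scaleN1r ctrZ rmorphN1 scaleN1r mulNmx (gen _ _ e) mulmxN.
have pair2 (A B A' B' : 'M[C]_(udim V)) : A^t* *m gram V = gram V *m A' -> B^t* *m gram V = gram V *m B' ->
    (A *m B)^t* *m gram V = gram V *m (B' *m A').
  by move=> eA eB; rewrite ctrM -mulmxA eA [LHS]mulmxA eB mulmxA.
apply: pairing_gen; rewrite ?dual_E ?dual_F ?dual_H.
- exact: genN (pair2 _ _ _ _ vKi vE).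
- exact: genN (pair2 _ _ _ _ vF vK).
- exact: gen vKi.
- exact: gen vK.
exact: genN.
Qed.

(** Both matrices square to the twist of the dual. A highest weight vector of the dual, of weight a,
    is a row vector of V of weight -a killed by E. It has index r - 1, hence parameter
    [- vpar r a 0], and [xval] is even. *)
Lemma half_dual V : weight_module r V -> half (dual_mod V) = (half V)^T.
Proof.
move=> wV; have wD := dual_weight wV.
have lt : ulinear (V := dual_mod V) (W := dual_mod V) (half V)^T by apply: ulinear_dual; exact: half_lin.
have ld := half_lin hr wD.
have uD : half (dual_mod V) + (half V)^T \in unitmx.
  apply: (hw_unit wD) => [|a p hp Ep p0]; first exact: ulinearD.
  have hu : p^T *m aH V = (- a) *: p^T.
    by have := congr1 trmx hp; rewrite dual_H mulNmx linearN /= trmx_mul trmxK trmxZ scaleNr => <-; rewrite opprK.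
  have uE : p^T *m aE V = 0.
    have := congr1 trmx Ep; rewrite dual_E mulNmx linearN /= trmx_mul trmxK trmx0 => /eqP.
    rewrite oppr_eq0 mulmxA => /eqP /(congr1 (mulmx^~ (aK V))).
    by lazy beta; rewrite -[LHS]mulmxA (rel_KiK (weight_relations wV)) mulmx1 mul0mx.
  have rl : (r.-1 < r)%N by rewrite ltn_predL r_gt0.
  have := half_row hr wV rl hu (casimir_rowE hr wV hu uE).
  move=> ep; have e : (half V)^T *m p = xval r (vpar r (- a) r.-1) *: p.
    by rewrite -[p in LHS]trmxK -trmx_mul ep [LHS]trmxZ trmxK.
  move: e; have -> : vpar r (- a) r.-1 = - vpar r a 0 by rewrite /vpar (predrE R hr); ring.
  rewrite (xvalN hr) => e; rewrite (_ : _ *m p = (xval r (vpar r a 0) + xval r (vpar r a 0)) *: p).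
    rewrite scaler_eq0 negb_or p0 andbT.
    by rewrite -mulr2n mulrn_eq0 /= xval_neq0.
  by rewrite mulmxDl (half_hw hr wD hp Ep) [RHS]scalerDl; congr (_ + _).
have cD := half_nat hr wD wD lt.
have : (half (dual_mod V) - (half V)^T) *m (half (dual_mod V) + (half V)^T) = 0.
  have e1 := half_sq hr wD; rewrite (twist_dualE hr wV) -(half_sq hr wV) trmx_mul in e1.
  rewrite mulmxBl !mulmxDr e1 cD.
  by apply/matrixP => x y; rewrite !mxE; ring.
by move/(congr1 (mulmx^~ (invmx (half (dual_mod V) + (half V)^T)))); rewrite mulmxK // mul0mx => /eqP; rewrite subr_eq0 => /eqP.
Qed.

(** The unit has highest weight 0, hence parameter 1 - r, at which [hexp] is 1. *)
Lemma half_unit_mod : half (unit_mod R) = 1%:M.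
Proof.
have wU := unit_weight R hr.
have hv : wt (V := unit_mod R) 0 (delta_mx 0 0 : 'cV[C]_1) by rewrite /wt mul0mx scale0r.
apply: (eq_on_cols (unitmx1 _ _)) => j; rewrite col1 mul1mx (ord1 j).
rewrite (half_hw hr wU hv) ?mul0mx // (_ : xval _ _ = 1) ?scale1r //.
have e : vpar r 0 0 = (1 - Posz r)%:~R :> C by rewrite /vpar intrD intrN -pmulrn; ring.
rewrite e (@xval_non _ _ hr _ (1 - Posz r)).
- by rewrite /hexp intrB -pmulrn (_ : _ / 4 = 0) ?qpow0 //; field.
- case=> [[]|[k]]; first by exists (1 - Posz r).
  rewrite [r%:R]pmulrn -intrM => /intC_inj; move: hr; case: (ltgtP k 0) => [||->]; nia.
exists 0; first by rewrite mul0r addr0.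
by move: hr; lia.
Qed.

Lemma twist_unit_mod : twist_mx r (unit_mod R) = 1%:M.
Proof. by rewrite -(half_sq hr (unit_weight R hr)) half_unit_mod mulmx1. Qed.

Lemma ev_tensv V (p v : 'cV[C]_(udim V)) : ev_mx V *m tensv p v = p^T *m v.
Proof.
apply/matrixP => i j; rewrite !ord1 !mxE (reindex (@mxtens_index (udim V) (udim V))) /=; last first.
  by exists (@mxtens_unindex _ _) => l _; rewrite (mxtens_indexK, mxtens_unindexK).
rewrite (eq_bigr (fun k => (k.1 == k.2)%:R * (p k.1 0 * v k.2 0))); last first.
  by case=> k l _; rewrite tensvE !mxE mxtens_indexK.
rewrite -(pair_bigA _ (fun k l => (k == l)%:R * (p k 0 * v l 0))) /=; apply: eq_bigr => k _.
rewrite (bigD1 k) //= eqxx mul1r big1 ?addr0 ?mxE // => l lk.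
by rewrite eq_sym (negPf lk) mul0r.
Qed.

Lemma ev_tr V : (ev_mx V)^T = coev_mx V.
Proof. by apply/matrixP => i j; rewrite !mxE. Qed.

Lemma ev_ctr V : (ev_mx V)^t* = coev_mx V.
Proof. by apply/matrixP => i j; rewrite !mxE rmorph_nat. Qed.

Lemma coev_ctr V : (coev_mx V)^t* = ev_mx V.
Proof. by rewrite -ev_ctr ctrK. Qed.

Lemma ev_tensmx V (A B : 'M[C]_(udim V)) : ev_mx V *m tensmx A B = ev_mx V *m tensmx 1%:M (A^T *m B).
Proof.
by apply: eq_tensv => p v; rewrite -!mulmxA !tensv_mul !ev_tensv mul1mx trmx_mul !mulmxA.
Qed.

Lemma coev_tensmx V (A B : 'M[C]_(udim V)) : tensmx A B *m coev_mx V = tensmx (A *m B^T) 1%:M *m coev_mx V.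
Proof.
apply: trmx_inj; rewrite !trmx_mul -!ev_tr !trmxK !trmx_tens ev_tensmx [RHS]ev_tensmx.
by rewrite trmx1 mulmx1 !trmxK.
Qed.

Lemma ev_flip V : ev_mx V *m flip R (udim V) (udim V) = ev_mx V.
Proof.
apply: eq_tensv => p v; rewrite -mulmxA flip_tensv !ev_tensv.
by rewrite -[LHS]trmxK trmx_mul trmxK [LHS]mx11_scalar [RHS]mx11_scalar mxE.
Qed.

Lemma coev_flip V : flip R (udim V) (udim V) *m coev_mx V = coev_mx V.
Proof. by rewrite -ev_ctr -{1}(flip_ctr R (udim V) (udim V)) -ctrM ev_flip. Qed.

Lemma ev_lin V : weight_module r V -> ulinear (V := tens (dual_mod V) V) (W := unit_mod R) (ev_mx V).
Proof.
move=> wV; have rel := weight_relations wV.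
have kk := rel_KiK rel; have kk' := rel_KKi rel.
apply/ulinearP; split.
- rewrite [aE (tens _ _)]/(tensmx 1%:M (aE V) + tensmx (aE (dual_mod V)) (aK V)) mulmxDr.
  rewrite (ev_tensmx 1%:M) (ev_tensmx (aE _)) -mulmxDr -tensmxDr dual_E linearN /= trmxK trmx1 mul1mx mulNmx.
  by rewrite -mulmxA kk mulmx1 subrr tensmx0 mulmx0 mul0mx.
- rewrite [aF (tens _ _)]/(tensmx (aK V)^T (aF V) + tensmx (aF (dual_mod V)) 1%:M) mulmxDr.
  rewrite (ev_tensmx (aK V)^T) (ev_tensmx (aF _)) -mulmxDr -tensmxDr dual_F linearN /= !trmxK mulmx1.
  by rewrite subrr tensmx0 mulmx0 mul0mx.
- rewrite [aK (tens _ _)]/(tensmx (aKi V)^T (aK V)) ev_tensmx trmxK kk tensmx1 mulmx1.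
  by rewrite mul1mx.
- rewrite [aKi (tens _ _)]/(tensmx (aK V)^T (aKi V)) ev_tensmx trmxK kk' tensmx1 mulmx1.
  by rewrite mul1mx.
rewrite [aH (tens _ _)]/(tensmx (aH (dual_mod V)) 1%:M + tensmx 1%:M (aH V)) mulmxDr.
rewrite (ev_tensmx (aH _)) -mulmxDr -tensmxDr dual_H linearN /= trmxK mulmx1 addNr.
by rewrite tensmx0 mulmx0 mul0mx.
Qed.

Lemma coev_lin V : weight_module r V -> ulinear (V := unit_mod R) (W := tens V (dual_mod V)) (coev_mx V).
Proof.
move=> wV; have rel := weight_relations wV; have kk := rel_KiK rel; have kk' := rel_KKi rel.
apply/ulinearP; split.
- rewrite [aE (tens _ _)]/(tensmx 1%:M (aE (dual_mod V)) + tensmx (aE V) (aKi V)^T) mulmxDl.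
  rewrite (coev_tensmx 1%:M) (coev_tensmx (aE V)) -mulmxDl -tensmxDl dual_E linearN /= !trmxK mul1mx addNr.
  by rewrite tens0mx mul0mx mulmx0.
- rewrite [aF (tens _ _)]/(tensmx (aKi V) (aF (dual_mod V)) + tensmx (aF V) 1%:M) mulmxDl.
  rewrite (coev_tensmx (aKi V)) -mulmxDl -tensmxDl dual_F linearN /= trmxK mulmxN mulmxA kk mul1mx addNr.
  by rewrite tens0mx mul0mx mulmx0.
- rewrite [aK (tens _ _)]/(tensmx (aK V) (aKi V)^T) coev_tensmx trmxK kk' tensmx1 mul1mx.
  by rewrite mulmx1.
- rewrite [aKi (tens _ _)]/(tensmx (aKi V) (aK V)^T) coev_tensmx trmxK kk tensmx1 mul1mx.
  by rewrite mulmx1.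
rewrite [aH (tens _ _)]/(tensmx (aH V) 1%:M + tensmx 1%:M (aH (dual_mod V))) mulmxDl.
rewrite (coev_tensmx 1%:M) -mulmxDl -tensmxDl dual_H linearN /= trmxK mul1mx subrr.
by rewrite tens0mx mul0mx mulmx0.
Qed.

Section Adjoints.
Variable V : hmod R.
Hypotheses (hV : hermitian_module r V) (rV : real_weights V).
Let wV := herm_weight hV.
Let wD := dual_weight wV.

(** The Gram matrices of V and its dual cancel against the coevaluation, which leaves the evaluation
    after [Xmap]. Evaluation absorbs the half twist of its source, as that of the unit is 1, and
    carries the half twist of the dual over to V, where two half twists make the twist. *)
Lemma adjoint_coev : adjoint (V := hunit R) (W := htens r V (hdual V)) (coev_mx V)
  = ev_mx V *m braiding r V (dual_mod V) *m tensmx (twist_mx r V) 1%:M.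
Proof.
have [_ sV uV pV] := (hermitian_moduleP r V).1 hV; have wU := unit_weight R hr.
have wVD := tens_weight hr wV wD; have wDV := tens_weight hr wD wV.
have e0 (X : 'M[C]_(udim V * udim V)) : invmx 1%:M *m (coev_mx V)^t* *m
    (tensmx (gram V) (invmx (gram V))^T *m (flip R (udim V) (udim V) *m X)) = ev_mx V *m X.
  rewrite invmx1 mul1mx coev_ctr [LHS]mulmxA ev_tensmx -trmx_mul mulVmx // trmx1 tensmx1 mulmx1.
  by rewrite [LHS]mulmxA ev_flip.
have eX : Xmap r V (hdual V) = invmx (half (tens (dual_mod V) V)) *m braiding r V (dual_mod V)
    *m tensmx (half V) (half V)^T.
  by rewrite (XmapE hr hV (hdual_hermitian hV)) half_dual.
have -> : adjoint (V := hunit R) (W := htens r V (hdual V)) (coev_mx V) = ev_mx V *m Xmap r V (hdual V).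
  by rewrite -e0 -(gram_hdual sV).
rewrite eX.
have evU : ev_mx V *m invmx (half (tens (dual_mod V) V)) = ev_mx V.
  have := half_nat hr wDV wU (ev_lin wV); rewrite half_unit_mod mul1mx => e.
  by rewrite {1}e mulmxK ?(half_unit hr wDV).
have lS := half_lin hr wV; have lSt : ulinear (V := dual_mod V) (W := dual_mod V) (half V)^T by apply: ulinear_dual.
transitivity (ev_mx V *m (braiding r V (dual_mod V) *m tensmx (half V) (half V)^T)).
  by rewrite [LHS]mulmxA [ev_mx V *m (_ *m _)]mulmxA evU -[LHS]mulmxA.
rewrite (braiding_nat wV wV wD wD lS lSt) mulmxA ev_tensmx trmxK (half_sq hr wV).
rewrite -[RHS]mulmxA (braiding_nat wV wV wD wD (twist_lin hr wV) (ulinear1 _)).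
exact: esym (mulmxA _ _ _).
Qed.

(** After multiplication by the Gram matrix it suffices that [Xmap] sends the right-hand side to the
    coevaluation. There the double braiding and the half twists combine into the twist of V with its
    dual, which fixes the coevaluation by naturality. *)
Lemma adjoint_ev : adjoint (V := htens r (hdual V) V) (W := hunit R) (ev_mx V)
  = tensmx 1%:M (twist_mx r V) *m braiding r V (dual_mod V) *m coev_mx V.
Proof.
have [_ sV uV pV] := (hermitian_moduleP r V).1 hV; have wU := unit_weight R hr.
have wVD := tens_weight hr wV wD; have wDV := tens_weight hr wD wV.
have hD := hdual_hermitian hV; have rD := real_weights_dual wV rV.
have ug := gram_tens_unit hr hD hV.
rewrite /adjoint [gram (hunit R)]/(1%:M) mulmx1 ev_ctr.
apply: (can_inj (mulKmx ug)); rewrite mulKVmx //.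
have uZ := half_unit hr wVD; have lS := half_lin hr wV; have lT := twist_lin hr wV.
have lSt : ulinear (V := dual_mod V) (W := dual_mod V) (half V)^T by apply: ulinear_dual.
pose c := braiding r V (dual_mod V); pose c' := braiding r (dual_mod V) V.
have hX : Xmap r (dual_mod V) V *m (tensmx 1%:M (twist_mx r V) *m c *m coev_mx V) = coev_mx V.
  have -> : Xmap r (dual_mod V) V = invmx (half (tens V (dual_mod V))) *m c' *m tensmx (half V)^T (half V).
    by have := XmapE hr hD hV; rewrite [half (hdual V)](half_dual wV).
  apply: (can_inj (mulKmx uZ)).
  have -> : half (tens V (dual_mod V)) *m coev_mx V = coev_mx V.
    by rewrite (half_nat hr wU wVD (coev_lin wV)) half_unit_mod mulmx1.
  transitivity (c' *m (tensmx (half V)^T (half V) *m (tensmx 1%:M (twist_mx r V) *m c *m coev_mx V))).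
    exact: (mulKVmx4 _ _ _ uZ).
  have e1 : tensmx 1%:M (twist_mx r V) *m c = c *m tensmx (twist_mx r V) 1%:M.
    exact: esym (braiding_nat wV wV wD wD lT (ulinear1 _)).
  have e2 : tensmx (half V)^T (half V) *m c = c *m tensmx (half V) (half V)^T.
    exact: esym (braiding_nat wV wV wD wD lS lSt).
  have e3 : tensmx (half V) (half V)^T *m (tensmx (twist_mx r V) 1%:M *m coev_mx V) =
      tensmx (twist_mx r V) (twist_mx r V)^T *m coev_mx V.
    rewrite mulmxA tensmx_mul mulmx1 [LHS]coev_tensmx [RHS]coev_tensmx !trmxK -(half_sq hr wV).
    by rewrite -!mulmxA.
  have e4 : c' *m c *m tensmx (twist_mx r V) (twist_mx r V)^T = twist_mx r (tens V (dual_mod V)).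
    by rewrite (twist_tens hr wV wD) (twist_dualE hr wV).
  rewrite e1 -(mulmxA c) (mulmxA (tensmx (half V)^T _) c) e2 -(mulmxA c) e3.
  rewrite (mulmxA c' c) (mulmxA (c' *m c)) e4 (twist_nat hr wU wVD (coev_lin wV)) twist_unit_mod.
  exact: mulmx1.
have e0 (X : 'M[C]_(udim V * udim V)) (k : 'cV_(udim V * udim V)) : X *m k = coev_mx V ->
    coev_mx V = tensmx (invmx (gram V))^T (gram V) *m (flip R (udim V) (udim V) *m X) *m k.
  move=> e; rewrite -[RHS]mulmxA -[X in _ = _ *m X]mulmxA e coev_flip coev_tensmx -trmx_mul.
  by rewrite mulmxV // trmx1 tensmx1 mul1mx.
rewrite [LHS](e0 _ _ hX) -(gram_hdual sV); congr (_ *m _).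
Qed.

End Adjoints.
End Dual.

(** * The category D *)

Section ClosureD.
Variables (R : realType) (r : nat).
Hypothesis hr : (2 <= r)%N.
Local Notation C := R[i].
Implicit Types (V W X Y P : umod R) (a b c : C).

Lemma real_diag V (d : 'rV[C]_(udim V)) : aH V = diag_mx d -> (forall j, (d 0 j)^*%C = d 0 j) ->
  real_weights V.
Proof.
move=> hd rd; apply: real_weightsI => B hB; apply: (eq_on_cols (unitmx1 _ _)) => j.
rewrite col1 mul0mx; apply: (hB (d 0 j)) => //.
rewrite /wt hd; apply/colP => k; rewrite mul_diag_mx !mxE.
by case: eqP => [->|]; rewrite ?mulr0.
Qed.

Lemma conj_real_int (k : int) : (k%:~R : C)^*%C = k%:~R.
Proof. exact: (rmorph_int (conjc : {rmorphism C -> C})). Qed.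

Lemma retract_real X Y : retract_of X Y -> real_weights Y -> real_weights X.
Proof.
move=> [i [p [li lp pi]]] rY a v hv v0; apply: (rY a (i *m v)); first exact: wt_ulinear.
by apply: contraNneq v0 => iv; rewrite -[v]mul1mx -pi -mulmxA iv mulmx0.
Qed.

Lemma direct_sum_real k (X : 'I_k -> umod R) V : direct_sum X V ->
  (forall j, real_weights (X j)) -> real_weights V.
Proof.
move=> [inj [prj [lip _ _ ip]]] rX a v hv v0.
have [j pj] : exists j, prj j *m v != 0.
  apply: contrapT => h; case/eqP: v0; rewrite -[v]mul1mx -ip mulmx_suml big1 // => j _.
  apply/eqP; rewrite -mulmxA; case: (eqVneq (prj j *m v) 0) => [->|pv]; first by rewrite mulmx0.
  by case: h; exists j.
by apply: (rX j a _ _ pj); apply: wt_ulinear hv; case: (lip j).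
Qed.

Lemma Smod_real n : real_weights (Smod R r n).
Proof.
apply: (@real_diag _ (\row_j (n%:R - 2 * j%:R))) => // j; rewrite mxE.
by have := conj_real_int (Posz n - 2 * Posz j); rewrite intrB intrM -!pmulrn.
Qed.

Lemma Cmod_real (k : int) : real_weights (Cmod R r k).
Proof.
apply: (@real_diag _ (const_mx (k%:~R * r%:R))) => [|j]; first by rewrite diag_const_mx.
by rewrite mxE; have := conj_real_int (k * Posz r); rewrite intrM -pmulrn.
Qed.

Lemma Vmod_real (a : R) : real_weights (Vmod r a%:C).
Proof.
apply: (@real_diag _ (\row_j (a%:C + r%:R - 1 - 2 * j%:R))) => // j; rewrite mxE.
have -> : a%:C + r%:R - 1 - 2 * j%:R = (a + r%:R - 1 - 2 * j%:R)%:C :> C.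
  by rewrite !(rmorphB, rmorphD, rmorphM) /= !rmorph_nat rmorph1.
exact: conjc_real.
Qed.

(* The real weights span a direct summand of [P] onto which the minimality of
   the cover applies. *)
Lemma cover_real P S : projective_cover r P S -> real_weights S -> real_weights P.
Proof.
move=> [wP _ [p [lp fp minp]]] rS.
pose f a : C := (a^*%C == a)%:R; pose e := mxfun f (aH P).
have he a v : wt (V := P) a v -> e *m v = f a *: v by exact: mxfun_weight.
have dP := weight_diag wP.
have c2 : (2 : C)^*%C = 2 by exact: (conj_real_int 2).
have cD (x y : C) : (x + y)^*%C = x^*%C + y^*%C := rmorphD _ x y.
have cB (x y : C) : (x - y)^*%C = x^*%C - y^*%C := rmorphB _ x y.
have le : ulinear (V := P) (W := P) e.
  apply/ulinearP; split; apply: (eq_on_wt dP) => a v hv; rewrite -!mulmxA (he _ _ hv) -scalemxAr.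
  - by rewrite (he _ _ (wtE wP hv)) /f cD c2 (inj_eq (addIr _)).
  - by rewrite (he _ _ (wtF wP hv)) /f cB c2 (inj_eq (addIr _)).
  - by rewrite (wtK wP hv) -!scalemxAr (he _ _ hv) !scalerA mulrC.
  - by rewrite (wtKi wP hv) -!scalemxAr (he _ _ hv) !scalerA mulrC.
  by rewrite hv -!scalemxAr (he _ _ hv) !scalerA mulrC.
have ee : e *m e = e.
  apply: (eq_on_wt dP) => a v hv; rewrite -mulmxA (he _ _ hv) -scalemxAr (he _ _ hv) scalerA.
  by rewrite /f; case: eqP; rewrite ?mulr1 ?mulr0.
have [k [i [s [si is_]]]] := idempotent_split ee.
have lis : ulinear (V := P) (W := P) (i *m s) by rewrite is_.
have [li _] := sub_mod_lin si lis; have wQ := sub_mod_weight si lis wP.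
have pe : p *m e = p.
  apply: (eq_on_wt dP) => a v hv; rewrite -mulmxA (he _ _ hv) -scalemxAr /f.
  case: eqP => [_|ra]; rewrite ?scale1r // scale0r.
  by apply/esym/eqP/contraT => pv; case: ra; apply: (rS a _ _ pv); exact: wt_ulinear hv.
have fi : row_free i.
  apply: (minp (sub_mod i s)) => //; have /row_freeP[B pB] := fp.
  by apply/row_freeP; exists (s *m B); rewrite mulmxA -[p *m i *m s]mulmxA is_ pe.
have /row_freeP[B iB] := fi.
have e1 : e = 1%:M by rewrite -is_ -[s]mulmx1 -iB [s *m _]mulmxA si mul1mx.
move=> a v hv v0; have := he a v hv; rewrite e1 mul1mx /f; case: eqP => // _.
by rewrite scale0r => /eqP; rewrite (negPf v0).
Qed.

Lemma inA_weight X : inA r X -> weight_module r X /\ real_weights X.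
Proof.
case=> [a _|n hn|i P hi hP|k].
- by split; [exact: Vmod_weight | exact: Vmod_real].
- by split; [exact: Smod_weight | exact: Smod_real].
- by split; [case: hP | exact: cover_real hP (@Smod_real i)].
by split; [exact: Cmod_weight | exact: Cmod_real].
Qed.

Lemma tensor_product_weight Y : tensor_product_of_A r Y -> weight_module r Y /\ real_weights Y.
Proof.
elim=> {Y} [X hX|X hX|X Y _ [wX rX] _ [wY rY]]; first exact: inA_weight.
  by have [wX rX] := inA_weight hX; split; [exact: dual_weight | exact: (@real_weights_dual R r)].
by split; [exact: tens_weight | exact: (@real_weights_tens R r)].
Qed.

Lemma in_D_real V : in_D r V -> real_weights V.
Proof.
move=> [_ [k [X [sX hX]]]]; apply: (direct_sum_real sX) => j.
by have [_ [Y tY rXY]] := hX j; apply: (retract_real rXY); case: (tensor_product_weight tY).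
Qed.

Lemma retract_refl X : retract_of X X.
Proof. by exists 1%:M, 1%:M; split; [exact: ulinear1 | exact: ulinear1 | rewrite mulmx1]. Qed.

Lemma retract_trans X Y W : retract_of X Y -> retract_of Y W -> retract_of X W.
Proof.
move=> [i [p [li lp pi]]] [i' [p' [li' lp' pi']]]; exists (i' *m i), (p *m p'); split.
- exact: (ulinear_mul (V := Y)).
- exact: (ulinear_mul (V := Y)).
by rewrite mulmxA -(mulmxA p) pi' mulmx1.
Qed.

Lemma retract_tens X X' Y Y' : retract_of X Y -> retract_of X' Y' ->
  retract_of (tens X X') (tens Y Y').
Proof.
move=> [i [p [li lp pi]]] [i' [p' [li' lp' pi']]]; exists (tensmx i i'), (tensmx p p'); split.
- exact: ulinear_tens.
- exact: ulinear_tens.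
by rewrite tensmx_mul pi pi' tensmx1.
Qed.

Lemma retract_dual X Y : retract_of X Y -> retract_of (dual_mod X) (dual_mod Y).
Proof.
move=> [i [p [li lp pi]]]; exists p^T, i^T; split; [exact: ulinear_dual | exact: ulinear_dual |].
by rewrite -trmx_mul pi trmx1.
Qed.

(** The square of the antipode is conjugation by K, so K is an isomorphism from V to its bidual,
    realized on the same space. *)
Lemma retract_bidual V : weight_module r V -> retract_of (dual_mod (dual_mod V)) V.
Proof.
move=> wV; have rel := weight_relations wV.
have trN m n (A : 'M[C]_(m, n)) : (- A)^T = - A^T by apply/matrixP => x y; rewrite !mxE.
have NN n (A B : 'M[C]_n) : ((-1)%:M *m (((-1)%:M *m A)^T *m B^T))^T = B *m A.
  by rewrite !mul_scalar_mx !scaleN1r trN trmx_mul !trmxK mulmxN opprK.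
have NN' n (A B : 'M[C]_n) : ((-1)%:M *m (B^T *m ((-1)%:M *m A)^T))^T = A *m B.
  by rewrite !mul_scalar_mx !scaleN1r trN trmx_mul !trmxK mulNmx opprK.
have lK : ulinear (V := V) (W := dual_mod (dual_mod V)) (aK V).
  have eE : aE (dual_mod (dual_mod V)) = aK V *m (aE V *m aKi V).
    exact: NN.
  have eF : aF (dual_mod (dual_mod V)) = aK V *m aF V *m aKi V.
    exact: NN'.
  apply/ulinearP; split.
  - by rewrite eE -!mulmxA (rel_KiK rel) mulmx1.
  - by rewrite eF -!mulmxA (rel_KiK rel) mulmx1.
  - by rewrite /= trmxK.
  - by rewrite /= trmxK (rel_KiK rel) (rel_KKi rel).
  by rewrite dual_H dual_H trN trmxK opprK (rel_HK rel).
exists (aKi V), (aK V); split=> //; last by rewrite (rel_KKi rel).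
exact: ulinear_inv lK (rel_KiK rel) (rel_KKi rel).
Qed.

(** The antipode reverses the coproduct, so the flip is an isomorphism. *)
Lemma retract_dual_tens X Y : weight_module r X -> weight_module r Y ->
  retract_of (dual_mod (tens X Y)) (tens (dual_mod Y) (dual_mod X)).
Proof.
move=> wX wY; have rX := weight_relations wX; have rY := weight_relations wY.
have lf : ulinear (V := dual_mod (tens X Y)) (W := tens (dual_mod Y) (dual_mod X)) (flip R (udim X) (udim Y)).
  have tN m n p l (A : 'M[C]_(m, n)) (B : 'M[C]_(p, l)) : tensmx (- A) B = - tensmx A B.
    by rewrite -scaleN1r tensmxZl scaleN1r.
  have tN' m n p l (A : 'M[C]_(m, n)) (B : 'M[C]_(p, l)) : tensmx A (- B) = - tensmx A B.
    by rewrite -scaleN1r tensmxZr scaleN1r.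
  have eE : aE (dual_mod (tens X Y)) = tensmx (aKi X)^T (aE (dual_mod Y)) + tensmx (aE (dual_mod X)) 1%:M.
    rewrite !dual_E tN tN' -opprD; congr (- _).
    have -> : aE (tens X Y) *m aKi (tens X Y) = tensmx (aKi X) (aE Y *m aKi Y) + tensmx (aE X *m aKi X) 1%:M.
      by rewrite /= mulmxDl !tensmx_mul mul1mx (rel_KKi rY).
    by rewrite linearD /= !trmx_tens trmx1.
  have eF : aF (dual_mod (tens X Y)) = tensmx 1%:M (aF (dual_mod Y)) + tensmx (aF (dual_mod X)) (aK Y)^T.
    rewrite !dual_F tN tN' -opprD; congr (- _).
    have -> : aK (tens X Y) *m aF (tens X Y) = tensmx 1%:M (aK Y *m aF Y) + tensmx (aK X *m aF X) (aK Y).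
      by rewrite /= mulmxDr !tensmx_mul mulmx1 (rel_KKi rX).
    by rewrite linearD /= !trmx_tens trmx1.
  have eH : aH (dual_mod (tens X Y)) = tensmx (aH (dual_mod X)) 1%:M + tensmx 1%:M (aH (dual_mod Y)).
    rewrite !dual_H tN tN' -opprD; congr (- _).
    by rewrite /= linearD /= !trmx_tens !trmx1.
  apply/ulinearP; split.
  - by rewrite eE mulmxDr !flip_nat -mulmxDl addrC.
  - by rewrite eF mulmxDr !flip_nat -mulmxDl addrC.
  - by rewrite /= trmx_tens flip_nat.
  - by rewrite /= trmx_tens flip_nat.
  by rewrite eH mulmxDr !flip_nat -mulmxDl addrC.
exists (flip R (udim X) (udim Y)), (flip R (udim Y) (udim X)); split=> //; last exact: flipK.
apply: ulinear_inv lf _ _; exact: flipK.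
Qed.

(** Tensor products are built from elements of A and their duals; retracts absorb the isomorphisms
    with biduals and with the reversed product of duals. *)
Lemma tensor_product_dual Y : tensor_product_of_A r Y ->
  exists2 Y', tensor_product_of_A r Y' & retract_of (dual_mod Y) Y'.
Proof.
elim=> {Y} [X hX|X hX|X Y tX [X' tX' rX] tY [Y' tY' rY]].
- by exists (dual_mod X); [exact: TPdual | exact: retract_refl].
- by exists X; [exact: TPA | apply: retract_bidual; case: (inA_weight hX)].
have [wX _] := tensor_product_weight tX; have [wY _] := tensor_product_weight tY.
exists (tens Y' X'); first exact: TPtens.
exact: retract_trans (retract_dual_tens wX wY) (retract_tens rY rX).
Qed.

Lemma in_D_dual V : in_D r V -> in_D r (dual_mod V).
Proof.
move=> [wV [k [X [[inj [prj [lip pi pij ip]]] hX]]]]; split; first exact: dual_weight.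
exists k, (fun j => dual_mod (X j)); split.
  exists (fun j => (prj j)^T), (fun j => (inj j)^T); split=> [j|j|j l jl|].
  - by have [li lp] := lip j; split; exact: ulinear_dual.
  - by rewrite -trmx_mul pi trmx1.
  - by rewrite -trmx_mul pij ?trmx0 // eq_sym.
  rewrite -[RHS]trmx1 -ip linear_sum; apply: eq_bigr => j _; exact: esym (trmx_mul _ _).
move=> j; have [wX [Y tY rXY]] := hX j; split; first exact: dual_weight.
have [Y' tY' rY] := tensor_product_dual tY.
by exists Y' => //; apply: retract_trans rY; apply: retract_dual.
Qed.

Lemma in_D_tens V W : in_D r V -> in_D r W -> in_D r (tens V W).
Proof.
move=> [wV [k [X [[inj [prj [lip pi pij ip]]] hX]]]] [wW [l [X' [[inj' [prj' [lip' pi' pij' ip']]] hX']]]].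
split; first exact: tens_weight.
exists (k * l)%N, (fun j => tens (X (mxtens_unindex j).1) (X' (mxtens_unindex j).2)); split.
  exists (fun j => tensmx (inj (mxtens_unindex j).1) (inj' (mxtens_unindex j).2)),
    (fun j => tensmx (prj (mxtens_unindex j).1) (prj' (mxtens_unindex j).2)); split=> [j|j|j m jm|].
  - have [li lp] := lip (mxtens_unindex j).1; have [li' lp'] := lip' (mxtens_unindex j).2.
    by split; exact: ulinear_tens.
  - by rewrite tensmx_mul pi pi' tensmx1.
  - rewrite tensmx_mul; have [e1|n1] := eqVneq (mxtens_unindex j).1 (mxtens_unindex m).1; last by rewrite pij // tens0mx.
    rewrite pij' ?tensmx0 //; apply: contraNneq jm => e2; rewrite -(mxtens_unindexK j) -(mxtens_unindexK m).
    by case: (mxtens_unindex j) (mxtens_unindex m) e1 e2 => a b [c d] /= -> ->.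
  rewrite (reindex (@mxtens_index k l)); last first.
    by exists (@mxtens_unindex _ _) => j _; rewrite (mxtens_indexK, mxtens_unindexK).
  rewrite (eq_bigr (fun p : 'I_k * 'I_l => tensmx (inj p.1 *m prj p.1) (inj' p.2 *m prj' p.2))); last first.
    by case=> a b _; rewrite mxtens_indexK tensmx_mul.
  rewrite -(pair_bigA _ (fun (a : 'I_k) (b : 'I_l) => tensmx (inj a *m prj a) (inj' b *m prj' b))) /= -tensmx1 -ip -ip'.
  rewrite (big_morph _ (fun A A' => tensmxDl A A' _) (tens0mx _)); apply: eq_bigr => a _.
  by rewrite (big_morph _ (fun B B' => tensmxDr _ B B') (tensmx0 _)).
move=> j; have [wX [Y tY rXY]] := hX (mxtens_unindex j).1; have [wX' [Y' tY' rXY']] := hX' (mxtens_unindex j).2.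
split; first exact: tens_weight.
by exists (tens Y Y'); [exact: TPtens | exact: retract_tens].
Qed.

(** The unit is C^H_0, a member of A; the identity matrix is an isomorphism because q^0 = 1. *)
Lemma in_D_unit : in_D r (unit_mod R).
Proof.
have wU := unit_weight R hr; split=> //.
have l1 : ulinear (1%:M : 'M[C]_(udim (unit_mod R))) by exact: ulinear1.
exists 1%N, (fun=> unit_mod R); split.
  exists (fun=> 1%:M), (fun=> 1%:M); split=> // [j|j l|]; first by rewrite mulmx1.
    by rewrite (ord1 j) (ord1 l) eqxx.
  by rewrite big_ord1 mulmx1.
move=> _; split=> //; exists (Cmod R r 0); first by apply: TPA; exact: inA_C.
have h0 : (0%:~R * r%:R : C) = 0 by rewrite mul0r.
have lc : ulinear (V := unit_mod R) (W := Cmod R r 0) 1%:M.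
  apply/ulinearP; split; rewrite /= ?h0 ?oppr0 ?qpow0 ?mulmx0 ?mul0mx //.
  by rewrite mulmx1 raddf0.
exists 1%:M, 1%:M; split=> //; last by rewrite mulmx1.
by apply: ulinear_inv lc _ _; rewrite mulmx1.
Qed.

End ClosureD.

(** * The Hermitian ribbon category *)

Section Coherence.
Variable R : realType.
Local Notation C := R[i].
Implicit Types (U V W X : umod R).

Lemma eq_tensv3 m n p k (A B : 'M[C]_(k, m * n * p)) :
  (forall u v w, A *m tensv (tensv u v) w = B *m tensv (tensv u v) w) -> A = B.
Proof.
move=> h; apply/matrixP => i j; case: (mxtens_indexP j) => j1 j2; case: (mxtens_indexP j1) => j3 j4.
have /matrixP/(_ i 0) := h (delta_mx j3 0) (delta_mx j4 0) (delta_mx j2 0).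
by rewrite !tensv_delta -!colE [LHS]mxE [RHS]mxE.
Qed.

Lemma eq_tensv4 m n p q k (A B : 'M[C]_(k, m * n * p * q)) :
  (forall u v w x, A *m tensv (tensv (tensv u v) w) x = B *m tensv (tensv (tensv u v) w) x) -> A = B.
Proof.
move=> h; apply/matrixP => i j; case: (mxtens_indexP j) => j1 j2; case: (mxtens_indexP j1) => j3 j4.
case: (mxtens_indexP j3) => j5 j6.
have /matrixP/(_ i 0) := h (delta_mx j5 0) (delta_mx j6 0) (delta_mx j4 0) (delta_mx j2 0).
by rewrite !tensv_delta -!colE [LHS]mxE [RHS]mxE.
Qed.

Definition amx m n p : 'M[C]_(m * (n * p), m * n * p) := idcast_mx R _ _.
Definition aVmx m n p : 'M[C]_(m * n * p, m * (n * p)) := idcast_mx R _ _.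

Lemma aVmxK m n p : amx m n p *m aVmx m n p = 1%:M.
Proof. by apply: idcastK; rewrite mulnA. Qed.

Lemma amxK m n p : aVmx m n p *m amx m n p = 1%:M.
Proof. by apply: idcastK; rewrite mulnA. Qed.

Lemma amx_tensv m n p (u : 'cV[C]_m) (v : 'cV[C]_n) (w : 'cV[C]_p) :
  amx m n p *m tensv (tensv u v) w = tensv u (tensv v w).
Proof. exact: assoc_tensv. Qed.

Lemma aVmx_tensv m n p (u : 'cV[C]_m) (v : 'cV[C]_n) (w : 'cV[C]_p) :
  aVmx m n p *m tensv u (tensv v w) = tensv (tensv u v) w.
Proof. exact: assocV_tensv. Qed.

Lemma amx_nat m m' n n' p p' (f : 'M[C]_(m', m)) (g : 'M[C]_(n', n)) (h : 'M[C]_(p', p)) :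
  amx m' n' p' *m tensmx (tensmx f g) h = tensmx f (tensmx g h) *m amx m n p.
Proof.
apply: eq_tensv3 => u v w.
by rewrite -[LHS]mulmxA -[RHS]mulmxA amx_tensv !tensv_mul amx_tensv.
Qed.

Lemma amx_pentagon m n p q :
  tensmx 1%:M (amx n p q) *m amx m (n * p) q *m tensmx (amx m n p) 1%:M = amx m n (p * q) *m amx (m * n) p q.
Proof.
apply: eq_tensv4 => u v w x; rewrite -[LHS]mulmxA -[RHS]mulmxA tensv_mul !amx_tensv mul1mx.
by rewrite -[LHS]mulmxA amx_tensv tensv_mul amx_tensv mul1mx.
Qed.

Definition lmx m : 'M[C]_(m, 1 * m) := idcast_mx R _ _.
Definition rmx m : 'M[C]_(m, m * 1) := idcast_mx R _ _.

Lemma lmx_tensv m (u : 'cV[C]_1) (v : 'cV[C]_m) : lmx m *m tensv u v = u 0 0 *: v.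
Proof. exact: lunit_tensv. Qed.

Lemma rmx_tensv m (u : 'cV[C]_1) (v : 'cV[C]_m) : rmx m *m tensv v u = u 0 0 *: v.
Proof. exact: runit_tensv. Qed.

Lemma lmx_nat m n (f : 'M[C]_(n, m)) : lmx n *m tensmx 1%:M f = f *m lmx m.
Proof.
by apply: eq_tensv => u v; rewrite -!mulmxA tensv_mul !lmx_tensv mul1mx scalemxAr.
Qed.

Lemma rmx_nat m n (f : 'M[C]_(n, m)) : rmx n *m tensmx f 1%:M = f *m rmx m.
Proof.
by apply: eq_tensv => v u; rewrite -!mulmxA tensv_mul !rmx_tensv mul1mx scalemxAr.
Qed.

Lemma amx_triangle m n : tensmx 1%:M (lmx n) *m amx m 1 n = tensmx (rmx m) 1%:M.
Proof.
apply: eq_tensv3 => u v w.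
by rewrite -mulmxA amx_tensv !tensv_mul lmx_tensv rmx_tensv !mul1mx tensvZl tensvZr.
Qed.

Lemma amx_lin U V W : ulinear (V := tens (tens U V) W) (W := tens U (tens V W)) (amx (udim U) (udim V) (udim W)).
Proof.
apply/ulinearP; split; rewrite /= ?mulmxDl ?mulmxDr ?tensmxDl ?tensmxDr ?mulmxDl ?mulmxDr -?tensmx1 ?amx_nat ?addrA //.
Qed.

Lemma aVmx_lin U V W : ulinear (V := tens U (tens V W)) (W := tens (tens U V) W) (aVmx (udim U) (udim V) (udim W)).
Proof. exact: ulinear_inv (@amx_lin U V W) (amxK _ _ _) (aVmxK _ _ _). Qed.

Lemma lmx_lin V : ulinear (V := tens (unit_mod R) V) (W := V) (lmx (udim V)).
Proof.
apply/ulinearP; split; rewrite /= ?mulmxDr ?tens0mx ?mulmx0 ?add0r ?addr0; exact: lmx_nat.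
Qed.

Lemma rmx_lin V : ulinear (V := tens V (unit_mod R)) (W := V) (rmx (udim V)).
Proof.
apply/ulinearP; split; rewrite /= ?mulmxDr ?tensmx0 ?mulmx0 ?add0r ?addr0; exact: rmx_nat.
Qed.

Definition lVmx m : 'M[C]_(1 * m, m) := idcast_mx R _ _.
Definition rVmx m : 'M[C]_(m * 1, m) := idcast_mx R _ _.

Lemma lmxK m : lVmx m *m lmx m = 1%:M. Proof. by apply: idcastK; rewrite mul1n. Qed.
Lemma lVmxK m : lmx m *m lVmx m = 1%:M. Proof. by apply: idcastK; rewrite mul1n. Qed.
Lemma rmxK m : rVmx m *m rmx m = 1%:M. Proof. by apply: idcastK; rewrite muln1. Qed.
Lemma rVmxK m : rmx m *m rVmx m = 1%:M. Proof. by apply: idcastK; rewrite muln1. Qed.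

Lemma coev_mxE V : coev_mx V = \sum_j tensv (delta_mx j 0) (delta_mx j 0).
Proof.
apply: trmx_inj; rewrite -ev_tr trmxK; apply: eq_tensv => p v.
rewrite ev_tensv linear_sum mulmx_suml /=; apply/matrixP => i k; rewrite !ord1 !mxE summxE.
apply: eq_bigr => j _; rewrite tensv_delta trmx_delta -rowE mxE.
by rewrite mxE tensvE.
Qed.

Lemma zigzag_mx V :
  rmx (udim V) *m tensmx 1%:M (ev_mx V) *m amx (udim V) (udim V) (udim V) *m tensmx (coev_mx V) 1%:M = lmx (udim V).
Proof.
apply: eq_tensv => u v; rewrite -[LHS]mulmxA tensv_mul mul1mx lmx_tensv.
have -> : coev_mx V *m u = u 0 0 *: coev_mx V by rewrite [u]mx11_scalar mul_mx_scalar mxE.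
rewrite tensvZl -scalemxAr coev_mxE tensv_suml mulmx_sumr; congr (_ *: _).
rewrite [RHS](_ : v = \sum_j v j 0 *: delta_mx j 0); last first.
  by apply/colP => i; rewrite summxE (bigD1 i) //= !mxE eqxx mulr1 big1 ?addr0 // => j ji; rewrite !mxE eq_sym (negPf ji) mulr0.
apply: eq_bigr => j _; rewrite -[LHS]mulmxA amx_tensv -[LHS]mulmxA tensv_mul mul1mx ev_tensv rmx_tensv.
by rewrite trmx_delta -rowE mxE.
Qed.

Lemma zigzag_dual_mx V :
  lmx (udim V) *m tensmx (ev_mx V) 1%:M *m aVmx (udim V) (udim V) (udim V) *m tensmx 1%:M (coev_mx V) = rmx (udim V).
Proof.
apply: eq_tensv => v u; rewrite -[LHS]mulmxA tensv_mul mul1mx rmx_tensv.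
have -> : coev_mx V *m u = u 0 0 *: coev_mx V by rewrite [u]mx11_scalar mul_mx_scalar mxE.
rewrite tensvZr -scalemxAr coev_mxE tensv_sumr mulmx_sumr; congr (_ *: _).
rewrite [RHS](_ : v = \sum_j v j 0 *: delta_mx j 0); last first.
  by apply/colP => i; rewrite summxE (bigD1 i) //= !mxE eqxx mulr1 big1 ?addr0 // => j ji; rewrite !mxE eq_sym (negPf ji) mulr0.
apply: eq_bigr => j _; rewrite -[LHS]mulmxA aVmx_tensv -[LHS]mulmxA tensv_mul mul1mx ev_tensv lmx_tensv.
by rewrite -colE !mxE.
Qed.

End Coherence.

Section RibbonLaws.
Variables (R : realType) (r : nat).
Hypothesis hr : (2 <= r)%N.
Local Notation D := (Ddagger R r).
Implicit Types (U V W X : ob D).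

Lemma ob_weight V : isob V -> weight_module r V. Proof. by case=> /herm_weight. Qed.
Lemma ob_real V : isob V -> real_weights V. Proof. by case=> _; exact: in_D_real. Qed.

Lemma Ddagger_category : category_laws D.
Proof.
split=> [V hV|U V W g f [_ hW lg] [hU _ lf]|V W f _|V W f _|U V W X h g f _ _ _].
- by split=> //; exact: ulinear1.
- by split=> //; exact: ulinear_mul lg lf.
- exact: mul1mx.
- exact: mulmx1.
exact: mulmxA.
Qed.

Lemma hunit_ob : in_Ddagger r (hunit R).
Proof.
split; last exact: in_D_unit.
apply/hermitian_moduleP; split; [exact: unit_weight | exact: ctr1 | exact: unitmx1 |].
by apply: pairing_gen; rewrite /= ?ctr0 ?ctr1 ?mul0mx ?mulmx0.
Qed.

Lemma htens_ob V W : isob V -> isob W -> in_Ddagger r (htens r V W).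
Proof.
move=> hV hW; split; last by apply: in_D_tens => //; [case: hV | case: hW].
by apply: htens_hermitian => //; [case: hV | case: hW | exact: ob_real | exact: ob_real].
Qed.

Lemma hdual_ob V : isob V -> in_Ddagger r (hdual V).
Proof. by case=> hV dV; split; [exact: hdual_hermitian | exact: in_D_dual]. Qed.

Lemma Ddagger_monoidal : monoidal_laws D.
Proof.
have tob_ob V W : isob V -> isob W -> isob (tob V W) by exact: htens_ob.
split.
- exact: hunit_ob.
- exact: tob_ob.
- move=> V V' W W' f g [hV hV' lf] [hW hW' lg]; split; [exact: tob_ob | exact: tob_ob |].
  exact: ulinear_tens lf lg.
- by move=> V W _ _; exact: tensmx1.
- by move=> V V' V'' W W' W'' f' f g' g _ _ _ _; exact: esym (tensmx_mul _ _ _ _).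
- move=> U V W hU hV hW; split; [exact: tob_ob (tob_ob _ _ hU hV) hW | exact: tob_ob hU (tob_ob _ _ hV hW) |].
  exact: amx_lin.
- move=> U V W hU hV hW; split; [exact: tob_ob hU (tob_ob _ _ hV hW) | exact: tob_ob (tob_ob _ _ hU hV) hW |].
  exact: aVmx_lin.
- by move=> U V W _ _ _; split; [exact: amxK | exact: aVmxK].
- by move=> U U' V V' W W' f g h _ _ _; exact: amx_nat.
- move=> V hV; have hu := hunit_ob; split; first by split; [exact: tob_ob | | exact: lmx_lin].
  exists (lVmx R (udim V)); last by split; [exact: lmxK | exact: lVmxK].
  split=> //; first exact: tob_ob.
  exact: ulinear_inv (@lmx_lin R V) (lmxK _ _) (lVmxK _ _).
- by move=> V W f _; exact: lmx_nat.
- move=> V hV; have hu := hunit_ob; split; first by split; [exact: tob_ob | | exact: rmx_lin].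
  exists (rVmx R (udim V)); last by split; [exact: rmxK | exact: rVmxK].
  split=> //; first exact: tob_ob.
  exact: ulinear_inv (@rmx_lin R V) (rmxK _ _) (rVmxK _ _).
- by move=> V W f _; exact: rmx_nat.
- by move=> U V W X _ _ _ _; exact: amx_pentagon.
by move=> V W _ _; exact: amx_triangle.
Qed.

Lemma Ddagger_braiding : braiding_laws D.
Proof.
split.
- move=> V W hV hW; have wV := ob_weight hV; have wW := ob_weight hW.
  have lc := braiding_lin hr wV wW; have [cc1 cc2] := braiding_inv hr wV wW.
  split; first by split; [exact: htens_ob | exact: htens_ob | exact: lc].
  exists (invmx (Rmatrix r V W) *m flip R (udim W) (udim V)); last by [].
  by split; [exact: htens_ob | exact: htens_ob | exact: ulinear_inv lc cc2 cc1].
- move=> V V' W W' f g [/ob_weight wV /ob_weight wV' lf] [/ob_weight wW /ob_weight wW' lg].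
  exact: braiding_nat wV wV' wW wW' lf lg.
- by move=> U V W /ob_weight wU /ob_weight wV /ob_weight wW; exact: (braid_hexl hr wU wV wW).
by move=> U V W /ob_weight wU /ob_weight wV /ob_weight wW; exact: (braid_hexr hr wU wV wW).
Qed.

Lemma Ddagger_twist : twist_laws D.
Proof.
split.
- move=> V hV; have wV := ob_weight hV; have lt := twist_lin hr wV; have ut := twist_unit hr wV.
  split; first by split.
  exists (invmx (twist_mx r V)); first by split=> //; exact: ulinear_invmx.
  by split; [exact: mulVmx | exact: mulmxV].
- by move=> V W f [/ob_weight wV /ob_weight wW lf]; exact: (twist_nat hr wV wW lf).
by move=> V W /ob_weight wV /ob_weight wW; exact: twist_tens.
Qed.

Lemma Ddagger_duality : duality_laws D.
Proof.
split.
- exact: hdual_ob.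
- move=> V hV; split; [exact: htens_ob (hdual_ob hV) hV | exact: hunit_ob |].
  exact: ev_lin (ob_weight hV).
- move=> V hV; split; [exact: hunit_ob | exact: htens_ob hV (hdual_ob hV) |].
  exact: coev_lin (ob_weight hV).
- by move=> V _; exact: zigzag_mx.
- by move=> V _; exact: zigzag_dual_mx.
move=> V /ob_weight wV; rewrite [LHS]/(tensmx (twist_mx r V) 1%:M *m coev_mx V).
rewrite [RHS]/(tensmx 1%:M (twist_mx r (dual_mod V)) *m coev_mx V) (twist_dualE hr wV).
by rewrite [RHS]coev_tensmx mul1mx trmxK.
Qed.

Lemma Ddagger_ribbon : ribbon_category D.
Proof.
by split; [exact: Ddagger_category | exact: Ddagger_monoidal | exact: Ddagger_braiding | exact: Ddagger_twist | exact: Ddagger_duality].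
Qed.

End RibbonLaws.

Section MulmxAssoc.
Variables (F : pzSemiRingType) (m n p k l t : nat).
Variables (A : 'M[F]_(m, n)) (B : 'M[F]_(n, p)) (D : 'M[F]_(p, k)) (E : 'M[F]_(k, l)) (G : 'M[F]_(l, t)).

Lemma mulmxA5 : A *m (B *m D *m E) *m G = A *m (B *m (D *m (E *m G))).
Proof. by rewrite !mulmxA. Qed.

Lemma mulmxA5' s (K : 'M[F]_(t, s)) :
  A *m (B *m (D *m (E *m G))) *m K = A *m (B *m (D *m (E *m G *m K))).
Proof. by rewrite !mulmxA. Qed.

End MulmxAssoc.

Lemma mulmx_swap (F : pzSemiRingType) m n (P : 'M[F]_(m, n)) (A B S T K : 'M[F]_n) :
  A *m B = B *m A -> A *m S = T -> P *m A *m (B *m (S *m K)) = P *m B *m (T *m K).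
Proof. by move=> e <-; rewrite -!mulmxA (mulmxA A B) e -!mulmxA. Qed.

Lemma mulmx_slide (F : pzSemiRingType) m n (J : 'M[F]_(m, n)) (P S K : 'M[F]_m) (P' S' K' : 'M[F]_n) :
  P *m J = J *m P' -> S *m J = J *m S' -> K *m J = J *m K' ->
  P *m (S *m K) *m J = J *m (P' *m (S' *m K')).
Proof.
by move=> eP eS eK; rewrite -!mulmxA eK (mulmxA S) eS -!mulmxA (mulmxA P) eP -!mulmxA.
Qed.

Lemma mulmx_conj (F : pzSemiRingType) m n (J : 'M[F]_(m, n)) (J' : 'M[F]_(n, m)) (P S : 'M[F]_m) (P' S' : 'M[F]_n) :
  J' *m J = 1%:M -> P *m J = J *m P' -> S *m J = J *m S' ->
  J' *m (P *m S) *m J = P' *m S'.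
Proof.
move=> eJ eP eS; rewrite -!mulmxA eS (mulmxA P) eP -!mulmxA (mulmxA J') eJ mul1mx //.
Qed.

(** For the unitarity of the braiding c: its adjoint d, moved across the product forms, becomes ci,
    which cancels the opposite braiding c' contained in the form on the target. *)
Lemma mulmx_braid (F : pzSemiRingType) m n (c : 'M[F]_(n, m)) (d : 'M[F]_(m, n)) (f : 'M[F]_(m, n)) (f' : 'M[F]_(n, m))
    (c' : 'M[F]_(m, n)) (ci : 'M[F]_(n, m)) (G : 'M[F]_n) (G' K T : 'M[F]_m) (J T' : 'M[F]_n) :
  d *m (G *m f') = G' *m (f *m ci) -> ci *m c' = 1%:M -> K *m c' = c' *m J -> T' *m c = c *m T ->
  d *m (G *m (f' *m (K *m c' *m T'))) *m c = G' *m (f *m (J *m c *m T)).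
Proof.
move=> e1 e2 e3 e4; have -> : d *m (G *m (f' *m (K *m c' *m T'))) *m c = d *m (G *m f') *m (K *m c' *m (T' *m c)).
  by rewrite !mulmxA.
rewrite e1 e3 e4; have -> : G' *m (f *m ci) *m (c' *m J *m (c *m T)) = G' *m (f *m (ci *m c' *m (J *m c *m T))).
  by rewrite !mulmxA.
by rewrite e2 mul1mx.
Qed.

Lemma mulmx_sandwich (F : comUnitRingType) m n p k l (A : 'M[F]_(m, n)) (B : 'M[F]_(n, p)) (X : 'M[F]_(p, k)) (E : 'M[F]_(k, l)) G :
  G \in unitmx -> A *m (B *m X) *m E = A *m B *m G *m (invmx G *m X *m E).
Proof. by move=> uG; rewrite !mulmxA mulmxK. Qed.

Lemma mulmx_fix_sq (F : pzSemiRingType) n (A G S : 'M[F]_n) :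
  A *m G *m S = G -> A *m A *m G *m (S *m S) = G.
Proof. by move=> e; rewrite mulmxA -(mulmxA A) -(mulmxA A) e. Qed.

(** * The conjugation laws *)

Section Conjugation.
Variables (R : realType) (r : nat).
Hypothesis hr : (2 <= r)%N.
Local Notation C := R[i].
Local Notation D := (Ddagger R r).
Local Notation half := (half hr).
Local Notation a_ := (@amx R).
Local Notation aV_ := (@aVmx R).

(** The factor by which the form on V (x) W differs from the product form. Unlike [Xmap] it keeps
    the order of the factors, so the comparison of iterated forms becomes an identity between
    R-matrices. *)
Definition Ymx (V W : umod R) : 'M[C]_(udim V * udim W) := flip R (udim W) (udim V) *m Xmap r V W.

Lemma YmxE (V W : umod R) : weight_module r V -> weight_module r W ->
  Ymx V W = Rmatrix r V W *m (tensmx (half V) (half W) *m invmx (half (tens V W))).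
Proof.
move=> wV wW; have wVW := tens_weight hr wV wW; have wWV := tens_weight hr wW wV.
rewrite /Ymx /Xmap !(half_twistE hr) //.
have uU := half_unit hr wWV; have uZ := half_unit hr wVW.
rewrite (invmx_nat uU uZ (half_nat hr wVW wWV (braiding_lin hr wV wW))).
have lS : ulinear (V := tens V W) (W := tens V W) (tensmx (half V) (half W)) by apply: ulinear_tens; exact: half_lin.
rewrite -(mulmxA (braiding _ _ _)) (invmx_nat uZ uZ (half_nat hr wVW wVW lS)) braidingE.
by rewrite -(mulmxA (flip _ _ _)) (mulmxA (flip _ _ _) (flip _ _ _)) flipK mul1mx.
Qed.

Lemma Ymx_nat (V V' W W' : umod R) (f : 'M[C]_(udim V', udim V)) (g : 'M[C]_(udim W', udim W)) :
  weight_module r V -> weight_module r V' -> weight_module r W -> weight_module r W' ->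
  ulinear f -> ulinear g -> Ymx V' W' *m tensmx f g = tensmx f g *m Ymx V W.
Proof.
move=> wV wV' wW wW' lf lg; have wVW := tens_weight hr wV wW; have wVW' := tens_weight hr wV' wW'.
have lfg := ulinear_tens lf lg.
rewrite !YmxE // -!(mulmxA (Rmatrix _ _ _)) -!(mulmxA (tensmx (half _) _)).
rewrite (invmx_nat (half_unit hr wVW') (half_unit hr wVW) (half_nat hr wVW wVW' lfg)).
rewrite (mulmxA (tensmx (half _) _)) tensmx_mul (half_nat hr wV wV' lf) (half_nat hr wW wW' lg) -tensmx_mul.
rewrite -(mulmxA (tensmx f g)) (mulmxA (Rmatrix _ _ _) (tensmx f g)) (Rmatrix_nat wV wV' wW wW' lf lg).
by rewrite -(mulmxA (tensmx f g)).
Qed.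

Lemma gram_htensE (V W : hmod R) : gram (htens r V W) = tensmx (gram V) (gram W) *m Ymx V W.
Proof. by []. Qed.

Lemma adjoint_unitary (V W : hmod R) (g : 'M[C]_(udim W, udim V)) h :
  gram V \in unitmx -> h *m g = 1%:M -> g *m h = 1%:M -> g^t* *m gram W *m g = gram V ->
  adjoint g *m g = 1%:M /\ g *m adjoint g = 1%:M.
Proof.
move=> uV hg gh e; have e1 : adjoint g *m g = 1%:M.
  by rewrite /adjoint -(mulmxA _ (g^t*)) -(mulmxA (invmx _)) e mulVmx.
by split=> //; rewrite -[adjoint g]mulmx1 -gh (mulmxA (adjoint g)) e1 mul1mx.
Qed.

Lemma adjointP (V W : hmod R) (g : 'M[C]_(udim W, udim V)) : gram V \in unitmx ->
  g^t* *m gram W = gram V *m adjoint g.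
Proof. by move=> uV; rewrite /adjoint -(mulmxA (invmx _)) mulKVmx. Qed.

Lemma adjoint_lin (V W : hmod R) (g : 'M[C]_(udim W, udim V)) :
  hermitian_module r V -> hermitian_module r W -> ulinear g -> ulinear (V := W) (W := V) (adjoint g).
Proof.
move=> /hermitian_moduleP[wV sV uV pV] /hermitian_moduleP[wW sW uW pW] lg x.
apply: (can_inj (mulKmx uV)); rewrite (mulmxA (gram V) (adjoint g)) -adjointP // (mulmxA (gram V) (uact V x)) -pV -[RHS]mulmxA -adjointP //.
by rewrite -[LHS]mulmxA -pW !mulmxA -!ctrM lg.
Qed.

Lemma adjointK (V W : hmod R) (g : 'M[C]_(udim W, udim V)) :
  hermitian_module r V -> hermitian_module r W -> adjoint (adjoint g) = g.
Proof.
move=> /hermitian_moduleP[wV sV uV pV] /hermitian_moduleP[wW sW uW pW].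
rewrite {1}/adjoint /adjoint !ctrM ctr_inv ctrK sV sW -!mulmxA mulVmx // mulmx1.
by rewrite mulKmx.
Qed.

(** Adjoints of linear maps are linear, so naturality lets [Ymx] pass across their tensor
    product. *)
Lemma adjoint_tens (V V' W W' : hmod R) (f : 'M[C]_(udim V', udim V)) (g : 'M[C]_(udim W', udim W)) :
  hermitian_module r V -> hermitian_module r V' -> hermitian_module r W -> hermitian_module r W' ->
  ulinear f -> ulinear g -> gram (htens r V W) \in unitmx ->
  adjoint (V := htens r V W) (W := htens r V' W') (tensmx f g) = tensmx (adjoint f) (adjoint g).
Proof.
move=> hV hV' hW hW' lf lg u.
have [wV _ uV _] := (hermitian_moduleP r V).1 hV; have [wW _ uW _] := (hermitian_moduleP r W).1 hW.
have wV' := herm_weight hV'; have wW' := herm_weight hW'.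
apply: (can_inj (mulKmx u)); rewrite -adjointP // !gram_htensE ctr_tens mulmxA tensmx_mul !adjointP //.
rewrite -tensmx_mul -[LHS]mulmxA -[RHS]mulmxA; congr (_ *m _).
by rewrite (Ymx_nat wV' wV wW' wW (adjoint_lin hV hV' lf) (adjoint_lin hW hW' lg)).
Qed.

Definition rev3 m n p : 'M[C]_(p * (n * m), m * (n * p)) :=
  a_ p n m *m (flip R m (p * n) *m tensmx 1%:M (flip R n p)).

Lemma rev3_tensv m n p (u : 'cV[C]_m) (v : 'cV[C]_n) (w : 'cV[C]_p) :
  rev3 m n p *m tensv u (tensv v w) = tensv w (tensv v u).
Proof. by rewrite /rev3 -!mulmxA tensv_mul flip_tensv mul1mx flip_tensv amx_tensv. Qed.

Lemma rev3_inj m n p k (A B : 'M[C]_(m * (n * p), k)) : rev3 m n p *m A = rev3 m n p *m B -> A = B.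
Proof.
pose T : 'M[C]_(m * (n * p), p * (n * m)) := tensmx 1%:M (flip R p n) *m (flip R (p * n) m *m aV_ p n m).
have TK : T *m rev3 m n p = 1%:M.
  rewrite /T /rev3 -!mulmxA (mulmxA (aV_ _ _ _)) amxK mul1mx (mulmxA (flip _ _ _) (flip _ _ _)) flipK mul1mx.
  by rewrite tensmx_mul mulmx1 flipK tensmx1.
by move=> /(congr1 (mulmx T)); rewrite (mulmxA T (rev3 m n p) A) (mulmxA T (rev3 m n p) B) TK !mul1mx.
Qed.

Lemma rev3_amx m n p : rev3 m n p *m a_ m n p = flip R (n * m) p *m tensmx (flip R m n) 1%:M.
Proof.
by apply: eq_tensv3 => u v w; rewrite -[LHS]mulmxA -[RHS]mulmxA amx_tensv rev3_tensv tensv_mul mul1mx !flip_tensv.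
Qed.

(** After reversal of the three factors both sides are composites of braidings, equal by the two
    hexagons and the naturality of the braiding in its first argument. *)
Lemma yang_baxter (U V W : umod R) : weight_module r U -> weight_module r V -> weight_module r W ->
  tensmx 1%:M (Rmatrix r V W) *m Rmatrix r U (tens V W) *m a_ (udim U) (udim V) (udim W)
  = a_ (udim U) (udim V) (udim W) *m (tensmx (Rmatrix r U V) 1%:M *m Rmatrix r (tens U V) W).
Proof.
move=> wU wV wW; apply: rev3_inj.
have wUV := tens_weight hr wU wV; have wVU := tens_weight hr wV wU.
have lc := braiding_lin hr wU wV.
have hl := braid_hexl hr wU wV wW; have hR := braid_hexr hr wV wU wW.
rewrite -/(a_ _ _ _) -/(a_ _ _ _) -/(a_ _ _ _) in hl.
rewrite -/(aV_ _ _ _) -/(aV_ _ _ _) -/(aV_ _ _ _) in hR.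
have e1 : rev3 (udim U) (udim V) (udim W) *m (a_ (udim U) (udim V) (udim W) *m
    (tensmx (Rmatrix r U V) 1%:M *m Rmatrix r (tens U V) W)) =
    braiding r (tens V U) W *m tensmx (braiding r U V) 1%:M.
  rewrite (braiding_nat wUV wVU wW wW lc (ulinear1 W)) mulmxA rev3_amx -(mulmxA (flip _ _ _)).
  rewrite (mulmxA (tensmx (flip _ _ _) _)) tensmx_mul mul1mx -braidingE mulmxA flip_nat.
  by rewrite -[LHS]mulmxA; congr (_ *m _); exact: esym (braidingE _ _ _).
have e2 : rev3 (udim U) (udim V) (udim W) *m (tensmx 1%:M (Rmatrix r V W) *m Rmatrix r U (tens V W) *m
    a_ (udim U) (udim V) (udim W)) =
    a_ (udim W) (udim V) (udim U) *m (tensmx (braiding r V W) 1%:M *m (braiding r U (tens V W) *m a_ (udim U) (udim V) (udim W))).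
  rewrite /rev3 -(mulmxA (a_ _ _ _)) -(mulmxA (flip _ _ _)); congr (_ *m _).
  rewrite -(mulmxA (tensmx _ (Rmatrix _ _ _))) (mulmxA (tensmx _ (flip _ _ _))) tensmx_mul mulmx1 -braidingE.
  rewrite (mulmxA (flip _ _ _)) flip_nat -(mulmxA (tensmx _ _)) (mulmxA (flip _ _ _)).
  by congr (_ *m (_ *m _)); exact: esym (braidingE _ _ _).
rewrite e1 e2.
have e3 : braiding r (tens V U) W = a_ (udim W) (udim V) (udim U) *m (tensmx (braiding r V W) 1%:M *m
    (aV_ (udim V) (udim W) (udim U) *m (tensmx 1%:M (braiding r U W) *m a_ (udim V) (udim U) (udim W)))).
  have e (c : 'M[C]_(udim W * (udim V * udim U), udim V * udim U * udim W)) :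
      a_ (udim W) (udim V) (udim U) *m (aV_ (udim W) (udim V) (udim U) *m c *m aV_ (udim V) (udim U) (udim W))
        *m a_ (udim V) (udim U) (udim W) = c.
    by rewrite !mulmxA aVmxK mul1mx -mulmxA amxK mulmx1.
  by rewrite -[LHS]e hR; exact: mulmxA5.
rewrite e3 mulmxA5' -hl; congr (_ *m (_ *m _)).
by rewrite -(mulmxA (a_ _ _ _)) (mulmxA (aV_ _ _ _)) amxK mul1mx.
Qed.

(** The half twist of the inner tensor product occurs together with its inverse, and naturality of
    the R-matrix brings the two next to each other. [yang_baxter] compares what remains, the outer
    half twists being natural along the associator. *)
Lemma Ymx_assoc (U V W : umod R) : weight_module r U -> weight_module r V -> weight_module r W ->
  tensmx 1%:M (Ymx V W) *m Ymx U (tens V W) *m a_ (udim U) (udim V) (udim W)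
  = a_ (udim U) (udim V) (udim W) *m (tensmx (Ymx U V) 1%:M *m Ymx (tens U V) W).
Proof.
move=> wU wV wW; have wUV := tens_weight hr wU wV; have wVW := tens_weight hr wV wW.
have wl := tens_weight hr wUV wW; have wr := tens_weight hr wU wVW.
have lin (X : umod R) : weight_module r X -> ulinear (half X) by exact: half_lin.
have lS (X X' : umod R) : weight_module r X -> weight_module r X' ->
    ulinear (V := tens X X') (W := tens X X') (tensmx (half X) (half X') *m invmx (half (tens X X'))).
  move=> wX wX'; apply: (ulinear_mul (V := tens X X')); first by apply: ulinear_tens; exact: half_lin.
  by apply: ulinear_invmx; [apply: half_lin; exact: tens_weight | apply: half_unit; exact: tens_weight].
have el : tensmx (Ymx U V) 1%:M *m Ymx (tens U V) W = tensmx (Rmatrix r U V) 1%:M *m Rmatrix r (tens U V) W *m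
    (tensmx (tensmx (half U) (half V)) (half W) *m invmx (half (tens (tens U V) W))).
  rewrite !YmxE //; set A := tensmx (half U) (half V) *m _.
  have -> : tensmx (Rmatrix r U V *m A) 1%:M = tensmx (Rmatrix r U V) 1%:M *m tensmx A (1%:M : 'M[C]_(udim W)).
    by rewrite tensmx_mul mulmx1.
  apply: mulmx_swap; first exact: esym (Rmatrix_nat wUV wUV wW wW (lS _ _ wU wV) (ulinear1 W)).
  by rewrite tensmx_mul mul1mx /A mulmxKV ?(half_unit hr).
have er : tensmx 1%:M (Ymx V W) *m Ymx U (tens V W) = tensmx 1%:M (Rmatrix r V W) *m Rmatrix r U (tens V W) *m
    (tensmx (half U) (tensmx (half V) (half W)) *m invmx (half (tens U (tens V W)))).
  rewrite !YmxE //; set A := tensmx (half V) (half W) *m _.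
  have -> : tensmx 1%:M (Rmatrix r V W *m A) = tensmx 1%:M (Rmatrix r V W) *m tensmx (1%:M : 'M[C]_(udim U)) A.
    by rewrite tensmx_mul mulmx1.
  apply: mulmx_swap; first exact: esym (Rmatrix_nat wU wU wVW wVW (ulinear1 U) (lS _ _ wV wW)).
  by rewrite tensmx_mul mul1mx /A mulmxKV ?(half_unit hr).
rewrite el er; apply: mulmx_slide; [exact: yang_baxter | exact: esym (amx_nat _ _ _) |].
exact: invmx_nat (half_unit hr wr) (half_unit hr wl) (half_nat hr wl wr (@amx_lin R U V W)).
Qed.

(** On the unit E vanishes and the weight is 0, so the R-matrix is 1; the half twist of the unit is
    1 as well. *)
Lemma Ymx_unitl (V : umod R) : weight_module r V -> Ymx (unit_mod R) V = 1%:M.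
Proof.
move=> wV; have wU := unit_weight R hr; have w1 := tens_weight hr wU wV.
rewrite YmxE // half_unit_mod.
have -> : Rmatrix r (unit_mod R) V = 1%:M.
  apply: (eq_on_tens wU wV) => a b v w hv hw; rewrite mul1mx.
  have [->|v0] := eqVneq v 0; first by rewrite tensv0l mulmx0.
  have a0 : a = 0.
    by move: hv; rewrite /wt mul0mx => /esym/eqP; rewrite scaler_eq0 (negPf v0) orbF => /eqP.
  rewrite (Rmatrix_wt wU wV hv hw) (bigD1 (Ordinal (r_gt0 hr))) //= big1 => [|[[|n] nr] //= _].
    by rewrite !expmx0 !mul1mx Rcoef0 a0 mulr0 add0r !mul0r qpow0 mulr1 scale1r addr0.
  by rewrite (_ : 0 ^+ n.+1 = 0) ?mul0mx ?tensv0l ?scaler0 // expmxS mul0mx.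
have e : tensmx 1%:M (half V) = half (tens (unit_mod R) V).
  have := half_nat hr w1 wV (@lmx_lin R V); rewrite -lmx_nat => /(congr1 (mulmx (lVmx R (udim V)))).
  by rewrite !mulmxA lmxK !mul1mx.
by rewrite e mulmxV ?mulmx1 ?(half_unit hr w1).
Qed.

Lemma Ymx_unitr (V : umod R) : weight_module r V -> Ymx V (unit_mod R) = 1%:M.
Proof.
move=> wV; have wU := unit_weight R hr; have w1 := tens_weight hr wV wU.
rewrite YmxE // half_unit_mod.
have -> : Rmatrix r V (unit_mod R) = 1%:M.
  apply: (eq_on_tens wV wU) => a b v w hv hw; rewrite mul1mx.
  have [->|w0] := eqVneq w 0; first by rewrite tensv0r mulmx0.
  have b0 : b = 0.
    by move: hw; rewrite /wt mul0mx => /esym/eqP; rewrite scaler_eq0 (negPf w0) orbF => /eqP.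
  rewrite (Rmatrix_wt wV wU hv hw) (bigD1 (Ordinal (r_gt0 hr))) //= big1 => [|[[|n] nr] //= _].
    by rewrite !expmx0 !mul1mx Rcoef0 b0 mulr0 subr0 mulr0 mul0r qpow0 mulr1 scale1r addr0.
  by rewrite (_ : 0 ^+ n.+1 = 0) ?mul0mx ?tensv0r ?scaler0 // expmxS mul0mx.
have e : tensmx (half V) 1%:M = half (tens V (unit_mod R)).
  have := half_nat hr w1 wV (@rmx_lin R V); rewrite -rmx_nat => /(congr1 (mulmx (rVmx R (udim V)))).
  by rewrite !mulmxA rmxK !mul1mx.
by rewrite e mulmxV ?mulmx1 ?(half_unit hr w1).
Qed.

Lemma idcast_ctr m n : (idcast_mx R m n)^t* = idcast_mx R n m.
Proof. by apply/matrixP => i j; rewrite !mxE rmorph_nat eq_sym. Qed.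

Lemma Ddagger_conjugation : conjugation_laws D.
Proof.
have hm (V : ob D) : isob V -> hermitian_module r V by case.
have ug (V : ob D) : isob V -> gram V \in unitmx by move=> /hm /hermitian_moduleP[].
have unitary (V W : ob D) (g : 'M[C]_(udim W, udim V)) h : isob V -> h *m g = 1%:M -> g *m h = 1%:M ->
    g^t* *m gram W *m g = gram V -> inverse (D := D) (V := V) (W := W) g (adjoint g).
  by move=> /ug uV hg gh e; exact: adjoint_unitary uV hg gh e.
split.
- by move=> V W f [hV hW lf]; split=> //; apply: adjoint_lin => //; exact: hm.
- by move=> V W f [hV hW lf]; apply: adjointK; exact: hm.
- move=> V V' W W' f g [hV hV' lf] [hW hW' lg].
  by apply: adjoint_tens => //; try exact: hm; apply: ug; exact: htens_ob.
- move=> U V W f g [hV hW lf] [hU _ lg]; rewrite [LHS]/(adjoint (f *m g)) [RHS]/(adjoint g *m adjoint f) /adjoint ctrM.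
  exact: mulmx_sandwich (ug _ hV).
- move=> U V W hU hV hW; have wU := ob_weight hU; have wV := ob_weight hV; have wW := ob_weight hW.
  apply: (unitary (tob (tob U V) W) (tob U (tob V W)) (a_ _ _ _) (aV_ (udim U) (udim V) (udim W))).
  + exact: htens_ob (htens_ob hr hU hV) hW.
  + exact: amxK.
  + exact: aVmxK.
  have -> : (a_ (udim U) (udim V) (udim W))^t* = aV_ (udim U) (udim V) (udim W) by exact: idcast_ctr.
  have eR : gram (htens r U (htens r V W)) = tensmx (gram U) (tensmx (gram V) (gram W)) *m
      (tensmx 1%:M (Ymx V W) *m Ymx U (tens V W)).
    by rewrite [RHS]mulmxA tensmx_mul mulmx1.
  have eL : gram (htens r (htens r U V) W) = tensmx (tensmx (gram U) (gram V)) (gram W) *m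
      (tensmx (Ymx U V) 1%:M *m Ymx (tens U V) W).
    by rewrite [RHS]mulmxA tensmx_mul mulmx1.
  rewrite [gram (tob U _)]eR [RHS]eL; apply: mulmx_conj; [exact: amxK | exact: esym (amx_nat _ _ _) |].
  exact: Ymx_assoc.
- move=> V hV; have wV := ob_weight hV.
  apply: (unitary (tob uob V) V (lmx R (udim V)) (lVmx R (udim V))); [exact: htens_ob (hunit_ob R hr) hV | exact: lmxK | exact: lVmxK |].
  have -> : (lmx R (udim V))^t* = lVmx R (udim V) by exact: idcast_ctr.
  have -> : gram (tob uob V) = tensmx 1%:M (gram V) *m Ymx (unit_mod R) V by [].
  by rewrite (Ymx_unitl wV) mulmx1 -mulmxA -lmx_nat mulmxA lmxK mul1mx.
move=> V hV; have wV := ob_weight hV.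
apply: (unitary (tob V uob) V (rmx R (udim V)) (rVmx R (udim V))); [exact: htens_ob hV (hunit_ob R hr) | exact: rmxK | exact: rVmxK |].
have -> : (rmx R (udim V))^t* = rVmx R (udim V) by exact: idcast_ctr.
have -> : gram (tob V uob) = tensmx (gram V) 1%:M *m Ymx V (unit_mod R) by [].
by rewrite (Ymx_unitr wV) mulmx1 -mulmxA -rmx_nat mulmxA rmxK mul1mx.
Qed.

Lemma braiding_unitary (V W : hmod R) : hermitian_module r V -> hermitian_module r W ->
  real_weights V -> real_weights W ->
  (braiding r V W)^t* *m gram (htens r W V) *m braiding r V W = gram (htens r V W).
Proof.
move=> hV hW rV rW; have wV := herm_weight hV; have wW := herm_weight hW.
have wVW := tens_weight hr wV wW; have wWV := tens_weight hr wW wV.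
have uU := half_unit hr wWV; have uZ := half_unit hr wVW.
have [_ cc] := braiding_inv hr wW wV.
have hc := braiding_ctr hr hV hW rV rW.
rewrite !gram_htens (XmapE hr hW hV) (XmapE hr hV hW).
have e1 := invmx_nat uZ uU (half_nat hr wWV wVW (braiding_lin hr wW wV)).
have e2 := braiding_nat wV wV wW wW (half_lin hr wV) (half_lin hr wW).
exact: mulmx_braid hc cc e1 (esym e2).
Qed.

End Conjugation.

Theorem theorem4p18 (R : realType) (r : nat) (hr : (2 <= r)%N) :
  hermitian_ribbon_category (Ddagger R r).
Proof.
split.
- exact: Ddagger_ribbon.
- exact: Ddagger_conjugation.
- move=> V W hV hW; have wV := ob_weight hV; have wW := ob_weight hW.
  have [cc1 cc2] := braiding_inv hr wV wW.
  apply: (adjoint_unitary (V := htens r V W) (W := htens r W V) _ cc2 cc1); last by apply: braiding_unitary => //; [case: hV | case: hW | exact: ob_real | exact: ob_real].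
  by have [/hermitian_moduleP[]] := htens_ob hr hV hW.
- move=> V hV; have wV := ob_weight hV; have [hmV _] := hV.
  have [_ _ uV _] := (hermitian_moduleP r V).1 hmV.
  apply: (adjoint_unitary uV (mulVmx (twist_unit hr wV)) (mulmxV (twist_unit hr wV))).
  have e := gram_half hr hmV (ob_real hr hV).
  (* The twist is the square of [half], which preserves the form. *)
  by rewrite -(half_sq hr wV) ctrM; exact: mulmx_fix_sq e.
- by move=> V hV; have [hmV _] := hV; refine (etrans (adjoint_coev hr hmV) _).
by move=> V hV; have [hmV _] := hV; refine (etrans (adjoint_ev hr hmV (ob_real hr hV)) _).
Qed.
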